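(* Let $p,q$ be two real polynomials in $d$ variables and assume that the rational function $\xi\mapsto q(i\xi)/p(i\xi)$ has a holomorphic extension in a strip $\{z\in\mathbb{C}^d:\|\Im z\|<\varepsilon\}$ for some $\varepsilon>0$. Let $\omega$ be an admissible weight and let $\dot L$ be a Lévy white noise on the space of tempered ultradistributions $\mathcal{S}'_\omega$ with characteristic triplet $(a,\gamma,\nu)$ such that, for some $c\in(0,\infty)$, $$\int_{|r|>1}|r|\int_0^{1/|r|}\omega^{\rightarrow}\big(c\log(|\alpha|^{-1})\big)^d\,\lambda^1(d\alpha)\,\nu(dr)<\infty .$$ Then there exists a stationary generalized random process $s$ in $\mathcal{S}'_\omega$ such that $p(D)s=q(D)\dot L$, i.e. $\langle s,p(D)^*\varphi\rangle=\langle\dot L,q(D)^*\varphi\rangle$ for all $\varphi\in\mathcal{S}_\omega$. Moreover, if $p(i\cdot)$ has no zeroes in the strip $\{z\in\mathbb{C}^d:\|\Im z\|<\varepsilon\}$, then the solution is unique.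
   Context: Notation: $\lambda^d$ is Lebesgue measure on $\mathbb{R}^d$; $\mathcal{F}f(x)=\int_{\mathbb{R}^d}e^{-i\langle z,x\rangle}f(z)\,\lambda^d(dz)$; $D^\alpha=\partial_{x_1}^{\alpha_1}\cdots\partial_{x_d}^{\alpha_d}$; for $p(z)=\sum_\alpha p_\alpha z^\alpha$, $p(D)=\sum_\alpha p_\alpha D^\alpha$, and its formal adjoint is $p(D)^*=p(-D)$ (likewise for $q$). Admissible weight: a function $\omega:\mathbb{R}^d\to\mathbb{R}$ with $\omega(x)=\sigma(\|x\|)$, where $\sigma$ is an increasing continuous concave function on $[0,\infty)$ with $\sigma(0)=0$, $\int_0^\infty\frac{\sigma(t)}{1+t^2}\lambda^1(dt)<\infty$, and $\sigma(t)\ge c_0+m\log(1+t)$ for all $t\ge0$, for some $c_0\in\mathbb{R}$ and $m>0$. For $\alpha\in(0,\infty)$, $\omega^{\rightarrow}(\alpha):=\sup\{x\in[0,\infty):\omega(xe_1)<\alpha\}$, with $e_1=(1,0,\dots,0)$. $\mathcal{S}_\omega$ is the set of all infinitely differentiable $\varphi:\mathbb{R}^d\to\mathbb{C}$ such that $p_{\alpha,\eta}(\varphi)=\sup_x e^{\eta\omega(x)}|D^\alpha\varphi(x)|<\infty$ and $\pi_{\alpha,\eta}(\varphi)=\sup_x e^{\eta\omega(x)}|D^\alpha(\mathcal{F}\varphi)(x)|<\infty$ for every multi-index $\alpha$ and every $\eta>0$, with the topology given by these seminorms; $\mathcal{S}'_\omega$ is its topological dual (the space of tempered ultradistributions). For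 a test function space $A$ with dual $A'$ (here $A=\mathcal{S}_\omega$), an $A'$-valued generalized random process is a measurable mapping from a probability space $(\Omega,\mathcal{F})$ (with probability measure $\mathcal{P}$) to $(A',C(A'))$, where $C(A')$ is the $\sigma$-field generated by the cylindrical sets $\{u\in A':\langle u,\varphi_j\rangle\in B,\ j=1,\dots,n\}$, $\varphi_1,\dots,\varphi_n\in A$, $B$ Borel. Its characteristic functional is $\widehat{\mathcal{P}}_s(\varphi)=\int_{A'}\exp(i\langle u,\varphi\rangle)\,d\mathcal{P}_s(u)$, $\mathcal{P}_s$ being the law of $s$. A Lévy white noise $\dot L$ on $A'$ with characteristic triplet $(a,\gamma,\nu)$ is an $A'$-valued generalized random process whose characteristic functional is $\exp\big(\int_{\mathbb{R}^d}\psi(\varphi(x))\lambda^d(dx)\big)$ for (real-valued) $\varphi\in A$, where $\psi(z)=i\gamma z-\frac12az^2+\int_{\mathbb{R}}(e^{ixz}-1-ixz\mathbf{1}_{|x|\le1})\nu(dx)$, $a\ge0$, $\gamma\in\mathbb{R}$, and $\nu$ is a Lévy measure ($\nu(\{0\})=0$, $\int\min(1,x^2)\nu(dx)<\infty$). For complex-valued $\varphi$, $\langle\dot L,\varphi\rangle:=\langle\dot L,\Re\varphi\rangle+i\langle\dot L,\Im\varphi\rangle$. A generalized random process $s$ is stationary if for every $t\in\mathbb{R}^d$ the process $s(\cdot+t)$, defined by $\langle s(\cdot+t),\varphi\rangle:=\langle s,\varphi(\cdot-t)\rangle$, has the same law as $s$. *)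

(* Defs.v *)
From HB Require Import structures.
From mathcomp Require Import all_boot all_order all_algebra.
From mathcomp Require Import -(notations) mpoly.
From mathcomp Require Import all_classical all_reals all_analysis.
From mathcomp Require Import complex.

Set Implicit Arguments.
Unset Strict Implicit.
Unset Printing Implicit Defensive.

Import Order.TTheory GRing.Theory Num.Theory.
Import numFieldNormedType.Exports.

Local Open Scope classical_set_scope.
Local Open Scope ring_scope.

(* The dimension is d = n.+1, and points of R^d and C^d are row vectors.
   mpoly.v is imported without its notations, which clash with those of
   MathComp-Analysis: [mpoly d R] is {mpoly R[d]} and [multinom d] is the type
   'X_{1..d} of multi-indices.
   R[i] has no structure of normed space over R in the libraries: R[i]-valued
   functions are differentiated (in real directions) and integrated through
   their real and imaginary parts.  Topological notions over R[i] itself use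
   R[i]^o, the field R[i] as a normed space over itself. *)

Section complex_preliminaries.
Variable R : realType.

Definition iu : R[i] := Complex 0 1.

Definition cexp (z : R[i]) : R[i] :=
  Complex (expR (complex.Re z) * cos (complex.Im z))
          (expR (complex.Re z) * sin (complex.Im z)).

Definition borelC (B : set R[i]) : Prop :=
  <<s [set U : set R[i]^o | open U] >> B.

(* Frechet differentiability over the field R[i] *)
Definition holomorphic_on (V W : normedModType R[i]) (A : set V) (h : V -> W) :
    Prop :=
  forall z, A z -> differentiable h z.

Definition cintegrable d (T : measurableType d)
    (mu : {measure set T -> \bar R}) (f : T -> R[i]) : Prop :=
  mu.-integrable setT (fun x => (complex.Re (f x))%:E) /\
  mu.-integrable setT (fun x => (complex.Im (f x))%:E).

Definition cintegral d (T : measurableType d)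
    (mu : {measure set T -> \bar R}) (f : T -> R[i]) : R[i] :=
  Complex (Rintegral mu setT (fun x => complex.Re (f x)))
          (Rintegral mu setT (fun x => complex.Im (f x))).

End complex_preliminaries.
Arguments iu {R}.

Section lebesgue_step.
Variables (R : realType) (k : nat).
Let T : measurableType _ := measurableTypeR R.
Variable m : {sigma_finite_measure set (k.-tuple T) -> \bar R}.

Definition cons_pair (x : T * k.-tuple T) : k.+1.-tuple T :=
  [the k.+1.-tuple T of x.1 :: x.2].

Lemma measurable_cons_pair : measurable_fun setT cons_pair.
Proof. exact: (@measurable_cons _ _ _ _ fst k snd). Qed.

Definition lebesgue_step : set (k.+1.-tuple T) -> \bar R :=
  pushforward (@product_measure1 _ _ T _ R lebesgue_measure m) cons_pair.

Let lebesgue_step0 : lebesgue_step set0 = 0%E.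
Proof. by rewrite /lebesgue_step /pushforward preimage_set0 measure0. Qed.

Let lebesgue_step_ge0 A : (0 <= lebesgue_step A)%E.
Proof.
exact: (measure_ge0 (@product_measure1 _ _ T _ R lebesgue_measure m)).
Qed.

Let lebesgue_step_sigma_additive : semi_sigma_additive lebesgue_step.
Proof.
move=> F mF tF mUF; rewrite /lebesgue_step /pushforward preimage_bigcup.
apply: (@measure_semi_sigma_additive _ _ _
          (@product_measure1 _ _ T _ R lebesgue_measure m)).
- by move=> i; rewrite -[X in measurable X]setTI; exact: measurable_cons_pair.
- apply/trivIsetP => /= i j _ _ ij; rewrite -preimage_setI.
  by move/trivIsetP : tF => /(_ _ _ _ _ ij) ->//; rewrite preimage_set0.
- rewrite -preimage_bigcup -[X in measurable X]setTI.
  exact: measurable_cons_pair.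
Qed.

HB.instance Definition _ := isMeasure.Build _ _ _ lebesgue_step
  lebesgue_step0 lebesgue_step_ge0 lebesgue_step_sigma_additive.

Let lebesgue_step_sigma_finite : sigma_finite setT lebesgue_step.
Proof.
have /sigma_finiteP[F [TF ndF Foo]] := sigma_finiteT (@lebesgue_measure R).
have /sigma_finiteP[G [TG ndG Goo]] := sigma_finiteT m.
pose g (t : k.+1.-tuple T) := (thead t, [tuple of behead t]).
have gK : cancel cons_pair g.
  by case=> x t; rewrite /g theadE; congr (_, _); exact: val_inj.
have mg : measurable_fun setT g.
  apply/measurable_fun_pairP; split.
    exact: (measurable_tnth ord0).
  exact: measurable_behead.
exists (fun i => g @^-1` (F i `*` G i)) => [|i].
  rewrite predeqE => t; split => // _.
  have [i _ Fi] : (\bigcup_i F i) (g t).1 by rewrite -TF.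
  have [j _ Gj] : (\bigcup_i G i) (g t).2 by rewrite -TG.
  exists (maxn i j) => //; split.
    by move: Fi; exact/subsetPset/ndF/leq_maxl.
  by move: Gj; exact/subsetPset/ndG/leq_maxr.
have [mF Fi] := Foo i; have [mG Gi] := Goo i; split.
  by rewrite -[X in measurable X]setTI; apply: mg => //; exact: measurableX.
rewrite /lebesgue_step /pushforward -comp_preimage.
rewrite (_ : g \o cons_pair = id); last by apply/funext => x /=; exact: gK.
rewrite preimage_id product_measure1E//.
by rewrite lte_mul_pinfty// ge0_fin_numE.
Qed.

HB.instance Definition _ :=
  Measure_isSigmaFinite.Build _ _ _ lebesgue_step lebesgue_step_sigma_finite.

End lebesgue_step.

(* Lebesgue measure on R^k, carried by k-tuples (whose sigma-algebra is generated
   by the coordinates): lambda^(k+1) is the image of lambda^1 \x lambda^k under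
   (x, t) |-> x :: t. *)
Fixpoint lebesgue_tuple (R : realType) (k : nat) :
    {sigma_finite_measure set (k.-tuple (measurableTypeR R)) -> \bar R} :=
  match k with
  | 0 => dirac [tuple]
  | k'.+1 => lebesgue_step (lebesgue_tuple R k')
  end.

Section euclidean_space.
Variables (R : realType) (n : nat).
Local Notation Rd := 'rV[R]_n.+1.

Definition dotp (x y : Rd) : R := \sum_i x 0 i * y 0 i.

Definition enorm (x : Rd) : R := Num.sqrt (dotp x x).

Definition cintegralRd (f : Rd -> R[i]) : R[i] :=
  cintegral (lebesgue_tuple R n.+1) (fun t => f (\row_j tnth t j)).

Definition fourier (f : Rd -> R[i]) (x : Rd) : R[i] :=
  cintegralRd (fun z => cexp (- iu * (dotp z x)%:C%C) * f z).

Definition partial (f : Rd -> R[i]) (j : 'I_n.+1) : Rd -> R[i] := fun x =>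
  Complex ('D_(delta_mx 0 j) (fun y => complex.Re (f y)) x)
          ('D_(delta_mx 0 j) (fun y => complex.Im (f y)) x).

Definition Dmulti (a : multinom n.+1) (f : Rd -> R[i]) : Rd -> R[i] :=
  foldr (fun j g => iter (fun_of_multinom a j) (partial^~ j) g)
        f (enum 'I_n.+1).

(* All iterated partial derivatives, in any order, are (totally) differentiable
   at every point; in particular they exist and are continuous. *)
Definition smooth (f : Rd -> R[i]) : Prop :=
  forall (js : seq 'I_n.+1) (x : Rd),
    differentiable (fun y => complex.Re (foldl partial f js y)) x /\
    differentiable (fun y => complex.Im (foldl partial f js y)) x.

(* p(D)^* = p(-D) *)
Definition adjD (p : mpoly n.+1 R) (f : Rd -> R[i]) : Rd -> R[i] :=
  fun x => \sum_(a <- msupp p)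
    ((-1) ^+ mdeg a * mcoeff a p)%:C%C * Dmulti a f x.

(* p(iz) *)
Definition evali (p : mpoly n.+1 R) (z : 'rV[R[i]]_n.+1) : R[i] :=
  meval (fun j => iu * z 0 j) (map_mpoly (real_complex R) p).

Definition strip (eps : R) : set 'rV[R[i]]_n.+1 :=
  [set z | enorm (map_mx (@complex.Im R) z) < eps].

(* The values of q(i xi) / p(i xi) are prescribed at the real points where it is
   defined. *)
Definition has_holomorphic_extension (p q : mpoly n.+1 R) (eps : R) :
    Prop :=
  exists h : 'rV[R[i]]_n.+1 -> R[i]^o,
    holomorphic_on (strip eps) h /\
    (forall xi : Rd, let z := map_mx (real_complex R) xi in
       evali p z != 0 -> h z = evali q z / evali p z).

Definition admissible_weight (w : Rd -> R) : Prop :=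
  exists sigma : R -> R,
    [/\ forall x, w x = sigma (enorm x),
        {in `[0, +oo[ &, {homo sigma : s t / s <= t}},
        {within `[0, +oo[, continuous sigma},
        (forall s t l, 0 <= s -> 0 <= t -> 0 <= l <= 1 ->
           l * sigma s + (1 - l) * sigma t <= sigma (l * s + (1 - l) * t)) &
        [/\ sigma 0 = 0,
            (\int[lebesgue_measure]_(t in `[0%R, +oo[)
               (sigma t / (1 + t ^+ 2))%:E < +oo)%E &
            exists c0 m : R, 0 < m /\
              forall t, 0 <= t -> c0 + m * ln (1 + t) <= sigma t]].

Definition weight_inv (w : Rd -> R) (alpha : R) : R :=
  sup [set x : R | 0 <= x /\ w (x *: delta_mx 0 0) < alpha].

End euclidean_space.

Section ultradistributions.
Variables (R : realType) (n : nat) (w : 'rV[R]_n.+1 -> R).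
Local Notation Rd := 'rV[R]_n.+1.

Definition p_norm (a : multinom n.+1) (eta : R) (f : Rd -> R[i]) :
    \bar R :=
  ereal_sup (range (fun x => (expR (eta * w x) * ComplexField.Normc.normc (Dmulti a f x))%:E)).

Definition pi_norm (a : multinom n.+1) (eta : R) (f : Rd -> R[i]) :
    \bar R :=
  p_norm a eta (fourier f).

Definition is_test (f : Rd -> R[i]) : Prop :=
  smooth f /\ forall a eta, 0 < eta ->
    (p_norm a eta f < +oo)%E /\ (pi_norm a eta f < +oo)%E.

(* S_omega *)
Record test_function : Type := TestFunction {
  test_val :> Rd -> R[i];
  testP : is_test test_val
}.

(* the basic neighbourhood of f given by the seminorms with indices in s *)
Definition seminorm_ball (f : test_function)
    (s : seq (multinom n.+1 * R)) (delta : R) (g : test_function) :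
    Prop :=
  forall i, i \in s -> 0 < i.2 ->
    (p_norm i.1 i.2 (fun x => (g x - f x)%R) < delta%:E)%E /\
    (pi_norm i.1 i.2 (fun x => (g x - f x)%R) < delta%:E)%E.

Definition clinear (u : test_function -> R[i]) : Prop :=
  forall (c : R[i]) (f g h : test_function),
    (forall x, h x = c * f x + g x) -> u h = c * u f + u g.

Definition seminorm_continuous (u : test_function -> R[i]) : Prop :=
  forall (f : test_function) (e : R), 0 < e ->
    exists s delta, 0 < delta /\
      forall g, seminorm_ball f s delta g -> ComplexField.Normc.normc (u g - u f) < e.

(* S'_omega *)
Record ultradistribution : Type := Ultradistribution {
  pairing :> test_function -> R[i];
  pairing_linear : clinear pairing;
  pairing_continuous : seminorm_continuous pairing
}.

Lemma zero_linear : clinear (fun _ => 0).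
Proof. by move=> c f g h _; rewrite mulr0 addr0. Qed.

Lemma zero_continuous : seminorm_continuous (fun _ => 0).
Proof.
move=> f e e0; exists [::], 1; split => // g _.
by rewrite subrr ComplexField.Normc.normc0.
Qed.

HB.instance Definition _ := gen_eqMixin ultradistribution.
HB.instance Definition _ := gen_choiceMixin ultradistribution.
HB.instance Definition _ := isPointed.Build ultradistribution
  (Ultradistribution zero_linear zero_continuous).

Definition cylindrical : set (set ultradistribution) :=
  [set A | exists (k : nat) (f : 'I_k -> test_function) (B : set R[i]),
     borelC B /\ A = [set u : ultradistribution | forall j, B (u (f j))]].

(* (S'_omega, C(S'_omega)) *)
Definition ultradistributionC : measurableType (sigma_display cylindrical) :=
  g_sigma_algebraType cylindrical.

(* f is a test function and <u, f> = c *)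
Definition pairs_to (u : ultradistribution) (f : Rd -> R[i]) (c : R[i]) :
    Prop :=
  exists g : test_function, test_val g = f /\ u g = c.

(* p(D) u = q(D) v *)
Definition pde (p q : mpoly n.+1 R) (u v : ultradistribution) : Prop :=
  forall f : test_function,
    exists c, pairs_to u (adjD p f) c /\ pairs_to v (adjD q f) c.

End ultradistributions.

Section levy.
Variable R : realType.

Definition levy_measure (nu : {measure set (measurableTypeR R) -> \bar R}) :
    Prop :=
  nu [set 0] = 0%E /\
  (\int[nu]_x (Num.min 1 (x ^+ 2))%:E < +oo)%E.

Definition levy_exponent (a gamma : R)
    (nu : {measure set (measurableTypeR R) -> \bar R}) (z : R) : R[i] :=
  iu * (gamma * z)%:C%C - (2^-1 * a * z ^+ 2)%:C%C +
  cintegral nu (fun x => cexp (iu * (x * z)%:C%C) - 1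
    - iu * (x * z * (`|x| <= 1)%R%:R)%:C%C).

End levy.

Section processes.
Context {R : realType} {n : nat} {w : 'rV[R]_n.+1 -> R}.
Context {d : measure_display} {Omega : measurableType d}.
Variable P : probability Omega R.
Local Notation process := {mfun Omega >-> ultradistributionC w}.

Definition char_functional (s : process) (f : test_function w) : R[i] :=
  cintegral (distribution P s)
    (fun u : ultradistributionC w => cexp (iu * u f)).

(* The process is real: <L, f> is real for real f, so that complex linearity of
   the pairing reads <L, f> = <L, Re f> + i <L, Im f> with real <L, Re f> and
   <L, Im f>. *)
Definition levy_white_noise (L : process) (a gamma : R)
    (nu : {measure set (measurableTypeR R) -> \bar R}) : Prop :=
  forall f : test_function w, (forall x, complex.Im (f x) = 0) ->
    let psif := fun x => levy_exponent a gamma nu (complex.Re (f x)) in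
    [/\ forall o, complex.Im (L o f) = 0,
        cintegrable (lebesgue_tuple R n.+1)
          (fun t => psif (\row_j tnth t j)) &
        char_functional L f = cexp (cintegralRd psif)].

Definition same_law (s s' : process) : Prop :=
  forall A, measurable A -> distribution P s A = distribution P s' A.

(* s' = s(. + t) *)
Definition is_shift (t : 'rV[R]_n.+1) (s s' : process) : Prop :=
  forall o (f : test_function w),
    pairs_to (s o) (fun x => f (x - t)) (s' o f).

Definition stationary (s : process) : Prop :=
  forall t, exists s', is_shift t s s' /\ same_law s' s.

End processes.

(* Main.v *)
From HB Require Import structures.
Require Import Defs.
From mathcomp Require Import all_boot all_order all_algebra.
From mathcomp Require Import -(notations) mpoly.
From mathcomp Require Import all_classical all_reals all_analysis.
From mathcomp Require Import complex measurable_realfun.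
From mathcomp Require Import ring lra.

Set Implicit Arguments.
Unset Strict Implicit.
Unset Printing Implicit Defensive.

Import Order.TTheory GRing.Theory Num.Theory.
Import numFieldNormedType.Exports.

Local Open Scope classical_set_scope.
Local Open Scope ring_scope.

(** The solution is the noise pulled back by a Fourier multiplier.  Let h be the
    holomorphic extension of q(i.)/p(i.).  On test functions put

      (T_h f)(x) = c^-2 int e^(i <xi,x>) h(- xi) (F f)(xi) d xi,

    and s := L o T_h.  Since p(D)^* is the multiplier with symbol p(i.)
    ([adjD_Tmul]) and symbols multiply ([Tmul_comp]), h p = q gives
    T_h p(D)^* = q(D)^*, that is p(D) s = q(D) L ([pull_pde]).  If p(i.) has no
    zero in the strip, 1/p(i.) is a symbol too, every test function is
    p(D)^* (T_(1/p) f), and p(D) s determines s ([pde_unique]).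

    The main point is that T_h maps S_omega to itself continuously
    ([dominated_Tmul]).  First, h has polynomial growth on a smaller strip: this is
    Malgrange's division estimate ([division_symbol], from the one-variable bound
    [Malgrange_bound]), applied to the identity h p = q on the strip, which follows
    from its validity at real points by density and the identity theorem
    ([extension_identity]).  Next, after division by an elliptic symbol the kernel
    of T_h is the Fourier integral of a function that is integrable on every
    horizontal slice of a strip; shifting the contour shows that it decays
    exponentially ([contour_shift_hol], [kernel_decay]).  A weight is subadditive
    and o(||x||) ([admissible_tame]), so convolution with such a kernel preserves
    the decay e^(- eta omega) for every eta.  Finally, interpolation recovers the
    decay of all derivatives from the decay of f and F f alone
    ([wbound_partial], [tempered_bounds]), so that the seminorms without derivatives
    define the topology of S_omega.

    For the stationarity, T_h commutes with translations and Lebesgue measure is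
    translation invariant, so L and its translates have the same characteristic
    functional; it remains to see that this functional determines the law of a
    real process ([same_law_of_char]).  The characteristic functional gives the
    characteristic functions of the vectors (<L,f_1>, ..., <L,f_k>), Gaussian
    regularization turns these into the probabilities of boxes
    ([box_prob_of_charfun]), and boxes form a pi-system generating the cylindrical
    sigma-algebra.

    The complex analysis (Goursat, Cauchy's formula, the identity theorem) is done
    on rectangles and squares.  Fourier inversion is proved with the constant c^2,
    where c is the integral of the Gaussian ([fourier_inversion]). *)

(** * Complex-valued functions and their integrals *)

Notation normc := ComplexField.Normc.normc.
Notation cRe := complex.Re.
Notation cIm := complex.Im.

Section ComplexBasics.
Variable R : realType.
Implicit Types x y z : R[i].

Lemma cplx_eq x y : cRe x = cRe y -> cIm x = cIm y -> x = y.
Proof. by case: x => a b; case: y => c d /= -> ->. Qed.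

Lemma ReD x y : cRe (x + y) = cRe x + cRe y. Proof. by case: x; case: y. Qed.
Lemma ImD x y : cIm (x + y) = cIm x + cIm y. Proof. by case: x; case: y. Qed.
Lemma ReN x : cRe (- x) = - cRe x. Proof. by case: x. Qed.
Lemma ImN x : cIm (- x) = - cIm x. Proof. by case: x. Qed.
Lemma ReM x y : cRe (x * y) = cRe x * cRe y - cIm x * cIm y.
Proof. by case: x; case: y. Qed.
Lemma ImM x y : cIm (x * y) = cRe x * cIm y + cIm x * cRe y.
Proof. by case: x; case: y. Qed.
Lemma Re_conj x : cRe (conjc x) = cRe x. Proof. by case: x. Qed.
Lemma Im_conj x : cIm (conjc x) = - cIm x. Proof. by case: x. Qed.
Definition ReImE := (ReD, ImD, ReN, ImN, ReM, ImM, Re_conj, Im_conj).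

Lemma Re_sum (I : Type) (r : seq I) (P : pred I) (F : I -> R[i]) :
  cRe (\sum_(i <- r | P i) F i) = \sum_(i <- r | P i) cRe (F i).
Proof. by elim/big_rec2: _ => //= i u v _ <-; rewrite ReD. Qed.

Lemma Im_sum (I : Type) (r : seq I) (P : pred I) (F : I -> R[i]) :
  cIm (\sum_(i <- r | P i) F i) = \sum_(i <- r | P i) cIm (F i).
Proof. by elim/big_rec2: _ => //= i u v _ <-; rewrite ImD. Qed.

Lemma normc_ge0 x : 0 <= normc x. Proof. by case: x => a b; rewrite /= sqrtr_ge0. Qed.
Lemma normcM x y : normc (x * y) = normc x * normc y.
Proof. exact: ComplexField.Normc.normcM. Qed.
Lemma normcV x : normc x^-1 = (normc x)^-1.
Proof. exact: ComplexField.Normc.normcV. Qed.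
Lemma normc0 : normc (0 : R[i]) = 0. Proof. exact: ComplexField.Normc.normc0. Qed.
Lemma normc1 : normc (1 : R[i]) = 1. Proof. exact: ComplexField.Normc.normc1. Qed.
Lemma normcN x : normc (- x) = normc x. 
Proof. by case: x => a b /=; rewrite !sqrrN. Qed.
Lemma normcD x y : normc (x + y) <= normc x + normc y.
Proof. exact: le_normcD. Qed.
Lemma normcB x y : normc (x - y) <= normc x + normc y.
Proof. by rewrite -(normcN y) normcD. Qed.
Lemma normcBC x y : normc (x - y) = normc (y - x).
Proof. by rewrite -normcN opprB. Qed.
Lemma normc_eq0 x : (normc x == 0) = (x == 0).
Proof.
apply/eqP/eqP => [|->]; last exact: normc0.
exact: ComplexField.Normc.eq0_normc.
Qed.
Lemma normc_gt0 x : (0 < normc x) = (x != 0).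
Proof. by rewrite lt_neqAle normc_ge0 andbT eq_sym normc_eq0. Qed.
Lemma normc_real (a : R) : normc (a%:C)%C = `|a|.
Proof. by rewrite /= expr0n addr0 sqrtr_sqr. Qed.
Lemma normc_iu : normc (@iu R) = 1.
Proof. by rewrite /= expr0n add0r expr1n sqrtr1. Qed.
Lemma normcX x n : normc (x ^+ n) = normc x ^+ n.
Proof. by elim: n => [|n IH]; rewrite ?normc1// !exprS normcM IH. Qed.
Lemma normc_conj x : normc (conjc x) = normc x.
Proof. by case: x => a b /=; rewrite sqrrN. Qed.

Lemma sqr_le_sqrt (a b : R) : `|a| <= Num.sqrt (a ^+ 2 + b ^+ 2).
Proof. by rewrite -sqrtr_sqr ler_wsqrtr// lerDl sqr_ge0. Qed.

Lemma Re_le_normc x : `|cRe x| <= normc x.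
Proof. by case: x => a b /=; exact: sqr_le_sqrt. Qed.
Lemma Im_le_normc x : `|cIm x| <= normc x.
Proof. by case: x => a b /=; rewrite addrC; exact: sqr_le_sqrt. Qed.
Lemma normc_le_ReIm x : normc x <= `|cRe x| + `|cIm x|.
Proof.
rewrite [x in normc x](_ : x = (cRe x)%:C%C + iu * (cIm x)%:C%C).
  by rewrite (le_trans (normcD _ _))// normcM normc_iu mul1r !normc_real.
by apply: cplx_eq; rewrite !ReImE /=; ring.
Qed.

Lemma normc_sum (I : Type) (r : seq I) (P : pred I) (F : I -> R[i]) :
  normc (\sum_(i <- r | P i) F i) <= \sum_(i <- r | P i) normc (F i).
Proof.
elim/big_rec2: _ => [|i u v _ H]; first by rewrite normc0.
by rewrite (le_trans (normcD _ _))// lerD2l.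
Qed.
Lemma normc_prod (I : Type) (r : seq I) (P : pred I) (F : I -> R[i]) :
  normc (\prod_(i <- r | P i) F i) = \prod_(i <- r | P i) normc (F i).
Proof.
by elim/big_rec2: _ => [|i u v _ H]; rewrite ?normc1// normcM H.
Qed.

Lemma cnormE x : `|x| = (normc x)%:C%C. Proof. by []. Qed.

Lemma iu2 : (@iu R) * iu = -1.
Proof. by apply: cplx_eq; rewrite !ReImE /=; ring. Qed.

Lemma cexpD x y : cexp (x + y) = cexp x * cexp y.
Proof.
apply: cplx_eq; rewrite !ReImE /= !ReImE expRD ?cosD ?sinD; ring.
Qed.
Lemma cexp0 : cexp (0 : R[i]) = 1.
Proof. by apply: cplx_eq; rewrite /= expR0 ?cos0 ?sin0 mul1r. Qed.
Lemma normc_cexp x : normc (cexp x) = expR (cRe x).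
Proof.
rewrite /= !exprMn -mulrDr cos2Dsin2 mulr1 sqrtr_sqr.
by rewrite ger0_norm ?expR_ge0.
Qed.
Lemma cexp_neq0 x : cexp x != 0.
Proof. by rewrite -normc_gt0 normc_cexp expR_gt0. Qed.
Lemma normc_cexp_im x : cRe x = 0 -> normc (cexp x) = 1.
Proof. by move=> h; rewrite normc_cexp h expR0. Qed.
Lemma conjc_cexp x : conjc (cexp x) = cexp (conjc x).
Proof.
case: x => a b; apply: cplx_eq => /=; first by rewrite cosN.
by rewrite sinN; ring.
Qed.

Lemma iuM_real (t : R) : iu * (t%:C)%C = Complex 0 t.
Proof. by apply: cplx_eq; rewrite !ReImE /=; ring. Qed.

Lemma cos_lip (t : R) : `|cos t - 1| <= `|t|.
Proof.
rewrite -[1]cos0.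
wlog t0 : t / 0 < t => [H|].
  have [t0|t0|->] := ltgtP t 0; last by rewrite subrr !normr0.
    by rewrite -cosN -[X in _ <= X]normrN H// oppr_gt0.
  exact: H.
have /(MVT t0)[] : forall s : R, s \in `]0, t[%R -> is_derive s 1 cos (- sin s).
  by move=> x _; exact: is_derive_cos.
  by move=> ?; apply: continuous_subspaceT => ?; exact: continuous_cos.
  move=> c _; rewrite subr0 => ->.
  by rewrite normrM normrN ler_piMl// ler_norml sin_geN1 sin_le1.
Qed.

Lemma sin_lip (t : R) : `|sin t| <= `|t|.
Proof.
wlog t0 : t / 0 < t => [H|].
  have [t0|t0|->] := ltgtP t 0; last by rewrite sin0 normr0.
    by rewrite -normrN -sinN -[X in _ <= X]normrN H// oppr_gt0.
  exact: H.
have /(MVT t0)[] : forall s : R, s \in `]0, t[%R -> is_derive s 1 sin (cos s).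
  by move=> x _; exact: is_derive_sin.
  by apply: continuous_subspaceT => ?; exact: continuous_sin.
move=> c _; rewrite sin0 !subr0 => ->.
rewrite normrM ler_piMl// ler_norml.
by rewrite cos_geN1 cos_le1.
Qed.

Lemma sin_taylor (t : R) : `|sin t - t| <= t ^+ 2.
Proof.
wlog t0 : t / 0 < t => [H|].
  have [t0|t0|->] := ltgtP t 0; last by rewrite sin0 subrr normr0 expr0n.
    by rewrite -normrN opprD -sinN -sqrrN H// oppr_gt0.
  exact: H.
have /(MVT t0)[] : forall s : R, s \in `]0, t[%R ->
    is_derive s 1 (fun u : R => sin u - u) (cos s - 1).
  by move=> x _; apply: is_deriveB.
  apply: continuous_subspaceT => x; apply: cvgB; last exact: cvg_id.
  exact: continuous_sin.
move=> c; rewrite in_itv/= => /andP[c0 ct]; rewrite sin0 !subr0 => ->.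
rewrite normrM expr2 (gtr0_norm t0) ler_pM2r//.
by rewrite (le_trans (cos_lip c))// gtr0_norm// ltW.
Qed.

Lemma cos_taylor (t : R) : `|cos t - 1| <= t ^+ 2.
Proof.
rewrite -[1]cos0.
wlog t0 : t / 0 < t => [H|].
  have [t0|t0|->] := ltgtP t 0; last by rewrite subrr normr0 expr0n.
    by rewrite -cosN -sqrrN H// oppr_gt0.
  exact: H.
have /(MVT t0)[] : forall s : R, s \in `]0, t[%R -> is_derive s 1 cos (- sin s).
  by move=> x _; exact: is_derive_cos.
  by move=> ?; apply: continuous_subspaceT => ?; exact: continuous_cos.
move=> c; rewrite in_itv/= => /andP[c0 ct]; rewrite subr0 => ->.
rewrite normrM normrN expr2 (gtr0_norm t0) ler_pM2r//.
by rewrite (le_trans (sin_lip c))// gtr0_norm// ltW.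
Qed.

(** Under the integral sign this bound makes Fourier integrals differentiable,
    with a remainder that is quadratic in the increment. *)
Lemma cexp_taylor (t : R) :
  normc (cexp (iu * (t%:C)%C) - 1 - iu * (t%:C)%C) <= 2 * t ^+ 2.
Proof.
rewrite (le_trans (normc_le_ReIm _))// iuM_real !ReImE/= expR0 !mul1r.
rewrite !oppr0 !addr0 mulr2n mulrDl mul1r lerD ?sin_taylor//.
exact: cos_taylor.
Qed.
End ComplexBasics.
Arguments ComplexField.Normc.normc : simpl never.
Arguments cexp : simpl never.

Section ComplexMeasurable.
Context d (T : measurableType d) (R : realType).
Implicit Types f g : T -> R[i].

Definition cmeas f := measurable_fun setT (fun x => cRe (f x)) /\
  measurable_fun setT (fun x => cIm (f x)).

Lemma cmeas_cst (c : R[i]) : cmeas (fun _ => c).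
Proof. by split; exact: measurable_cst. Qed.

Lemma cmeasD f g : cmeas f -> cmeas g -> cmeas (fun x => f x + g x).
Proof.
move=> [f1 f2] [g1 g2]; split.
- under eq_fun do rewrite ReD; exact: measurable_funD.
- under eq_fun do rewrite ImD; exact: measurable_funD.
Qed.

Lemma cmeasM f g : cmeas f -> cmeas g -> cmeas (fun x => f x * g x).
Proof.
move=> [f1 f2] [g1 g2]; split.
- under eq_fun do rewrite ReM.
  by apply: measurable_funB; exact: measurable_funM.
- under eq_fun do rewrite ImM.
  by apply: measurable_funD; exact: measurable_funM.
Qed.

Lemma cmeas_real (r : T -> R) : measurable_fun setT r ->
  cmeas (fun x => ((r x)%:C)%C).
Proof. by move=> rm; split => //=; exact: measurable_cst. Qed.

Lemma cmeas_cexp f : cmeas f -> cmeas (fun x => cexp (f x)).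
Proof.
move=> [f1 f2]; split => /=; rewrite /cexp/=; apply: measurable_funM; apply: measurableT_comp => //.
- by apply: continuous_measurable_fun; exact: continuous_cos.
- by apply: continuous_measurable_fun; exact: continuous_sin.
Qed.

Lemma cmeas_normc f : cmeas f -> measurable_fun setT (fun x => normc (f x)).
Proof.
move=> [f1 f2].
rewrite (_ : (fun x => _) = fun x => Num.sqrt (cRe (f x) ^+ 2 + cIm (f x) ^+ 2)).
  apply: measurableT_comp.
    by apply: continuous_measurable_fun; exact: sqrt_continuous.
  by apply: measurable_funD; exact: measurable_funX.
by apply/funext => x; rewrite /normc; case: (f x).
Qed.

End ComplexMeasurable.

Lemma cmeas_comp d d' (T : measurableType d) (T' : measurableType d')
    (R : realType) (h : T' -> T) (f : T -> R[i]) :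
  measurable_fun setT h -> cmeas f -> cmeas (fun x => f (h x)).
Proof.
move=> hm [f1 f2]; split.
- exact: (measurableT_comp f1 hm).
- exact: (measurableT_comp f2 hm).
Qed.

Section ComplexIntegral.
Context d (T : measurableType d) (R : realType) (mu : {measure set T -> \bar R}).
Implicit Types (f g : T -> R[i]) (h : T -> R).

Definition rintegrable h := mu.-integrable setT (EFin \o h).

Lemma cintegrableP f : cintegrable mu f <->
  rintegrable (fun x => cRe (f x)) /\ rintegrable (fun x => cIm (f x)).
Proof. by []. Qed.

Lemma rintegrable_le h h' : measurable_fun setT h -> (forall x, `|h x| <= h' x) ->
  rintegrable h' -> rintegrable h.
Proof.
move=> hm hh' h'i; apply: le_integrable h'i => //; first exact/measurable_EFinP.
by move=> x _ /=; rewrite lee_fin (le_trans (hh' x))// ler_norm.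
Qed.

Lemma cintegrable_le f h : cmeas f -> (forall x, normc (f x) <= h x) ->
  rintegrable h -> cintegrable mu f.
Proof.
move=> [f1 f2] fh hi; split.
- apply: (rintegrable_le f1 _ hi) => x.
  by rewrite (le_trans (Re_le_normc _)).
- apply: (rintegrable_le f2 _ hi) => x.
  by rewrite (le_trans (Im_le_normc _)).
Qed.

Lemma cintegrable_meas f : cintegrable mu f -> cmeas f.
Proof.
by move=> [/integrableP[/measurable_EFinP f1 _] /integrableP[/measurable_EFinP f2 _]].
Qed.

Lemma cintegrable0 : cintegrable mu (fun _ => 0).
Proof. by split; exact: integrable0. Qed.

Lemma rintegrableD h h' : rintegrable h -> rintegrable h' ->
  rintegrable (fun x => h x + h' x).
Proof. by move=> hi h'i; exact: (integrableD measurableT hi h'i). Qed.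

Lemma rintegrableZ c h : rintegrable h -> rintegrable (fun x => c * h x).
Proof. by move=> hi; exact: (integrableZl measurableT c hi). Qed.

Lemma cintegrable_normc f : cintegrable mu f -> rintegrable (fun x => normc (f x)).
Proof.
move=> fi; have fm := cintegrable_meas fi; case: fi => f1 f2.
apply: (@rintegrable_le _ (fun x => `|cRe (f x)| + `|cIm (f x)|)).
- exact: cmeas_normc.
- by move=> x; rewrite ger0_norm ?normc_ge0// normc_le_ReIm.
- by apply: rintegrableD; exact: integrable_norm.
Qed.

Lemma cintegrableD f g : cintegrable mu f -> cintegrable mu g ->
  cintegrable mu (fun x => f x + g x).
Proof.
move=> [f1 f2] [g1 g2]; apply/cintegrableP; split.
- under eq_fun do rewrite ReD; exact: rintegrableD.
- under eq_fun do rewrite ImD; exact: rintegrableD.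
Qed.

Lemma cintegrableZ c f : cintegrable mu f -> cintegrable mu (fun x => c * f x).
Proof.
move=> fi; apply: (@cintegrable_le _ (fun x => normc c * normc (f x))).
- by apply: cmeasM; [exact: cmeas_cst|exact: cintegrable_meas].
- by move=> x; rewrite normcM.
- by apply: rintegrableZ; exact: cintegrable_normc.
Qed.

Lemma eq_cintegral f g : f =1 g -> cintegral mu f = cintegral mu g.
Proof. by move=> /funext ->. Qed.

Lemma cintegralD f g : cintegrable mu f -> cintegrable mu g ->
  cintegral mu (fun x => f x + g x) = cintegral mu f + cintegral mu g.
Proof.
move=> [f1 f2] [g1 g2]; apply: cplx_eq; rewrite ReImE /=.
- by under eq_Rintegral do rewrite ReD; exact: RintegralD.
- by under eq_Rintegral do rewrite ImD; exact: RintegralD.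
Qed.

Lemma cintegralZ c f : cintegrable mu f ->
  cintegral mu (fun x => c * f x) = c * cintegral mu f.
Proof.
move=> [f1 f2]; have Zi k h : rintegrable h -> rintegrable (fun x => k * h x).
  exact: rintegrableZ.
apply: cplx_eq; rewrite ReImE /=.
- under eq_Rintegral do rewrite ReM.
  by rewrite RintegralB ?RintegralZl//; exact: Zi.
- under eq_Rintegral do rewrite ImM.
  by rewrite RintegralD ?RintegralZl//; exact: Zi.
Qed.

(** The factor 2 comes from treating the real and imaginary parts separately. *)
Lemma normc_cintegral_le f h : cmeas f -> (forall x, normc (f x) <= h x) ->
  rintegrable h -> normc (cintegral mu f) <= 2 * Rintegral mu setT h.
Proof.
move=> fm fh hi; have [f1 f2] := cintegrable_le fm fh hi.
rewrite (le_trans (normc_le_ReIm _))// mulr2n mulrDl mul1r /=; apply: lerD.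
- rewrite (le_trans (le_normr_Rintegral _ f1))//.
  apply: le_Rintegral => //; first exact: integrable_norm.
  by move=> x _; rewrite (le_trans (Re_le_normc _)).
- rewrite (le_trans (le_normr_Rintegral _ f2))//.
  apply: le_Rintegral => //; first exact: integrable_norm.
  by move=> x _; rewrite (le_trans (Im_le_normc _)).
Qed.

Lemma cintegral_real h : cintegral mu (fun x => ((h x)%:C)%C) =
  ((Rintegral mu setT h)%:C)%C.
Proof.
by apply: cplx_eq => //=; rewrite Rintegral_cst// mul0r.
Qed.

Lemma conjc_cintegral f : cintegrable mu f ->
  conjc (cintegral mu f) = cintegral mu (fun x => conjc (f x)).
Proof.
move=> [f1 f2]; apply: cplx_eq; rewrite ReImE /=.
  by apply: eq_Rintegral => x _; rewrite Re_conj.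
rewrite -mulN1r -RintegralZl//; apply: eq_Rintegral => x _.
by rewrite Im_conj mulN1r.
Qed.
End ComplexIntegral.

(** * Integrals over segments *)

Section IntervalIntegral.
Variable R : realType.
Local Notation mu := (@lebesgue_measure R).
Implicit Types (f g : R -> R[i]) (a b : R).

Definition ccont1 f (t : R) := forall e, 0 < e -> exists2 d, 0 < d &
  forall s, `|s - t| < d -> normc (f s - f t) < e.

Definition ccont_on f a b := forall t, a <= t <= b -> ccont1 f t.

Lemma ccont1_Re f t : ccont1 f t -> {for t, continuous (fun s => cRe (f s))}.
Proof.
move=> fc; apply/cvgrPdist_lt => e e0; have [d d0 fd] := fc e e0.
apply/nbhs_ballP; exists d => //= s; rewrite /ball/= distrC => /fd fs.
rewrite -normrN opprB (le_lt_trans _ fs)//.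
by rewrite -ReN -ReD Re_le_normc.
Qed.

Lemma ccont1_Im f t : ccont1 f t -> {for t, continuous (fun s => cIm (f s))}.
Proof.
move=> fc; apply/cvgrPdist_lt => e e0; have [d d0 fd] := fc e e0.
apply/nbhs_ballP; exists d => //= s; rewrite /ball/= distrC => /fd fs.
rewrite -normrN opprB (le_lt_trans _ fs)//.
by rewrite -ImN -ImD Im_le_normc.
Qed.

(** Consecutive half-open intervals are disjoint, which makes the integral
    additive in the segment. *)
Definition on_itv a b f := fun t => if (a <= t < b) then f t else 0.

Definition cint a b f : R[i] := cintegral mu (on_itv a b f).

Lemma on_itv_patch (h : R -> R) a b :
  (fun t => if a <= t < b then h t else 0) = h \_ [set` `[a, b[].
Proof.
apply/funext => t; rewrite patchE; case: ifPn => tab.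
  by rewrite mem_set//= in_itv.
by rewrite memNset//= in_itv/=; apply/negP.
Qed.

Lemma rintegrable_itv (h : R -> R) a b :
  (forall t, a <= t <= b -> {for t, continuous h}) ->
  rintegrable mu (fun t => if a <= t < b then h t else 0).
Proof.
move=> hc; rewrite on_itv_patch /rintegrable -restrict_EFin.
apply/(integrable_mkcond _ _).1 => //.
suff: mu.-integrable `[a, b] (EFin \o h).
  apply: integrableS => //.
  by move=> t; rewrite /= !in_itv/= => /andP[-> /ltW].
apply: continuous_compact_integrable; first exact: segment_compact.
apply: continuous_in_subspaceT => t; rewrite inE/= in_itv/=; exact: hc.
Qed.

Lemma on_itv_integrable a b f : ccont_on f a b -> cintegrable mu (on_itv a b f).
Proof.
move=> fc; apply/cintegrableP; split.
- under eq_fun do rewrite /on_itv (fun_if (@complex.Re R)).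
  by apply: rintegrable_itv => t tab; exact/ccont1_Re/fc.
- under eq_fun do rewrite /on_itv (fun_if (@complex.Im R)).
  by apply: rintegrable_itv => t tab; exact/ccont1_Im/fc.
Qed.

Lemma rintegrable_indic_itv (M a b : R) :
  rintegrable mu (fun t => if a <= t < b then M else 0).
Proof. by apply: rintegrable_itv => t _; exact: cvg_cst. Qed.

Lemma Rintegral_indic_itv (M a b : R) : a <= b ->
  Rintegral mu setT (fun t => if a <= t < b then M else 0) = M * (b - a).
Proof.
move=> ab; rewrite on_itv_patch -Rintegral_mkcond Rintegral_cst//.
rewrite [X in fine X](@lebesgue_measure_itv R `[a, b[) /= lte_fin.
case: ifPn => //; rewrite -leNgt => ba.
by rewrite (@le_anti _ _ a b) ?ab// subrr.
Qed.

Lemma eq_cint a b f g : (forall t, a <= t < b -> f t = g t) ->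
  cint a b f = cint a b g.
Proof.
by move=> fg; apply: eq_cintegral => t; rewrite /on_itv; case: ifPn => // /fg.
Qed.

Lemma normc_cint_le a b f M : a <= b -> ccont_on f a b ->
  (forall t, a <= t <= b -> normc (f t) <= M) ->
  normc (cint a b f) <= 2 * (M * (b - a)).
Proof.
move=> ab fc fM; rewrite -Rintegral_indic_itv//.
apply: normc_cintegral_le.
- exact/cintegrable_meas/on_itv_integrable.
- move=> t; rewrite /on_itv; case: ifPn; last by rewrite normc0.
  by move=> /andP[ta tb]; apply: fM; rewrite ta ltW.
- exact: rintegrable_indic_itv.
Qed.

Lemma cintD a b f g : ccont_on f a b -> ccont_on g a b ->
  cint a b (fun t => f t + g t) = cint a b f + cint a b g.
Proof.
move=> fc gc; rewrite /cint -cintegralD; [|exact: on_itv_integrable..].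
by apply: eq_cintegral => t; rewrite /on_itv; case: ifP; rewrite ?addr0.
Qed.

Lemma cintZ a b c f : ccont_on f a b ->
  cint a b (fun t => c * f t) = c * cint a b f.
Proof.
move=> fc; rewrite /cint -cintegralZ; last exact: on_itv_integrable.
by apply: eq_cintegral => t; rewrite /on_itv; case: ifP; rewrite ?mulr0.
Qed.

Lemma cint_split m a b f : a <= m <= b -> ccont_on f a b ->
  cint a b f = cint a m f + cint m b f.
Proof.
move=> /andP[am mb] fc; rewrite /cint -cintegralD.
- apply: eq_cintegral => t; rewrite /on_itv.
  have [tm|tm] := ltP t m; first by rewrite andbT (lt_le_trans tm mb) andbT addr0.
  by rewrite andbF add0r (le_trans am tm).
- by apply: on_itv_integrable => t /andP[ta tm]; apply: fc; rewrite ta (le_trans tm).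
- by apply: on_itv_integrable => t /andP[ta tm]; apply: fc; rewrite tm (le_trans am).
Qed.

Lemma ccont1_cst (c : R[i]) t : ccont1 (fun _ => c) t.
Proof. by move=> e e0; exists 1 => // s _; rewrite subrr normc0. Qed.

Lemma ccont1_id t : ccont1 (fun s => (s%:C)%C) t.
Proof.
move=> e e0; exists e => // s; suff -> : (s%:C - t%:C = (s - t)%:C :> R[i])%C.
  by rewrite normc_real.
by apply: cplx_eq; rewrite !ReImE /= ?subr0.
Qed.

Lemma ccont1Z c f t : ccont1 f t -> ccont1 (fun s => c * f s) t.
Proof.
move=> fc e e0; have c0 : 0 < normc c + 1 by rewrite ltr_wpDl ?normc_ge0.
have [d d0 h] := fc _ (divr_gt0 e0 c0).
exists d => // s /h; rewrite ltr_pdivlMr// => h'.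
rewrite -mulrBr normcM; apply: le_lt_trans h'.
by rewrite mulrC ler_wpM2l ?normc_ge0// lerDl.
Qed.

Lemma cint_cst a b c : a <= b -> cint a b (fun _ => c) = c * ((b - a)%:C)%C.
Proof.
move=> ab; rewrite -[c in LHS]mulr1.
rewrite cintZ; last by move=> t _; exact: ccont1_cst.
congr (_ * _); rewrite /cint.
rewrite [on_itv _ _ _](_ : _ = (fun t => ((if a <= t < b then 1 else 0)%:C)%C)).
  by rewrite cintegral_real Rintegral_indic_itv// mul1r.
by apply/funext => t; rewrite /on_itv; case: ifP.
Qed.

Lemma cint_id a b : a <= b ->
  cint a b (fun t => (t%:C)%C) = (((b ^+ 2 - a ^+ 2) / 2)%:C)%C.
Proof.
move=> ab; rewrite /cint.
rewrite [on_itv _ _ _](_ : _ = (fun t => ((if a <= t < b then t else 0)%:C)%C)); last first.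
  by apply/funext => t; rewrite /on_itv; case: ifP.
rewrite cintegral_real on_itv_patch -Rintegral_mkcond; congr (_%:C)%C.
have idc : {within `[a, b], continuous (fun t : R => t)}.
  by apply: continuous_subspaceT => t; exact: cvg_id.
rewrite Rintegral_itv_bndo_bndc; last first.
  suff: mu.-integrable `[a, b] (EFin \o (fun t : R => t)).
    apply: integrableS => //.
    by move=> t; rewrite /= !in_itv/= => /andP[-> /ltW].
  by apply: continuous_compact_integrable; first exact: segment_compact.
have [ab'|ba] := ltP a b; last first.
  rewrite (@le_anti _ _ a b) ?ab// subrr mul0r set_itv1.
  by rewrite Rintegral_set1.
rewrite /Rintegral (@continuous_FTC2 _ _ (fun t => t ^+ 2 / 2))//=.
- by rewrite mulrBl.
- have cF : continuous (fun t : R => t ^+ 2 / 2).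
    by move=> t; apply: cvgM; [exact: exprn_continuous|exact: cvg_cst].
  split; last 2 first.
  + by apply: cvg_at_right_filter; exact: cF.
  + by apply: cvg_at_left_filter; exact: cF.
  by move=> t _; apply: derivableM.
- move=> t _; rewrite derive1E deriveMr//= exp_derive expr1 scaler1.
  by rewrite -[_ *: _]mulrC; lra.
Qed.
End IntervalIntegral.

(** * Goursat's theorem *)

Section Goursat.
Variable R : realType.
Implicit Types (f g : R[i] -> R[i]) (z w : R[i]) (a b c d : R).

Definition ccont f z := forall e, 0 < e -> exists2 r, 0 < r &
  forall w, normc (w - z) < r -> normc (f w - f z) < e.

(** The bounds are stated with the real-valued modulus; the norm that R[i]
    carries as a normed space over itself has its values in R[i]. *)
Definition cderiv f z l := forall e, 0 < e -> exists2 r, 0 < r &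
  forall w, normc (w - z) < r ->
    normc (f w - f z - l * (w - z)) <= e * normc (w - z).

Definition cdiff f z := exists l, cderiv f z l.

(** The counterclockwise integral over the boundary of [a,b] x [c,d]. *)
Definition oint f a b c d : R[i] :=
  cint a b (fun x => f (Complex x c)) - cint a b (fun x => f (Complex x d)) +
  iu * (cint c d (fun y => f (Complex b y)) - cint c d (fun y => f (Complex a y))).

Arguments oint : simpl never.

Definition on_rect (P : R[i] -> Prop) a b c d :=
  forall x y, a <= x <= b -> c <= y <= d -> P (Complex x y).

Definition on_edges (P : R[i] -> Prop) a b c d :=
  forall x y, a <= x <= b -> c <= y <= d -> [\/ x = a, x = b, y = c | y = d] ->
    P (Complex x y).

Lemma on_rect_edges (P : R[i] -> Prop) a b c d :
  on_rect P a b c d -> on_edges P a b c d.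
Proof. by move=> H x y hx hy _; exact: H. Qed.

Lemma complexBh x x' y : Complex x y - Complex x' y = ((x - x')%:C)%C :> R[i].
Proof. by apply: cplx_eq; rewrite !ReImE /=; ring. Qed.
Lemma complexBv x y y' : Complex x y - Complex x y' = iu * ((y - y')%:C)%C :> R[i].
Proof. by apply: cplx_eq; rewrite !ReImE /=; ring. Qed.

Lemma ccont_h f x y : ccont f (Complex x y) -> ccont1 (fun x => f (Complex x y)) x.
Proof.
move=> fc e e0; have [r r0 h] := fc e e0; exists r => // s sx.
by apply: h; rewrite complexBh normc_real.
Qed.

Lemma ccont_v f x y : ccont f (Complex x y) -> ccont1 (fun y => f (Complex x y)) y.
Proof.
move=> fc e e0; have [r r0 h] := fc e e0; exists r => // s sx.
by apply: h; rewrite complexBv normcM normc_iu mul1r normc_real.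
Qed.

Lemma on_rect_h f a b c d y : c <= y <= d -> on_rect (ccont f) a b c d ->
  ccont_on (fun x => f (Complex x y)) a b.
Proof. by move=> cyd fc x axb; apply: ccont_h; exact: fc. Qed.

Lemma on_rect_v f a b c d x : a <= x <= b -> on_rect (ccont f) a b c d ->
  ccont_on (fun y => f (Complex x y)) c d.
Proof. by move=> axb fc y cyd; apply: ccont_v; exact: fc. Qed.

Lemma on_edges_cont f a b c d : a <= b -> c <= d -> on_edges (ccont f) a b c d ->
  [/\ ccont_on (fun x => f (Complex x c)) a b, ccont_on (fun x => f (Complex x d)) a b,
      ccont_on (fun y => f (Complex a y)) c d & ccont_on (fun y => f (Complex b y)) c d].
Proof.
move=> ab cd fc; split=> t ht.
- by apply: ccont_h; apply: fc; rewrite ?lexx//; constructor.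
- by apply: ccont_h; apply: fc; rewrite ?lexx ?cd//; constructor.
- by apply: ccont_v; apply: fc; rewrite ?lexx//; constructor.
- by apply: ccont_v; apply: fc; rewrite ?lexx ?ab//; constructor.
Qed.

Lemma on_rect_sub (P : R[i] -> Prop) a b c d a' b' c' d' : a <= a' -> b' <= b -> c <= c' -> d' <= d ->
  on_rect P a b c d -> on_rect P a' b' c' d'.
Proof.
move=> aa bb cc dd H x y /andP[ax xb] /andP[cy yd]; apply: H.
  by rewrite (le_trans aa)//= (le_trans xb).
by rewrite (le_trans cc)//= (le_trans yd).
Qed.

Lemma oint_splitx m f a b c d : a <= m <= b -> c <= d ->
  on_rect (ccont f) a b c d -> oint f a b c d = oint f a m c d + oint f m b c d.
Proof.
move=> amb cd fc; have /andP[am mb] := amb; rewrite /oint.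
rewrite !(@cint_split _ m a b)//; first by ring.
  by apply: on_rect_h fc; rewrite cd lexx.
by apply: on_rect_h fc; rewrite cd lexx.
Qed.

Lemma oint_splity m f a b c d : a <= b -> c <= m <= d ->
  on_rect (ccont f) a b c d -> oint f a b c d = oint f a b c m + oint f a b m d.
Proof.
move=> ab cmd fc; have /andP[cm md] := cmd; rewrite /oint.
rewrite !(@cint_split _ m c d)//; first by ring.
  by apply: on_rect_v fc; rewrite ab lexx.
by apply: on_rect_v fc; rewrite ab lexx.
Qed.

Lemma ointD f g a b c d : a <= b -> c <= d ->
  on_edges (ccont f) a b c d -> on_edges (ccont g) a b c d ->
  oint (fun z => f z + g z) a b c d = oint f a b c d + oint g a b c d.
Proof.
move=> ab cd /on_edges_cont[]// f1 f2 f3 f4 /on_edges_cont[]// g1 g2 g3 g4.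
by rewrite /oint !cintD//; ring.
Qed.

Lemma ointZ k f a b c d : a <= b -> c <= d -> on_edges (ccont f) a b c d ->
  oint (fun z => k * f z) a b c d = k * oint f a b c d.
Proof.
move=> ab cd /on_edges_cont[]// f1 f2 f3 f4.
by rewrite /oint !cintZ//; ring.
Qed.

Lemma eq_oint f g a b c d : a <= b -> c <= d ->
  on_edges (fun z => f z = g z) a b c d -> oint f a b c d = oint g a b c d.
Proof.
move=> ab cd fg; rewrite /oint.
congr (_ - _ + _ * (_ - _)); apply: eq_cint => t /andP[t1 /ltW t2];
  by apply: fg; rewrite ?ab ?cd ?lexx ?t1//; constructor.
Qed.

Lemma normc_oint_le M f a b c d : a <= b -> c <= d -> on_edges (ccont f) a b c d ->
  on_edges (fun z => normc (f z) <= M) a b c d ->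
  normc (oint f a b c d) <= 4 * M * ((b - a) + (d - c)).
Proof.
move=> ab cd /on_edges_cont[]// f1 f2 f3 f4 fM.
have h1 := normc_cint_le ab f1 (M := M); have h2 := normc_cint_le ab f2 (M := M).
have h3 := normc_cint_le cd f3 (M := M); have h4 := normc_cint_le cd f4 (M := M).
rewrite /oint (le_trans (normcD _ _))// normcM normc_iu mul1r.
rewrite (le_trans (lerD (normcB _ _) (normcB _ _)))//.
have {}h1 : _ := h1 _; have {}h2 := h2 _; have {}h3 := h3 _; have {}h4 := h4 _.
have {}h1 := h1 (fun t ht => fM t c ht (introT andP (conj (lexx c) cd)) (Or43 _ _ _ erefl)).
have {}h2 := h2 (fun t ht => fM t d ht (introT andP (conj cd (lexx d))) (Or44 _ _ _ erefl)).
have {}h3 := h3 (fun t ht => fM a t (introT andP (conj (lexx a) ab)) ht (Or41 _ _ _ erefl)).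
have {}h4 := h4 (fun t ht => fM b t (introT andP (conj ab (lexx b))) ht (Or42 _ _ _ erefl)).
by move: h1 h2 h3 h4; lra.
Qed.

(** The edge integrals are computed. In Goursat's theorem this removes the
    linear part of f at the limit point. *)
Lemma oint_affine (u v : R[i]) a b c d : a <= b -> c <= d ->
  oint (fun z => u + v * z) a b c d = 0.
Proof.
move=> ab cd; rewrite /oint.
have h y : cint a b (fun x => u + v * Complex x y) =
    (u + v * (iu * (y%:C)%C)) * ((b - a)%:C)%C + v * (((b ^+ 2 - a ^+ 2) / 2)%:C)%C.
  rewrite -cint_cst// -cint_id// -cintZ; last by move=> t _; exact: ccont1_id.
  rewrite -cintD; first last.
  - by move=> t _; apply: ccont1Z; exact: ccont1_id.
  - by move=> t _; exact: ccont1_cst.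
  apply: eq_cint => t _; rewrite -addrA -mulrDr; congr (_ + _ * _).
  by apply: cplx_eq; rewrite !ReImE/=; ring.
have k x : cint c d (fun y => u + v * Complex x y) =
    (u + v * (x%:C)%C) * ((d - c)%:C)%C + v * iu * (((d ^+ 2 - c ^+ 2) / 2)%:C)%C.
  rewrite -cint_cst// -cint_id// -cintZ; last by move=> t _; exact: ccont1_id.
  rewrite -cintD; first last.
  - by move=> t _; apply: ccont1Z; exact: ccont1_id.
  - by move=> t _; exact: ccont1_cst.
  apply: eq_cint => t _; rewrite -addrA -mulrA -mulrDr; congr (_ + _ * _).
  by apply: cplx_eq; rewrite !ReImE/=; ring.
rewrite !h !k !rmorphB /=; ring.
Qed.

Lemma cdiff_cont f z : cdiff f z -> ccont f z.
Proof.
move=> [l fl] e e0; have [r r0 h] := fl 1 ltr01.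
have l0 : 0 < normc l + 1 by rewrite ltr_wpDl ?normc_ge0.
exists (Num.min r (e / (normc l + 1))); first by rewrite lt_min r0 divr_gt0.
move=> w; rewrite lt_min => /andP[/h h1]; rewrite ltr_pdivlMr// => h2.
rewrite -(subrK (l * (w - z)) (f w - f z)) (le_lt_trans (normcD _ _))//.
rewrite normcM; apply: le_lt_trans h2; rewrite mul1r in h1; rewrite [normc l * _]mulrC.
by move: h1; lra.
Qed.

Lemma ccontD f g z : ccont f z -> ccont g z -> ccont (fun w => f w + g w) z.
Proof.
move=> fc gc e e0; have e20 : 0 < e / 2 by rewrite divr_gt0.
have [d1 d10 h1] := fc _ e20; have [d2 d20 h2] := gc _ e20.
exists (Num.min d1 d2); first by rewrite lt_min d10.
move=> s; rewrite lt_min => /andP[/h1 s1 /h2 s2].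
rewrite opprD addrACA (le_lt_trans (normcD _ _))// [ltRHS](splitr e).
exact: ltrD.
Qed.

Lemma cderiv_affine (u v : R[i]) z : cderiv (fun w => u + v * w) z v.
Proof.
move=> e e0; exists 1 => // w _.
rewrite (_ : _ - _ - _ = 0) ?normc0; first by rewrite mulr_ge0 ?normc_ge0// ltW.
by ring.
Qed.

Lemma ccont_affine (u v : R[i]) z : ccont (fun w => u + v * w) z.
Proof. by apply: cdiff_cont; exists v; exact: cderiv_affine. Qed.

(** The supremum of the left endpoints lies in all the intervals, since each
    right endpoint is an upper bound of all left endpoints. *)
Lemma nested_halving (x : nat -> R) s : 0 <= s ->
  (forall n, x n <= x n.+1 <= x n + s / 2 ^+ n.+1) ->
  exists X, forall n, x n <= X <= x n + s / 2 ^+ n.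
Proof.
move=> s0 xs.
have x_inc m n : (m <= n)%N -> x m <= x n.
  by apply: (@homo_leq _ x <=%R) => // [? ? ?|k]; [exact: le_trans|case/andP: (xs k)].
have y_dec m n : (m <= n)%N -> x n + s / 2 ^+ n <= x m + s / 2 ^+ m.
  apply: (@homo_leq _ (fun k => x k + s / 2 ^+ k) (fun u v => v <= u)) => //.
    by move=> u v w vu uw; exact: le_trans uw vu.
  move=> k; case/andP: (xs k) => _ h.
  have -> : s / 2 ^+ k = s / 2 ^+ k.+1 + s / 2 ^+ k.+1.
    by rewrite exprS; field; rewrite expf_neq0.
  by rewrite addrA lerD2r.
have p0 k : 0 <= s / 2 ^+ k by rewrite divr_ge0// exprn_ge0.
have xy m n : x m <= x n + s / 2 ^+ n.
  have [mn|nm] := leqP m n; first by rewrite (le_trans (x_inc _ _ mn))// lerDl.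
  by rewrite (le_trans _ (y_dec _ _ (ltnW nm)))// lerDl.
have hs : has_sup (range x).
  by split; [exists (x 0%N); exists 0%N|exists (x 0%N + s / 2 ^+ 0) => _ [n _ <-]].
exists (sup (range x)) => n; apply/andP; split.
  by apply: ub_le_sup; [case: hs|exists n].
by apply: ge_sup; [case: hs|move=> _ [m _ <-]].
Qed.

(** The inner edges are traversed twice in opposite directions, so the
    integrals over the four quarters add up to the integral over the
    rectangle. *)
Lemma oint_quarters f (x y s t K : R) : 0 < s -> 0 < t ->
  on_rect (ccont f) x (x + (s + s)) y (y + (t + t)) ->
  (forall u v, (u = x \/ u = x + s) -> (v = y \/ v = y + t) ->
     normc (oint f u (u + s) v (v + t)) < K) ->
  normc (oint f x (x + (s + s)) y (y + (t + t))) < 4 * K.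
Proof.
move=> s0 t0 fc H.
have L (r : R) : r = r \/ r = r + s by left.
have L' (r : R) : r = r \/ r = r + t by left.
have R1 : x + s = x \/ x + s = x + s by right.
have R2 : y + t = y \/ y + t = y + t by right.
have := H x y (L x) (L' y); have := H (x + s) y R1 (L' y).
have := H x (y + t) (L x) R2; have := H (x + s) (y + t) R1 R2.
have e1 : x <= x + s <= x + (s + s) by apply/andP; lra.
have e2 : y <= y + t <= y + (t + t) by apply/andP; lra.
rewrite -!addrA => h1 h2 h3 h4.
have e3 : y <= y + (t + t) by lra.
have e4 : x <= x + s by lra.
have e5 : x + s <= x + (s + s) by lra.
rewrite (oint_splitx e1 e3 fc) (oint_splity e4 e2); last first.
  by apply: on_rect_sub fc.
rewrite (oint_splity e5 e2); last by apply: on_rect_sub fc.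
apply: (le_lt_trans (normcD _ _)).
have := normcD (oint f x (x + s) y (y + t)) (oint f x (x + s) (y + t) (y + (t + t))).
have := normcD (oint f (x + s) (x + (s + s)) y (y + t)) (oint f (x + s) (x + (s + s)) (y + t) (y + (t + t))).
lra.
Qed.

(** By bisection: a rectangle on which the integral is large compared with the
    square of its perimeter has a quarter with the same property, which is
    incompatible with differentiability at the limit point. *)
Lemma Goursat f a b c d : a < b -> c < d -> on_rect (cdiff f) a b c d ->
  oint f a b c d = 0.
Proof.
move=> ab cd fd; apply/eqP; rewrite -normc_eq0; apply/eqP/le_anti.
rewrite normc_ge0 andbT leNgt; apply/negP => I0.
pose s := b - a; pose t := d - c.
have s0 : 0 < s by rewrite subr_gt0.
have t0 : 0 < t by rewrite subr_gt0.
have st0 : 0 < s + t by rewrite addr_gt0.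
pose e := normc (oint f a b c d) / (s + t) ^+ 2.
have e0 : 0 < e by rewrite divr_gt0// exprn_gt0.
pose S n := s / 2 ^+ n; pose T n := t / 2 ^+ n.
have Sgt0 n : 0 < S n by rewrite divr_gt0// exprn_gt0.
have Tgt0 n : 0 < T n by rewrite divr_gt0// exprn_gt0.
have SS n : S n = S n.+1 + S n.+1 by rewrite /S exprS; field; rewrite expf_neq0.
have TS n : T n = T n.+1 + T n.+1 by rewrite /T exprS; field; rewrite expf_neq0.
pose bad n (p : R * R) := [/\ a <= p.1, p.1 + S n <= b, c <= p.2, p.2 + T n <= d &
  e * (S n + T n) ^+ 2 <= normc (oint f p.1 (p.1 + S n) p.2 (p.2 + T n))].
pose near n (p p' : R * R) := p.1 <= p'.1 <= p.1 + S n.+1 /\ p.2 <= p'.2 <= p.2 + T n.+1.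
have step (np : nat * (R * R)) : exists p', bad np.1 np.2 ->
    bad np.1.+1 p' /\ near np.1 np.2 p'.
  case: np => n [x y] /=.
  have [|nb] := pselect (bad n (x, y)); last by exists (x, y).
  move=> [/= ax xb cy yd B].
  have Sn := Sgt0 n.+1; have Tn := Tgt0 n.+1.
  have fc : on_rect (ccont f) x (x + (S n.+1 + S n.+1)) y (y + (T n.+1 + T n.+1)).
    rewrite -SS -TS => u v /andP[u1 u2] /andP[v1 v2]; apply: cdiff_cont.
    by apply: fd; apply/andP; split; [exact: le_trans u1|exact: le_trans xb|
      exact: le_trans v1|exact: le_trans yd].
  apply: contrapT => /forallNP nobad.
  have := B; apply/negP; rewrite -ltNge.
  have -> : e * (S n + T n) ^+ 2 = 4 * (e * (S n.+1 + T n.+1) ^+ 2).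
    by rewrite (SS n) (TS n); ring.
  rewrite (SS n) (TS n); apply: oint_quarters => // u v hu hv.
  rewrite ltNge; apply/negP => h; apply: (nobad (u, v)) => _.
  move: xb yd; rewrite (SS n) (TS n); move: Sn Tn h hu hv; rewrite /bad /near/=.
  move: (S n.+1) (T n.+1) => S' T' S0 T0 h hu hv xb yd.
  have ux : x <= u <= x + S' by case: hu => ->; rewrite ?lexx ?lerDl ?(ltW S0).
  have vy : y <= v <= y + T' by case: hv => ->; rewrite ?lexx ?lerDl ?(ltW T0).
  split => //; case/andP: ux => x1 x2; case/andP: vy => y1 y2; split => //.
  - exact: le_trans ax x1.
  - by rewrite (le_trans _ xb)// addrA lerD2r.
  - exact: le_trans cy y1.
  - by rewrite (le_trans _ yd)// addrA lerD2r.
have [F Fstep] := choice step.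
pose P := fix P n := if n is n'.+1 then F (n', P n') else (a, c).
have Pbad n : bad n (P n).
  elim: n => [|n IH]; last by have [] := Fstep (n, P n) IH.
  rewrite /bad /S /T/= expr0 !divr1 /s /t [a + _]addrC subrK [c + _]addrC subrK.
  split => //.
  by rewrite /e divfK// lt0r_neq0// exprn_gt0.
have Pnear n : near n (P n) (P n.+1) by have [] := Fstep (n, P n) (Pbad n).
have [X hX] := nested_halving (ltW s0) (fun n => proj1 (Pnear n)).
have [Y hY] := nested_halving (ltW t0) (fun n => proj2 (Pnear n)).
have [l lf] : cdiff f (Complex X Y).
  have [/= a1 b1 c1 d1 _] := Pbad 0%N; have := hX 0%N; have := hY 0%N.
  rewrite -/(S 0%N) -/(T 0%N) => /andP[y1 y2] /andP[x1 x2].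
  by apply: fd; apply/andP; split; [exact: le_trans x1|exact: le_trans b1|
    exact: le_trans y1|exact: le_trans d1].
have [r r0 hr] := lf (e / 8) (divr_gt0 e0 (ltr0n _ 8)).
have [n nr] : exists n, S n + T n < r.
    have [n _ hn] := near_infty_natSinv_expn_lt (PosNum (divr_gt0 r0 st0)).
  exists n; have /= := hn n (leqnn n).
  by rewrite ltr_pdivlMr// mulrDr /S /T mul1r mulrC [_ * t]mulrC.
have [/= a1 b1 c1 d1] := Pbad n; apply/negP; rewrite -ltNge.
have /andP[X1 X2] := hX n; have /andP[Y1 Y2] := hY n; rewrite -/(S n) -/(T n) in X2 Y2.
have Sn := Sgt0 n; have Tn := Tgt0 n.
move: (P n) (S n) (T n) Sn Tn nr a1 b1 c1 d1 X1 X2 Y1 Y2 => [x y] /= S' T'.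
move=> S0 T0 nr a1 b1 c1 d1 X1 X2 Y1 Y2.
have fc : on_rect (ccont f) x (x + S') y (y + T').
  move=> u v /andP[u1 u2] /andP[v1 v2]; apply: cdiff_cont.
  by apply: fd; apply/andP; split; [exact: le_trans u1|exact: le_trans b1|
    exact: le_trans v1|exact: le_trans d1].
have xS : x <= x + S' by rewrite lerDl ltW.
have yT : y <= y + T' by rewrite lerDl ltW.
pose Z := Complex X Y; pose q w := (f Z - l * Z) + l * w.
have rc : on_rect (ccont (fun w => f w + (-1) * q w)) x (x + S') y (y + T').
  move=> u v hu hv; apply: ccontD; first exact: fc.
  have -> : (fun w => -1 * q w) = (fun w => - (f Z - l * Z) + (- l) * w).
    by apply/funext => w; rewrite /q; ring.
  exact: ccont_affine.
have fE : oint f x (x + S') y (y + T') =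
    oint (fun w => q w + (f w + (-1) * q w)) x (x + S') y (y + T').
  by apply: eq_oint => // u v _ _ _; ring.
rewrite fE ointD//; last 2 first.
- by move=> u v _ _ _; exact: ccont_affine.
- exact: on_rect_edges.
rewrite oint_affine// add0r.
have M : on_rect (fun w => normc (f w + (-1) * q w) <= e / 8 * (S' + T'))
    x (x + S') y (y + T').
  move=> u v /andP[u1 u2] /andP[v1 v2].
  have uv : normc (Complex u v - Z) <= S' + T'.
    rewrite (le_trans (normc_le_ReIm _))//= lerD// ler_norml; apply/andP; lra.
  rewrite (_ : _ + _ = f (Complex u v) - f Z - l * (Complex u v - Z)); last first.
    by rewrite /q; ring.
  rewrite (le_trans (hr _ _))//; first exact: le_lt_trans nr.
  by rewrite ler_wpM2l// divr_ge0// ltW.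
rewrite (le_lt_trans (normc_oint_le _ _ (on_rect_edges rc) (on_rect_edges M)))//.
have -> : x + S' - x = S' by ring.
have -> : y + T' - y = T' by ring.
have ST : 0 < (S' + T') ^+ 2 by rewrite exprn_gt0// addr_gt0.
have := mulr_gt0 e0 ST; rewrite expr2; lra.
Qed.
End Goursat.

(** * Rules of complex differentiation *)

Section ComplexDerivative.
Variable R : realType.
Implicit Types (f g : R[i] -> R[i]) (z w : R[i]).

Lemma cplxE z : z = ((cRe z)%:C)%C + iu * ((cIm z)%:C)%C.
Proof. by apply: cplx_eq; rewrite !ReImE /=; ring. Qed.

Lemma cdiff_cst (k : R[i]) z : cdiff (fun _ => k) z.
Proof.
exists 0 => e e0; exists 1 => // w _.
by rewrite subrr mul0r subrr normc0 mulr_ge0 ?normc_ge0// ltW.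
Qed.

Lemma cdiff_id z : cdiff (fun w => w) z.
Proof.
exists 1 => e e0; exists 1 => // w _.
by rewrite mul1r subrr normc0 mulr_ge0 ?normc_ge0// ltW.
Qed.

Lemma cdiff_lip f z : cdiff f z -> exists K r, [/\ 0 < K, 0 < r &
  forall w, normc (w - z) < r -> normc (f w - f z) <= K * normc (w - z)].
Proof.
move=> [l fl]; have [r r0 h] := fl 1 ltr01.
exists (normc l + 1), r; split => //; first by rewrite ltr_wpDl ?normc_ge0.
move=> w /h h1; rewrite -(subrK (l * (w - z)) (f w - f z)).
by rewrite (le_trans (normcD _ _))// normcM; move: h1; lra.
Qed.

Lemma cdiffD f g z : cdiff f z -> cdiff g z -> cdiff (fun w => f w + g w) z.
Proof.
move=> [l fl] [m gm]; exists (l + m) => e e0.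
have e20 : 0 < e / 2 by rewrite divr_gt0.
have [d1 d10 h1] := fl _ e20; have [d2 d20 h2] := gm _ e20.
exists (Num.min d1 d2); first by rewrite lt_min d10.
move=> w; rewrite lt_min => /andP[/h1 s1 /h2 s2].
rewrite (_ : _ - _ - _ = (f w - f z - l * (w - z)) + (g w - g z - m * (w - z))).
  by rewrite (le_trans (normcD _ _))//; move: s1 s2; lra.
by ring.
Qed.

Lemma cdiffM f g z : cdiff f z -> cdiff g z -> cdiff (fun w => f w * g w) z.
Proof.
move=> df dg; have [K [r [K0 r0 hK]]] := cdiff_lip df.
have cg := cdiff_cont dg; case: df => l fl; case: dg => m gm.
exists (l * g z + f z * m) => e e0.
pose B := normc (g z) + normc (f z) + K + 1.
have B0 : 0 < B by rewrite ltr_wpDl// addr_ge0 ?addr_ge0 ?normc_ge0 ?(ltW K0).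
have eB : 0 < e / B by rewrite divr_gt0.
have [d1 d10 h1] := fl _ eB; have [d2 d20 h2] := gm _ eB; have [d3 d30 h3] := cg _ eB.
exists (Num.min r (Num.min d1 (Num.min d2 d3))); first by rewrite !lt_min r0 d10 d20.
move=> w; rewrite !lt_min => /and4P[/hK k /h1 s1 /h2 s2 /h3 s3].
rewrite (_ : _ - _ - _ = (f w - f z - l * (w - z)) * g z +
  (f z * (g w - g z - m * (w - z)) + (f w - f z) * (g w - g z))); last by ring.
rewrite (le_trans (normcD _ _))// normcM.
have t1 : normc (f w - f z - l * (w - z)) * normc (g z) <=
   (e / B * normc (w - z)) * normc (g z) by rewrite ler_wpM2r ?normc_ge0.
have t2 : normc (f z * (g w - g z - m * (w - z))) <=
   normc (f z) * (e / B * normc (w - z)) by rewrite normcM ler_wpM2l ?normc_ge0.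
have t3 : normc ((f w - f z) * (g w - g z)) <= (K * normc (w - z)) * (e / B).
  by rewrite normcM ler_pM ?normc_ge0// ltW.
have t4 := normcD (f z * (g w - g z - m * (w - z))) ((f w - f z) * (g w - g z)).
have t5 : 0 <= e / B * normc (w - z) by rewrite mulr_ge0 ?normc_ge0// ltW.
have -> : e * normc (w - z) = (e / B * normc (w - z)) * B by field; rewrite gt_eqF.
by move: t1 t2 t3 t4 t5; move: (e / B) => q; rewrite /B; lra.
Qed.

Lemma cdiffN f z : cdiff f z -> cdiff (fun w => - f w) z.
Proof.
by move=> df; under eq_fun do rewrite -mulN1r; apply: cdiffM => //; exact: cdiff_cst.
Qed.

Lemma cdiffX f z k : cdiff f z -> cdiff (fun w => f w ^+ k) z.
Proof.
move=> df; elim: k => [|k IH]; first by under eq_fun do rewrite expr0; exact: cdiff_cst.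
by under eq_fun do rewrite exprS; exact: cdiffM.
Qed.

Lemma cdiff_comp f g z : cdiff f (g z) -> cdiff g z -> cdiff (fun w => f (g w)) z.
Proof.
move=> [l fl] dg; have [K [r [K0 r0 hK]]] := cdiff_lip dg; case: dg => m gm.
exists (l * m) => e e0.
pose B := normc l + K; have B0 : 0 < B by rewrite ltr_wpDl ?normc_ge0.
have eB : 0 < e / B by rewrite divr_gt0.
have [d1 d10 h1] := fl _ eB; have [d2 d20 h2] := gm _ eB.
exists (Num.min r (Num.min (d1 / K) d2)); first by rewrite !lt_min r0 d20 divr_gt0.
move=> w; rewrite !lt_min => /and3P[/hK k]; rewrite ltr_pdivlMr// => k' /h2 s2.
have {h1} s1 := h1 (g w) _; have {}s1 := s1 (le_lt_trans k _).
have {}s1 : normc (f (g w) - f (g z) - l * (g w - g z)) <= e / B * normc (g w - g z).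
  by apply: s1; rewrite mulrC.
rewrite (_ : _ - _ - _ = (f (g w) - f (g z) - l * (g w - g z)) +
  l * (g w - g z - m * (w - z))); last by ring.
rewrite (le_trans (normcD _ _))// normcM.
have t1 : e / B * normc (g w - g z) <= e / B * (K * normc (w - z)).
  by rewrite ler_wpM2l// ltW.
have t2 : normc l * normc (g w - g z - m * (w - z)) <= normc l * (e / B * normc (w - z)).
  by rewrite ler_wpM2l ?normc_ge0.
have -> : e * normc (w - z) = (e / B * normc (w - z)) * B by field; rewrite gt_eqF.
by move: s1 t1 t2; move: (e / B) => q; rewrite /B; lra.
Qed.

Lemma cdiff_inv z : z != 0 -> cdiff (fun w => w^-1) z.
Proof.
move=> z0; have nz : 0 < normc z by rewrite normc_gt0.
exists (- (z ^+ 2)^-1) => e e0.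
exists (Num.min (normc z / 2) (e * normc z ^+ 3 / 2)).
  by rewrite lt_min !divr_gt0// mulr_gt0// exprn_gt0.
move=> w; rewrite lt_min => /andP[h1 h2].
have wz : normc z / 2 <= normc w.
  have := normcB w (w - z); rewrite opprB addrC subrK => h3.
  by move: h1 h3; lra.
have w0 : w != 0 by rewrite -normc_gt0 (lt_le_trans _ wz)// divr_gt0.
rewrite (_ : _ - _ - _ = (w - z) * ((w - z) / (w * z ^+ 2))); last first.
  by field; rewrite w0 z0.
rewrite normcM [leRHS]mulrC ler_wpM2l ?normc_ge0//.
rewrite normcM normcV normcM normcX ler_pdivrMr; last first.
  by rewrite mulr_gt0 ?exprn_gt0// normc_gt0.
have nz2 : 0 <= normc z ^+ 2 by rewrite exprn_ge0// ltW.
have : e * (normc z / 2 * normc z ^+ 2) <= e * (normc w * normc z ^+ 2).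
  by rewrite ler_wpM2l ?(ltW e0)// ler_wpM2r.
by move: h2; rewrite exprS; lra.
Qed.

Lemma cdiffV f z : f z != 0 -> cdiff f z -> cdiff (fun w => (f w)^-1) z.
Proof. by move=> f0 df; exact: cdiff_comp (cdiff_inv f0) df. Qed.

Lemma expR_taylor (t : R) : `|t| <= 2^-1 -> 0 <= expR t - 1 - t <= 2 * t ^+ 2.
Proof.
rewrite ler_norml => /andP[t1 t2]; have := expR_ge1Dx t; have := expR_ge1Dx (- t).
rewrite expRN => h1 h2; apply/andP; split; first lra.
have t3 : 0 < 1 - t by lra.
have h3 : expR t <= (1 - t)^-1 by rewrite -[expR t]invrK lef_pV2// posrE ?invr_gt0 ?expR_gt0.
suff : (1 - t)^-1 <= 1 + t + 2 * t ^+ 2 by lra.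
rewrite -[(1 - t)^-1]mul1r ler_pdivrMr//.
have : 0 <= t ^+ 2 * (1 - 2 * t) by rewrite mulr_ge0 ?sqr_ge0//; lra.
by rewrite !expr2; lra.
Qed.

(** By cexp (a + b) = cexp a * cexp b it is enough to look at the origin,
    where the real and the imaginary direction are expanded separately. *)
Lemma cderiv_cexp z : cderiv (@cexp R) z (cexp z).
Proof.
move=> e e0; have E0 : 0 < normc (cexp z) by rewrite normc_gt0 cexp_neq0.
exists (Num.min 2^-1 (e / (8 * normc (cexp z)))).
  by rewrite lt_min invr_gt0 ltr0n divr_gt0// mulr_gt0.
move=> w; rewrite lt_min ltr_pdivlMr ?mulr_gt0// => /andP[h1 h2].
pose h := w - z; rewrite -/h in h1 h2 *.
have -> : cexp w - cexp z - cexp z * h = cexp z * (cexp h - 1 - h).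
  by rewrite /h [w in LHS](_ : w = z + (w - z)) ?cexpD; ring.
rewrite normcM; set a := cRe h; set b := cIm h.
have ha : `|a| <= normc h := Re_le_normc h.
have hb : `|b| <= normc h := Im_le_normc h.
have hE : cexp h = ((expR a)%:C)%C * cexp (iu * (b%:C)%C).
  rewrite iuM_real; apply: cplx_eq; rewrite !ReImE /cexp /= expR0 -/a -/b; ring.
have -> : cexp h - 1 - h = ((expR a)%:C)%C * (cexp (iu * (b%:C)%C) - 1 - iu * (b%:C)%C) +
   ((expR a - 1 - a)%:C)%C + ((expR a - 1)%:C)%C * (iu * (b%:C)%C).
  by rewrite hE [X in _ - X = _](cplxE h) -/a -/b !rmorphB !rmorph1; ring.
have a2 : `|a| <= 2^-1 by rewrite (le_trans ha)// ltW.
have /andP[e1 e2] := expR_taylor a2.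
have nh2 : a ^+ 2 <= normc h ^+ 2 by rewrite -[a ^+ 2]ger0_norm ?sqr_ge0// normrX lerXn2r ?nnegrE ?normc_ge0.
have nb2 : b ^+ 2 <= normc h ^+ 2 by rewrite -[b ^+ 2]ger0_norm ?sqr_ge0// normrX lerXn2r ?nnegrE ?normc_ge0.
have ea2 : expR a <= 2.
  move: a2; rewrite ler_norml => /andP[q1 q2].
  have : a ^+ 2 <= 4^-1 by rewrite expr2; nra.
  lra.
have ea1 : `|expR a - 1| <= 2 * `|a|.
  have -> : expR a - 1 = (expR a - 1 - a) + a by ring.
  rewrite (le_trans (ler_normD _ _))// ger0_norm//.
  have : a ^+ 2 <= 2^-1 * `|a| by rewrite -real_normK ?num_real// expr2 ler_wpM2r.
  lra.
have tb := cexp_taylor b.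
apply: (@le_trans _ _ (normc (cexp z) * (8 * normc h ^+ 2))).
  rewrite ler_wpM2l ?normc_ge0//.
  rewrite (le_trans (normcD _ _))// (le_trans (lerD (normcD _ _) (lexx _)))//.
  rewrite !normcM normc_iu mul1r !normc_real (ger0_norm (expR_ge0 _)) (ger0_norm e1).
  have t1 : expR a * normc (cexp (iu * (b%:C)%C) - 1 - iu * (b%:C)%C) <= 2 * (2 * b ^+ 2).
    by rewrite ler_pM ?expR_ge0 ?normc_ge0.
  have t2 : `|expR a - 1| * `|b| <= (2 * normc h) * normc h.
    by rewrite ler_pM// (le_trans ea1)// ler_wpM2l.
  by move: t1 t2 nh2 nb2 e2; rewrite -mulrA -expr2; lra.
by move: h2; have := normc_ge0 h; rewrite expr2; nra.
Qed.

Lemma cdiff_cexp f z : cdiff f z -> cdiff (fun w => cexp (f w)) z.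
Proof. by apply: cdiff_comp; exists (cexp (f z)); exact: cderiv_cexp. Qed.
End ComplexDerivative.

(** * Cauchy's formula *)

Section CauchyFormula.
Variable R : realType.
Implicit Types (f g : R[i] -> R[i]) (z w : R[i]) (a b c d : R).

Lemma cint_Re_ge (F : R -> R[i]) a b M : a <= b -> ccont_on F a b ->
  (forall t, a <= t <= b -> M <= cRe (F t)) -> M * (b - a) <= cRe (cint a b F).
Proof.
move=> ab Fc FM; rewrite -Rintegral_indic_itv//=.
have [F1 _] := on_itv_integrable Fc.
apply: le_Rintegral => //; first exact: rintegrable_indic_itv.
by move=> t _; rewrite /on_itv; case: ifP => // /andP[t1 /ltW t2]; rewrite FM ?t1.
Qed.

Lemma cint_Im_ge (F : R -> R[i]) a b M : a <= b -> ccont_on F a b ->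
  (forall t, a <= t <= b -> M <= cIm (F t)) -> M * (b - a) <= cIm (cint a b F).
Proof.
move=> ab Fc FM; rewrite -Rintegral_indic_itv//=.
have [_ F1] := on_itv_integrable Fc.
apply: le_Rintegral => //; first exact: rintegrable_indic_itv.
by move=> t _; rewrite /on_itv; case: ifP => // /andP[t1 /ltW t2]; rewrite FM ?t1.
Qed.

Lemma ReV z : cRe z^-1 = cRe z / (cRe z ^+ 2 + cIm z ^+ 2).
Proof. by case: z. Qed.
Lemma ImV z : cIm z^-1 = - (cIm z / (cRe z ^+ 2 + cIm z ^+ 2)).
Proof. by case: z. Qed.

(** A positive lower bound takes the place of the exact value 2 pi i, and
    suffices to divide by the integral. All four edges contribute
    nonnegatively to the imaginary part; the bound is the contribution of the
    bottom edge. *)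
Lemma winding_gt a b c d x y : a < x < b -> c < y < d ->
  (y - c) / ((b - a) ^+ 2 + (d - c) ^+ 2) * (b - a) <=
    cIm (oint (fun w => (w - Complex x y)^-1) a b c d).
Proof.
move=> /andP[ax xb] /andP[cy yd]; set z := Complex x y.
have ab : a <= b by apply: ltW; exact: lt_trans xb.
have cd : c <= d by apply: ltW; exact: lt_trans yd.
have fc : on_edges (ccont (fun w => (w - z)^-1)) a b c d.
  move=> u v hu hv huv; apply: cdiff_cont; apply: cdiffV; last first.
    by apply: cdiffD; [exact: cdiff_id|exact: cdiff_cst].
  rewrite subr_eq0; apply/eqP => -[ux vy]; subst u v.
  by case: huv => h; move: ax xb cy yd; rewrite h ltxx.
have [f1 f2 f3 f4] := on_edges_cont ab cd fc.
have S0 (u v : R) : 0 <= u ^+ 2 + v ^+ 2 by rewrite addr_ge0// sqr_ge0.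
have h1 : (y - c) / ((b - a) ^+ 2 + (d - c) ^+ 2) * (b - a) <=
    cIm (cint a b (fun t => (Complex t c - z)^-1)).
  apply: cint_Im_ge => // t /andP[at_ tb]; rewrite ImV !ReImE/=.
  rewrite -mulNr opprB ler_wpM2l ?subr_ge0 ?(ltW cy)//.
  have P : 0 < (t - x) ^+ 2 + (c - y) ^+ 2.
    by rewrite ltr_wpDl ?sqr_ge0// exprn_even_gt0//= subr_eq0 lt_eqF.
  have Q : (t - x) ^+ 2 + (c - y) ^+ 2 <= (b - a) ^+ 2 + (d - c) ^+ 2.
    by rewrite lerD// -ler_sqrt ?sqr_ge0// !sqrtr_sqr ler_norml; 
      rewrite [`|_ - _|]ger0_norm ?subr_ge0//; apply/andP; lra.
  by rewrite lef_pV2 ?posrE// (lt_le_trans P).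
have h2 : 0 * (b - a) <= cIm (- cint a b (fun t => (Complex t d - z)^-1)).
  rewrite -[- cint _ _ _]mulN1r -cintZ//; apply: cint_Im_ge => //.
    by move=> t ht; apply: ccont1Z; exact: f2.
  move=> t ht; rewrite mulN1r ImN ImV !ReImE/= opprK divr_ge0// subr_ge0 ltW//.
have h3 : 0 * (d - c) <= cRe (cint c d (fun t => (Complex b t - z)^-1)).
  apply: cint_Re_ge => // t ht; rewrite ReV !ReImE/= divr_ge0// subr_ge0 ltW//.
have h4 : 0 * (d - c) <= cRe (- cint c d (fun t => (Complex a t - z)^-1)).
  rewrite -[- cint _ _ _]mulN1r -cintZ//; apply: cint_Re_ge => //.
    by move=> t ht; apply: ccont1Z; exact: f3.
  move=> t ht; rewrite mulN1r ReN ReV !ReImE/=.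
  by rewrite -mulNr opprB divr_ge0// subr_ge0 ltW.
rewrite /oint !ReImE [cRe iu]/= [cIm iu]/= mul0r mul1r add0r.
by rewrite ?ReImE in h2 h4; move: h1 h2 h3 h4; lra.
Qed.

(** Goursat's theorem applies to the rectangles around a small square centred
    at the exceptional point, and the integral over that square is at most a
    constant times its side. *)
Lemma Goursat_removable f a b c d x y : a < x < b -> c < y < d ->
  on_rect (ccont f) a b c d ->
  on_rect (fun w => w != Complex x y -> cdiff f w) a b c d ->
  oint f a b c d = 0.
Proof.
move=> /andP[ax xb] /andP[cy yd] fc fd.
have ab : a <= b by apply: ltW; exact: lt_trans xb.
have cd : c <= d by apply: ltW; exact: lt_trans yd.
have xab : a <= x <= b by rewrite !ltW.
have ycd : c <= y <= d by rewrite !ltW.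
have [r r0 hr] := fc _ _ xab ycd 1 ltr01.
pose M := normc (f (Complex x y)) + 1.
have M0 : 0 < M by rewrite ltr_wpDl ?normc_ge0.
have key (e : R) : 0 < e -> e < r / 2 -> e < x - a -> e < b - x -> e < y - c -> e < d - y ->
    normc (oint f a b c d) <= 16 * M * e.
  move=> e0 er ea eb ec ed.
  have [A1 A2 A3 A4] : [/\ a < x - e, x - e < x, x < x + e & x + e < b].
    by split; clear -e0 ea eb; lra.
  have [B1 B2 B3 B4] : [/\ c < y - e, y - e < y, y < y + e & y + e < d].
    by split; clear -e0 ec ed; lra.
  have away a' b' c' d' : (x < a' \/ b' < x \/ y < c' \/ d' < y) ->
     a' < b' -> c' < d' -> a <= a' -> b' <= b ->
     c <= c' -> d' <= d -> oint f a' b' c' d' = 0.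
    move=> off ab' cd' aa bb cc dd; apply: Goursat => // u v /andP[u1 u2] /andP[v1 v2].
    apply: fd; rewrite ?(le_trans aa u1) ?(le_trans u2 bb) ?(le_trans cc v1) ?(le_trans v2 dd)//.
    by apply/eqP => -[ux vy]; move: off; rewrite -ux -vy !ltNge u1 u2 v1 v2; case=> [|[|[]]].
  have Axe := lt_trans A2 A3; have Bye := lt_trans B2 B3.
  have Axb := lt_trans Axe A4; have Byd := lt_trans Bye B4.
  have h1 : a <= x - e <= b by rewrite !ltW.
  have h2 : x - e <= x + e <= b by rewrite !ltW.
  have h3 : c <= y - e <= d by rewrite !ltW.
  have h4 : y - e <= y + e <= d by rewrite !ltW.
  have ab' : a < b := lt_trans ax xb.
  have cd' : c < d := lt_trans cy yd.
  rewrite (oint_splitx h1 cd fc) [X in X + _]away ?(ltW Axb)//; last by right; left.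
  rewrite add0r (oint_splitx h2 cd); last by apply: on_rect_sub fc => //; exact: ltW.
  rewrite [X in _ + X]away ?(ltW (lt_trans A1 Axe))//; last by left.
  rewrite addr0 (oint_splity _ h3) ?(ltW Axe)//; last first.
    by apply: on_rect_sub fc => //; exact: ltW.
  rewrite [X in X + _]away ?(ltW A1) ?(ltW A4) ?(ltW Byd)//; last by do 3 right.
  rewrite add0r (oint_splity _ h4) ?(ltW Axe)//; last first.
    by apply: on_rect_sub fc => //; exact: ltW.
  rewrite [X in _ + X]away ?(ltW A1) ?(ltW A4) ?(ltW (lt_trans B1 Bye))//; last by do 2 right; left.
  rewrite addr0 (le_trans (@normc_oint_le _ M _ _ _ _ _ _ _ _ _)) ?(ltW Axe) ?(ltW Bye)//.
  - by apply: on_rect_edges; apply: on_rect_sub fc; exact: ltW.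
  - move=> u v /andP[u1 u2] /andP[v1 v2] _.
    have : normc (Complex u v - Complex x y) < r.
      rewrite (le_lt_trans (normc_le_ReIm _))//= (@le_lt_trans _ _ (e + e))//; last first.
        by clear -er; lra.
      by rewrite lerD// ler_norml; apply/andP; split; [clear -u1|clear -u2|clear -v1|clear -v2]; lra.
    move=> /hr h; have := normcB (f (Complex u v) - f (Complex x y)) (- f (Complex x y)).
    rewrite opprK subrK normcN /M => h'; rewrite (le_trans h')// addrC lerD2l; exact: ltW.
  - have -> : x + e - (x - e) + (y + e - (y - e)) = 4 * e by ring.
    by rewrite (_ : 4 * M * (4 * e) = 16 * M * e)//; ring.
apply/eqP; rewrite -normc_eq0; apply/eqP/le_anti; rewrite normc_ge0 andbT.
apply/ler_addgt0Pr => e e0; rewrite add0r.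
(* Half of the minimum keeps the square strictly inside the rectangle. *)
pose e' := Num.min (e / (16 * M)) (Num.min (r / 2) (Num.min (x - a)
  (Num.min (b - x) (Num.min (y - c) (d - y))))) / 2.
have m0 : 0 < 16 * M by rewrite mulr_gt0.
have r20 : 0 < r / 2 by rewrite divr_gt0.
have e'0 : 0 < e'.
  by rewrite /e' divr_gt0// !lt_min divr_gt0// r20 !subr_gt0 ax xb cy yd.
have lt2 (u v : R) : 0 < u -> u <= v -> u / 2 < v by lra.
have : e' < Num.min (e / (16 * M)) (Num.min (r / 2) (Num.min (x - a)
  (Num.min (b - x) (Num.min (y - c) (d - y))))).
  by rewrite /e' ltr_pdivrMr// ltr_pMr ?ltr1n// !lt_min divr_gt0// r20 !subr_gt0 ax xb cy yd.
rewrite !lt_min => /and5P[h1 h2 h3 h4 /andP[h5 h6]].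
rewrite (le_trans (key _ e'0 h2 h3 h4 h5 h6))// mulrC -ler_pdivlMr//.
exact: ltW.
Qed.

(** The difference quotient (f w - f z) / (w - z), extended by the derivative
    at z, is continuous, and differentiable away from z; its boundary integral
    therefore vanishes. *)
Lemma Cauchy_formula f a b c d x y : a < x < b -> c < y < d ->
  on_rect (cdiff f) a b c d -> let z := Complex x y in
  oint (fun w => f w / (w - z)) a b c d =
    f z * oint (fun w => (w - z)^-1) a b c d.
Proof.
move=> axb cyd fd z; have /andP[ax xb] := axb; have /andP[cy yd] := cyd.
have ab : a <= b by apply: ltW; exact: lt_trans xb.
have cd : c <= d by apply: ltW; exact: lt_trans yd.
have [l lf] : cdiff f z by apply: fd; rewrite !ltW.
pose G w := if w == z then l else (f w - f z) / (w - z).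
have sub0 w : w != z -> w - z != 0 by rewrite subr_eq0.
have dsub w : cdiff (fun w => w - z) w by apply: cdiffD; [exact: cdiff_id|exact: cdiff_cst].
have dG u v : a <= u <= b -> c <= v <= d -> Complex u v != z -> cdiff G (Complex u v).
  move=> hu hv uvz; have : cdiff (fun w => (f w - f z) / (w - z)) (Complex u v).
    apply: cdiffM; last by apply: cdiffV => //; exact: sub0.
    by apply: cdiffD; [exact: fd|exact: cdiff_cst].
  move=> [l' h]; exists l' => e e0; have [r r0 hr] := h e e0.
  exists (Num.min r (normc (Complex u v - z))); first by rewrite lt_min r0 normc_gt0 sub0.
  move=> w; rewrite lt_min => /andP[/hr h1 h2]; rewrite /G (negbTE uvz) ifN//.
  by apply/eqP => wz; move: h2; rewrite wz normcBC ltxx.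
have cG : on_rect (ccont G) a b c d.
  move=> u v hu hv; have [uvz|uvz] := eqVneq (Complex u v) z; last exact/cdiff_cont/dG.
  rewrite uvz => e e0; have e20 : 0 < e / 2 by rewrite divr_gt0.
  have [r r0 hr] := lf _ e20; exists r => // w /hr h.
  rewrite {2}/G eqxx /G; case: eqVneq => [_|wz]; first by rewrite subrr normc0.
  have nz : 0 < normc (w - z) by rewrite normc_gt0 sub0.
  rewrite (_ : _ - l = (f w - f z - l * (w - z)) / (w - z)); last first.
    by field; exact: sub0.
  rewrite normcM normcV ltr_pdivrMr// (le_lt_trans h)// ltr_pM2r//.
  by move: e0; lra.
have G0 := Goursat_removable axb cyd cG (fun u v hu hv => dG u v hu hv).
have edge : on_edges (fun w => w != z) a b c d.
  move=> u v hu hv huv; apply/eqP => -[ux vy]; subst u v.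
  by case: huv => h; move: ax xb cy yd; rewrite h ltxx.
have c1 : on_edges (ccont (fun w => (w - z)^-1)) a b c d.
  by move=> u v hu hv /edge uvz; apply/cdiff_cont/cdiffV => //; apply/sub0/uvz.
have -> : oint (fun w => f w / (w - z)) a b c d =
    oint (fun w => G w + f z * (w - z)^-1) a b c d.
  apply: eq_oint => // u v hu hv /(edge u v hu hv) uvz; rewrite /G (negbTE uvz).
  by field; exact: sub0.
rewrite ointD//; first by rewrite G0 add0r ointZ.
- exact: on_rect_edges.
- move=> u v hu hv huv; have uvz := edge _ _ hu hv huv.
  apply/cdiff_cont/cdiffM; first exact: cdiff_cst.
  by apply/cdiffV => //; exact: sub0.
Qed.
End CauchyFormula.

(** * The identity theorem *)

Section IdentityTheorem.
Variable R : realType.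
Implicit Types (f g : R[i] -> R[i]) (z w : R[i]) (a b c d s : R).

Lemma ccont_on_bounded (F : R -> R[i]) a b : a <= b -> ccont_on F a b ->
  exists M, forall t, a <= t <= b -> normc (F t) <= M.
Proof.
move=> ab Fc; have nc : {within `[a, b], continuous (fun t => normc (F t))}.
  apply: continuous_in_subspaceT => t; rewrite inE/= in_itv/= => tab.
  apply/cvgrPdist_lt => e e0; have [r r0 hr] := Fc t tab e e0.
  apply/nbhs_ballP; exists r => //= u; rewrite /ball/= distrC => /hr h.
  rewrite distrC (le_lt_trans _ h)// ler_norml.
  have := normcD (F u - F t) (F t); rewrite subrK => h1.
  have := normcD (F t - F u) (F u); rewrite subrK [normc (_ - _)]normcBC => h2.
  by apply/andP; clear -h1 h2; lra.
have [m _ hm] := EVT_max ab nc.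
by exists (normc (F m)) => t tab; apply: hm; rewrite in_itv.
Qed.

Lemma on_edges_bounded f a b c d : a <= b -> c <= d -> on_edges (ccont f) a b c d ->
  exists2 M, 0 <= M & on_edges (fun w => normc (f w) <= M) a b c d.
Proof.
move=> ab cd /on_edges_cont[]// f1 f2 f3 f4.
have [M1 h1] := ccont_on_bounded ab f1; have [M2 h2] := ccont_on_bounded ab f2.
have [M3 h3] := ccont_on_bounded cd f3; have [M4 h4] := ccont_on_bounded cd f4.
exists (Num.max 0 (Num.max (Num.max M1 M2) (Num.max M3 M4))); first by rewrite le_max lexx.
move=> x y hx hy [->|->|->|->]; rewrite !le_max.
- by rewrite h3// !orbT.
- by rewrite h4// !orbT.
- by rewrite h1// !orbT.
- by rewrite h2// !orbT.
Qed.

Lemma square_edge_norm s x y : - s <= x <= s -> - s <= y <= s ->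
  [\/ x = - s, x = s, y = - s | y = s] -> s <= normc (Complex x y).
Proof.
move=> /andP[x1 x2] _ [->|->|->|->].
- by rewrite (le_trans _ (Re_le_normc _))//= normrN ler_norm.
- by rewrite (le_trans _ (Re_le_normc _))//= ler_norm.
- by rewrite (le_trans _ (Im_le_normc _))//= normrN ler_norm.
- by rewrite (le_trans _ (Im_le_normc _))//= ler_norm.
Qed.

Lemma geometric_le0 (A B q : R) : 0 <= q < 1 -> (forall n, A <= B * q ^+ n) -> A <= 0.
Proof.
move=> /andP[q0 q1] H; rewrite leNgt; apply/negP => A0.
have q1' : `|q| < 1 by rewrite ger0_norm.
have [B0|B0] := leP B 0.
  have := H 0%N; rewrite expr0 mulr1; move: A0 B0; clear; lra.
have /cvgrPdist_lt/(_ _ (divr_gt0 A0 B0))[n _ hn] := cvg_expr q1'.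
have := hn n (leqnn n); rewrite /= sub0r normrN ger0_norm ?exprn_ge0//.
by rewrite ltr_pdivlMr// mulrC ltNge H.
Qed.

Section taylor.
Local Opaque oint.
Variables (s : R) (g : R[i] -> R[i]).
Hypothesis s0 : 0 < s.
Hypothesis dg : on_rect (cdiff g) (- s) s (- s) s.

Let ss : - s <= s. Proof. by rewrite ge0_cp// ltW. Qed.

Let term n z w := g w * z ^+ n / (w ^+ n * (w - z)).
Let coef n := oint (fun w => g w / w ^+ n.+1) (- s) s (- s) s.
Let rest n z := oint (term n z) (- s) s (- s) s.

Let edge z : normc z < s ->
  on_edges (fun w => w != 0 /\ w != z) (- s) s (- s) s.
Proof.
move=> zs x y hx hy hxy; have := square_edge_norm hx hy hxy.
move=> sw; split; last by apply/eqP => wz; move: zs; rewrite -wz ltNge sw.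
by apply/eqP => wz; move: sw; rewrite wz normc0 leNgt s0.
Qed.

(** One step of the geometric expansion of the Cauchy kernel, 1/(w - z) = 1/w
    + z/(w (w - z)). *)
Let taylor_step n z : normc z < s -> rest n z = z ^+ n * coef n + rest n.+1 z.
Proof.
move=> zs; have E := edge zs.
have dterm m : on_edges (ccont (term m z)) (- s) s (- s) s.
  move=> x y hx hy hxy; have [w0 wz] := E _ _ hx hy hxy.
  apply/cdiff_cont/cdiffM.
    by apply: cdiffM; [exact: dg|exact: cdiff_cst].
  apply: cdiffV; first by rewrite mulf_neq0 ?expf_neq0// subr_eq0.
  apply: cdiffM; first by apply: cdiffX; exact: cdiff_id.
  by apply: cdiffD; [exact: cdiff_id|exact: cdiff_cst].
have dc : on_edges (ccont (fun w => g w / w ^+ n.+1)) (- s) s (- s) s.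
  move=> x y hx hy hxy; have [w0 wz] := E _ _ hx hy hxy.
  apply/cdiff_cont/cdiffM; first exact: dg.
  by apply: cdiffV; [rewrite expf_neq0|apply: cdiffX; exact: cdiff_id].
rewrite /rest /coef -ointZ// -ointD//; last first.
  move=> x y hx hy hxy; have [w0 wz] := E _ _ hx hy hxy.
  apply/cdiff_cont/cdiffM; first exact: cdiff_cst.
  apply/cdiffM; first exact: dg.
  by apply: cdiffV; [rewrite expf_neq0|apply: cdiffX; exact: cdiff_id].
apply: eq_oint => // x y hx hy hxy; have [w0 wz] := E _ _ hx hy hxy.
rewrite /term; set w := Complex x y in w0 wz *.
have wz' : w - z != 0 by rewrite subr_eq0.
rewrite !exprS; field; rewrite w0 wz' expf_neq0//.
Qed.

Let rest_bound : exists2 B, 0 <= B & forall n z, normc z < s ->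
  normc (rest n z) <= B * (normc z / s) ^+ n / (s - normc z).
Proof.
have [M M0 hM] : exists2 M, 0 <= M & on_edges (fun w => normc (g w) <= M) (- s) s (- s) s.
  by apply: on_edges_bounded => //; move=> x y hx hy _; exact/cdiff_cont/dg.
exists (4 * M * (s + s + (s + s))).
  by rewrite mulr_ge0 ?mulr_ge0 ?addr_ge0 ?(ltW s0).
move=> n z zs; have E := edge zs.
have dterm m : on_edges (ccont (term m z)) (- s) s (- s) s.
  move=> x y hx hy hxy; have [w0 wz] := E _ _ hx hy hxy.
  apply/cdiff_cont/cdiffM.
    by apply: cdiffM; [exact: dg|exact: cdiff_cst].
  apply: cdiffV; first by rewrite mulf_neq0 ?expf_neq0// subr_eq0.
  apply: cdiffM; first by apply: cdiffX; exact: cdiff_id.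
  by apply: cdiffD; [exact: cdiff_id|exact: cdiff_cst].
have sz : 0 < s - normc z by rewrite subr_gt0.
rewrite (le_trans (@normc_oint_le _ (M * (normc z / s) ^+ n / (s - normc z)) _ _ _ _ _ ss ss (dterm n) _))//.
  move=> x y hx hy hxy; have sw := square_edge_norm hx hy hxy.
  rewrite /term; set w := Complex x y in sw *.
  rewrite !normcM normcV normcM !normcX expr_div_n -!mulrA.
  rewrite ler_pM ?normc_ge0//; first 2 last.
  - rewrite ler_wpM2l ?exprn_ge0 ?normc_ge0// -invfM lef_pV2 ?posrE; last 2 first.
    + rewrite mulr_gt0 ?exprn_gt0 ?(lt_le_trans s0 sw)// normc_gt0 subr_eq0.
      by have [] := E _ _ hx hy hxy.
    + by rewrite mulr_gt0 ?exprn_gt0.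
    rewrite ler_pM ?exprn_ge0 ?(ltW s0) ?(ltW sz)//.
      by rewrite lerXn2r ?nnegrE ?normc_ge0 ?(ltW s0).
    have := normcD (w - z) z; rewrite subrK => h; move: h sw; lra.
  - by rewrite mulr_ge0 ?exprn_ge0 ?normc_ge0 ?invr_ge0 ?mulr_ge0 ?exprn_ge0 ?normc_ge0.
  - exact: hM.
by rewrite le_eqVlt; apply/orP; left; apply/eqP; ring.
Qed.

(** Vanishing on the real segment kills the Taylor coefficients at the origin
    one by one, and then the remainder estimate gives the vanishing on a disc. *)
Lemma identity_square :
  (forall x : R, `|x| < s -> g (x%:C)%C = 0) -> forall z, normc z < s -> g z = 0.
Proof.
move=> g0; have [B B0 hB] := rest_bound.
have rest0 z : normc z < s ->
    rest 0 z = g z * oint (fun w => (w - z)^-1) (- s) s (- s) s.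
  case: z => x y zs.
  have hx : - s < x < s by rewrite -ltr_norml (le_lt_trans (Re_le_normc (Complex x y))).
  have hy : - s < y < s by rewrite -ltr_norml (le_lt_trans (Im_le_normc (Complex x y))).
  rewrite -(Cauchy_formula hx hy dg)//; apply: eq_oint => // u v _ _ _.
  by rewrite /term !expr0 mulr1 mul1r.
have c0 n : coef n = 0 /\ forall z, normc z < s -> rest 0 z = rest n.+1 z.
  elim/ltn_ind: n => n IH.
  have restn z : normc z < s -> rest 0 z = rest n z.
    by case: n IH => // n IH /((IH n (leqnn _)).2 z).
  suff cn : coef n = 0.
    split=> // z zs; rewrite restn// taylor_step// cn; by rewrite mulr0 add0r.
  apply/eqP; rewrite -normc_eq0; apply/eqP/le_anti; rewrite normc_ge0 andbT.
  pose K := B / s ^+ n.+1 / (s / 2); have K0 : 0 <= K.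
    by rewrite !divr_ge0// ?exprn_ge0// ltW.
  have small (x : R) : 0 < x -> x < s / 2 -> normc (coef n) <= K * x.
    move=> x0 xs; have nx : normc (x%:C)%C = x by rewrite normc_real gtr0_norm.
    have xs' : x < s by lra.
    have zs : normc (x%:C)%C < s by rewrite nx.
    have := restn _ zs; rewrite rest0// g0 ?gtr0_norm// mul0r taylor_step//.
    move=> /eqP; rewrite eq_sym addr_eq0 => /eqP h.
    have := hB n.+1 _ zs; rewrite -normcN -h normcM normcX nx => h2.
    have xn : 0 < x ^+ n by rewrite exprn_gt0.
    rewrite -(ler_pM2l xn) (le_trans h2)//.
    rewrite expr_div_n exprS.
    have -> : B * (x * x ^+ n / s ^+ n.+1) / (s - x) = x ^+ n * (B / s ^+ n.+1 * x) / (s - x) by ring.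
    have -> : x ^+ n * (K * x) = x ^+ n * (B / s ^+ n.+1 * x) / (s / 2) by rewrite /K; ring.
    rewrite ler_wpM2l//.
      by rewrite !mulr_ge0 ?invr_ge0 ?exprn_ge0 ?(ltW x0) ?(ltW s0).
    by rewrite lef_pV2 ?posrE; lra.
  apply/ler_addgt0Pr => e e0; rewrite add0r.
  have e1 : 0 < e / (K + 1) by rewrite divr_gt0// ltr_wpDl.
  pose x := Num.min (e / (K + 1)) (s / 2) / 2.
  have m0 : 0 < Num.min (e / (K + 1)) (s / 2) by rewrite lt_min e1 divr_gt0.
  have x0 : 0 < x by rewrite divr_gt0.
  have : x < Num.min (e / (K + 1)) (s / 2) by rewrite ltr_pdivrMr// ltr_pMr// ltr1n.
  rewrite lt_min ltr_pdivlMr ?ltr_wpDl// => /andP[xe xs].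
  by rewrite (le_trans (small x x0 xs))//; move: xe x0; lra.
move=> z zs; have sz : 0 < s - normc z by rewrite subr_gt0.
have : rest 0 z = 0.
  apply/eqP; rewrite -normc_eq0; apply/eqP/le_anti; rewrite normc_ge0 andbT.
  apply: (@geometric_le0 _ (B * (s - normc z)^-1 + normc (rest 0 z)) (normc z / s)).
    by rewrite divr_ge0 ?normc_ge0 ?(ltW s0)// ltr_pdivrMr// mul1r.
  case=> [|n].
    by rewrite expr0 mulr1 lerDr divr_ge0// ltW.
  rewrite {1}((c0 n).2 _ zs) (le_trans (hB _ _ zs))// mulrAC ler_wpM2r//.
    by rewrite exprn_ge0// divr_ge0 ?normc_ge0// ltW.
  by rewrite lerDl normc_ge0.
rewrite rest0//; case: z zs {sz} => x y zs.
have hx : - s < x < s by rewrite -ltr_norml (le_lt_trans (Re_le_normc (Complex x y))).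
have hy : - s < y < s by rewrite -ltr_norml (le_lt_trans (Im_le_normc (Complex x y))).
have := winding_gt hx hy; set k := oint _ _ _ _ _ => hk.
move=> /eqP; rewrite mulf_eq0 => /orP[/eqP//|/eqP k0].
move: hk; rewrite k0 leNgt => /negP[].
have s2 : 0 < s - - s by rewrite opprK addr_gt0.
rewrite (_ : cIm (0 : R[i]) = 0) //.
have ys : 0 < y - - s by rewrite subr_gt0; case/andP: hy.
by rewrite mulr_gt0// divr_gt0// addr_gt0// exprn_gt0.
Qed.

(** Cauchy's formula at the centre, with the lower bound of [winding_gt] in
    place of the winding number; hence the constant. *)
Lemma Cauchy_bound M : on_edges (fun w => normc (g w) <= M) (- s) s (- s) s ->
  normc (g 0) <= 64 * M.
Proof.
move=> gM; have h0 : - s < 0 < s by rewrite oppr_lt0 s0.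
have gM' : on_edges (fun w => normc (g w / (w - 0)) <= M / s) (- s) s (- s) s.
  move=> x y hx hy hxy; have sw := square_edge_norm hx hy hxy.
  rewrite normcM normcV subr0 ler_pM ?normc_ge0 ?invr_ge0 ?normc_ge0//.
    exact: gM.
  by rewrite lef_pV2 ?posrE// (lt_le_trans s0).
have := Cauchy_formula h0 h0 dg; rewrite /= => CF.
have k4 : 4^-1 <= normc (oint (fun w => (w - 0)^-1) (- s) s (- s) s).
  rewrite (le_trans _ (Im_le_normc _))// (le_trans _ (ler_norm _))//.
  rewrite (le_trans _ (winding_gt h0 h0))// le_eqVlt; apply/orP; left; apply/eqP.
  have s1 : s != 0 by rewrite gt_eqF.
  rewrite opprK add0r (_ : _ + _ = 8 * s ^+ 2); last by ring.
  by field.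
have E := edge (z := 0); rewrite normc0 in E.
have := normc_oint_le ss ss (_ : on_edges (ccont (fun w => g w / (w - 0))) _ _ _ _) gM'.
rewrite CF normcM opprK => H.
have {}H : normc (g 0) * normc (oint (fun w => (w - 0)^-1) (- s) s (- s) s) <= 16 * M.
  rewrite (le_trans (H _))//.
    move=> x y hx hy hxy; have [w0 wz] := E s0 _ _ hx hy hxy.
    apply/cdiff_cont/cdiffM; first exact: dg.
    apply: cdiffV; first by rewrite subr_eq0.
    by apply: cdiffD; [exact: cdiff_id|exact: cdiff_cst].
  by rewrite le_eqVlt; apply/orP; left; apply/eqP; field; rewrite (gt_eqF s0).
have : normc (g 0) * 4^-1 <= 16 * M by rewrite (le_trans _ H)// ler_wpM2l ?normc_ge0.
by lra.
Qed.
End taylor.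
End IdentityTheorem.

(** * Malgrange's estimate in one variable *)

Section Malgrange.
Variable R : realType.

(** The sup norm of the plane, whose spheres are the squares of integration. *)
Definition supc (w : R[i]) : R := Num.max `|cRe w| `|cIm w|.

Lemma supc_dist (w z : R[i]) : `|supc w - supc z| <= normc (w - z).
Proof.
have h1 : `|cRe w - cRe z| <= normc (w - z) by rewrite -ReN -ReD Re_le_normc.
have h2 : `|cIm w - cIm z| <= normc (w - z) by rewrite -ImN -ImD Im_le_normc.
have key (u v : R[i]) : normc (u - v) = normc (w - z) -> 
   `|cRe u - cRe v| <= normc (w - z) -> `|cIm u - cIm v| <= normc (w - z) -> 
   supc u <= supc v + normc (w - z).
  move=> _ k1 k2; rewrite /supc ge_max; apply/andP; split.
    have := ler_normD (cRe u - cRe v) (cRe v); rewrite subrK => k.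
    rewrite (le_trans k)// addrC lerD// le_max lexx//.
  have := ler_normD (cIm u - cIm v) (cIm v); rewrite subrK => k.
  by rewrite (le_trans k)// addrC lerD// le_max lexx orbT.
have := key w z erefl h1 h2; have := key z w (normcBC _ _).
rewrite distrC [`|cIm z - _|]distrC => /(_ h1 h2) k1 k2.
by rewrite ler_norml; apply/andP; clear -k1 k2; lra.
Qed.

Lemma square_edge_supc s x y : 0 <= s -> - s <= x <= s -> - s <= y <= s ->
  [\/ x = - s, x = s, y = - s | y = s] -> supc (Complex x y) = s.
Proof.
move=> s0; rewrite -!ler_norml /supc /= => hx hy.
have ns : `|s| = s by rewrite ger0_norm.
have := hx; have := hy.
by move=> h1 h2 [->|->|->|->]; rewrite ?normrN ns;
  apply/eqP; rewrite eq_le ge_max le_max ?lexx ?h1 ?h2 ?orbT.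
Qed.

(** Among m + 1 concentric squares whose half-sides are spaced by 2 delta, one
    stays at distance delta from the m roots of the polynomial; there the
    polynomial is bounded below, so the Cauchy bound applies to g. *)
Lemma Malgrange_bound (P : {poly R[i]}) (g : R[i] -> R[i]) (rho S : R) :
  let m := (size P).-1 in let delta := rho / (2 * m.+1%:R) in
  P != 0 -> 0 < rho ->
  on_rect (cdiff g) (- rho) rho (- rho) rho ->
  on_rect (fun w => normc (g w * P.[w]) <= S) (- rho) rho (- rho) rho ->
  normc (lead_coef P) * normc (g 0) <= 64 * (S / delta ^+ m).
Proof.
move=> m delta P0 rho0 dg gP.
have m0 : 0 < m.+1%:R :> R by rewrite ltr0n.
have delta0 : 0 < delta by rewrite divr_gt0// mulr_gt0.
have [r rE] := closed_field_poly_normal P.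
have lP : lead_coef P != 0 by rewrite lead_coef_eq0.
have sr : size r = m by rewrite /m rE size_scale// size_prod_XsubC.
pose s (k : 'I_m.+1) := 2 * delta * k.+1%:R.
have s_gt0 k : 0 < s k by rewrite !mulr_gt0// ltr0n.
have s_le k : s k <= rho.
  have -> : rho = 2 * delta * m.+1%:R by rewrite /delta; field; rewrite gt_eqF.
  by rewrite /s ler_pM2l ?mulr_gt0// ler_nat.
have [k hk] : exists k, forall j : 'I_m, delta <= `|s k - supc (r`_j)|.
  apply: contrapT => /forallNP nk.
  have /choice[F hF] : forall k, exists j : 'I_m, `|s k - supc (r`_j)| < delta.
    move=> k; apply: contrapT => /forallNP nj; apply: (nk k) => j.
    by rewrite leNgt; apply/negP; exact: nj.
  have : injective F.
    move=> k k' kk'; apply/eqP; apply: contrapT => /negP kNk'.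
    have := hF k; have := hF k'; rewrite kk' => h1 h2.
    have := ler_distD (supc r`_(F k')) (s k) (s k').
    rewrite [`|supc _ - _|]distrC leNgt => /negP; apply.
    rewrite (lt_le_trans (ltrD h2 h1))// /s -mulrBr normrM ger0_norm; last first.
      by rewrite mulr_ge0// ltW.
    rewrite (_ : delta + delta = 2 * delta * 1); last by ring.
    rewrite ler_pM2l ?mulr_gt0//.
    clear kk' h1 h2; wlog lt : k k' kNk' / (k < k')%N => [H|].
      have [lt|gt|eq] := ltngtP k k'; first exact: (H k k').
        by rewrite distrC H// eq_sym.
      by move: kNk'; rewrite (val_inj eq) eqxx.
    by rewrite distrC -natrB ?ltnS ?(ltnW lt)// subSS ger0_norm// ler1n subn_gt0.
  by move=> /leq_card; rewrite !card_ord ltnn.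
have Pn w : normc P.[w] = normc (lead_coef P) * \prod_(z <- r) normc (w - z).
  rewrite {1}rE hornerZ normcM; congr (_ * _).
  rewrite horner_prod normc_prod; apply: eq_bigr => z _.
  by rewrite hornerXsubC.
have sub : on_rect (fun w => cdiff g w /\ normc (g w * P.[w]) <= S) (- s k) (s k) (- s k) (s k).
  by move=> x y /andP[x1 x2] /andP[y1 y2]; split; [apply: dg|apply: gP]; 
     apply/andP; split; rewrite (le_trans _ (s_le k), le_trans _ x1, le_trans _ y1)// lerN2.
have sub1 : on_rect (cdiff g) (- s k) (s k) (- s k) (s k) by move=> x y hx hy; case: (sub x y hx hy).
have := @Cauchy_bound _ _ _ (s_gt0 k) sub1 (S / (normc (lead_coef P) * delta ^+ m)).
have nl : 0 < normc (lead_coef P) by rewrite normc_gt0.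
move=> H; rewrite mulrC -ler_pdivlMr//.
rewrite (_ : 64 * _ / _ = 64 * (S / (normc (lead_coef P) * delta ^+ m))); last first.
  by field; rewrite !gt_eqF ?exprn_gt0.
apply: H => x y hx hy hxy; have [_ hS] := sub x y hx hy.
rewrite ler_pdivlMr; last by rewrite mulr_gt0// exprn_gt0.
rewrite (le_trans _ hS)// normcM ler_wpM2l ?normc_ge0// Pn ler_wpM2l ?normc_ge0//.
rewrite (big_nth 0) sr big_mkord -[X in _ ^+ X]card_ord -prodr_const.
apply: ler_prod => j _; rewrite (ltW delta0)/= (le_trans (hk j))//.
by rewrite -(square_edge_supc (ltW (s_gt0 k)) hx hy hxy) supc_dist.
Qed.
End Malgrange.

(** * Lebesgue measure under affine maps *)

Section LebesgueLine.
Variable R : realType.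
Local Notation mu := (@lebesgue_measure R).
Local Notation T := (measurableTypeR R).

Let affine1 (s c : R) : T -> T := fun x => s * x + c.

Lemma measurable_affine1 (s c : R) : measurable_fun setT (affine1 s c).
Proof.
apply: measurable_funD; last exact: measurable_cst.
by apply: measurable_funM; [exact: measurable_cst|exact: measurable_id].
Qed.

(** Both sides come from measures that agree on half-open intervals, hence
    everywhere. *)
Lemma ge0_integral_affine1 (s c : R) (f : T -> \bar R) : s != 0 ->
  measurable_fun setT f -> (forall x, (0 <= f x)%E) ->
  (\int[mu]_x f (s * x + c)%R = (`|s|^-1)%:E * \int[mu]_x f x)%E.
Proof.
move=> s0 mf f0.
have ns : 0 < `|s| by rewrite normr_gt0.
have key : (`|s|%:E * \int[mu]_x f (s * x + c)%R = \int[mu]_x f x)%E; last first.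
  rewrite -key muleA -EFinM mulVf ?gt_eqF// mul1e//.
have mphi := measurable_affine1 s c.
pose pf : {measure set T -> \bar R} :=
  measure_function_pushforward__canonical__measure_function_Measure mu mphi.
pose m' : {measure set T -> \bar R} := mscale (NngNum (ltW ns)) pf.
have -> : (\int[mu]_x f x = \int[m']_x f x)%E.
  apply: eq_measure_integral.
  move=> A mA _; apply: lebesgue_measure_unique => // X /ocitvP[->|[[a b] /= ab ->]].
    by rewrite !measure0.
  rewrite /m' /mscale/= /pushforward.
  rewrite lebesgue_measure_itv/= lte_fin ab.
  have [sp|sn|/eqP] := ltgtP 0 s; last by rewrite eq_sym (negbTE s0).
  - have -> : affine1 s c @^-1` `]a, b] = [set` `](a - c) / s, (b - c) / s]].
      apply/seteqP; split => x; rewrite /affine1 /= !in_itv/=.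
        by rewrite ltr_pdivrMr// ler_pdivlMr// mulrC ltrBlDr lerBrDr.
      by rewrite ltr_pdivrMr// ler_pdivlMr// mulrC ltrBlDr lerBrDr.
    rewrite lebesgue_measure_itv/= lte_fin ltr_pM2r ?invr_gt0// ltrD2r ab.
    rewrite -!EFinB -EFinM gtr0_norm//; congr EFin; field; by rewrite gt_eqF.
  - have -> : affine1 s c @^-1` `]a, b] = [set` `[(b - c) / s, (a - c) / s[].
      apply/seteqP; split => x; rewrite /affine1 /= !in_itv/=.
        by rewrite ler_ndivrMr// ltr_ndivlMr// mulrC ltrBlDr lerBrDr andbC.
      by rewrite ler_ndivrMr// ltr_ndivlMr// mulrC ltrBlDr lerBrDr andbC.
    rewrite lebesgue_measure_itv/= lte_fin ltr_nM2r ?invr_lt0// ltrD2r ab.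
    rewrite -!EFinB -EFinM ltr0_norm//; congr EFin; field; by rewrite lt_eqF.
rewrite /m' ge0_integral_mscale//; congr (_ * _)%E.
have := @ge0_integral_pushforward _ _ _ _ _ _ mphi mu setT f measurableT mf (fun y _ => f0 y).
by rewrite preimage_setT.
Qed.
End LebesgueLine.

Section LebesgueTuple.
Variable R : realType.
Local Notation mu := (@lebesgue_measure R).
Local Notation T := (measurableTypeR R).
Local Notation lt k := (lebesgue_tuple R k).
Local Open Scope ereal_scope.

(** Tonelli's theorem for the recursive definition of the measure. *)
Lemma ge0_integral_ltS k (F : k.+1.-tuple T -> \bar R) :
  measurable_fun setT F -> (forall t, 0 <= F t) ->
  \int[lt k.+1]_t F t = \int[mu]_x \int[lt k]_t F (cons_pair (x, t)).
Proof.
move=> mF F0.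
have := @ge0_integral_pushforward _ _ _ _ _ _ (@measurable_cons_pair R k) (mu \x lt k)
  setT F measurableT mF (fun y _ => F0 y).
rewrite preimage_setT => pf; apply: (eq_trans pf); rewrite (fubini_tonelli1 (F \o @cons_pair R k))//.
  by apply: measurableT_comp => //; exact: measurable_cons_pair.
by move=> x; exact: F0.
Qed.

Definition affine_tuple k (s : R) (c : 'I_k -> R) (t : k.-tuple T) : k.-tuple T :=
  [tuple (s * tnth t j + c j)%R | j < k].

Lemma tnth_affine k s c (t : k.-tuple T) j :
  tnth (affine_tuple s c t) j = (s * tnth t j + c j)%R.
Proof. by rewrite /affine_tuple tnth_mktuple. Qed.

Lemma measurable_affine_tuple k s (c : 'I_k -> R) :
  measurable_fun setT (affine_tuple s c).
Proof.
apply/measurable_fun_tnthP => j.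
rewrite (_ : _ \o _ = (fun x : T => (s * x + c j)%R) \o (fun t => tnth t j)).
  apply: measurableT_comp; first exact: measurable_affine1.
  exact: measurable_tnth.
by apply/funext => t /=; rewrite tnth_affine.
Qed.

Lemma affine_cons k s (c : 'I_k.+1 -> R) x (t : k.-tuple T) :
  affine_tuple s c (cons_pair (x, t)) =
  cons_pair ((s * x + c ord0)%R, affine_tuple s (fun j => c (lift ord0 j)) t).
Proof.
apply: eq_from_tnth => j; rewrite tnth_affine.
case: (unliftP ord0 j) => [i ->|->]; last by rewrite !(tnth_nth (x : T)).
by rewrite /cons_pair/= !tnthS tnth_affine.
Qed.

(** One coordinate at a time, by induction on the dimension. *)
Lemma ge0_integral_affine k (s : R) (c : 'I_k -> R) (F : k.-tuple T -> \bar R) :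
  s != 0%R -> measurable_fun setT F -> (forall t, 0 <= F t) ->
  \int[lt k]_t F (affine_tuple s c t) = (`|s| ^- k)%:E * \int[lt k]_t F t.
Proof.
move=> s0; elim: k c F => [|k IH] c F mF F0.
  rewrite expr0 invr1 mul1e; apply: eq_integral => t _.
  by rewrite (tuple0 t) (tuple0 (affine_tuple s c _)).
have mA := measurable_affine_tuple s c.
rewrite ge0_integral_ltS//; last exact: measurableT_comp.
have mFc x : measurable_fun setT (fun t => F (cons_pair (x, t))).
  apply: (measurableT_comp mF); apply: (measurableT_comp (@measurable_cons_pair R k)).
  exact: measurable_pair1.
have mFc' : measurable_fun setT (F \o @cons_pair R k).
  by apply: measurableT_comp => //; exact: measurable_cons_pair.
pose Phi x := \int[lt k]_t F (cons_pair (x, t)).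
have mPhi : measurable_fun setT Phi.
  by apply: (measurable_fun_fubini_tonelli_F (F \o @cons_pair R k)) => //= x; exact: F0.
have Phi0 x : 0 <= Phi x by exact: integral_ge0.
transitivity (\int[mu]_x ((`|s| ^- k)%:E * Phi (s * x + c ord0)%R)).
  apply: eq_integral => x _.
  under eq_integral do rewrite affine_cons.
  by rewrite (IH _ (fun t => F (cons_pair (_, t)))).
rewrite ge0_integralZl ?lee_fin ?invr_ge0 ?exprn_ge0//; last first.
  exact: (measurableT_comp mPhi (measurable_affine1 s (c ord0))).
rewrite ge0_integral_affine1// muleA -EFinM ge0_integral_ltS//.
by rewrite exprS invfM [X in _ = X%:E * _]mulrC.
Qed.

Lemma integral_affine k (s : R) (c : 'I_k -> R) (h : k.-tuple T -> R) :
  s != 0%R -> rintegrable (lt k) h ->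
  rintegrable (lt k) (fun t => h (affine_tuple s c t)) /\
  Rintegral (lt k) setT (fun t => h (affine_tuple s c t)) =
    (`|s| ^- k * Rintegral (lt k) setT h)%R.
Proof.
move=> s0 hi; have mA := measurable_affine_tuple s c.
have s1 : (0 <= `|s| ^- k)%R by rewrite invr_ge0 exprn_ge0.
have [mh hf] := integrableP _ _ _ hi.
have key (F : k.-tuple T -> \bar R) := @ge0_integral_affine k s c F s0.
have hi' : rintegrable (lt k) (fun t => h (affine_tuple s c t)).
  apply/integrableP; split; first exact: (measurableT_comp mh mA).
  rewrite (key (fun t => `|(h t)%:E|))//; last exact: measurableT_comp.
  by rewrite lte_mul_pinfty// lee_fin.
split=> //; rewrite /Rintegral.
have hp : \int[lt k]_t (EFin \o h)^\+ t \is a fin_num.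
  exact: integrable_pos_fin_num.
have hn : \int[lt k]_t (EFin \o h)^\- t \is a fin_num.
  exact: integrable_neg_fin_num.
rewrite integralE [in RHS]integralE.
rewrite (_ : \int[lt k]_x _ = (`|s| ^- k)%:E * \int[lt k]_t (EFin \o h)^\+ t).
  rewrite (_ : \int[lt k]_x (_^\-) x = (`|s| ^- k)%:E * \int[lt k]_t (EFin \o h)^\- t).
    set A := \int[lt k]_t (EFin \o h)^\+ t in hp *.
    set B := \int[lt k]_t (EFin \o h)^\- t in hn *.
    transitivity (`|s| ^- k * fine (A - B))%R => //.
    by rewrite -(fineK hp) -(fineK hn) -!EFinM -!EFinB /= mulrBr.
  apply/esym/(eq_trans (esym (key (EFin \o h)^\- _ _))) => //.
    exact: measurable_funeneg.
  by apply: eq_integral => t _; rewrite !funenegE.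
apply/esym/(eq_trans (esym (key (EFin \o h)^\+ _ _))) => //.
  exact: measurable_funepos.
by apply: eq_integral => t _; rewrite !funeposE.
Qed.
End LebesgueTuple.

(** * Integration over R^d *)

Section TupleMeasurability.
Variable R : realType.
Local Notation T := (measurableTypeR R).

Lemma measurable_box k (c : 'I_k -> R) (r : R) :
  measurable [set t : k.-tuple T | forall j, `|tnth t j - c j| < r].
Proof.
rewrite [X in measurable X](_ : _ = \bigcap_(j in [set: 'I_k])
    ((fun t => tnth t j) @^-1` ball (c j : R) r)); last first.
  apply/seteqP; split => t /=.
    by move=> H j _; rewrite /ball/= distrC.
  by move=> H j; have := H j I; rewrite /ball/= distrC.
apply: fin_bigcap_measurable => // j _.
have := @measurable_tnth _ T k j measurableT (ball (c j : R) r).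
by rewrite setTI; apply; exact: measurable_ball.
Qed.

Definition tcont k (f : k.-tuple T -> R) := forall t (e : R), 0 < e ->
  exists2 d : R, 0 < d & forall t', (forall j, `|tnth t' j - tnth t j| < d) ->
    `|f t' - f t| < e.

(** An open set is a countable union of rational boxes, and boxes are
    measurable because the coordinates are. *)
Lemma tcont_measurable k (f : k.-tuple T -> R) : tcont f -> measurable_fun setT f.
Proof.
move=> fc; apply: (measurability _ (RGenOInfty.measurableE R)) => _ [_ [a ->] <-].
rewrite setTI; set U := f @^-1` _.
have Uop t : U t -> exists2 d, 0 < d &
    forall t', (forall j, `|tnth t' j - tnth t j| < d) -> U t'.
  rewrite /U/= in_itv/= andbT => at_; have [d d0 H] := fc t (f t - a) ltac:(by rewrite subr_gt0).
  exists d => // t' /H; rewrite /= in_itv/= andbT ltr_norml => /andP[h _].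
  by clear -h; lra.
pose box (q : k.-tuple rat * rat) : set (k.-tuple T) :=
  [set t | forall j, `|tnth t j - ratr (tnth q.1 j)| < ratr q.2].
rewrite (_ : U = \bigcup_q (if `[< box q `<=` U >] then box q else set0)).
  apply: countable_bigcupT_measurable; first exact: countableP.
  by move=> q; case: asboolP => _ //; exact: measurable_box.
apply/seteqP; split => t; last by case=> q _; case: asboolP => // qU; exact: qU.
move=> Ut; have [d d0 H] := Uop t Ut.
have [r] := rat_in_itvoo (divr_gt0 d0 (ltr0n R 2)).
rewrite in_itv/= => /andP[r0 rd].
have /choice[q hq] : forall j, exists q : rat, `|tnth t j - ratr q| < ratr r.
  move=> j; have [|q] := @rat_in_itvoo R (tnth t j - ratr r) (tnth t j + ratr r).
    by clear -r0; lra.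
  rewrite in_itv/= => /andP[q1 q2]; exists q; rewrite distrC ltr_norml.
  by apply/andP; clear -q1 q2; lra.
have tq : box ([tuple q j | j < k], r) t by move=> j /=; rewrite tnth_mktuple; exact: hq.
exists ([tuple q j | j < k], r) => //; case: asboolP => // -[].
move=> t' ht'; apply: H => j; have /= := ht' j; have /= := tq j.
rewrite !tnth_mktuple => h1 h2.
rewrite -(subrK (ratr (q j)) (tnth t' j)) -addrA (le_lt_trans (ler_normD _ _))//.
by rewrite distrC in h1; rewrite (splitr d) ltrD// (lt_trans _ rd).
Qed.

Definition ctcont k (f : k.-tuple T -> R[i]) := forall t (e : R), 0 < e ->
  exists2 d : R, 0 < d & forall t', (forall j, `|tnth t' j - tnth t j| < d) ->
    normc (f t' - f t) < e.

Lemma ctcont_cmeas k (f : k.-tuple T -> R[i]) : ctcont f -> cmeas f.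
Proof.
move=> fc; split; apply: tcont_measurable => t e e0; have [d d0 H] := fc t e e0;
  exists d => // t' /H; apply: le_lt_trans.
- by rewrite -ReN -ReD Re_le_normc.
- by rewrite -ImN -ImD Im_le_normc.
Qed.
End TupleMeasurability.

Section NonnegIntegrable.
Context d (T : measurableType d) (R : realType) (mu : {measure set T -> \bar R}).

Lemma rintegrable_ge0 (h : T -> R) : (forall x, 0 <= h x) ->
  rintegrable mu h <-> measurable_fun setT h /\ (\int[mu]_x (h x)%:E < +oo)%E.
Proof.
move=> h0.
have E : (\int[mu]_x `|(EFin \o h) x| = \int[mu]_x (h x)%:E)%E.
  by apply: eq_integral => x _; rewrite /= ger0_norm.
split.
  by move=> /integrableP[/measurable_EFinP hm hf]; split => //; rewrite -E.
by move=> [hm hf]; apply/integrableP; split; [exact/measurable_EFinP|rewrite E].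
Qed.
End NonnegIntegrable.

Section IntegralRd.
Variables (R : realType) (n : nat).
Local Notation Rd := 'rV[R]_n.+1.
Local Notation T := (measurableTypeR R).
Local Notation lt k := (lebesgue_tuple R k).

Definition rowof (t : n.+1.-tuple T) : Rd := \row_j tnth t j.

Definition vmeas (f : Rd -> R[i]) := cmeas (fun t => f (rowof t)).
Definition vint (f : Rd -> R[i]) := cintegrable (lt n.+1) (fun t => f (rowof t)).
Definition rvint (h : Rd -> R) := rintegrable (lt n.+1) (fun t => h (rowof t)).
Definition rintRd (h : Rd -> R) : R := Rintegral (lt n.+1) setT (fun t => h (rowof t)).

Lemma cintegralRdE (f : Rd -> R[i]) :
  cintegralRd f = cintegral (lt n.+1) (fun t => f (rowof t)).
Proof. by []. Qed.

Lemma vintD f g : vint f -> vint g -> vint (fun x => f x + g x).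
Proof. by move=> fi gi; exact: cintegrableD fi gi. Qed.
Lemma vintZ c f : vint f -> vint (fun x => c * f x).
Proof. by move=> fi; exact: cintegrableZ fi. Qed.
Lemma cintegralRdD f g : vint f -> vint g ->
  cintegralRd (fun x => f x + g x) = cintegralRd f + cintegralRd g.
Proof. by move=> fi gi; exact: cintegralD fi gi. Qed.
Lemma cintegralRdZ c f : vint f ->
  cintegralRd (fun x => c * f x) = c * cintegralRd f.
Proof. by move=> fi; exact: cintegralZ fi. Qed.

Lemma rowof_affine s (c : Rd) t :
  rowof (affine_tuple s (fun j => c 0 j) t) = s *: rowof t + c.
Proof. by apply/rowP => j; rewrite !mxE tnth_affine. Qed.

Lemma cintegralRd_affine (s : R) (c : Rd) f : s != 0 -> vint f ->
  vint (fun x => f (s *: x + c)) /\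
  cintegralRd (fun x => f (s *: x + c)) = ((`|s| ^- n.+1)%:C)%C * cintegralRd f.
Proof.
move=> s0 [f1 f2].
have [i1 e1] := integral_affine (fun j => c 0 j) s0 f1.
have [i2 e2] := integral_affine (fun j => c 0 j) s0 f2.
split.
  split; [move: i1|move: i2]; congr rintegrable; apply/funext => t /=;
    by rewrite rowof_affine.
apply: cplx_eq; rewrite ReImE /= mul0r ?subr0 ?addr0.
  by rewrite -e1; apply: eq_Rintegral => t _; rewrite rowof_affine.
by rewrite -e2; apply: eq_Rintegral => t _; rewrite rowof_affine.
Qed.

Lemma cintegralRd_translate (c : Rd) f : vint f ->
  vint (fun x => f (x + c)) /\ cintegralRd (fun x => f (x + c)) = cintegralRd f.
Proof.
move=> fi; have [] := cintegralRd_affine c (oner_neq0 R) fi.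
under eq_fun do rewrite scale1r.
by rewrite normr1 expr1n invr1 mul1r.
Qed.

Lemma cintegralRd_opp f : vint f ->
  vint (fun x => f (- x)) /\ cintegralRd (fun x => f (- x)) = cintegralRd f.
Proof.
have n1 : -1 != 0 :> R by rewrite oppr_eq0 oner_neq0.
move=> fi; have [] := cintegralRd_affine 0 n1 fi.
under eq_fun do rewrite scaleN1r addr0.
by rewrite normrN normr1 expr1n invr1 mul1r.
Qed.

Definition vcont (f : Rd -> R[i]) := forall (x : Rd) (e : R), 0 < e -> exists2 d : R, 0 < d &
  forall y : Rd, (forall j, `|y 0 j - x 0 j| < d) -> normc (f y - f x) < e.

Lemma vcont_vmeas f : vcont f -> vmeas f.
Proof.
move=> fc; apply: ctcont_cmeas => t e e0; have [d d0 H] := fc (rowof t) e e0.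
by exists d => // t' tt'; apply: H => j; rewrite !mxE.
Qed.

(** This weight plays the part of a power of 1 + |x|. It factors over the
    coordinates, so its inverse is integrable by Tonelli. *)
Definition bracket (x : Rd) : R := \prod_j (1 + x 0 j ^+ 2).

Lemma bracket_ge1 x : 1 <= bracket x.
Proof.
rewrite /bracket; elim/big_ind: _ => // [u v u1 v1|j _].
  by rewrite -[1]mulr1 ler_pM.
by rewrite lerDl sqr_ge0.
Qed.
Lemma bracket_gt0 x : 0 < bracket x.
Proof. exact: lt_le_trans ltr01 (bracket_ge1 x). Qed.
Lemma bracket_ge0 x : 0 <= bracket x.
Proof. exact/ltW/bracket_gt0. Qed.

Lemma bracket_coord (x : Rd) j : 1 + x 0 j ^+ 2 <= bracket x.
Proof.
rewrite /bracket (bigD1 j)//= -[leLHS]mulr1 ler_wpM2l ?addr_ge0 ?sqr_ge0//.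
elim/big_ind: _ => // [u v u1 v1|i _]; first by rewrite -[1]mulr1 ler_pM.
by rewrite lerDl sqr_ge0.
Qed.

Lemma coord_le_bracket (x : Rd) j : `|x 0 j| <= bracket x.
Proof.
rewrite (le_trans _ (bracket_coord x j))//.
have := sqr_ge0 (`|x 0 j| - 1); have := normr_ge0 (x 0 j).
rewrite -(real_normK (num_real (x 0 j))) !expr2; move: (`|x 0 j|) => u; nra.
Qed.

Lemma integrable_oneDsqrV :
  rintegrable (@lebesgue_measure R) (fun x => (1 + x ^+ 2)^-1).
Proof.
have cf : continuous (fun x : R => (1 + x ^+ 2)^-1) := @continuous_oneDsqrV R.
have f0 (x : R) : 0 <= (1 + x ^+ 2)^-1 by rewrite invr_ge0 addr_ge0 ?sqr_ge0.
apply/rintegrable_ge0; first exact: f0.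
split; first exact: continuous_measurable_fun.
rewrite ge0_symfun_integralT//; last by move=> x /=; rewrite sqrrN.
have := integral0y_oneDsqr R.
rewrite (_ : [set x | 0 <= x] = [set` `[0%R, +oo[]); last first.
  by apply/seteqP; split => x /=; rewrite in_itv/= andbT.
move=> E; rewrite [X in (_ * X)%E](_ : _ = (pi / 2)%:E).
  by rewrite -EFinM ltry.
exact: E.
Qed.

Lemma integrable_prod k (g : R -> R) : rintegrable (@lebesgue_measure R) g ->
  (forall x, 0 <= g x) ->
  rintegrable (lt k) (fun t => \prod_(j < k) g (tnth t j)).
Proof.
move=> gi g0; have /rintegrable_ge0[//|gm gf] := gi.
have pm m : measurable_fun setT (fun t : m.-tuple T => \prod_(j < m) g (tnth t j)).
  apply: measurable_prod => j _; apply: (measurableT_comp gm); exact: measurable_tnth.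
have p0 m (t : m.-tuple T) : 0 <= \prod_(j < m) g (tnth t j) by apply: prodr_ge0.
apply/rintegrable_ge0; first exact: p0.
split; first exact: pm.
elim: k => [|k IH].
  have mF : measurable_fun setT (fun t : 0.-tuple T => (\prod_(j < 0) g (tnth t j))%:E).
    by apply/measurable_EFinP; exact: pm.
  have := @integral_dirac _ _ [tuple] R setT measurableT _ mF.
  rewrite diracT mul1e => E; apply: (@le_lt_trans _ _ (\prod_(j < 0) g (tnth [tuple] j))%:E).
    by rewrite -E.
  exact: ltry.
rewrite ge0_integral_ltS; last 2 first.
- by apply/measurable_EFinP; exact: pm.
- by move=> t; rewrite lee_fin.
have gm' : measurable_fun setT (EFin \o g) by exact/measurable_EFinP.
rewrite (_ : integral _ _ _ = (\int[@lebesgue_measure R]_x ((g x)%:E *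
    \int[lt k]_t (\prod_(j < k) g (tnth t j))%:E))%E); last first.
  apply: eq_integral => x _.
  rewrite -ge0_integralZl ?lee_fin//; last 2 first.
  - by apply/measurable_EFinP; exact: pm.
  - by move=> t _; rewrite lee_fin.
  apply: eq_integral => t _.
  rewrite big_ord_recl (_ : tnth (cons_pair (x, t)) ord0 = x); last by rewrite (tnth_nth x).
  by rewrite EFinM; congr (_ * (_)%:E)%E; apply: eq_bigr => j _; rewrite /cons_pair/= tnthS.
rewrite ge0_integralZr//; last 2 first.
- by move=> x _; rewrite lee_fin.
- by apply: integral_ge0 => t _; rewrite lee_fin.
rewrite lte_mul_pinfty//.
- by apply: integral_ge0 => x _; rewrite lee_fin.
- by rewrite ge0_fin_numE//; apply: integral_ge0 => x _; rewrite lee_fin.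
Qed.

Lemma vint_bracketV : rvint (fun x => (bracket x)^-1).
Proof.
have := integrable_prod n.+1 integrable_oneDsqrV.
rewrite /rvint /bracket => H.
have E : (fun t : n.+1.-tuple T => \prod_(j < n.+1) (1 + tnth t j ^+ 2)^-1) =
   (fun t => (\prod_j (1 + rowof t 0 j ^+ 2))^-1).
  by apply/funext => t; rewrite -prodfV; apply: eq_bigr => j _; rewrite mxE.
by rewrite -E; apply: H => x; rewrite invr_ge0 addr_ge0 ?sqr_ge0.
Qed.
End IntegralRd.

(** * Fubini and dominated convergence *)

Section DominatedFubini.
Context d1 d2 (T1 : measurableType d1) (T2 : measurableType d2) (R : realType).
Variable m1 : {sigma_finite_measure set T1 -> \bar R}.
Variable m2 : {sigma_finite_measure set T2 -> \bar R}.
Variables (g1 : T1 -> R) (g2 : T2 -> R).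
Hypotheses (g1i : rintegrable m1 g1) (g2i : rintegrable m2 g2).
Hypotheses (g10 : forall x, 0 <= g1 x) (g20 : forall y, 0 <= g2 y).

Section real.
Variable h : T1 * T2 -> R.
Hypothesis mh : measurable_fun setT h.
Hypothesis hb : forall x y, `|h (x, y)| <= g1 x * g2 y.

Let slice1 x : rintegrable m2 (fun y => h (x, y)).
Proof.
apply: (@rintegrable_le _ _ _ _ _ (fun y => g1 x * g2 y)) => //.
  by apply: (measurableT_comp mh); exact: measurable_pair1.
exact: rintegrableZ.
Qed.

Let slice2 y : rintegrable m1 (fun x => h (x, y)).
Proof.
apply: (@rintegrable_le _ _ _ _ _ (fun x => g2 y * g1 x)) => //.
- by apply: (measurableT_comp mh); exact: measurable_pair2.
- by move=> x; rewrite mulrC.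
- exact: rintegrableZ.
Qed.

Let prod_int : (m1 \x m2)%E.-integrable setT (EFin \o h).
Proof.
apply/integrable12ltyP; first exact/measurable_EFinP.
have /rintegrable_ge0[//|mg1 fg1] := g1i; have /rintegrable_ge0[//|mg2 fg2] := g2i.
have e2 : (0 <= \int[m2]_y (g2 y)%:E)%E by apply: integral_ge0 => y _; rewrite lee_fin.
have mg1' : measurable_fun setT (EFin \o g1) by exact/measurable_EFinP.
apply: (@le_lt_trans _ _ (\int[m1]_x ((g1 x)%:E * \int[m2]_y (g2 y)%:E))%E); last first.
  rewrite ge0_integralZr//; last by move=> x _; rewrite lee_fin.
  rewrite lte_mul_pinfty//; first by apply: integral_ge0 => x _; rewrite lee_fin.
  by rewrite ge0_fin_numE//; apply: integral_ge0 => x _; rewrite lee_fin.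
have mabs : measurable_fun setT (abse \o (EFin \o h)).
  by apply: measurableT_comp => //; exact/measurable_EFinP.
apply: ge0_le_integral => //.
- by move=> x _; exact: integral_ge0.
- apply: (measurable_fun_fubini_tonelli_F (abse \o (EFin \o h))) => //.
  by move=> z; exact: abse_ge0.
- by apply: emeasurable_funM => //; exact: measurable_cst.
- move=> x _; rewrite -ge0_integralZl ?lee_fin//; last 2 first.
  + exact/measurable_EFinP.
  + by move=> y _; rewrite lee_fin.
  apply: ge0_le_integral => //.
  + by apply: (measurableT_comp mabs); exact: measurable_pair1.
  + by apply: emeasurable_funM; [exact: measurable_cst|exact/measurable_EFinP].
  + by move=> y _; rewrite /= lee_fin.
Qed.

Lemma dominated_fubini_int : rintegrable m1 (fun x => Rintegral m2 setT (fun y => h (x, y))).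
Proof.
rewrite /rintegrable (_ : _ \o _ = fubini_F m2 (EFin \o h)).
  exact: integrable_fubini_F.
apply/funext => x /=; rewrite /Rintegral fineK//.
by apply: integrable_fin_num => //; exact: slice1.
Qed.

Lemma dominated_fubini_real :
  Rintegral m1 setT (fun x => Rintegral m2 setT (fun y => h (x, y))) =
  Rintegral m2 setT (fun y => Rintegral m1 setT (fun x => h (x, y))).
Proof.
rewrite {1}/Rintegral [in RHS]/Rintegral; congr fine.
transitivity (\int[m1]_x \int[m2]_y (h (x, y))%:E)%E.
  apply: eq_integral => x _; rewrite /Rintegral fineK//.
  by apply: integrable_fin_num => //; exact: slice1.
rewrite (Fubini prod_int); apply: eq_integral => y _; rewrite /Rintegral fineK//.
by apply: integrable_fin_num => //; exact: slice2.
Qed.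
End real.

Variable f : T1 * T2 -> R[i].
Hypothesis mf : cmeas f.
Hypothesis fb : forall x y, normc (f (x, y)) <= g1 x * g2 y.

Let fb1 x y : `|cRe (f (x, y))| <= g1 x * g2 y.
Proof. exact: le_trans (Re_le_normc _) _. Qed.
Let fb2 x y : `|cIm (f (x, y))| <= g1 x * g2 y.
Proof. exact: le_trans (Im_le_normc _) _. Qed.

Lemma cintegrable_fubini :
  cintegrable m1 (fun x => cintegral m2 (fun y => f (x, y))).
Proof.
case: mf => m1f m2f; split.
- exact: (dominated_fubini_int m1f fb1).
- exact: (dominated_fubini_int m2f fb2).
Qed.

(** A majorant of product form is easier to supply than integrability on the
    product space, which it implies by Tonelli. *)
Lemma dominated_fubini :
  cintegral m1 (fun x => cintegral m2 (fun y => f (x, y))) =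
  cintegral m2 (fun y => cintegral m1 (fun x => f (x, y))).
Proof.
case: mf => m1f m2f; apply: cplx_eq => /=.
- exact: (dominated_fubini_real m1f fb1).
- exact: (dominated_fubini_real m2f fb2).
Qed.
End DominatedFubini.

Lemma cintegral0 d (T : measurableType d) (R : realType)
  (mu : {measure set T -> \bar R}) : cintegral mu (fun _ => 0) = 0.
Proof. by apply: cplx_eq => /=; rewrite Rintegral_cst// mul0r. Qed.

Section DominatedConvergence.
Context d (T : measurableType d) (R : realType) (mu : {measure set T -> \bar R}).
Variables (g : T -> R).
Hypothesis gi : rintegrable mu g.

Lemma Rintegral_cvg (h_ : nat -> T -> R) (h : T -> R) :
  (forall m, measurable_fun setT (h_ m)) ->
  (forall x, h_ m x @[m --> \oo] --> h x) ->
  (forall m x, `|h_ m x| <= g x) ->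
  Rintegral mu setT (h_ m) @[m --> \oo] --> Rintegral mu setT h.
Proof.
move=> mh hh hb.
have mhl : measurable_fun setT h by apply: (measurable_fun_cvg mh) => x _; exact: hh.
have mh' m : measurable_fun setT (EFin \o h_ m) by exact/measurable_EFinP.
have mhl' : measurable_fun setT (EFin \o h) by exact/measurable_EFinP.
have cv : {ae mu, forall x, setT x -> (EFin \o h_ m) x @[m --> \oo] --> (EFin \o h) x}.
  by apply: aeW => x _; apply: cvg_EFin; [exact: nearW|exact: hh].
have bd : {ae mu, forall x, forall m : nat, setT x -> (`|(EFin \o h_ m) x| <= (EFin \o g) x)%E}.
  by apply: aeW => x m _; rewrite /= lee_fin.
have [hi _ lim] := dominated_convergence measurableT mh' mhl' cv gi bd.
have fin : (\int[mu]_x (EFin \o h) x)%E \is a fin_num by exact: integrable_fin_num.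
rewrite /Rintegral; apply: fine_cvg; rewrite fineK//.
Qed.

Lemma cintegral_cvg (f_ : nat -> T -> R[i]) (f : T -> R[i]) :
  (forall m, cmeas (f_ m)) ->
  (forall x e, 0 < e -> exists N, forall m, (N <= m)%N -> normc (f_ m x - f x) < e) ->
  (forall m x, normc (f_ m x) <= g x) ->
  forall e, 0 < e -> exists N, forall m, (N <= m)%N ->
    normc (cintegral mu (f_ m) - cintegral mu f) < e.
Proof.
move=> mf ff fb e e0.
have c1 : Rintegral mu setT (fun x => cRe (f_ m x)) @[m --> \oo] -->
    Rintegral mu setT (fun x => cRe (f x)).
  apply: Rintegral_cvg => [m|x|m x]; first by case: (mf m).
    apply/cvgrPdist_lt => r r0; have [N H] := ff x r r0; exists N => // m /= Nm.
    by rewrite distrC (le_lt_trans _ (H m Nm))// -ReN -ReD Re_le_normc.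
  exact: le_trans (Re_le_normc _) _.
have c2 : Rintegral mu setT (fun x => cIm (f_ m x)) @[m --> \oo] -->
    Rintegral mu setT (fun x => cIm (f x)).
  apply: Rintegral_cvg => [m|x|m x]; first by case: (mf m).
    apply/cvgrPdist_lt => r r0; have [N H] := ff x r r0; exists N => // m /= Nm.
    by rewrite distrC (le_lt_trans _ (H m Nm))// -ImN -ImD Im_le_normc.
  exact: le_trans (Im_le_normc _) _.
have e20 : 0 < e / 2 by rewrite divr_gt0.
move/cvgrPdist_lt : c1 => /(_ _ e20)[N1 _ H1].
move/cvgrPdist_lt : c2 => /(_ _ e20)[N2 _ H2].
exists (maxn N1 N2) => m; rewrite geq_max => /andP[/H1 /= h1 /H2 /= h2].
rewrite (le_lt_trans (normc_le_ReIm _))// !ReImE /= [ltRHS](splitr e).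
by rewrite ltrD// distrC.
Qed.
End DominatedConvergence.

(** * Cauchy's theorem for integrals over R^d *)

Section ContourShift.
Variables (R : realType) (n : nat).
Local Notation Rd := 'rV[R]_n.+1.
Local Notation Cd := 'rV[R[i]]_n.+1.
Local Notation T := (measurableTypeR R).

(** The point x + i y of C^d. *)
Definition cpt (x y : Rd) : Cd := \row_j Complex (x 0 j) (y 0 j).

Definition gcont (G : Cd -> R[i]) (z : Cd) := forall e : R, 0 < e ->
  exists2 r : R, 0 < r & forall z' : Cd, (forall j, normc (z' 0 j - z 0 j) < r) ->
    normc (G z' - G z) < e.

Lemma clamp_lipschitz (b u v : R) : 0 <= b ->
  `|Num.max 0 (Num.min b u) - Num.max 0 (Num.min b v)| <= `|u - v|.
Proof.
move=> b0; have h1 := ler_norm (u - v); have := ler_norm (- (u - v)); rewrite normrN => h2.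
rewrite ler_norml; case: (leP b u) => bu; case: (leP b v) => bv; rewrite ?(max_idPr b0).
- by rewrite subrr oppr_le0 normr_ge0.
- by case: (leP 0 v) => v0; apply/andP; split; lra.
- by case: (leP 0 u) => u0; apply/andP; split; lra.
- by case: (leP 0 u) => u0; case: (leP 0 v) => v0; apply/andP; split; lra.
Qed.

Definition basis (j : 'I_n.+1) : Rd := delta_mx 0 j.
Definition cbasis (j : 'I_n.+1) : Cd := delta_mx 0 j.

Lemma cpt_line x y j (s v : R) :
  cpt x y + Complex s v *: cbasis j = cpt (x + s *: basis j) (y + v *: basis j).
Proof.
apply/rowP => k; rewrite !mxE eqxx /=.
by apply: cplx_eq; rewrite !ReImE /=; case: (k == j) => /=; ring.
Qed.

(** Peetre's inequality. *)
Lemma bracket_translate (x h : Rd) :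
  bracket x <= 2 ^+ n.+1 * bracket h * bracket (x + h).
Proof.
rewrite /bracket -[X in _ ^+ X]card_ord -prodr_const -!big_split /=.
apply: ler_prod => j _; rewrite addr_ge0 ?sqr_ge0//= mxE.
have := sqr_ge0 (x 0 j + h 0 j + h 0 j).
have : 0 <= h 0 j ^+ 2 * (x 0 j + h 0 j) ^+ 2 by rewrite mulr_ge0 ?sqr_ge0.
by move: (x 0 j) (h 0 j) => u v; rewrite !expr2; nra.
Qed.

Definition jcont (F : R -> Rd -> R[i]) := forall s (x : Rd) (e : R), 0 < e ->
  exists2 r : R, 0 < r & forall s' (x' : Rd), `|s' - s| < r ->
    (forall j, `|x' 0 j - x 0 j| < r) -> normc (F s' x' - F s x) < e.

Lemma jcont_cmeas F : jcont F ->
  cmeas (fun p : n.+1.-tuple T * T => F p.2 (rowof p.1)).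
Proof.
move=> Fc; pose f (t : n.+2.-tuple T) := F (thead t) (rowof [tuple of behead t]).
have mf : cmeas f.
  apply: ctcont_cmeas => t e e0; have [r r0 H] := Fc (thead t) (rowof [tuple of behead t]) e e0.
  exists r => // t' tt'; apply: H; first exact: tt'.
  by move=> j; rewrite !mxE !tnth_behead.
have -> : (fun p : n.+1.-tuple T * T => F p.2 (rowof p.1)) =
    (fun p => f [the n.+2.-tuple T of p.2 :: p.1]).
  by apply/funext => -[t s]; rewrite /f theadE; congr (F _ (rowof _)); exact: val_inj.
by apply: (cmeas_comp (measurable_cons _ _) mf).
Qed.

Lemma vcont_jcont F s : jcont F -> vcont (F s).
Proof.
move=> Fc x e e0; have [r r0 H] := Fc s x e e0; exists r => // y xy.
by apply: H => //; rewrite subrr normr0.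
Qed.

(** Fubini, with the majorant that is M / bracket x for s in [0,b[ and zero
    elsewhere. *)
Lemma cint_cintegralRd F (b M : R) : 0 < b -> jcont F ->
  (forall s x, 0 <= s < b -> normc (F s x) <= M / bracket x) ->
  vint (fun x => cint 0 b (F ^~ x)) /\
  cintegralRd (fun x => cint 0 b (F ^~ x)) = cint 0 b (fun s => cintegralRd (F s)).
Proof.
move=> b0 Fc FM.
have M0 : 0 <= M.
  have := FM 0 0; rewrite lexx b0 => /(_ isT) h.
  rewrite -(pmulr_lge0 _ (_ : 0 < (bracket (0 : Rd))^-1)) ?invr_gt0 ?bracket_gt0//.
  exact: le_trans (normc_ge0 _) h.
pose g1 (t : n.+1.-tuple T) := (bracket (rowof t))^-1.
pose g2 (s : T) : R := if 0 <= s < b then M else 0.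
pose f (p : n.+1.-tuple T * T) := on_itv 0 b (F ^~ (rowof p.1)) p.2.
have g1i : rintegrable (lebesgue_tuple R n.+1) g1 := vint_bracketV R n.
have g2i : rintegrable (@lebesgue_measure R) g2 := rintegrable_indic_itv M 0 b.
have g10 t : 0 <= g1 t by rewrite invr_ge0 bracket_ge0.
have g20 s : 0 <= g2 s by rewrite /g2; case: ifP.
have fb t s : normc (f (t, s)) <= g1 t * g2 s.
  rewrite /f /on_itv /g2 /=; case: ifP => sb; last by rewrite normc0 mulr0.
  by rewrite mulrC FM.
have mf : cmeas f.
  rewrite (_ : f = fun p => ((\1_`[0, b[ p.2)%:C)%C * F p.2 (rowof p.1)).
    apply: cmeasM; last exact: jcont_cmeas.
    by apply: cmeas_real; apply: measurableT_comp.
  apply/funext => -[t s]; rewrite /f /on_itv /= indicE.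
  case: ifP => sb; first by rewrite mem_set ?mul1r//= in_itv.
  by rewrite memNset ?mul0r//= in_itv/= sb.
split; first exact: (cintegrable_fubini g1i g2i g10 g20 mf fb).
rewrite cintegralRdE /cint (dominated_fubini g1i g2i g10 g20 mf fb).
apply: eq_cintegral => s; rewrite /f /on_itv /=; case: ifP => // _.
exact: cintegral0.
Qed.

Local Opaque cint cintegralRd.

(** Goursat's theorem is applied on the fixed square [0,b] x [0,b] in the j-th
    variable and then integrated over all base points: translation invariance
    cancels the two vertical sides, so that no limit of rectangles is taken. *)
Lemma contour_shift_pos (G : Cd -> R[i]) (y : Rd) (j : 'I_n.+1) (b M : R) : 0 < b ->
  (forall x v, 0 <= v <= b -> gcont G (cpt x (y + v *: basis j))) ->
  (forall x v, 0 <= v <= b ->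
     cdiff (fun w => G (cpt x y + w *: cbasis j)) (Complex 0 v)) ->
  (forall x v, 0 <= v <= b ->
     normc (G (cpt x (y + v *: basis j))) <= M / bracket x) ->
  cintegralRd (fun x => G (cpt x y)) =
  cintegralRd (fun x => G (cpt x (y + b *: basis j))).
Proof.
move=> b0 Gc Gd GM; have b0' := ltW b0.
have M0 : 0 <= M.
  have := GM 0 0; rewrite lexx b0' => /(_ isT) h.
  rewrite -(pmulr_lge0 _ (_ : 0 < (bracket (0 : Rd))^-1)) ?invr_gt0 ?bracket_gt0//.
  exact: le_trans (normc_ge0 _) h.
pose F v s x := G (cpt (x + s *: basis j) (y + v *: basis j)).
(* The vertical side is extended by constants to all heights, so that its
   integrand is continuous on the whole line. *)
pose clamp v : R := Num.max 0 (Num.min b v).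
have clampP v : 0 <= clamp v <= b by rewrite /clamp le_max lexx/= ge_max b0' ge_min lexx.
have clamp_id v : 0 <= v < b -> clamp v = v.
  by move=> /andP[v0 vb]; rewrite /clamp (min_idPr (ltW vb)) (max_idPr v0).
have clamp_lip u v : `|clamp u - clamp v| <= `|u - v|.
  exact: clamp_lipschitz.
have gbasis (s : R) k : `|(s *: basis j) 0 k| <= `|s|.
  by rewrite !mxE eqxx /= normrM ler_piMr//; case: (k == j); rewrite /= ?normr1 ?normr0.
have Fcont v : 0 <= v <= b -> jcont (F v).
  move=> hv s x e e0; have [r r0 H] := Gc (x + s *: basis j) v hv e e0.
  exists (r / 2); first by rewrite divr_gt0.
  move=> s' x' ss' xx'; apply: H => k; rewrite !mxE complexBh normc_real.
  rewrite opprD addrACA -mulrBl (le_lt_trans (ler_normD _ _))// [ltRHS](splitr r).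
  rewrite ltrD ?xx'//; have := gbasis (s' - s) k; rewrite !mxE => /le_lt_trans; exact.
have Vcont : jcont (fun v x => G (cpt x (y + clamp v *: basis j))).
  move=> v x e e0; have [r r0 H] := Gc x (clamp v) (clampP v) e e0.
  exists (r / 2); first by rewrite divr_gt0.
  move=> v' x' vv' xx'; apply: H => k; rewrite !mxE.
  rewrite (le_lt_trans (normc_le_ReIm _))// !ReImE /= [ltRHS](splitr r) ltrD ?xx'//.
  rewrite opprD addrACA subrr add0r -mulrBl.
  have := gbasis (clamp v' - clamp v) k; rewrite !mxE => /le_lt_trans; apply.
  exact: le_lt_trans vv'.
pose C := 2 ^+ n.+1 * (1 + b ^+ 2).
have bb (s : R) : 0 <= s < b -> bracket (s *: basis j) <= 1 + b ^+ 2.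
  move=> /andP[s0 sb]; rewrite /bracket (bigD1 j)//= big1 ?mulr1.
    by rewrite !mxE !eqxx mulr1 lerD2l lerXn2r ?nnegrE// ltW.
  by move=> k kj; rewrite !mxE eqxx (negbTE kj) mulr0 expr0n addr0.
have Fbound v : 0 <= v <= b -> forall s x, 0 <= s < b -> normc (F v s x) <= M * C / bracket x.
  move=> hv s x hs; rewrite (le_trans (GM _ _ hv))// -mulrA ler_wpM2l//.
  rewrite -[leLHS]mul1r ler_pdivrMr ?bracket_gt0// mulrAC ler_pdivlMr ?bracket_gt0// mul1r.
  rewrite (le_trans (bracket_translate x (s *: basis j)))//.
  by rewrite ler_wpM2r ?bracket_ge0// ler_wpM2l ?exprn_ge0// bb.
have Vbound s x : 0 <= s < b -> normc (G (cpt x (y + clamp s *: basis j))) <= M / bracket x.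
  by move=> _; exact: GM.
have [V1 V2] := cint_cintegralRd b0 Vcont Vbound.
have z0 : 0 <= (0 : R) <= b by apply/andP; split.
have zb : 0 <= b <= b by apply/andP; split.
have [A1 A2] := cint_cintegralRd b0 (Fcont _ z0) (Fbound _ z0).
have [B1 B2] := cint_cintegralRd b0 (Fcont _ zb) (Fbound _ zb).
pose V x := cint 0 b (fun v => G (cpt x (y + clamp v *: basis j))).
have [W1 W2] := cintegralRd_translate (b *: basis j) V1.
have slice v : 0 <= v <= b -> vint (F v 0).
  move=> hv; apply: (@cintegrable_le _ _ _ _ _ (fun t => M / bracket (rowof t))).
  - by apply: vcont_vmeas; exact/vcont_jcont/Fcont.
  - by move=> t; rewrite /F scale0r addr0 GM.
  - by apply: rintegrableZ; exact: vint_bracketV.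
have inv v s : 0 <= v <= b -> cintegralRd (F v s) = cintegralRd (F v 0).
  move=> hv; have [_ <-] := cintegralRd_translate (s *: basis j) (slice v hv).
  by congr cintegralRd; apply/funext => t; rewrite /F scale0r addr0.
have cst (K : R[i]) : cint 0 b (fun _ => K) = K * (b%:C)%C.
  by rewrite (cint_cst _ b0') subr0.
have {A2} A2 : cintegralRd (fun x => cint 0 b (F 0 ^~ x)) = cintegralRd (F 0 0) * (b%:C)%C.
  rewrite A2 (@eq_cint _ _ _ _ (fun _ => cintegralRd (F 0 0))); first exact: cst.
  move=> s _; exact: (inv _ _ z0).
have {B2} B2 : cintegralRd (fun x => cint 0 b (F b ^~ x)) = cintegralRd (F b 0) * (b%:C)%C.
  rewrite B2 (@eq_cint _ _ _ _ (fun _ => cintegralRd (F b 0))); first exact: cst.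
  move=> s _; exact: (inv _ _ zb).
have gou x : cint 0 b (F 0 ^~ x) - cint 0 b (F b ^~ x) + iu * (V (x + b *: basis j) - V x) = 0.
  have h1 := @Goursat R (fun w => G (cpt x y + w *: cbasis j)) 0 b 0 b b0 b0.
  rewrite -[RHS]h1.
    rewrite /oint; congr (_ - _ + iu * (_ - _)); apply: eq_cint => s hs.
    - by rewrite cpt_line.
    - by rewrite cpt_line.
    - by rewrite cpt_line clamp_id.
    - by rewrite cpt_line scale0r addr0 clamp_id.
  move=> s v hs hv; have := Gd (x + s *: basis j) v hv.
  have -> : (fun w => G (cpt x y + w *: cbasis j)) =
    (fun w => G (cpt (x + s *: basis j) y + (w - (s%:C)%C) *: cbasis j)).
    apply/funext => w; congr G; rewrite scalerBl addrA addrAC; congr (_ + _).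
    apply/esym/eqP; rewrite subr_eq; apply/eqP.
    by have := cpt_line x y j s 0; rewrite scale0r addr0 => <-.
  move=> d; have sv : Complex s v - (s%:C)%C = Complex 0 v :> R[i].
    by apply: cplx_eq; rewrite !ReImE /=; ring.
  apply: (@cdiff_comp _ (fun w => G (cpt (x + s *: basis j) y + w *: cbasis j))).
    by rewrite sv.
  by apply: cdiffD; [exact: cdiff_id|exact: cdiff_cst].
have b0C : (b%:C)%C != 0 :> R[i] by rewrite -normc_gt0 normc_real gtr0_norm.
apply: (mulIf b0C); move: A2 B2; rewrite {1 3}/F => A2 B2.
have E0 : (fun x => G (cpt x y)) = F 0 0.
  by apply/funext => x; rewrite /F !scale0r !addr0.
have Eb : (fun x => G (cpt x (y + b *: basis j))) = F b 0.
  by apply/funext => x; rewrite /F scale0r addr0.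
rewrite E0 Eb -A2 -B2.
have : cintegralRd (fun x => cint 0 b (F 0 ^~ x) - cint 0 b (F b ^~ x) +
    iu * (V (x + b *: basis j) - V x)) = 0.
  rewrite (_ : (fun x => _) = fun=> 0); last by apply/funext => x; rewrite gou.
  by rewrite cintegralRdE cintegral0.
have B1' := vintZ (-1) B1; have V1' := vintZ (-1) V1.
have I1 := vintD A1 B1'.
have I2 := vintD W1 V1'.
rewrite (_ : (fun x => cint 0 b (F 0 ^~ x) - cint 0 b (F b ^~ x) + iu * (V (x + b *: basis j) - V x)) =
  (fun x => (cint 0 b (F 0 ^~ x) + (-1) * cint 0 b (F b ^~ x)) +
      iu * (V (x + b *: basis j) + (-1) * V x))); last first.
  by apply/funext => x; rewrite !mulN1r.
rewrite (cintegralRdD I1 (vintZ _ I2)) (cintegralRdZ _ I2) (cintegralRdD A1 B1').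
rewrite (cintegralRdZ _ B1) (cintegralRdD W1 V1') (cintegralRdZ _ V1) W2.
move: (cintegralRd (fun x => cint 0 b (F 0 ^~ x))) => a1.
move: (cintegralRd (fun x => cint 0 b (F b ^~ x))) => a2.
by rewrite !mulN1r subrr mulr0 addr0 => /eqP; rewrite subr_eq0 => /eqP.
Qed.
End ContourShift.
Section ContourShift2.
Variables (R : realType) (n : nat).
Local Notation Rd := 'rV[R]_n.+1.
Local Notation Cd := 'rV[R[i]]_n.+1.
Local Opaque cint cintegralRd.

(** For b < 0 the shift by - b is applied at the other end of the segment. *)
Lemma contour_shift (G : Cd -> R[i]) (y : Rd) (j : 'I_n.+1) (b r M : R) : `|b| <= r ->
  (forall x v, `|v| <= r -> gcont G (cpt x (y + v *: basis R j))) ->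
  (forall x v, `|v| <= r ->
     cdiff (fun w => G (cpt x y + w *: cbasis R j)) (Complex 0 v)) ->
  (forall x v, `|v| <= r ->
     normc (G (cpt x (y + v *: basis R j))) <= M / bracket x) ->
  cintegralRd (fun x => G (cpt x y)) =
  cintegralRd (fun x => G (cpt x (y + b *: basis R j))).
Proof.
move=> br Gc Gd GM; have [b0|b0|->] := ltgtP b 0; last by rewrite scale0r addr0.
- pose y' := y + b *: basis R j.
  have yE v : y' + v *: basis R j = y + (b + v) *: basis R j.
    by rewrite /y' scalerDl addrA.
  have nb : `|b| = - b by rewrite ltr0_norm.
  have range v : 0 <= v <= - b -> `|b + v| <= r.
    move=> /andP[v0 vb]; rewrite (le_trans _ br)// nb ler_norml; apply/andP; split; lra.
  have nb0 : 0 < - b by rewrite oppr_gt0.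
  have := @contour_shift_pos R n G y' j (- b) M nb0.
  rewrite yE subrr scale0r addr0 => ->//.
  + by move=> x v hv; rewrite yE; apply: Gc; exact: range.
  + move=> x v hv.
    have -> : (fun w => G (cpt x y' + w *: cbasis R j)) =
        (fun w => G (cpt x y + (w + Complex 0 b) *: cbasis R j)).
      apply/funext => w; congr G; rewrite scalerDl addrCA addrC; congr (_ + _).
      by rewrite /y' cpt_line scale0r addr0.
    apply: (@cdiff_comp _ (fun w => G (cpt x y + w *: cbasis R j))); last first.
      by apply: cdiffD; [exact: cdiff_id|exact: cdiff_cst].
    rewrite (_ : _ + _ = Complex 0 (b + v)); first exact/Gd/range.
    by apply: cplx_eq; rewrite !ReImE /=; ring.
  + by move=> x v hv; rewrite yE; apply: GM; exact: range.
- have range v : 0 <= v <= b -> `|v| <= r.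
    by move=> /andP[v0 vb]; rewrite (le_trans _ br)// (gtr0_norm b0) (ger0_norm v0).
  apply: (@contour_shift_pos R n G y j b M b0) => x v /range.
  + exact: Gc.
  + exact: Gd.
  + exact: GM.
Qed.
End ContourShift2.

(** * Differentiability from a quadratic remainder *)

Section QuadraticDifferentiability.
Variables (R : realType) (n : nat).
Local Notation Rd := 'rV[R]_n.+1.

Lemma coord_le_norm (x : Rd) j : `|x 0 j| <= `|x|.
Proof.
have E := mx_normrE x; rewrite [leRHS](_ : _ = mx_norm x) // E.
exact: (le_bigmax _ (fun ij : 'I_1 * 'I_n.+1 => `|x ij.1 ij.2|) (0, j)).
Qed.

Lemma norm_le_coord (x : Rd) (e : R) : 0 <= e -> (forall j, `|x 0 j| <= e) -> `|x| <= e.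
Proof.
move=> e0 H; have E := mx_normrE x; rewrite [leLHS](_ : _ = mx_norm x) // E.
by apply: bigmax_le => //= -[i j] _ /=; rewrite ord1.
Qed.

Definition lin_form (l : 'I_n.+1 -> R) (h : Rd) : R := \sum_j l j * h 0 j.

Lemma lin_form_linear l : linear (lin_form l).
Proof.
move=> c u v; rewrite /lin_form /GRing.scale/= mulr_sumr -big_split/=.
by apply: eq_bigr => j _; rewrite !mxE; ring.
Qed.
HB.instance Definition _ l :=
  GRing.isLinear.Build R Rd R *:%R (lin_form l) (lin_form_linear l).

Lemma lin_form_continuous l : continuous (lin_form l : Rd -> R).
Proof.
move=> x; apply: differentiable_continuous.
have -> : lin_form l = \sum_(j < n.+1) (fun h : Rd => l j * h 0 j).
  by apply/funext => h; rewrite /lin_form fct_sumE.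
apply: differentiable_sum => j; apply: differentiableM; first exact: differentiable_cst.
exact: differentiable_coord.
Qed.

(** The functions differentiated below are Fourier integrals, and their
    remainder is explicitly quadratic by [cexp_taylor]. *)
Lemma quad_differentiable (F : Rd -> R) x l (M : R) :
  (forall h, `|F (x + h) - F x - lin_form l h| <= M * `|h| ^+ 2) ->
  differentiable F x /\ forall j, 'D_(delta_mx 0 j) F x = l j.
Proof.
move=> H; have M0 : 0 <= M.
  have := H (const_mx 1); have -> : `|const_mx 1 : Rd| = 1.
    apply/eqP; rewrite eq_le; apply/andP; split.
      by apply: norm_le_coord => // j; rewrite mxE normr1.
    by have := coord_le_norm (const_mx 1 : Rd) 0; rewrite mxE normr1.
  by rewrite expr1n mulr1; apply: le_trans.
have E : F \o shift x = cst (F x) + lin_form l +o_ (0 : Rd) id.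
  apply/eqaddoP => e e0; near=> h.
  rewrite (_ : (_ - _) h = F (x + h) - F x - lin_form l h); last first.
    by rewrite !fctE /= [h + x]addrC; ring.
  rewrite (le_trans (H h))// expr2 mulrA ler_wpM2r//.
  have : `|h| < e / (M + 1).
    near: h; apply/nbhs_ballP; exists (e / (M + 1)); first by rewrite /= divr_gt0// ltr_wpDl.
    by move=> h; rewrite -ball_normE /= sub0r normrN.
  rewrite ltr_pdivlMr ?ltr_wpDl// => /ltW; apply: le_trans.
  by rewrite mulrC ler_wpM2l// lerDl.
have D := diff_unique (lin_form_continuous (l:=l)) E.
have dF : differentiable F x.
  by apply/diff_locallyP; rewrite D; split; [exact: lin_form_continuous|].
split => // j; rewrite deriveE// D /= /lin_form (bigD1 j)//= big1.
  by rewrite !mxE !eqxx mulr1 addr0.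
by move=> k kj; rewrite !mxE eqxx (negbTE kj) mulr0.
Unshelve. all: by end_near. Qed.

Lemma quad_partial (F : Rd -> R[i]) x (l : 'I_n.+1 -> R[i]) (M : R) :
  (forall h : Rd, normc (F (x + h) - F x - \sum_j l j * ((h 0 j)%:C)%C) <= M * `|h| ^+ 2) ->
  [/\ differentiable (fun y => cRe (F y)) x, differentiable (fun y => cIm (F y)) x &
     forall j, partial F j x = l j].
Proof.
move=> H.
have [|d1 p1] := @quad_differentiable (fun y => cRe (F y)) x (fun j => cRe (l j)) M.
  move=> h; apply: le_trans (H h); apply: le_trans (Re_le_normc _).
  rewrite !ReImE Re_sum /lin_form le_eqVlt; apply/orP; left; apply/eqP; congr (`| _ - _|).
  by apply: eq_bigr => j _; case: (l j) => u v; rewrite /= mulr0 subr0.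
have [|d2 p2] := @quad_differentiable (fun y => cIm (F y)) x (fun j => cIm (l j)) M.
  move=> h; apply: le_trans (H h); apply: le_trans (Im_le_normc _).
  rewrite !ReImE Im_sum /lin_form le_eqVlt; apply/orP; left; apply/eqP; congr (`| _ - _|).
  by apply: eq_bigr => j _; case: (l j) => u v; rewrite /= mulr0 add0r.
by split => // j; apply: cplx_eq; rewrite /partial /= ?p1 ?p2.
Qed.
End QuadraticDifferentiability.

(** * Fourier integrals *)

Section FourierIntegral.
Variables (R : realType) (n : nat).
Local Notation Rd := 'rV[R]_n.+1.
Local Notation T := (measurableTypeR R).
Implicit Types (f g : Rd -> R[i]) (s B M : R).

(** The unit character exp(i t), in terms of which Fourier integrals are
    written. *)
Definition ker (t : R) : R[i] := cexp (iu * (t%:C)%C).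

Lemma kerD a b : ker (a + b) = ker a * ker b.
Proof. by rewrite /ker rmorphD mulrDr cexpD. Qed.
Lemma ker0 : ker 0 = 1.
Proof. by rewrite /ker mulr0 cexp0. Qed.
Lemma normc_ker a : normc (ker a) = 1.
Proof. by rewrite normc_cexp_im// iuM_real. Qed.
Lemma conjc_ker a : conjc (ker a) = ker (- a).
Proof.
by rewrite /ker conjc_cexp !iuM_real; congr cexp; apply: cplx_eq; rewrite ReImE.
Qed.

Lemma dotpC (x y : Rd) : dotp x y = dotp y x.
Proof. by apply: eq_bigr => j _; rewrite mulrC. Qed.
Lemma dotpDl (x y z : Rd) : dotp (x + y) z = dotp x z + dotp y z.
Proof. by rewrite /dotp -big_split; apply: eq_bigr => j _; rewrite mxE mulrDl. Qed.
Lemma dotpDr (x y z : Rd) : dotp z (x + y) = dotp z x + dotp z y.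
Proof. by rewrite dotpC dotpDl !(dotpC z). Qed.
Lemma dotpZl a (x z : Rd) : dotp (a *: x) z = a * dotp x z.
Proof. by rewrite /dotp mulr_sumr; apply: eq_bigr => j _; rewrite mxE mulrA. Qed.
Lemma dotpZr a (x z : Rd) : dotp z (a *: x) = a * dotp z x.
Proof. by rewrite dotpC dotpZl dotpC. Qed.
Lemma dotpNr (x z : Rd) : dotp z (- x) = - dotp z x.
Proof. by rewrite -scaleN1r dotpZr mulN1r. Qed.
Lemma dotpNl (x z : Rd) : dotp (- x) z = - dotp x z.
Proof. by rewrite dotpC dotpNr dotpC. Qed.
Lemma dotp0r (z : Rd) : dotp z 0 = 0.
Proof. by rewrite -(scale0r 0) dotpZr mul0r. Qed.

Lemma dotp_le (z h : Rd) : `|dotp z h| <= n.+1%:R * (`|h| * bracket z).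
Proof.
rewrite (le_trans (ler_norm_sum _ _ _))//.
have -> : n.+1%:R * (`|h| * bracket z) = \sum_(j < n.+1) `|h| * bracket z.
  by rewrite sumr_const card_ord mulr_natl.
apply: ler_sum => j _; by rewrite normrM mulrC ler_pM// ?coord_le_norm// coord_le_bracket.
Qed.

Lemma measurable_dotp (x : Rd) : measurable_fun setT (fun t : n.+1.-tuple T => dotp (rowof t) x).
Proof.
apply: measurable_sum => j; apply: measurable_funM; last exact: measurable_cst.
rewrite (_ : (fun _ => _) = (fun t : n.+1.-tuple T => tnth t j)); first exact: measurable_tnth.
by apply/funext => t; rewrite mxE.
Qed.

Lemma cmeas_ker d (S : measurableType d) (h : S -> R) :
  measurable_fun setT h -> cmeas (fun x => ker (h x)).
Proof.
move=> mh; apply: cmeas_cexp; apply: cmeasM; [exact: cmeas_cst|exact: cmeas_real].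
Qed.

Lemma vmeas_ker s (x : Rd) : vmeas (fun z => ker (s * dotp z x)).
Proof.
apply: cmeas_ker; apply: measurable_funM; [exact: measurable_cst|exact: measurable_dotp].
Qed.

Lemma vmeas_coord (j : 'I_n.+1) : vmeas (fun z : Rd => ((z 0 j)%:C)%C).
Proof.
apply: cmeas_real.
rewrite (_ : (fun _ => _) = (fun t : n.+1.-tuple T => tnth t j)); first exact: measurable_tnth.
by apply/funext => t; rewrite mxE.
Qed.

(** Measurability is part of the notion, so that decay of order 1 implies
    integrability. *)
Definition decay (k : nat) (B : R) g := vmeas g /\ forall x, normc (g x) <= B / bracket x ^+ k.

Lemma decay_ge0 k B g : decay k B g -> 0 <= B.
Proof.
move=> [_ /(_ 0)] /(le_trans (normc_ge0 _)).
by rewrite pmulr_lge0// invr_gt0 exprn_gt0// bracket_gt0.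
Qed.

Lemma decayS k B g : decay k.+1 B g -> decay k B g.
Proof.
move=> H; split; first by case: H.
move=> x; case: (H) => _ /(_ x) /le_trans; apply; rewrite ler_wpM2l ?(decay_ge0 H)//.
by rewrite lef_pV2 ?posrE ?exprn_gt0 ?bracket_gt0// exprS ler_peMl ?exprn_ge0 ?bracket_ge0// bracket_ge1.
Qed.

Lemma decay_le k m B g : (k <= m)%N -> decay m B g -> decay k B g.
Proof.
move=> km; rewrite -(subnKC km); elim: (m - k)%N => [|i IH]; first by rewrite addn0.
by rewrite addnS => /decayS.
Qed.

Lemma decayM k B B' g f : vmeas f -> (forall x, normc (f x) <= B') ->
  decay k B g -> decay k (B' * B) (fun x => f x * g x).
Proof.
move=> fm fb [gm gb]; split; first exact: cmeasM.
move=> x; rewrite normcM -mulrA ler_pM ?normc_ge0//.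
Qed.

Lemma decay_ker k B g s x : decay k B g -> decay k B (fun z => ker (s * dotp z x) * g z).
Proof.
move=> H; rewrite -[B]mul1r; apply: decayM => //; first exact: vmeas_ker.
by move=> z; rewrite normc_ker.
Qed.

Lemma decay_coord k B g j : decay k.+1 B g -> decay k B (fun z : Rd => ((z 0 j)%:C)%C * g z).
Proof.
move=> H; have B0 := decay_ge0 H; case: H => gm gb; split.
  by apply: cmeasM => //; exact: vmeas_coord.
move=> z; rewrite normcM normc_real.
have b0 := bracket_gt0 z.
rewrite (le_trans (ler_pM _ _ (coord_le_bracket z j) (gb z)))// ?normc_ge0//.
by rewrite mulrCA exprS invfM mulVKf// gt_eqF.
Qed.

Definition bracket_int : R := rintRd (fun x : Rd => (bracket x)^-1).

Lemma bracket_int_ge0 : 0 <= bracket_int.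
Proof. by apply: Rintegral_ge0 => t _; rewrite invr_ge0 bracket_ge0. Qed.

Lemma vint_decay B g : decay 1 B g -> vint g.
Proof.
move=> [gm gb]; apply: (@cintegrable_le _ _ _ _ _ (fun t => B / bracket (rowof t)) gm).
  by move=> t; have := gb (rowof t); rewrite expr1.
apply: rintegrableZ; exact: vint_bracketV.
Qed.

Lemma normc_cintegralRd_le B g : decay 1 B g -> normc (cintegralRd g) <= 2 * (B * bracket_int).
Proof.
move=> [gm gb].
rewrite (le_trans (@normc_cintegral_le _ _ _ _ _ (fun t => B / bracket (rowof t)) gm _ _)).
- by [].
- by move=> t; have := gb (rowof t); rewrite expr1.
- apply: rintegrableZ; exact: vint_bracketV.
- by rewrite RintegralZl//; exact: vint_bracketV.
Qed.

Local Opaque cintegralRd.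

(** Both signs at once: s = -1 gives the Fourier transform, and s = 1 its
    inverse up to a constant. *)
Definition four s g (x : Rd) : R[i] := cintegralRd (fun z => ker (s * dotp z x) * g z).

Lemma fourierE g x : fourier g x = four (-1) g x.
Proof.
congr cintegralRd; apply/funext => z; congr (cexp _ * _).
by rewrite mulN1r rmorphN mulrN mulNr.
Qed.

Lemma fourD s f g x B B' : decay 1 B f -> decay 1 B' g ->
  four s (fun z => f z + g z) x = four s f x + four s g x.
Proof.
move=> fd gd; rewrite /four -cintegralRdD; last 2 first.
- exact/vint_decay/decay_ker/fd.
- exact/vint_decay/decay_ker/gd.
by congr cintegralRd; apply/funext => z; rewrite mulrDr.
Qed.

Lemma fourZ s c f x B : decay 1 B f -> four s (fun z => c * f z) x = c * four s f x.
Proof.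
move=> fd; rewrite /four -cintegralRdZ; last exact/vint_decay/decay_ker/fd.
by congr cintegralRd; apply/funext => z; rewrite mulrCA.
Qed.
End FourierIntegral.

(** * Derivatives of Fourier integrals *)

Section FourierSmooth.
Variables (R : realType) (n : nat).
Local Notation Rd := 'rV[R]_n.+1.
Implicit Types (f g : Rd -> R[i]) (s B M : R).
Local Opaque cintegralRd.

Lemma vint_sum (I : Type) (r : seq I) (F : I -> Rd -> R[i]) :
  (forall i, vint (F i)) -> vint (fun x => \sum_(i <- r) F i x) /\
  cintegralRd (fun x => \sum_(i <- r) F i x) = \sum_(i <- r) cintegralRd (F i).
Proof.
move=> Fi; elim: r => [|i r [IH1 IH2]].
  have E : (fun x => \sum_(i <- [::]) F i x) = (fun=> 0 : R[i]).
    by apply/funext => x; rewrite big_nil.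
  rewrite E big_nil cintegralRdE cintegral0; split => //; exact: cintegrable0.
have E : (fun x => \sum_(i <- i :: r) F i x) = (fun x => F i x + \sum_(i <- r) F i x).
  by apply/funext => x; rewrite big_cons.
rewrite E big_cons -IH2; split; first exact: vintD.
exact: cintegralRdD.
Qed.

Definition rapid g := forall k, exists B, decay k B g.

(** The factor i s z_j appears when d_j is taken under the integral sign. *)
Definition mulcoord s (j : 'I_n.+1) g : Rd -> R[i] := fun z => iu * ((s * z 0 j)%:C)%C * g z.

Lemma decay_mulcoord k s j B g : decay k.+1 B g -> decay k (`|s| * B) (mulcoord s j g).
Proof.
move=> H; have B0 := decay_ge0 H; have := decay_coord j H => -[gm gb]; split.
  have := @cmeasM _ _ _ (fun=> iu * (s%:C)%C) _ (cmeas_cst _ _) gm.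
  congr cmeas; apply/funext => t /=.
  by rewrite /mulcoord rmorphM -!mulrA.
move=> z; have -> : mulcoord s j g z = iu * (s%:C)%C * (((z 0 j)%:C)%C * g z).
  by rewrite /mulcoord rmorphM -!mulrA.
by rewrite normcM [normc (iu * _)]normcM normc_iu mul1r normc_real -mulrA ler_wpM2l.
Qed.

Lemma rapid_mulcoord s j g : rapid g -> rapid (mulcoord s j g).
Proof. by move=> H k; have [B /(decay_mulcoord s j)] := H k.+1; eexists; eassumption. Qed.

(** [cexp_taylor] under the integral sign; decay of order 3 makes the second
    moments of g finite. *)
Lemma four_taylor s B g x (h : Rd) : decay 3 B g ->
  normc (four s g (x + h) - four s g x - \sum_j four s (mulcoord s j g) x * ((h 0 j)%:C)%C)
    <= 4 * (s ^+ 2 * n.+1%:R ^+ 2 * B * bracket_int R n) * `|h| ^+ 2.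
Proof.
move=> H3; have B0 := decay_ge0 H3; have H1 : decay 1 B g by exact: decay_le H3.
have i1 := vint_decay (decay_ker s (x + h) H1).
have i2 := vint_decay (decay_ker s x H1).
have Hj j := decay_ker s x (decay_le (isT : (1 <= 2)%N) (decay_mulcoord s j H3)).
have ij j := vintZ ((h 0 j)%:C)%C (vint_decay (Hj j)).
have [i3 e3] := vint_sum (index_enum _) ij.
have -> : \sum_j four s (mulcoord s j g) x * ((h 0 j)%:C)%C =
    \sum_j cintegralRd (fun z => ((h 0 j)%:C)%C * (ker (s * dotp z x) * mulcoord s j g z)).
  by apply: eq_bigr => j _; rewrite (cintegralRdZ _ (vint_decay (Hj j))) mulrC.
rewrite -e3 -[- four s g x]mulN1r -[X in _ - X]mul1r -mulNr.
rewrite -(cintegralRdZ (-1) i2) -(cintegralRdZ (-1) i3).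
rewrite -(cintegralRdD i1 (vintZ _ i2)).
rewrite -(cintegralRdD (vintD i1 (vintZ _ i2)) (vintZ (-1) i3)).
set D := fun z => _.
suff HD : decay 1 (2 * (s ^+ 2 * n.+1%:R ^+ 2 * B * `|h| ^+ 2)) D.
  rewrite (le_trans (normc_cintegralRd_le HD))// le_eqVlt; apply/orP; left; apply/eqP; ring.
have DE z : D z = ker (s * dotp z x) *
    (ker (s * dotp z h) - 1 - iu * ((s * dotp z h)%:C)%C) * g z.
  rewrite /D dotpDr mulrDr kerD.
  have -> : \sum_i ((h 0 i)%:C)%C * (ker (s * dotp z x) * mulcoord s i g z) =
    ker (s * dotp z x) * g z * (iu * ((s * dotp z h)%:C)%C).
    rewrite /dotp rmorphM rmorph_sum /= !mulr_sumr; apply: eq_bigr => j _.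
    by rewrite /mulcoord !rmorphM /=; ring.
  by ring.
split.
  have := cmeasD (cmeasD (cintegrable_meas i1) (cmeasM (cmeas_cst _ (-1)) (cintegrable_meas i2)))
    (cmeasM (cmeas_cst _ (-1)) (cintegrable_meas i3)).
  exact.
move=> z; rewrite DE !normcM normc_ker mul1r.
have b0 := bracket_gt0 z.
rewrite (le_trans (ler_wpM2r (normc_ge0 _) (cexp_taylor _)))//.
case: H3 => _ /(_ z) gz.
rewrite (le_trans (ler_wpM2l _ gz))//; first by rewrite mulr_ge0 ?sqr_ge0.
rewrite expr1 exprMn -(real_normK (num_real (dotp z h))).
have E : B / bracket z ^+ 3 = B / bracket z / bracket z ^+ 2.
  by rewrite -mulrA -invfM -exprS.
rewrite E.
have F : `|dotp z h| ^+ 2 <= n.+1%:R ^+ 2 * `|h| ^+ 2 * bracket z ^+ 2.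
  have b0' := ltW b0; rewrite -!exprMn lerXn2r ?nnegrE ?normr_ge0//.
    by rewrite !mulr_ge0.
  by rewrite -mulrA; exact: dotp_le.
rewrite (_ : 2 * (s ^+ 2 * n.+1%:R ^+ 2 * B * `|h| ^+ 2) / bracket z =
   2 * (s ^+ 2 * (n.+1%:R ^+ 2 * `|h| ^+ 2)) * (B / bracket z)); last by ring.
rewrite [leLHS](_ : _ = 2 * s ^+ 2 * (B / bracket z) * (`|dotp z h| ^+ 2 / bracket z ^+ 2)); last first.
  by ring.
rewrite [leRHS](_ : _ = 2 * s ^+ 2 * (B / bracket z) * (n.+1%:R ^+ 2 * `|h| ^+ 2)); last by ring.
apply: ler_wpM2l.
  by rewrite mulr_ge0 ?divr_ge0 ?(mulr_ge0 _ (sqr_ge0 s)) ?bracket_ge0.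
by rewrite ler_pdivrMr ?exprn_gt0.
Qed.

Lemma four_partial s B g : decay 3 B g -> forall x,
  [/\ differentiable (fun y => cRe (four s g y)) x,
      differentiable (fun y => cIm (four s g y)) x &
      forall j, partial (four s g) j x = four s (mulcoord s j g) x].
Proof. by move=> H x; apply: (quad_partial (four_taylor s x ^~ H)). Qed.

Lemma four_foldl_partial s g js : rapid g ->
  foldl (@partial R n) (four s g) js = four s (foldl (fun f j => mulcoord s j f) g js).
Proof.
elim: js g => //= j js IH g gr; rewrite -IH; last exact: rapid_mulcoord.
congr foldl; apply/funext => x.
by have [B /four_partial H] := gr 3%N; have [_ _ ->] := H s x.
Qed.

Lemma four_smooth s g : rapid g -> smooth (four s g).
Proof.
move=> gr js x; rewrite four_foldl_partial//.
have gr' : rapid (foldl (fun f j => mulcoord s j f) g js).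
  by elim: js g gr => //= j js IH g gr; apply: IH; exact: rapid_mulcoord.
by have [B /four_partial H] := gr' 3%N; have [] := H s x.
Qed.
End FourierSmooth.

(** * Holomorphic functions of several variables *)

Section HolomorphicSeveral.
Variables (R : realType) (n : nat).
Local Notation Rd := 'rV[R]_n.+1.
Local Notation Cd := 'rV[R[i]]_n.+1.
Implicit Types (F G : Cd -> R[i]) (z u : Cd).

Lemma gcont_cst (c : R[i]) z : gcont (fun _ => c) z.
Proof. by move=> e e0; exists 1 => // z' _; rewrite subrr normc0. Qed.

Lemma gcont_coord j z : gcont (fun z => z 0 j) z.
Proof. by move=> e e0; exists e => // z'; exact. Qed.

Lemma gcontD F G z : gcont F z -> gcont G z -> gcont (fun z => F z + G z) z.
Proof.
move=> Fc Gc e e0; have e20 : 0 < e / 2 by rewrite divr_gt0.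
have [r1 r10 h1] := Fc _ e20; have [r2 r20 h2] := Gc _ e20.
exists (Num.min r1 r2); first by rewrite lt_min r10.
move=> z' zz'; rewrite opprD addrACA (le_lt_trans (normcD _ _))// [ltRHS](splitr e).
by rewrite ltrD ?h1 ?h2// => j; have := zz' j; rewrite lt_min => /andP[].
Qed.

Lemma gcont_comp (phi : R[i] -> R[i]) G z : cdiff phi (G z) -> gcont G z ->
  gcont (fun z => phi (G z)) z.
Proof.
move=> /cdiff_cont pc Gc e e0; have [r r0 h] := pc e e0.
by have [r' r'0 h'] := Gc r r0; exists r' => // z' /h' /h.
Qed.

Lemma gcontZ c G z : gcont G z -> gcont (fun z => c * G z) z.
Proof.
apply: (@gcont_comp (fun w => c * w)); apply: cdiffM; [exact: cdiff_cst|exact: cdiff_id].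
Qed.

(** Polarization: a product is a combination of squares, and squaring is
    complex differentiable. *)
Lemma gcontM F G z : gcont F z -> gcont G z -> gcont (fun z => F z * G z) z.
Proof.
move=> Fc Gc.
have sq H : gcont H z -> gcont (fun z => H z ^+ 2) z.
  by apply: (@gcont_comp (fun w => w ^+ 2)); apply: cdiffX; exact: cdiff_id.
have -> : (fun z => F z * G z) =
    (fun z => 2^-1 * ((F z + G z) ^+ 2 + ((-1) * F z ^+ 2 + (-1) * G z ^+ 2))).
  apply/funext => x; have n2 : (2 : R[i]) != 0 by rewrite pnatr_eq0.
  by field.
by apply/gcontZ/gcontD; [exact/sq/gcontD|apply: gcontD; exact/gcontZ/sq].
Qed.

(** Holomorphy in a form tailored to complex lines: continuity, together with
    a derivative in every complex direction. *)
Definition hol G z := gcont G z /\ forall u, cdiff (fun w => G (z + w *: u)) 0.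

Lemma hol_line G z u w0 : hol G (z + w0 *: u) -> cdiff (fun w => G (z + w *: u)) w0.
Proof.
move=> [_ /(_ u) d].
have -> : (fun w => G (z + w *: u)) = (fun w => G (z + w0 *: u + (w - w0) *: u)).
  by apply/funext => w; rewrite scalerBl addrA addrAC addrK.
apply: (@cdiff_comp _ (fun w => G (z + w0 *: u + w *: u)) (fun w => w - w0)).
  by rewrite subrr.
by apply: cdiffD; [exact: cdiff_id|exact: cdiff_cst].
Qed.

Lemma hol_cst c z : hol (fun _ => c) z.
Proof. by split; [exact: gcont_cst|move=> u; exact: cdiff_cst]. Qed.

Lemma hol_coord j z : hol (fun z => z 0 j) z.
Proof.
split; first exact: gcont_coord.
move=> u; have -> : (fun w => (z + w *: u) 0 j) = (fun w => z 0 j + w * u 0 j).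
  by apply/funext => w; rewrite !mxE.
apply: cdiffD; first exact: cdiff_cst.
by apply: cdiffM; [exact: cdiff_id|exact: cdiff_cst].
Qed.

Lemma holD F G z : hol F z -> hol G z -> hol (fun z => F z + G z) z.
Proof. by move=> [F1 F2] [G1 G2]; split; [exact: gcontD|move=> u; exact: cdiffD]. Qed.
Lemma holM F G z : hol F z -> hol G z -> hol (fun z => F z * G z) z.
Proof. by move=> [F1 F2] [G1 G2]; split; [exact: gcontM|move=> u; exact: cdiffM]. Qed.
Lemma hol_comp (phi : R[i] -> R[i]) G z : cdiff phi (G z) -> hol G z -> hol (fun z => phi (G z)) z.
Proof.
move=> pd [G1 G2]; split; first exact: gcont_comp.
by move=> u; apply: (cdiff_comp (f := phi)) => //; rewrite scale0r addr0.
Qed.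
Lemma holV G z : G z != 0 -> hol G z -> hol (fun z => (G z)^-1) z.
Proof. by move=> Gz; apply: (@hol_comp (fun w => w^-1)); exact: cdiff_inv. Qed.
Lemma hol_cexp G z : hol G z -> hol (fun z => cexp (G z)) z.
Proof. by apply: (@hol_comp (@cexp R)); apply: cdiff_cexp; exact: cdiff_id. Qed.
Lemma holX G z k : hol G z -> hol (fun z => G z ^+ k) z.
Proof. by apply: (@hol_comp (fun w => w ^+ k)); apply: cdiffX; exact: cdiff_id. Qed.
Lemma holN G z : hol G z -> hol (fun z => - G z) z.
Proof. by apply: (@hol_comp (fun w => - w)); apply: cdiffN; exact: cdiff_id. Qed.
Lemma holB F G z : hol F z -> hol G z -> hol (fun z => F z - G z) z.
Proof. by move=> hF hG; apply: holD => //; exact: holN. Qed.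

Lemma hol_sum (I : Type) (r : seq I) (F : I -> Cd -> R[i]) z :
  (forall i, hol (F i) z) -> hol (fun z => \sum_(i <- r) F i z) z.
Proof.
move=> Fh; elim: r => [|i r IH].
  rewrite (_ : (fun z => _) = fun=> 0); first exact: hol_cst.
  by apply/funext => y; rewrite big_nil.
rewrite (_ : (fun z => _) = fun z => F i z + \sum_(j <- r) F j z); first exact: holD.
by apply/funext => y; rewrite big_cons.
Qed.

Lemma hol_prod (I : Type) (r : seq I) (F : I -> Cd -> R[i]) z :
  (forall i, hol (F i) z) -> hol (fun z => \prod_(i <- r) F i z) z.
Proof.
move=> Fh; elim: r => [|i r IH].
  rewrite (_ : (fun z => _) = fun=> 1); first exact: hol_cst.
  by apply/funext => y; rewrite big_nil.
rewrite (_ : (fun z => _) = fun z => F i z * \prod_(j <- r) F j z); first exact: holM.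
by apply/funext => y; rewrite big_cons.
Qed.

Lemma cpt_coord (x y : Rd) j : cpt x y 0 j = Complex (x 0 j) (y 0 j).
Proof. by rewrite mxE. Qed.

Lemma vcont_hol G (y : Rd) : (forall x, hol G (cpt x y)) -> vcont (fun x => G (cpt x y)).
Proof.
move=> Gh x e e0; have [Gc _] := Gh x; have [r r0 h] := Gc e e0.
exists r => // x' xx'; apply: h => j; rewrite !cpt_coord complexBh normc_real.
exact: xx'.
Qed.

Lemma contour_shift_hol G (y : Rd) (j : 'I_n.+1) (b r M : R) : `|b| <= r ->
  (forall x v, `|v| <= r -> hol G (cpt x (y + v *: basis R j))) ->
  (forall x v, `|v| <= r ->
     normc (G (cpt x (y + v *: basis R j))) <= M / bracket x) ->
  cintegralRd (fun x => G (cpt x y)) =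
  cintegralRd (fun x => G (cpt x (y + b *: basis R j))).
Proof.
move=> br Gh GM; apply: (contour_shift br _ _ GM) => [x v vr|x v vr].
  by have [] := Gh x v vr.
apply: hol_line; rewrite cpt_line scale0r addr0; exact: Gh.
Qed.
End HolomorphicSeveral.

(** * The Gaussian *)

Section Gaussian.
Variables (R : realType) (n : nat).
Local Notation Rd := 'rV[R]_n.+1.
Local Notation Cd := 'rV[R[i]]_n.+1.
Local Notation T := (measurableTypeR R).
Local Notation lt k := (lebesgue_tuple R k).

Definition gauss (x : Rd) : R := expR (- (dotp x x / 2)).
Definition gaussC (x : Rd) : R[i] := ((gauss x)%:C)%C.
(** The entire extension of the Gaussian. *)
Definition hgauss (z : Cd) : R[i] := cexp (- (2^-1 * \sum_j z 0 j ^+ 2)).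

Lemma dotp_ge0 (x : Rd) : 0 <= dotp x x.
Proof. by apply: sumr_ge0 => j _; rewrite -expr2 sqr_ge0. Qed.

Lemma gauss_gt0 x : 0 < gauss x. Proof. exact: expR_gt0. Qed.
Lemma gauss_le1 x : gauss x <= 1.
Proof. by rewrite -expR0 ler_expR oppr_le0 divr_ge0// dotp_ge0. Qed.
Lemma gauss_near1 i x : 0 <= i -> i <= 1 -> 1 - gauss (i *: x) <= i * dotp x x.
Proof.
move=> i0 i1; rewrite /gauss dotpZl dotpZr.
have := dotp_ge0 x; set q := dotp x x => q0.
have := expR_ge1Dx (- (i * (i * q) / 2)); set E := expR _ => h.
have iq : 0 <= i * q by rewrite mulr_ge0.
have : i * (i * q) <= i * q by rewrite ler_piMl.
by move: E (i * q) (i * (i * q)) h iq => E u v; clear; lra.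
Qed.
Lemma gauss_decay x : gauss x <= 2 ^+ n.+1 / bracket x.
Proof.
rewrite ler_pdivlMr ?bracket_gt0// /gauss expRN ler_pdivrMl ?expR_gt0//.
rewrite /dotp mulr_suml expR_sum /bracket -[X in 2 ^+ X](card_ord n.+1) -prodr_const.
rewrite -big_split /=; apply: ler_prod => j _; rewrite addr_ge0 ?sqr_ge0//=.
have := expR_ge1Dx (x 0 j * x 0 j / 2); have := sqr_ge0 (x 0 j); rewrite expr2.
by set u := expR _; set v := x 0 j * x 0 j; move: u v => u v; clear; lra.
Qed.

Lemma cexp_realE (a : R) : cexp (a%:C)%C = ((expR a)%:C)%C :> R[i].
Proof. by apply: cplx_eq; rewrite /cexp /= ?cos0 ?sin0 ?mulr1 ?mulr0. Qed.

Lemma hgaussE x y : hgauss (cpt x y) =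
  ((expR (dotp y y / 2))%:C)%C * (ker (- 1 * dotp x y) * gaussC x).
Proof.
rewrite /hgauss /gaussC /gauss -!cexp_realE /ker -!cexpD; congr cexp.
have -> : \sum_j cpt x y 0 j ^+ 2 =
    ((dotp x x - dotp y y)%:C)%C + iu * ((2 * dotp x y)%:C)%C.
  rewrite /dotp mulr_sumr -sumrB !rmorph_sum mulr_sumr -big_split /=.
  apply: eq_bigr => j _; rewrite cpt_coord.
  by apply: cplx_eq; rewrite expr2 !ReImE /=; ring.
have n2 : (2^-1 : R[i]) = ((2^-1)%:C)%C by rewrite fmorphV rmorph_nat.
by rewrite n2; apply: cplx_eq; rewrite !ReImE /=; field.
Qed.

Lemma hol_hgauss z : hol hgauss z.
Proof.
apply/hol_cexp/holN/holM; first exact: hol_cst.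
by apply: hol_sum => j; apply: holX; exact: hol_coord.
Qed.

Lemma normc_hgauss x y : normc (hgauss (cpt x y)) = expR (dotp y y / 2) * gauss x.
Proof. by rewrite hgaussE !normcM normc_ker mul1r !normc_real !gtr0_norm ?expR_gt0. Qed.

Lemma enormsq_le (x : Rd) (M : R) : (forall j, `|x 0 j| <= M) -> dotp x x <= n.+1%:R * M ^+ 2.
Proof.
move=> H; have -> : n.+1%:R * M ^+ 2 = \sum_(j < n.+1) M ^+ 2.
  by rewrite sumr_const card_ord mulr_natl.
apply: ler_sum => j _; rewrite -expr2 -(real_normK (num_real _)) lerXn2r ?nnegrE//.
exact: le_trans (H j).
Qed.

Lemma hgauss_shift (y : Rd) (j : 'I_n.+1) (b : R) :
  cintegralRd (fun x => hgauss (cpt x y)) =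
  cintegralRd (fun x => hgauss (cpt x (y + b *: basis R j))).
Proof.
pose Y := n.+1%:R * (`|y| + `|b|) ^+ 2.
apply: (@contour_shift_hol _ _ hgauss y j b `|b| (expR (Y / 2) * 2 ^+ n.+1)) => // x v vb.
  exact: hol_hgauss.
rewrite normc_hgauss -mulrA; apply: ler_pM (gauss_decay x); first exact: expR_ge0.
  exact/ltW/gauss_gt0.
rewrite ler_expR ler_wpM2r ?invr_ge0//; apply: enormsq_le => k.
rewrite !mxE (le_trans (ler_normD _ _))// lerD ?coord_le_norm// eqxx normrM.
rewrite (le_trans _ vb)// ler_piMr//.
by case: (k == j); rewrite /= ?normr1 ?normr0.
Qed.

(** The real slice is reached by shifting one coordinate after another. *)
Lemma hgauss_integral (y : Rd) :
  cintegralRd (fun x => hgauss (cpt x y)) = cintegralRd gaussC.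
Proof.
have -> : cintegralRd gaussC = cintegralRd (fun x => hgauss (cpt x 0)).
  congr cintegralRd; apply/funext => x.
  by rewrite hgaussE !dotp0r mulr0 ker0 mul0r expR0 !mul1r.
rewrite [y in LHS]row_sum_delta.
elim/big_rec : _ => [|j z _ IH]; first exact: erefl.
by rewrite addrC -IH; symmetry; exact: hgauss_shift.
Qed.

Lemma lebesgue_tuple_gt0 k : (0 < lt k setT)%E.
Proof.
elim: k => [|k IH]; first by rewrite /= diracT.
rewrite /= /lebesgue_step /pushforward preimage_setT -setXTT.
rewrite product_measure1E// mule_gt0//.
apply: (@lt_le_trans _ _ (@lebesgue_measure R `[0%R, 1%R])).
  by rewrite lebesgue_measure_itv /= lte_fin ltr01 oppr0 adde0.
by apply: le_measure; rewrite ?inE.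
Qed.

Lemma measurable_gauss : measurable_fun setT (fun t : n.+1.-tuple T => gauss (rowof t)).
Proof.
apply: measurableT_comp => //; apply: measurableT_comp => //.
apply: measurable_funM; last exact: measurable_cst.
apply: measurable_sum => j.
rewrite (_ : (fun _ => _) = (fun t : n.+1.-tuple T => tnth t j * tnth t j)).
  by apply: measurable_funM; exact: measurable_tnth.
by apply/funext => t; rewrite mxE.
Qed.

Lemma decay_gaussC : decay 1 (2 ^+ n.+1) gaussC.
Proof.
split; first by apply: cmeas_real; exact: measurable_gauss.
by move=> x; rewrite normc_real expr1 gtr0_norm ?gauss_gt0// gauss_decay.
Qed.

(** This is (2 pi)^(d/2); the value is left unspecified throughout. *)
Definition gauss_int : R := rintRd gauss.

Lemma rvint_gauss : rvint gauss.
Proof. by have [] := vint_decay decay_gaussC. Qed.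

Lemma gauss_int_gt0 : 0 < gauss_int.
Proof.
have gi := rvint_gauss.
rewrite /gauss_int lt_neqAle; apply/andP; split; last first.
  by apply: Rintegral_ge0 => t _; exact/ltW/gauss_gt0.
apply/eqP => E0.
have mg : measurable_fun setT (fun t : n.+1.-tuple T => (gauss (rowof t))%:E).
  by apply/measurable_EFinP; exact: measurable_gauss.
have I0 : (\int[lt n.+1]_t `|(gauss (rowof t))%:E| = 0)%E.
  transitivity (\int[lt n.+1]_t (gauss (rowof t))%:E)%E.
    by apply: eq_integral => t _; rewrite /= gtr0_norm ?gauss_gt0.
  rewrite -[LHS]fineK; last exact: integrable_fin_num.
  exact: (congr1 EFin (esym E0)).
have := proj1 (@ae_eq_integral_abs _ _ _ (lt n.+1) setT measurableT _ mg) I0.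
move=> [N [mN N0 sub]].
have NT : N = setT.
  apply/seteqP; split => // t _; apply: sub => /= /(_ I) [] /eqP.
  by rewrite gt_eqF ?gauss_gt0.
by have := lebesgue_tuple_gt0 n.+1; rewrite -NT N0 ltxx.
Qed.

Lemma gauss_cint : cintegralRd gaussC = (gauss_int%:C)%C.
Proof. exact: cintegral_real. Qed.

(** Completing the square turns the Fourier integral into the integral of the
    entire Gaussian over a shifted copy of R^d. *)
Lemma four_gauss (s : R) (y : Rd) : s ^+ 2 = 1 ->
  four s gaussC y = ((gauss_int * gauss y)%:C)%C.
Proof.
move=> s1; have d : decay 1 (2 ^+ n.+1) (fun x => ker (- 1 * dotp x (- s *: y)) * gaussC x).
  exact/decay_ker/decay_gaussC.
have := hgauss_integral (- s *: y); rewrite gauss_cint.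
under [X in cintegralRd X]eq_fun do rewrite hgaussE.
rewrite (cintegralRdZ _ (vint_decay d)) => E.
have -> : four s gaussC y = cintegralRd (fun x => ker (- 1 * dotp x (- s *: y)) * gaussC x).
  by congr cintegralRd; apply/funext => x; rewrite dotpZr mulNr mul1r mulNr opprK.
have -> : ((gauss_int * gauss y)%:C)%C = ((gauss_int)%:C)%C * ((gauss y)%:C)%C :> R[i].
  by rewrite rmorphM.
rewrite -E mulrC mulrA -[_%:C%C * _%:C%C]rmorphM /gauss dotpZl dotpZr -expRD.
rewrite [X in expR X](_ : _ = 0) ?expR0 ?mul1r//.
by rewrite mulrA mulrNN -expr2 s1 mul1r addNr.
Qed.
End Gaussian.

(** * Fourier inversion *)

Section Inversion.
Variables (R : realType) (n : nat).
Local Notation Rd := 'rV[R]_n.+1.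
Local Notation T := (measurableTypeR R).
Local Notation lt k := (lebesgue_tuple R k).
Implicit Types (f g : Rd -> R[i]) (s B A : R).

Lemma measurable_dotp2 :
  measurable_fun setT (fun p : n.+1.-tuple T * n.+1.-tuple T => dotp (rowof p.1) (rowof p.2)).
Proof.
apply: measurable_sum => j.
rewrite (_ : (fun _ => _) = fun p : n.+1.-tuple T * n.+1.-tuple T => tnth p.1 j * tnth p.2 j).
  apply: measurable_funM.
    exact: (measurableT_comp (@measurable_tnth _ T n.+1 j) measurable_fst).
  exact: (measurableT_comp (@measurable_tnth _ T n.+1 j) measurable_snd).
by apply/funext => t; rewrite !mxE.
Qed.

Lemma cmeas_ker_dotp2 s :
  cmeas (fun p : n.+1.-tuple T * n.+1.-tuple T => ker (s * dotp (rowof p.1) (rowof p.2))).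
Proof.
apply: cmeas_ker; apply: measurable_funM; [exact: measurable_cst|exact: measurable_dotp2].
Qed.

Lemma vmeas_fst f : vmeas f ->
  cmeas (fun p : n.+1.-tuple T * n.+1.-tuple T => f (rowof p.1)).
Proof. by move=> fm; apply: (cmeas_comp (@measurable_fst _ _ _ _) fm). Qed.
Lemma vmeas_snd f : vmeas f ->
  cmeas (fun p : n.+1.-tuple T * n.+1.-tuple T => f (rowof p.2)).
Proof. by move=> fm; apply: (cmeas_comp (@measurable_snd _ _ _ _) fm). Qed.

(** For integrable F and G the function |F(x)| |G(y)| is a majorant of product
    form. *)
Lemma fubini_Rd (F G : Rd -> R[i]) (k : Rd -> Rd -> R[i]) :
  vint F -> vint G ->
  cmeas (fun p : n.+1.-tuple T * n.+1.-tuple T => k (rowof p.1) (rowof p.2)) ->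
  (forall x y, normc (k x y) <= 1) ->
  vint (fun x => F x * cintegralRd (fun y => k x y * G y)) /\
  cintegralRd (fun x => F x * cintegralRd (fun y => k x y * G y)) =
  cintegralRd (fun y => G y * cintegralRd (fun x => k x y * F x)).
Proof.
move=> Fi Gi km k1.
have kmx x : cmeas (fun t : n.+1.-tuple T => k (rowof x) (rowof t)).
  exact: (cmeas_comp (measurable_pair1 x) km).
have kmy y : cmeas (fun t : n.+1.-tuple T => k (rowof t) (rowof y)).
  exact: (cmeas_comp (measurable_pair2 y) km).
pose f (p : n.+1.-tuple T * n.+1.-tuple T) :=
  F (rowof p.1) * (k (rowof p.1) (rowof p.2) * G (rowof p.2)).
have Fm := cintegrable_meas Fi; have Gm := cintegrable_meas Gi.
have fm : cmeas f.
  by apply: cmeasM; [exact: vmeas_fst|apply: cmeasM => //; exact: vmeas_snd].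
have fb x y : normc (f (x, y)) <= normc (F (rowof x)) * normc (G (rowof y)).
  by rewrite /f /= !normcM ler_wpM2l ?normc_ge0// ler_piMl ?normc_ge0.
have g1i := cintegrable_normc Fi; have g2i := cintegrable_normc Gi.
have g10 x : 0 <= normc (F (rowof x)) by exact: normc_ge0.
have g20 x : 0 <= normc (G (rowof x)) by exact: normc_ge0.
have E1 : (fun x => F (rowof x) * cintegralRd (fun y => k (rowof x) y * G y)) =
    (fun x => cintegral (lt n.+1) (fun y => f (x, y))).
  apply/funext => x; rewrite -cintegralRdZ//.
  apply: (@cintegrable_le _ _ _ _ _ (fun t => normc (G (rowof t)))) => //.
    by apply: cmeasM.
  by move=> t; rewrite normcM ler_piMl ?normc_ge0.
have E2 : (fun y => G (rowof y) * cintegralRd (fun x => k x (rowof y) * F x)) =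
    (fun y => cintegral (lt n.+1) (fun x => f (x, y))).
  apply/funext => y; rewrite -cintegralRdZ.
    by congr cintegral; apply/funext => x; rewrite /f /=; ring.
  apply: (@cintegrable_le _ _ _ _ _ (fun t => normc (F (rowof t)))) => //.
    by apply: cmeasM.
  by move=> t; rewrite normcM ler_piMl ?normc_ge0.
split.
  rewrite /vint E1; exact: (cintegrable_fubini g1i g2i g10 g20 fm fb).
rewrite !cintegralRdE E1 E2; exact: (dominated_fubini g1i g2i g10 g20 fm fb).
Qed.
End Inversion.

Lemma climit_unique (R : realType) (u : nat -> R[i]) (a b : R[i]) :
  (forall e : R, 0 < e -> exists N, forall m, (N <= m)%N -> normc (u m - a) < e) ->
  (forall e : R, 0 < e -> exists N, forall m, (N <= m)%N -> normc (u m - b) < e) ->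
  a = b.
Proof.
move=> ua ub; apply/eqP; rewrite -subr_eq0 -normc_eq0; apply/eqP/le_anti/andP.
split; last exact: normc_ge0.
apply/ler_addgt0Pl => e e0; rewrite addr0.
have e2 : 0 < e / 2 by rewrite divr_gt0.
have [N1 H1] := ua _ e2; have [N2 H2] := ub _ e2; pose m := maxn N1 N2.
have h1 := H1 m (leq_maxl _ _); have h2 := H2 m (leq_maxr _ _).
rewrite (_ : a - b = (a - u m) + (u m - b)); last by ring.
by rewrite (le_trans (normcD _ _))// [leRHS]splitr lerD ?(ltW h2)// normcBC ltW.
Qed.

Section Inversion2.
Variables (R : realType) (n : nat).
Local Notation Rd := 'rV[R]_n.+1.
Local Notation T := (measurableTypeR R).
Local Notation lt k := (lebesgue_tuple R k).
Implicit Types (f g : Rd -> R[i]) (s B A : R).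
Local Opaque cintegralRd gauss gaussC ker four dotp bracket.

Lemma eventually_small (K e : R) : 0 < e ->
  exists N, forall m, (N <= m)%N -> K * (m.+1%:R)^-1 < e.
Proof.
move=> e0.
exists (Num.bound (`|K / e|)) => m Nm; have m0 : 0 < m.+1%:R :> R by [].
rewrite ltr_pdivrMr// mulrC -ltr_pdivrMr// (le_lt_trans (ler_norm _))//.
rewrite (lt_le_trans (archi_boundP (normr_ge0 _)))// ler_nat.
exact: leq_trans Nm (leqnSn m).
Qed.

(** The inversion integral with a Gaussian factor, which makes it absolutely
    convergent in both variables. *)
Definition regularized s f x (delta : R) : R[i] :=
  cintegralRd (fun xi => ker (s * dotp xi x) * gaussC (delta *: xi) * four (- s) f xi).

(** By Fubini the Gaussian factor is Fourier transformed; the result is an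
    average of f near x at the scale delta. *)
Lemma regularizedE s f x (delta : R) B : s ^+ 2 = 1 -> 0 < delta -> decay 1 B f ->
  regularized s f x delta = ((gauss_int R n)%:C)%C *
    cintegralRd (fun u => f (delta *: u + x) * gaussC u).
Proof.
move=> s1 d0 fd; have dn : delta != 0 by rewrite gt_eqF.
have fi := vint_decay fd.
have s1' : (- s) ^+ 2 = 1 by rewrite sqrrN.
have Gi := vint_decay (decay_gaussC R n).
have Gi' : vint (fun xi : Rd => gaussC (delta *: xi)).
  by have [] := cintegralRd_affine 0 dn Gi; under eq_fun do rewrite addr0.
have Fi : vint (fun xi => ker (s * dotp xi x) * gaussC (delta *: xi)).
  apply: (@cintegrable_le _ _ _ _ _ (fun t => normc (gaussC (delta *: rowof t)))).
  - by apply: cmeasM; [exact: vmeas_ker|exact: cintegrable_meas Gi'].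
  - by move=> t; rewrite normcM normc_ker mul1r.
  - exact: cintegrable_normc Gi'.
have km : cmeas (fun p : n.+1.-tuple T * n.+1.-tuple T =>
    ker (- s * dotp (rowof p.2) (rowof p.1))).
  have := @cmeas_ker_dotp2 R n (- s); congr cmeas; apply/funext => p.
  by rewrite dotpC.
have k1 (xi y : Rd) : normc (ker (- s * dotp y xi)) <= 1 by rewrite normc_ker.
have [_ E] := fubini_Rd Fi fi km k1.
rewrite /regularized E.
pose Th u := f (delta *: u + x) * gaussC u.
have [f1 _] := cintegralRd_affine x dn fi.
have Thi : vint Th.
  apply: (@cintegrable_le _ _ _ _ _ (fun t => normc (f (delta *: rowof t + x)))).
  - apply: cmeasM; first exact: cintegrable_meas f1.
    exact: cintegrable_meas Gi.
  - move=> t; rewrite normcM; apply: ler_piMr; first exact: normc_ge0.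
    by rewrite normc_real gtr0_norm; [exact: gauss_le1|exact: gauss_gt0].
  - exact: cintegrable_normc f1.
have dVn : delta^-1 != 0 by rewrite invr_eq0.
have [Th1 Th2] := cintegralRd_affine (- (delta^-1 *: x)) dVn Thi.
have dN0 : (`|delta^-1| ^- n.+1) != 0 by rewrite invr_eq0 expf_neq0 ?normr_eq0.
have dN0C : ((`|delta^-1| ^- n.+1)%:C)%C != 0 :> R[i].
  by rewrite -normc_gt0 normc_real normr_gt0.
rewrite -[X in _ * X](mulKf dN0C) -Th2 mulrA -(cintegralRdZ _ Th1).
congr cintegralRd; apply/funext => y.
have aux : delta *: (delta^-1 *: y - delta^-1 *: x) + x = y.
  by rewrite scalerBr !scalerA (divff dn) !scale1r subrK.
have -> : Th (delta^-1 *: y - delta^-1 *: x) = f y * gaussC (delta^-1 *: y - delta^-1 *: x).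
  by rewrite /Th aux.
rewrite [RHS]mulrCA; congr (_ * _).
pose Phi z := ker (- s * dotp z (delta^-1 *: y - delta^-1 *: x)) * gaussC z.
have Phii : vint Phi by exact/vint_decay/decay_ker/decay_gaussC.
have [_ P2] := cintegralRd_affine 0 dn Phii.
have -> : cintegralRd (fun x0 => ker (- s * dotp y x0) * (ker (s * dotp x0 x) * gaussC (delta *: x0)))
   = cintegralRd (fun xi => Phi (delta *: xi + 0)).
  congr cintegralRd; apply/funext => xi; rewrite /Phi addr0 mulrA -kerD; congr (ker _ * _).
  rewrite dotpZl dotpDr dotpNr !dotpZr (dotpC y).
  by field.
rewrite P2 (_ : cintegralRd Phi = four (- s) (@gaussC R n) (delta^-1 *: y - delta^-1 *: x)); last exact: erefl.
rewrite (four_gauss _ s1').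
have -> : ((`|delta^-1| ^- n.+1)%:C)%C^-1 = ((`|delta| ^- n.+1)%:C)%C :> R[i].
  by rewrite -fmorphV invrK normfV exprVn.
by rewrite [((_ * gauss _)%:C)%C]rmorphM mulrCA mulrA.
Qed.

Lemma regularized_cvg s f x A : decay 1 A (four (- s) f) -> forall e : R, 0 < e ->
  exists N, forall m, (N <= m)%N ->
    normc (regularized s f x (m.+1%:R)^-1 - four s (four (- s) f) x) < e.
Proof.
move=> Fd; apply: (@cintegral_cvg _ _ _ _ (fun t => A / bracket (rowof t))).
- by apply: rintegrableZ; exact: vint_bracketV.
- move=> m.
  have dn : (m.+1%:R : R)^-1 != 0 by rewrite invr_eq0 pnatr_eq0.
  have Gi := vint_decay (decay_gaussC R n).
  have [Gi' _] := cintegralRd_affine 0 dn Gi.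
  apply: cmeasM; last by case: Fd.
  apply: cmeasM; first exact: vmeas_ker.
  have := cintegrable_meas Gi'; congr cmeas; apply/funext => t.
  by rewrite addr0.
- move=> t e e0; set xi := rowof t.
  have [N HN] := eventually_small (dotp xi xi * (normc (four (- s) f xi) + 1)) e0.
  exists N => m /HN Hm; rewrite -mulrBl -[X in _ - X]mulr1 -mulrBr !normcM normc_ker mul1r.
  have -> : gaussC (m.+1%:R^-1 *: xi) - 1 = ((gauss (m.+1%:R^-1 *: xi) - 1)%:C)%C.
    by rewrite rmorphB rmorph1.
  rewrite normc_real distrC ger0_norm ?subr_ge0 ?gauss_le1//.
  have : 1 - gauss (m.+1%:R^-1 *: xi) <= dotp xi xi * m.+1%:R^-1.
    have i1 : m.+1%:R^-1 <= 1 :> R by rewrite invf_le1 ?ler1n.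
    rewrite mulrC; apply: gauss_near1; first by rewrite invr_ge0.
    exact: i1.
  move=> h; apply: le_lt_trans Hm.
  rewrite mulrAC ler_pM//; last by rewrite lerDl.
  + by rewrite subr_ge0 gauss_le1.
  + exact: normc_ge0.
- move=> m t; rewrite !normcM normc_ker mul1r normc_real gtr0_norm ?gauss_gt0//.
  case: Fd => _ /(_ (rowof t)); rewrite expr1 => h; apply: le_trans h.
  by rewrite ler_piMl ?normc_ge0 ?gauss_le1.
Qed.

Lemma mollified_cvg f x B : vcont f -> decay 1 B f -> forall e : R, 0 < e ->
  exists N, forall m, (N <= m)%N ->
    normc (cintegralRd (fun u => f ((m.+1%:R)^-1 *: u + x) * gaussC u)
      - cintegralRd (fun u : Rd => f x * gaussC u)) < e.
Proof.
move=> fc fd; have B0 := decay_ge0 fd.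
have fB y : normc (f y) <= B.
  case: fd => _ /(_ y) h; rewrite (le_trans h)// expr1 ler_pdivrMr ?bracket_gt0//.
  by rewrite ler_peMr// bracket_ge1.
apply: (@cintegral_cvg _ _ _ _ (fun t => B * gauss (rowof t))).
- by apply: rintegrableZ; exact: rvint_gauss.
- move=> m; have dn : (m.+1%:R : R)^-1 != 0 by rewrite invr_eq0 pnatr_eq0.
  have [f1 _] := cintegralRd_affine x dn (vint_decay fd).
  apply: cmeasM; first exact: cintegrable_meas f1.
  by have [] := decay_gaussC R n.
- move=> t e e0; set u := rowof t.
  have [r r0 fr] := fc x e e0; have [N HN] := eventually_small `|u| r0.
  exists N => m /HN Hm; rewrite -mulrBl normcM.
  apply: le_lt_trans (fr (m.+1%:R^-1 *: u + x) _).
    rewrite ler_piMr ?normc_ge0// normc_real gtr0_norm ?gauss_gt0//.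
    exact: gauss_le1.
  move=> j; rewrite !mxE addrK (le_lt_trans _ Hm)// normrM ger0_norm ?invr_ge0//.
  rewrite mulrC ler_wpM2r ?invr_ge0//.
  by have := coord_le_norm u j; rewrite mxE.
- move=> m t; rewrite normcM normc_real gtr0_norm ?gauss_gt0//.
  by rewrite ler_wpM2r ?fB// ltW ?gauss_gt0.
Qed.

Lemma regularized_cvg_point s f x B : s ^+ 2 = 1 -> vcont f -> decay 1 B f ->
  forall e : R, 0 < e -> exists N, forall m, (N <= m)%N ->
    normc (regularized s f x (m.+1%:R)^-1 - ((gauss_int R n ^+ 2)%:C)%C * f x) < e.
Proof.
move=> s1 fc fd e e0; have c0 := gauss_int_gt0 R n.
have [N HN] := mollified_cvg x fc fd (divr_gt0 e0 c0).
exists N => m /HN; have d0 : 0 < (m.+1%:R : R)^-1 by rewrite invr_gt0.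
rewrite (regularizedE x s1 d0 fd).
rewrite (cintegralRdZ _ (vint_decay (decay_gaussC R n))) gauss_cint ltr_pdivlMr//.
apply: le_lt_trans; rewrite expr2 rmorphM -[X in normc _ * X](gtr0_norm c0) -normc_real mulrC -normcM.
by rewrite le_eqVlt; apply/orP; left; apply/eqP; congr normc; ring.
Qed.

(** The regularized inversion integral has two expressions for its limit as
    delta tends to 0: by dominated convergence in the frequency variable, and
    by concentration of the average at x. *)
Lemma fourier_inversion s f x A B : s ^+ 2 = 1 -> vcont f -> decay 1 B f ->
  decay 1 A (four (- s) f) ->
  four s (four (- s) f) x = ((gauss_int R n ^+ 2)%:C)%C * f x.
Proof.
move=> s1 fc fd Fd.
exact: climit_unique (regularized_cvg x Fd) (regularized_cvg_point x s1 fc fd).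
Qed.
End Inversion2.

(** * Admissible weights *)

Section DivergentIntegral.
Variable R : realType.
Local Notation mu := (@lebesgue_measure R).

Lemma measurable_tail (r : R) : measurable_fun setT (fun t : R => (r * t / (1 + t ^+ 2))%:E).
Proof.
apply/measurable_EFinP; apply: measurable_funM.
  by apply: measurable_funM; [exact: measurable_cst|exact: measurable_id].
by apply: continuous_measurable_fun; exact: continuous_oneDsqrV.
Qed.

(** Each dyadic block [2^k, 2^(k+1)[ contributes at least r / 8. *)
Lemma tail_integral_ge (r : R) k : 0 <= r ->
  ((k%:R * (r / 8))%:E <= \int[mu]_(t in `[0%R, (2 ^+ k)%R[) (r * t / (1 + t ^+ 2))%:E)%E.
Proof.
move=> r0; have F0 (t : R) : 0 <= t -> (0 <= (r * t / (1 + t ^+ 2))%:E)%E.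
  by move=> t0; rewrite lee_fin divr_ge0 ?mulr_ge0// addr_ge0 ?sqr_ge0.
elim: k => [|k IH].
  rewrite mul0r; apply: integral_ge0 => t /=; rewrite in_itv /= => /andP[t0 _].
  exact: F0.
have p0 : 0 < 2 ^+ k :> R by rewrite exprn_gt0.
have pS : 2 ^+ k <= 2 ^+ k.+1 :> R by rewrite exprS ler_peMl ?ler1n// ltW.
have -> : [set` `[(0:R), 2 ^+ k.+1[] = [set` `[(0:R), 2 ^+ k[] `|` [set` `[2 ^+ k, 2 ^+ k.+1[].
  apply/seteqP; split => t /=; rewrite !in_itv /=.
    by move=> /andP[t0 t1]; case: (ltP t (2 ^+ k)) => tk; [left|right]; apply/andP.
  case=> /andP[t1 t2]; apply/andP; split => //.
    exact: lt_le_trans t2 pS.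
  exact: le_trans (ltW p0) t1.
rewrite ge0_integral_setU//; last 3 first.
- exact: measurable_funTS (measurable_tail r).
- move=> t /=; rewrite !in_itv /= => -[] /andP[t1 _]; apply: F0 => //.
  exact: le_trans (ltW p0) t1.
- apply/disj_set2P; apply/seteqP; split => // t /= []; rewrite !in_itv /= => /andP[_ h1] /andP[h2 _].
  by move: (lt_le_trans h1 h2); rewrite ltxx.
rewrite -natr1 mulrDl mul1r EFinD leeD//.
apply: (@le_trans _ _ (\int[mu]_(t in `[(2 ^+ k)%R, (2 ^+ k.+1)%R[) (cst (r / 8 / 2 ^+ k)%:E t))%E).
  rewrite integral_cst//.
  rewrite [X in (_ * X)%E](@lebesgue_measure_itv R `[(2 ^+ k : R), 2 ^+ k.+1[) /= lte_fin exprS ltr_pMl// ltr1n.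
  rewrite -EFinB -EFinM lee_fin mulr2n mulrDl mul1r addrK mulfVK ?gt_eqF//.
apply: ge0_le_integral => //.
- by move=> t _; rewrite lee_fin !divr_ge0// ltW.
- exact: measurable_funTS (measurable_tail r).
- move=> t /=; rewrite in_itv /= => /andP[t1 t2]; rewrite lee_fin.
  have t0 : 0 < t by exact: lt_le_trans p0 t1.
  rewrite -[X in X <= _]mulrA -[X in _ <= X]mulrA ler_wpM2l// -invfM.
  have p1 : 1 <= 2 ^+ k :> R by rewrite exprn_ege1// ler1n.
  rewrite ler_pdivlMr ?addr_gt0 ?exprn_gt0// mulrC ler_pdivrMr ?mulr_gt0//.
  move: t2; rewrite exprS expr2; move: (2 ^+ k) p1 t1 => p p1 t1 t2.
  by clear -t1 t2 p1; nra.
Qed.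
End DivergentIntegral.

Section Weights.
Variables (R : realType) (n : nat).
Local Notation Rd := 'rV[R]_n.+1.
Local Notation mu := (@lebesgue_measure R).

(** The properties of a weight on which the proof rests. Subadditivity comes
    from concavity, and the growth o(||x||) from the convergence of the
    logarithmic integral. *)
Record tame_weight (w : Rd -> R) : Prop := TameWeight {
  w_ge0 : forall x, 0 <= w x;
  wN : forall x, w (- x) = w x;
  wD : forall x y, w (x + y) <= w x + w y;
  w_lin : forall r : R, 0 < r -> exists K : R, forall x, w x <= r * `|x| + K;
  w_log : forall N : nat, exists eta C : R, 0 < eta /\
    forall x, bracket x ^+ N <= C * expR (eta * w x)
}.

Lemma enorm_ge0 (x : Rd) : 0 <= enorm x. Proof. exact: sqrtr_ge0. Qed.
Lemma enorm_sqr (x : Rd) : enorm x ^+ 2 = dotp x x.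
Proof. by rewrite sqr_sqrtr// dotp_ge0. Qed.

Lemma coord_le_enorm (x : Rd) j : `|x 0 j| <= enorm x.
Proof.
rewrite -ler_sqr ?nnegrE ?enorm_ge0// enorm_sqr real_normK ?num_real//.
rewrite /dotp (bigD1 j)//= expr2 lerDl; apply: sumr_ge0 => k _.
by rewrite -expr2 sqr_ge0.
Qed.

Lemma enorm_le_norm (x : Rd) : enorm x <= n.+1%:R * `|x|.
Proof.
rewrite -ler_sqr ?nnegrE ?enorm_ge0 ?mulr_ge0// enorm_sqr exprMn.
rewrite (le_trans (enormsq_le (fun j => coord_le_norm x j)))// ler_wpM2r ?sqr_ge0//.
by rewrite expr2 ler_peMl// ler1n.
Qed.

Lemma enorm0_dotp (x y : Rd) : enorm x = 0 -> dotp x y = 0.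
Proof.
move=> x0; apply: big1 => j _; have := coord_le_enorm x j.
by rewrite x0 normr_le0 => /eqP ->; rewrite mul0r.
Qed.

Lemma dotp_cauchy (x y : Rd) : dotp x y <= enorm x * enorm y.
Proof.
have a0 := enorm_ge0 x; have b0 := enorm_ge0 y.
have h (s t : R) : 0 <= s ^+ 2 * enorm x ^+ 2 - 2 * (s * t * dotp x y) + t ^+ 2 * enorm y ^+ 2.
  have := dotp_ge0 (s *: x - t *: y).
  rewrite dotpDr !dotpDl !dotpNr !dotpNl !dotpZl !dotpZr (dotpC y x) !enorm_sqr => /le_trans; apply.
  by rewrite le_eqVlt; apply/orP; left; apply/eqP; ring.
have [a_eq0|a_neq0] := eqVneq (enorm x) 0; first by rewrite enorm0_dotp// a_eq0 mul0r.
have [b_eq0|b_neq0] := eqVneq (enorm y) 0; first by rewrite dotpC enorm0_dotp// b_eq0 mulr0.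
have := h (enorm y) (enorm x).
have : 0 < enorm x * enorm y by rewrite mulr_gt0// lt_neqAle eq_sym ?a_neq0 ?b_neq0 ?a0 ?b0.
move: (dotp x y) (enorm x) (enorm y) => u a b ab; rewrite !expr2 => hh.
have : 0 <= (a * b) * (a * b - u) by nra.
by rewrite pmulr_rge0// subr_ge0.
Qed.

Lemma enormD (x y : Rd) : enorm (x + y) <= enorm x + enorm y.
Proof.
rewrite -ler_sqr ?nnegrE ?addr_ge0 ?enorm_ge0// enorm_sqr sqrrD !enorm_sqr.
rewrite dotpDl !dotpDr (dotpC y x); have := dotp_cauchy x y.
by rewrite mulr2n; lra.
Qed.

Lemma bracket_enorm (x : Rd) : bracket x <= (1 + enorm x) ^+ (2 * n.+1).
Proof.
rewrite exprM -[X in _ ^+ X](card_ord n.+1) -prodr_const /bracket.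
apply: ler_prod => j _; rewrite addr_ge0 ?sqr_ge0//=.
have := coord_le_enorm x j; have := normr_ge0 (x 0 j); have := enorm_ge0 x.
by rewrite -(real_normK (num_real (x 0 j))) !expr2; nra.
Qed.

(** If sigma(t) >= r t held for all t, the integral of sigma(t) / (1 + t^2)
    would diverge; so sigma(A) <= r A for some A > 0, and concavity extends
    this to all t >= A. *)
Lemma admissible_tame w : @admissible_weight R n w -> tame_weight w.
Proof.
move=> [sigma [ws sinc scont sconc [s0 sint [c0 [m [m0 slog]]]]]].
have sge0 t : 0 <= t -> 0 <= sigma t.
  by move=> t0; rewrite -s0; apply: sinc => //; rewrite in_itv/= ?lexx ?t0.
have smono s t : 0 <= s -> s <= t -> sigma s <= sigma t.
  move=> s_ge0 st; apply: sinc => //; rewrite in_itv/= andbT//.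
  exact: le_trans s_ge0 st.
have sstar l t : 0 <= l <= 1 -> 0 <= t -> l * sigma t <= sigma (l * t).
  move=> l01 t0; have := sconc t 0 l t0 (lexx _) l01.
  by rewrite s0 !mulr0 !addr0.
have sadd s t : 0 <= s -> 0 <= t -> sigma (s + t) <= sigma s + sigma t.
  move=> s_ge0 t_ge0; have [st0|st0] := eqVneq (s + t) 0.
    rewrite st0 s0 addr_ge0 ?sge0//.
  have st : 0 < s + t by rewrite lt_neqAle eq_sym st0 addr_ge0.
  have l1 : 0 <= s / (s + t) <= 1.
    by rewrite divr_ge0 ?addr_ge0//= ler_pdivrMr// mul1r lerDl.
  have l2 : 0 <= t / (s + t) <= 1.
    by rewrite divr_ge0 ?addr_ge0//= ler_pdivrMr// mul1r lerDr.
  have h1 := sstar _ _ l1 (ltW st); have h2 := sstar _ _ l2 (ltW st).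
  rewrite !divfK// in h1 h2; apply: le_trans (lerD h1 h2).
  by rewrite -mulrDl -mulrDl divff// mul1r.
have slin r : 0 < r -> exists K, forall t, 0 <= t -> sigma t <= r * t + K.
  move=> r0; have [A [A0 hA]] : exists A, 0 < A /\ sigma A <= r * A.
    apply: contrapT => /forallNP H.
    have sr t : 0 <= t -> r * t <= sigma t.
      rewrite le_eqVlt => /orP[/eqP <-|t0]; first by rewrite mulr0 s0.
      by rewrite leNgt; apply/negP => /ltW h; apply: (H t).
    have ms : measurable_fun `[(0:R), +oo[ (fun t : R => (sigma t / (1 + t ^+ 2))%:E).
      apply/measurable_EFinP; apply: measurable_funM.
        exact: subspace_continuous_measurable_fun.
      apply: measurable_funTS; apply: continuous_measurable_fun.
      exact: continuous_oneDsqrV.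
    have F0 (t : R) : 0 <= t -> (0 <= (r * t / (1 + t ^+ 2))%:E)%E.
      by move=> t0; rewrite lee_fin divr_ge0 ?mulr_ge0 ?(ltW r0)// addr_ge0 ?sqr_ge0.
    have Ile : (\int[mu]_(t in `[0%R, +oo[) (r * t / (1 + t ^+ 2))%:E <=
        \int[mu]_(t in `[0%R, +oo[) (sigma t / (1 + t ^+ 2))%:E)%E.
      apply: ge0_le_integral => //.
      - by move=> t /=; rewrite in_itv/= andbT => /F0.
      - exact: measurable_funTS (measurable_tail r).
      - move=> t /=; rewrite in_itv/= andbT => t0; rewrite lee_fin ler_wpM2r ?sr//.
        by rewrite invr_ge0 addr_ge0 ?sqr_ge0.
    have I0 := le_lt_trans Ile sint.
    have Inn : (0 <= \int[mu]_(t in `[0%R, +oo[) (r * t / (1 + t ^+ 2))%:E)%E.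
      by apply: integral_ge0 => t /=; rewrite in_itv/= andbT => /F0.
    move: I0 Inn; set I := integral _ _ _ => I0 Inn.
    have If : I \is a fin_num by rewrite ge0_fin_numE.
    have bound k : k%:R * (r / 8) <= fine I.
      rewrite -lee_fin fineK// (le_trans (tail_integral_ge k (ltW r0)))//.
      apply: ge0_subset_integral => //.
      - exact: measurable_funTS (measurable_tail r).
      - by move=> t /=; rewrite in_itv/= andbT => /F0.
      - by move=> t /=; rewrite !in_itv/= andbT => /andP[].
    have r8 : 0 < r / 8 by rewrite divr_gt0.
    have fI : 0 <= fine I / (r / 8) by rewrite divr_ge0 ?fine_ge0 ?(ltW r8).
    have := bound (Num.bound (fine I / (r / 8))).
    by rewrite -ler_pdivlMr// leNgt archi_boundP.
  exists (r * A) => t t0; have rA : 0 <= r * A by rewrite mulr_ge0 ?ltW.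
  have [tA|At] := leP t A.
    by rewrite (le_trans (smono _ _ t0 tA))// (le_trans hA)// lerDr mulr_ge0 ?(ltW r0).
  have t0' : 0 < t := lt_trans A0 At.
  have l1 : 0 <= A / t <= 1.
    by rewrite divr_ge0 ?(ltW A0) ?(ltW t0')//= ler_pdivrMr// mul1r ltW.
  have := sstar _ _ l1 t0; rewrite divfK ?gt_eqF// => h.
  have : A / t * sigma t <= r * A := le_trans h hA.
  rewrite mulrAC ler_pdivrMr// mulrC -mulrA [A * t]mulrC mulrA => h'.
  have : sigma t <= r * t by rewrite -(ler_pM2r A0).
  by move=> /le_trans; apply; rewrite lerDl.
split.
- by move=> x; rewrite ws sge0 ?enorm_ge0.
- by move=> x; rewrite !ws /enorm dotpNl dotpNr opprK.
- move=> x y; rewrite !ws (le_trans (smono _ _ (enorm_ge0 _) (enormD x y)))//.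
  by rewrite sadd ?enorm_ge0.
- move=> r r0; have rn : 0 < r / n.+1%:R by rewrite divr_gt0.
  have [K HK] := slin _ rn; exists K => x; rewrite ws (le_trans (HK _ (enorm_ge0 x)))//.
  rewrite lerD2r mulrAC ler_pdivrMr// -mulrA ler_pM2l// mulrC.
  exact: enorm_le_norm.
- move=> N; pose eta := (2 * n.+1 * N).+1%:R / m.
  exists eta, (expR (- (eta * c0))).
  split; first by rewrite divr_gt0.
  move=> x; rewrite -expRD -mulrN -mulrDr ws.
  have e1 : 1 <= 1 + enorm x by rewrite lerDl enorm_ge0.
  have e0 : 0 < 1 + enorm x by exact: lt_le_trans e1.
  apply: (@le_trans _ _ ((1 + enorm x) ^+ (2 * n.+1 * N).+1)).
    apply: (@le_trans _ _ ((1 + enorm x) ^+ (2 * n.+1 * N))).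
      by rewrite exprM lerXn2r ?nnegrE ?bracket_ge0 ?exprn_ge0 ?(ltW e0)// bracket_enorm.
    by rewrite exprS ler_peMl// exprn_ge0// ltW.
  rewrite -[X in X ^+ _](lnK e0) -expRM_natl ler_expR /eta.
  rewrite -mulrA ler_wpM2l// mulrC ler_pdivlMr// mulrC.
  by have := slog _ (enorm_ge0 x); lra.
Qed.
End Weights.

(** * Decay of derivatives and membership in S_omega *)

Section Characterization.
Variables (R : realType) (n : nat) (w : 'rV[R]_n.+1 -> R).
Hypothesis wt : tame_weight w.
Local Notation Rd := 'rV[R]_n.+1.
Implicit Types (f g u : Rd -> R[i]) (eta A K s : R).
Local Opaque cintegralRd bracket.

Definition wbound eta A f := forall x, normc (f x) <= A * expR (- (eta * w x)).

Lemma wbound_ge0 eta A f : wbound eta A f -> 0 <= A.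
Proof.
move=> /(_ 0) /(le_trans (normc_ge0 _)).
by rewrite pmulr_lge0// expR_gt0.
Qed.

Lemma wbound_le eta eta' A A' f : eta <= eta' -> A' <= A -> wbound eta' A' f -> wbound eta A f.
Proof.
move=> le_eta le_A fb x; have A0 := wbound_ge0 fb.
rewrite (le_trans (fb x))// ler_pM ?expR_ge0// ler_expR lerN2 ler_wpM2r//.
exact: w_ge0.
Qed.

Lemma wbound_decay (N : nat) : exists eta C, [/\ 0 < eta, 0 <= C &
  forall f A eta', eta <= eta' -> vmeas f -> wbound eta' A f -> decay N (A * C) f].
Proof.
have [eta [C [e0 H]]] := w_log wt N; exists eta, C; split => //.
  have := le_trans (exprn_ge0 N (bracket_ge0 0)) (H 0).
  by rewrite pmulr_lge0// expR_gt0.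
move=> f A eta' ee fm fb; split => // x; have A0 := wbound_ge0 fb.
have fb' := wbound_le ee (lexx A) fb.
rewrite (le_trans (fb' x))// -mulrA ler_wpM2l// expRN ler_pdivlMr ?exprn_gt0 ?bracket_gt0//.
by rewrite ler_pdivrMl ?expR_gt0// mulrC.
Qed.

Lemma differentiable_vcont f :
  (forall x, differentiable (fun y => cRe (f y)) x /\ differentiable (fun y => cIm (f y)) x) ->
  vcont f.
Proof.
move=> fd x e e0; have [d1 d2] := fd x; have e2 : 0 < e / 2 by rewrite divr_gt0.
have /cvgrPdist_lt /(_ _ e2) /nbhs_ballP[r1 /= r10 h1] := differentiable_continuous d1.
have /cvgrPdist_lt /(_ _ e2) /nbhs_ballP[r2 /= r20 h2] := differentiable_continuous d2.
pose r := Num.min r1 r2; have r0 : 0 < r by rewrite lt_min r10.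
exists (r / 2); first by rewrite divr_gt0.
move=> y xy; have : `|y - x| < r.
  apply: (@le_lt_trans _ _ (r / 2)); last by rewrite ltr_pdivrMr// ltr_pMr// ltr1n.
  by apply: norm_le_coord => [|j]; [rewrite divr_ge0// ltW|rewrite !mxE ltW].
rewrite lt_min => /andP[y1 y2].
rewrite (le_lt_trans (normc_le_ReIm _))// !ReImE [ltRHS]splitr.
rewrite distrC in y1; rewrite distrC in y2.
rewrite -!(ball_normE) /= in h1 h2.
by rewrite ltrD// distrC; [apply: h1|apply: h2].
Qed.

Lemma rapid_foldl_mulcoord s g js : rapid g -> rapid (foldl (fun f j => mulcoord s j f) g js).
Proof. by elim: js g => //= j js IH g gr; apply: IH; exact: rapid_mulcoord. Qed.

Lemma decay_foldl_mulcoord s B g js k : decay (k + size js) B g ->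
  decay k (`|s| ^+ size js * B) (foldl (fun f j => mulcoord s j f) g js).
Proof.
elim: js k B g => [|j js IH] k B g /=; first by rewrite addn0 mul1r.
rewrite addnS => /(decay_mulcoord s j) /IH.
by rewrite exprSr -mulrA.
Qed.

Lemma taylor_const_ge0 s B : 0 <= B ->
  0 <= 4 * (s ^+ 2 * n.+1%:R ^+ 2 * B * bracket_int R n).
Proof.
move=> B0; apply: mulr_ge0 => //; apply: mulr_ge0; last exact: bracket_int_ge0.
by apply: mulr_ge0 => //; apply: mulr_ge0; exact: sqr_ge0.
Qed.

(** A Taylor expansion with step t: the derivative of a Fourier integral is
    small where the integral itself is small. *)
Lemma partial_interpolation s B g x j t : decay 3 B g -> 0 < t ->
  normc (partial (four s g) j x) <=
  (normc (four s g (x + t *: basis R j)) + normc (four s g x)) / t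
    + 4 * (s ^+ 2 * n.+1%:R ^+ 2 * B * bracket_int R n) * t.
Proof.
move=> gd t0; have [_ _ ->] := four_partial s gd x.
have := four_taylor s x (t *: basis R j) gd.
set M := 4 * _; set l := four s (mulcoord s j g) x.
rewrite (bigD1 j)//= big1 ?addr0; last first.
  by move=> k kj; rewrite !mxE eqxx (negbTE kj) mulr0 (_ : (0%:C)%C = 0) ?mulr0.
rewrite !mxE !eqxx mulr1 => h.
have M0 : 0 <= M.
  exact: taylor_const_ge0 (decay_ge0 gd).
have nb : `|t *: basis R j| <= t.
  apply: norm_le_coord => [|k]; first exact: ltW.
  rewrite !mxE eqxx normrM gtr0_norm// ler_piMr ?(ltW t0)//.
  by case: (k == j); rewrite /= ?normr1 ?normr0.
have h2 : normc (l * (t%:C)%C) <= normc (four s g (x + t *: basis R j)) + normc (four s g x) + M * t ^+ 2.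
  set a := four s g (x + t *: basis R j) in h *; set b := four s g x in h *.
  rewrite (_ : l * _ = a - b - (a - b - l * (t%:C)%C)); last by ring.
  rewrite (le_trans (normcB _ _))// lerD ?normcB//.
  by rewrite (le_trans h)// ler_wpM2l// lerXn2r ?nnegrE// ltW.
rewrite normcM normc_real gtr0_norm// in h2.
rewrite -(ler_pM2r t0) (le_trans h2)// mulrDl divfK ?gt_eqF// lerD2l.
by rewrite expr2 mulrA.
Qed.

(** Interpolation at the point x with the step t = exp(- eta w x): each
    derivative costs a factor 2 in the exponent. *)
Lemma wbound_partial s js eta : 0 < eta -> exists eta' K, [/\ 0 < eta', 0 <= K &
  forall g A, rapid g -> wbound eta' A g -> wbound eta' A (four s g) ->
    wbound eta (K * A) (foldl (@partial R n) (four s g) js)].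
Proof.
elim/last_ind: js eta => [|js j IH] eta e0.
  by exists eta, 1; split => // g A _ _ h; rewrite mul1r.
have [eta1 [K [e10 K0 H1]]] := IH (2 * eta) (mulr_gt0 (ltr0n _ 2) e0).
have [eta2 [C [e20 C0 H2]]] := wbound_decay (3 + size js).
have [K1 HK1] := w_lin wt ltr01; pose S := 1 + K1.
pose M := 4 * (s ^+ 2 * n.+1%:R ^+ 2 * (`|s| ^+ size js * C) * bracket_int R n).
have M0 : 0 <= M by apply: taylor_const_ge0; rewrite mulr_ge0// exprn_ge0.
exists (Num.max eta1 eta2), (K * (expR (2 * eta * S) + 1) + M); split.
- by rewrite lt_max e10.
- by apply: addr_ge0 => //; apply: mulr_ge0 => //; rewrite addr_ge0 ?expR_ge0.
move=> g A gr gb fb x; have A0 := wbound_ge0 gb.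
have le1 : eta1 <= Num.max eta1 eta2 by rewrite le_max lexx.
have le2 : eta2 <= Num.max eta1 eta2 by rewrite le_max lexx orbT.
have ub := H1 g A gr (wbound_le le1 (lexx A) gb) (wbound_le le1 (lexx A) fb).
have gm : vmeas g by have [B []] := gr 0%N.
have gd := decay_foldl_mulcoord s (H2 g A _ le2 gm gb).
rewrite foldl_rcons (four_foldl_partial s js gr); rewrite (four_foldl_partial s js gr) in ub.
set G := foldl _ g js in gd ub *.
pose E := expR (- (eta * w x)); have E0 : 0 < E := expR_gt0 _.
have E1 : E <= 1 by rewrite -expR0 ler_expR oppr_le0 mulr_ge0 ?(w_ge0 wt)// ltW.
have EE : expR (- (2 * eta * w x)) = E * E by rewrite -expRD; congr expR; ring.
(* The step is at most 1, so w changes by at most a constant. *)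
have xt : w x - S <= w (x + E *: basis R j).
  rewrite lerBlDr -{1}(addrK (E *: basis R j) x) (le_trans (wD wt _ _))// lerD2l wN//.
  rewrite (le_trans (HK1 _))// mul1r lerD2r; apply: norm_le_coord => // k.
  rewrite !mxE eqxx normrM gtr0_norm// -[leRHS]mulr1 ler_pM// ?(ltW E0)//.
  by case: (k == j); rewrite /= ?normr1 ?normr0.
have u1 : normc (four s G x) <= K * A * (E * E) by rewrite -EE.
have u2 : normc (four s G (x + E *: basis R j)) <= K * A * expR (2 * eta * S) * (E * E).
  rewrite (le_trans (ub _))// -[leRHS]mulrA ler_wpM2l ?mulr_ge0// -EE -expRD ler_expR.
  have := ler_wpM2l (ltW (mulr_gt0 (ltr0n R 2) e0)) xt; rewrite mulrBr.
  by move: (2 * eta * w x) (2 * eta * S) (2 * eta * w _) => a b c; clear; lra.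
rewrite (le_trans (partial_interpolation s x j gd E0))//.
have -> : 4 * (s ^+ 2 * n.+1%:R ^+ 2 * (`|s| ^+ size js * (A * C)) * bracket_int R n) * E = M * A * E.
  by rewrite /M; ring.
rewrite -/E; apply: (@le_trans _ _ ((K * A * expR (2 * eta * S) * (E * E) + K * A * (E * E)) / E + M * A * E)).
  by rewrite lerD2r ler_wpM2r ?invr_ge0 ?(ltW E0)// lerD.
rewrite le_eqVlt; apply/orP; left; apply/eqP.
have En : E != 0 by rewrite gt_eqF.
by field.
Qed.

(** The list is reversed because [Dmulti] is a right fold. *)
Definition multi_seq (a : multinom n.+1) : seq 'I_n.+1 :=
  flatten [seq nseq (fun_of_multinom a j) j | j <- rev (enum 'I_n.+1)].

Lemma Dmulti_foldl a f : Dmulti a f = foldl (@partial R n) f (multi_seq a).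
Proof.
rewrite /Dmulti /multi_seq; elim: (enum _) => [|j r IH] //=.
rewrite rev_cons map_rcons flatten_rcons foldl_cat -IH.
by elim: (fun_of_multinom a j) (foldr _ _ _) => [//|k IHk h]; rewrite iterSr IHk.
Qed.

Lemma Dmulti0 f : Dmulti (@mnm0 n.+1) f = f.
Proof. by rewrite Dmulti_foldl /multi_seq; elim: (rev _) => //= j r IH; rewrite mnm0E. Qed.

Lemma p_norm_le a eta A f : wbound eta A (Dmulti a f) -> (p_norm w a eta f <= A%:E)%E.
Proof.
move=> H; apply: ub_ereal_sup => _ [x _ <-]; rewrite lee_fin mulrC.
by have := H x; rewrite expRN ler_pdivlMr ?expR_gt0.
Qed.

Lemma p_norm_ge a eta f x :
  ((expR (eta * w x) * normc (Dmulti a f x))%:E <= p_norm w a eta f)%E.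
Proof. by apply: ereal_sup_ubound; exists x. Qed.

Lemma wbound_p_norm a eta A f : (p_norm w a eta f <= A%:E)%E -> wbound eta A (Dmulti a f).
Proof.
move=> H x; rewrite expRN ler_pdivlMr ?expR_gt0// -lee_fin mulrC.
exact: le_trans (p_norm_ge a eta f x) H.
Qed.

(** Membership in S_omega without derivatives: the decay of f and of its
    Fourier transform controls them, by interpolation. *)
Definition tempered f := vcont f /\ forall eta, 0 < eta ->
  exists A, wbound eta A f /\ wbound eta A (fourier f).

Lemma wbound_rapid f : vmeas f -> (forall eta, 0 < eta -> exists A, wbound eta A f) -> rapid f.
Proof.
move=> fm fb k; have [eta [C [e0 C0 H]]] := wbound_decay k.
have [A fA] := fb eta e0; exists (A * C); exact: H (lexx eta) fm fA.
Qed.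

Lemma fourier_four f : fourier f = four (-1) f.
Proof. by apply/funext => x; rewrite fourierE. Qed.

Lemma rapid_four_vcont s g : rapid g -> vcont (four s g).
Proof. by move=> gr; apply: differentiable_vcont => x; exact: (four_smooth s gr [::] x). Qed.

Lemma tempered_rapid f : tempered f -> rapid f /\ rapid (fourier f).
Proof.
move=> [fc fb]; have fr : rapid f.
  apply: wbound_rapid; first exact: vcont_vmeas.
  by move=> eta /fb[A [fA _]]; exists A.
split => //; apply: wbound_rapid.
  by rewrite fourier_four; apply/vcont_vmeas/rapid_four_vcont.
by move=> eta /fb[A [_ fA]]; exists A.
Qed.

Definition inv_const : R[i] := (((gauss_int R n ^+ 2)^-1)%:C)%C.

Lemma inv_constK (z : R[i]) : inv_const * (((gauss_int R n ^+ 2)%:C)%C * z) = z.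
Proof.
rewrite mulrA -rmorphM mulVf ?mul1r// expf_neq0// gt_eqF//; exact: gauss_int_gt0.
Qed.

Lemma fourier_inv f x : vcont f -> rapid f -> rapid (fourier f) ->
  f x = inv_const * four 1 (fourier f) x.
Proof.
move=> fc fr gr; have [B fB] := fr 1%N; have [A gA] := gr 1%N.
rewrite fourier_four in gA *.
by rewrite (fourier_inversion x (expr1n _ 2) fc fB gA) inv_constK.
Qed.

Lemma inv_fourier g x : vcont g -> rapid g -> rapid (four 1 g) ->
  g x = inv_const * four (-1) (four 1 g) x.
Proof.
move=> fc fr gr; have [B fB] := fr 1%N; have [A gA] := gr 1%N.
have s1 : (-1 : R) ^+ 2 = 1 by rewrite sqrrN expr1n.
have := @fourier_inversion R n (-1) g x A B s1 fc fB; rewrite opprK => /(_ gA) ->.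
by rewrite inv_constK.
Qed.

Lemma wboundZ c eta A f : wbound eta A f -> wbound eta (normc c * A) (fun x => c * f x).
Proof. by move=> fA x; rewrite normcM -mulrA ler_wpM2l ?normc_ge0. Qed.

Lemma rapidZ c f : rapid f -> rapid (fun x => c * f x).
Proof.
move=> fr k; have [B fB] := fr k; exists (normc c * B).
by apply: (decayM _ _ fB); [exact: cmeas_cst|move=> x; exact: lexx].
Qed.

Lemma fourier_invE f : vcont f -> rapid f -> rapid (fourier f) ->
  f = four 1 (fun x => inv_const * fourier f x).
Proof.
move=> fc fr gr; apply/funext => x; have [A gA] := gr 1%N.
by rewrite (fourZ _ _ _ gA) -fourier_inv.
Qed.

(** f and its Fourier transform are Fourier integrals of each other, so
    [wbound_partial] applies to both. *)
Lemma tempered_bounds a eta : 0 < eta -> exists eta' K, [/\ 0 < eta', 0 <= K &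
  forall f A, tempered f -> wbound eta' A f -> wbound eta' A (fourier f) ->
    wbound eta (K * A) (Dmulti a f) /\ wbound eta (K * A) (Dmulti a (fourier f))].
Proof.
move=> e0; have [e1 [K1 [e10 K10 H1]]] := wbound_partial 1 (multi_seq a) e0.
have [e2 [K2 [e20 K20 H2]]] := wbound_partial (-1) (multi_seq a) e0.
pose k := normc inv_const + 1; have k0 : 0 <= k by rewrite addr_ge0 ?normc_ge0.
exists (Num.max e1 e2), (Num.max (K1 * k) K2); split.
- by rewrite lt_max e10.
- by rewrite le_max K20 orbT.
move=> f A ft fA gA; have A0 := wbound_ge0 fA.
have le1 : e1 <= Num.max e1 e2 by rewrite le_max lexx.
have le2 : e2 <= Num.max e1 e2 by rewrite le_max lexx orbT.
have [fr gr] := tempered_rapid ft; have [fc _] := ft.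
rewrite !Dmulti_foldl; split; last first.
  have h := wbound_le le2 (lexx A) gA; rewrite fourier_four in h *.
  apply: wbound_le (lexx _) _ (H2 f A fr (wbound_le le2 (lexx A) fA) h).
  by rewrite ler_wpM2r// le_max lexx orbT.
have fE := fourier_invE fc fr gr.
rewrite {1}fE; apply: wbound_le (lexx _) _ (H1 _ (k * A) _ _ _).
- by rewrite mulrA ler_wpM2r// le_max lexx.
- exact: rapidZ.
- apply: (wbound_le le1 _ (wboundZ inv_const gA)).
  by rewrite ler_wpM2r// lerDl.
- rewrite -fE; apply: (wbound_le le1 _ fA).
  by rewrite ler_peMl// lerDr normc_ge0.
Qed.

Lemma tempered_test f : tempered f -> is_test w f.
Proof.
move=> ft; have [fr gr] := tempered_rapid ft; have [fc fb] := ft; split.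
  by rewrite (fourier_invE fc fr gr); apply: four_smooth; exact: rapidZ.
move=> a eta e0; have [eta' [K [e0' K0 H]]] := tempered_bounds a e0.
have [A [fA gA]] := fb eta' e0'; have [h1 h2] := H f A ft fA gA.
by split; apply: le_lt_trans (ltry (K * A)); exact: p_norm_le.
Qed.

Lemma p_norm_fin a eta f : (p_norm w a eta f < +oo)%E -> exists A, wbound eta A (Dmulti a f).
Proof.
move=> H; exists (fine (p_norm w a eta f)); apply: wbound_p_norm.
rewrite fineK// ge0_fin_numE//; apply: le_trans (p_norm_ge a eta f 0).
by rewrite lee_fin mulr_ge0 ?expR_ge0 ?normc_ge0.
Qed.

Lemma test_tempered f : is_test w f -> tempered f.
Proof.
move=> [fs fb]; split; first by apply: differentiable_vcont => x; exact: (fs [::] x).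
move=> eta e0; have [/p_norm_fin[A fA] /p_norm_fin[B fB]] := fb (@mnm0 n.+1) eta e0.
rewrite Dmulti0 in fA; rewrite Dmulti0 in fB.
exists (Num.max A B); split.
  by apply: wbound_le fA => //; rewrite le_max lexx.
by apply: wbound_le fB => //; rewrite le_max lexx orbT.
Qed.
End Characterization.

(** * Symbols *)

Section Symbols.
Variables (R : realType) (n : nat).
Local Notation Rd := 'rV[R]_n.+1.
Local Notation Cd := 'rV[R[i]]_n.+1.
Implicit Types (f g : Rd -> R[i]) (h : Cd -> R[i]) (p : mpoly n.+1 R).
Local Opaque cintegralRd.

(** Symbols of Fourier multipliers: holomorphic near the real space, with
    polynomial growth there. *)
Definition symbol h := exists (r : R) (N : nat) (C : R), 0 < r /\
  forall x y : Rd, `|y| <= r -> hol h (cpt x y) /\ normc (h (cpt x y)) <= C * bracket x ^+ N.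

Lemma evaliE p (z : Cd) :
  evali p z = \sum_(a <- msupp p) ((mcoeff a p)%:C)%C * \prod_j (iu * z 0 j) ^+ fun_of_multinom a j.
Proof.
rewrite /evali mevalE.
have inj : injective (real_complex R) by move=> a b [].
rewrite (perm_big _ (msupp_map_mpoly p inj)) /=.
by apply: eq_bigr => a _; rewrite mcoeff_map_mpoly.
Qed.

Lemma hol_evali p z : hol (evali p) z.
Proof.
rewrite (_ : evali p = fun z => \sum_(a <- msupp p)
   ((mcoeff a p)%:C)%C * \prod_j (iu * z 0 j) ^+ fun_of_multinom a j).
  apply: hol_sum => a; apply: holM; first exact: hol_cst.
  apply: hol_prod => j; apply: holX; apply: holM; [exact: hol_cst|exact: hol_coord].
by apply/funext => y; rewrite evaliE.
Qed.

Lemma normc_cpt_coord (x y : Rd) j : `|y| <= 1 -> normc (cpt x y 0 j) <= 2 * bracket x.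
Proof.
move=> y1; rewrite cpt_coord (le_trans (normc_le_ReIm _))//= mulr2n mulrDl mul1r.
rewrite lerD ?coord_le_bracket// (le_trans (coord_le_norm y j))// (le_trans y1)//.
exact: bracket_ge1.
Qed.

Lemma symbol_evali p : symbol (evali p).
Proof.
suff [N [C H]] : exists (N : nat) (C : R), forall x y : Rd, `|y| <= 1 ->
    normc (evali p (cpt x y)) <= C * bracket x ^+ N.
  by exists 1, N, C; split => // x y y1; split; [exact: hol_evali|exact: H].
pose D := \max_(a <- msupp p) mdeg a.
exists D, (\sum_(a <- msupp p) `|mcoeff a p| * 2 ^+ mdeg a) => x y y1.
rewrite evaliE (le_trans (normc_sum _ _ _))// mulr_suml.
rewrite big_seq [leRHS]big_seq; apply: ler_sum => a ain.
rewrite normcM normc_real -mulrA ler_wpM2l// normc_prod.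
apply: (@le_trans _ _ (\prod_j (2 * bracket x) ^+ fun_of_multinom a j)).
  apply: ler_prod => j _; rewrite normc_ge0 normcX normcM normc_iu mul1r.
  rewrite lerXn2r ?nnegrE ?normc_ge0 ?mulr_ge0 ?bracket_ge0//.
  exact: normc_cpt_coord.
rewrite prodrXr -mdegE exprMn ler_wpM2l ?exprn_ge0//.
have aD : (mdeg a <= D)%N by rewrite /D (big_rem a)//= leq_max leqnn.
by rewrite -(subnK aD) exprD ler_peMl ?exprn_ge0 ?bracket_ge0// exprn_ege1// bracket_ge1.
Qed.

Definition hrefl h (xi : Rd) : R[i] := h (cpt (- xi) 0).

Lemma bracketN (x : Rd) : bracket (- x) = bracket x.
Proof.
by rewrite /bracket; apply: eq_bigr => j _; rewrite mxE sqrrN.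
Qed.

Lemma symbol_hrefl h : symbol h -> vcont (hrefl h) /\
  exists (N : nat) (C : R), forall xi, normc (hrefl h xi) <= C * bracket xi ^+ N.
Proof.
move=> [r [N [C [r0 H]]]]; have r0' : `|0 : Rd| <= r by rewrite normr0 ltW.
split; last first.
  by exists N, C => xi; have [_] := H (- xi) 0 r0'; rewrite bracketN.
have hc : vcont (fun x => h (cpt x 0)).
  by apply: vcont_hol => x; have [] := H x 0 r0'.
move=> x e e0; have [d d0 hd] := hc (- x) e e0; exists d => // y yx.
by apply: hd => j; rewrite !mxE -opprD normrN.
Qed.

Lemma vcont_comp (phi : R[i] -> R[i]) f : (forall z, cdiff phi z) -> vcont f ->
  vcont (fun x => phi (f x)).
Proof.
move=> pd fc x e e0; have [r r0 h] := cdiff_cont (pd (f x)) e0.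
by have [r' r'0 h'] := fc x r r0; exists r' => // y /h' /h.
Qed.

Lemma vcontD f g : vcont f -> vcont g -> vcont (fun x => f x + g x).
Proof.
move=> Fc Gc z e e0; have e20 : 0 < e / 2 by rewrite divr_gt0.
have [r1 r10 h1] := Fc z _ e20; have [r2 r20 h2] := Gc z _ e20.
exists (Num.min r1 r2); first by rewrite lt_min r10.
move=> z' zz'; rewrite opprD addrACA (le_lt_trans (normcD _ _))// [ltRHS](splitr e).
by rewrite ltrD ?h1 ?h2// => j; have := zz' j; rewrite lt_min => /andP[].
Qed.

Lemma vcontZ c f : vcont f -> vcont (fun x => c * f x).
Proof.
apply: (@vcont_comp (fun w => c * w)) => z.
by apply: cdiffM; [exact: cdiff_cst|exact: cdiff_id].
Qed.

(** Polarization, as for [gcontM]. *)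
Lemma vcontM f g : vcont f -> vcont g -> vcont (fun x => f x * g x).
Proof.
move=> Fc Gc.
have sq (k : Rd -> R[i]) : vcont k -> vcont (fun z => k z ^+ 2).
  by apply: (@vcont_comp (fun w => w ^+ 2)) => z; apply: cdiffX; exact: cdiff_id.
have -> : (fun z => f z * g z) =
    (fun z => 2^-1 * ((f z + g z) ^+ 2 + ((-1) * f z ^+ 2 + (-1) * g z ^+ 2))).
  apply/funext => x; have n2 : (2 : R[i]) != 0 by rewrite pnatr_eq0.
  by field.
by apply/vcontZ/vcontD; [exact/sq/vcontD|apply: vcontD; exact/vcontZ/sq].
Qed.

(** Paley-Wiener: shifting the contour in the j-th variable by r or - r gains
    the factor exp(- r |u_j|), for each j separately. *)
Lemma kernel_decay (G0 : Cd -> R[i]) (r C : R) : 0 < r ->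
  (forall x y : Rd, `|y| <= r -> hol G0 (cpt x y) /\ normc (G0 (cpt x y)) <= C / bracket x) ->
  forall u, normc (four 1 (hrefl G0) u) <= 2 * (C * bracket_int R n) * expR (- (r * `|u|)).
Proof.
move=> r0 H u.
pose G (z : Cd) := cexp (- (iu * \sum_j z 0 j * ((u 0 j)%:C)%C)) * G0 z.
have GE x y : G (cpt x y) = ((expR (dotp y u))%:C)%C * (ker (-1 * dotp x u) * G0 (cpt x y)).
  rewrite /G mulrA -cexp_realE /ker -cexpD; congr (cexp _ * _).
  rewrite /dotp !rmorph_sum /= mulr_sumr -sumrN mulN1r -sumrN rmorph_sum mulr_sumr -big_split /=.
  apply: eq_bigr => j _; rewrite cpt_coord.
  by apply: cplx_eq; rewrite !ReImE /=; ring.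
have bj (b : R) j : `|b| <= r -> `|b *: basis R j : Rd| <= r.
  move=> br; apply: norm_le_coord => [|k]; first exact: ltW.
  rewrite !mxE eqxx normrM (le_trans _ br)// ler_piMr//.
  by case: (k == j); rewrite /= ?normr1 ?normr0.
have dj b j : dotp (b *: basis R j) u = b * u 0 j.
  rewrite dotpZl; congr (_ * _); rewrite /dotp (bigD1 j)//= big1 ?addr0.
    by rewrite mxE !eqxx mul1r.
  by move=> k kj; rewrite mxE eqxx (negbTE kj) mul0r.
have dec b j : `|b| <= r -> decay 1 (expR (b * u 0 j) * C) (fun x => G (cpt x (b *: basis R j))).
  move=> /(bj _ j) br; split.
    apply: vcont_vmeas; apply: vcont_hol => x; apply: holM; last by have [] := H x _ br.
    apply: hol_cexp; apply: holN; apply: holM; first exact: hol_cst.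
    by apply: hol_sum => k; apply: holM; [exact: hol_coord|exact: hol_cst].
  move=> x; rewrite GE !normcM normc_ker mul1r normc_real gtr0_norm ?expR_gt0//.
  by rewrite dj expr1 -mulrA ler_wpM2l ?expR_ge0//; have [] := H x _ br.
have C0 : 0 <= C.
  have r0' : `|0 : Rd| <= r by rewrite normr0 ltW.
  have [_ /(le_trans (normc_ge0 _))] := H 0 0 r0'.
  by rewrite pmulr_lge0// invr_gt0 bracket_gt0.
suff step j : normc (four 1 (hrefl G0) u) <= 2 * (C * bracket_int R n) * expR (- (r * `|u 0 j|)).
  have [u0|u0] := eqVneq (`|u|) 0.
    apply: le_trans (step ord0) _; rewrite ler_wpM2l ?mulr_ge0 ?bracket_int_ge0//.
    by rewrite ler_expR lerN2 ler_wpM2l ?(ltW r0)// u0 normr_ge0.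
  have [[i j] /= E] := mx_norm_neq0 u0.
  by have -> : `|u| = `|u 0 j| by rewrite [LHS]E ord1.
have -> : four 1 (hrefl G0) u = cintegralRd (fun x => G (cpt x 0)).
  have := dec 0 j; rewrite normr0 => /(_ (ltW r0)); rewrite scale0r => /vint_decay vi.
  have [_ <-] := cintegralRd_opp vi.
  congr cintegralRd; apply/funext => x.
  by rewrite GE [dotp 0 u]dotpC dotp0r expR0 mul1r dotpNl mulN1r opprK mul1r.
pose b := if 0 <= u 0 j then - r else r.
have nb : `|b| <= r by rewrite /b; case: ifP => _; rewrite ?normrN gtr0_norm.
have bu : b * u 0 j = - (r * `|u 0 j|).
  rewrite /b; case: (leP 0 (u 0 j)) => uj; first by rewrite mulNr ger0_norm.
  by rewrite ltr0_norm// mulrN opprK.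
have E := @contour_shift_hol R n G 0 j b r (expR (r * `|u 0 j|) * C) nb.
rewrite add0r in E; rewrite E.
- apply: le_trans (normc_cintegralRd_le (dec b j nb)) _.
  by rewrite bu le_eqVlt; apply/orP; left; apply/eqP; ring.
- move=> x v vr; rewrite add0r; apply: holM; last by have [] := H x _ (bj v j vr).
  apply: hol_cexp; apply: holN; apply: holM; first exact: hol_cst.
  by apply: hol_sum => k; apply: holM; [exact: hol_coord|exact: hol_cst].
- move=> x v vr; rewrite add0r GE !normcM normc_ker mul1r normc_real gtr0_norm ?expR_gt0//.
  rewrite -mulrA; apply: ler_pM (proj2 (H x _ (bj v j vr))); [exact: expR_ge0|exact: normc_ge0|].
  rewrite ler_expR dj (le_trans (ler_norm _))// normrM ler_wpM2r//.
Qed.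
End Symbols.

(** * Fourier multipliers *)

Section Multipliers.
Variables (R : realType) (n : nat) (w : 'rV[R]_n.+1 -> R).
Hypothesis wt : tame_weight w.
Local Notation Rd := 'rV[R]_n.+1.
Local Notation Cd := 'rV[R[i]]_n.+1.
Local Notation T := (measurableTypeR R).
Implicit Types (f g : Rd -> R[i]) (h : Cd -> R[i]) (p : mpoly n.+1 R).
Local Opaque cintegralRd bracket.
Local Notation ic := (inv_const R n).

(** The reflected symbol h(- xi) is used so that p(D)^* has the symbol p(i.). *)
Definition Tmul h f : Rd -> R[i] := four 1 (fun xi => ic * (hrefl h xi * fourier f xi)).

(** Continuity for the weighted norms of f and of its Fourier transform, which
    define the topology of S_omega by [tempered_bounds]. *)
Definition dominated (T : (Rd -> R[i]) -> (Rd -> R[i])) := forall eta : R, 0 < eta ->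
  exists eta' K : R, [/\ 0 < eta', 0 <= K & forall f A, tempered w f ->
    wbound w eta' A f -> wbound w eta' A (fourier f) -> wbound w eta (K * A) (T f)].

Lemma dominated_symbol h : symbol h -> dominated (fun f xi => hrefl h xi * fourier f xi).
Proof.
move=> /symbol_hrefl[_ [N [C HC]]] eta e0.
have [eN [C' [eN0 HN]]] := w_log wt N.
have C0 : 0 <= C.
  have := le_trans (normc_ge0 _) (HC 0).
  by rewrite pmulr_lge0// exprn_gt0// bracket_gt0.
have C'0 : 0 <= C'.
  have := le_trans (exprn_ge0 N (bracket_ge0 0)) (HN 0).
  by rewrite pmulr_lge0// expR_gt0.
exists (eta + eN), (C * C'); split; [exact: addr_gt0|exact: mulr_ge0|].
move=> f A _ _ fA x; have A0 := wbound_ge0 fA.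
rewrite normcM; apply: le_trans (ler_pM (normc_ge0 _) (normc_ge0 _) (HC x) (fA x)) _.
apply: (@le_trans _ _ (C * (C' * expR (eN * w x)) * (A * expR (- ((eta + eN) * w x))))).
  by rewrite ler_wpM2r ?mulr_ge0 ?expR_ge0// ler_wpM2l.
rewrite le_eqVlt; apply/orP; left; apply/eqP.
rewrite mulrDl opprD expRD [expR (- (eN * w x))]expRN.
have E0 : expR (eN * w x) != 0 by rewrite gt_eqF ?expR_gt0.
by field.
Qed.

Lemma dominated_rapid (T : (Rd -> R[i]) -> (Rd -> R[i])) f : dominated T -> tempered w f ->
  vmeas (T f) -> rapid (T f).
Proof.
move=> HT ft fm; apply: (wbound_rapid wt fm) => eta /HT[eta' [K [e0 K0 H]]].
by have [_ /(_ _ e0)[A [h1 h2]]] := ft; exists (K * A); exact: H ft h1 h2.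
Qed.

Lemma symbol_rapid h f : symbol h -> tempered w f ->
  vcont (fun xi => hrefl h xi * fourier f xi) /\ rapid (fun xi => hrefl h xi * fourier f xi).
Proof.
move=> hs ft; have [fr gr] := tempered_rapid wt ft.
have gc : vcont (fun xi => hrefl h xi * fourier f xi).
  apply: vcontM; first by have [] := symbol_hrefl hs.
  by rewrite fourier_four; exact: rapid_four_vcont.
split => //; apply: (dominated_rapid (dominated_symbol hs) ft).
exact: vcont_vmeas.
Qed.

Lemma ic_neq0 : ic != 0.
Proof.
rewrite -normc_gt0 normc_real normr_gt0 invr_eq0 expf_neq0// gt_eqF//.
exact: gauss_int_gt0.
Qed.

(** Fourier inversion of the integrand of Tmul; it requires the decay of Tmul
    h f itself. *)
Lemma fourier_Tmul h f : symbol h -> tempered w f -> rapid (Tmul h f) ->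
  fourier (Tmul h f) = fun xi => hrefl h xi * fourier f xi.
Proof.
move=> hs ft Tr; have [gc gr] := symbol_rapid hs ft.
apply/funext => x; have E := inv_fourier x (vcontZ ic gc) (rapidZ ic gr) Tr.
rewrite [fourier _]fourier_four; exact: esym (mulfI ic_neq0 E).
Qed.

Lemma foldl_mulcoordE s g js z :
  foldl (fun f j => mulcoord s j f) g js z = (\prod_(j <- js) (iu * ((s * z 0 j)%:C)%C)) * g z.
Proof.
elim: js g => [|j js IH] g /=; first by rewrite big_nil mul1r.
by rewrite IH big_cons /mulcoord; ring.
Qed.

Lemma prod_multi_seq (F : 'I_n.+1 -> R[i]) (a : multinom n.+1) :
  \prod_(j <- multi_seq a) F j = \prod_j F j ^+ fun_of_multinom a j.
Proof.
rewrite /multi_seq big_flatten big_map (perm_big _ (permEl (perm_rev _))) /= big_enum /=.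
by apply: eq_bigr => j _; rewrite big_nseq -Monoid.iteropE.
Qed.

Lemma four_sum (I : Type) (r : seq I) (c : I -> R[i]) (G : I -> Rd -> R[i]) s x :
  (forall i, rapid (G i)) ->
  four s (fun z => \sum_(i <- r) c i * G i z) x = \sum_(i <- r) c i * four s (G i) x.
Proof.
move=> Gr; have vi i : vint (fun z => ker (s * dotp z x) * G i z).
  by have [B] := Gr i 1%N; move=> /(decay_ker s x); exact: vint_decay.
have [_ E] := vint_sum r (fun i => vintZ (c i) (vi i)).
rewrite /four (_ : (fun z => _ * \sum_(i <- r) _) =
    (fun z => \sum_(i <- r) c i * (ker (s * dotp z x) * G i z))).
  by rewrite E; apply: eq_bigr => i _; rewrite (cintegralRdZ _ (vi i)).
by apply/funext => z; rewrite mulr_sumr; apply: eq_bigr => i _; ring.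
Qed.

(** Differentiating the inversion formula under the integral sign brings down
    the factors i xi_j, and the sign in p(-D) is the reflection of the symbol. *)
Lemma adjD_Tmul p f : tempered w f -> adjD p f = Tmul (evali p) f.
Proof.
move=> ft; have [fr gr] := tempered_rapid wt ft; have [fc _] := ft.
apply/funext => x; rewrite /adjD /Tmul.
pose G a := foldl (fun f j => mulcoord 1 j f) (fun z => ic * fourier f z) (multi_seq a).
have Gr a : rapid (G a) by apply: rapid_foldl_mulcoord; exact: rapidZ.
transitivity (\sum_(a <- msupp p) ((-1) ^+ mdeg a * mcoeff a p)%:C%C * four 1 (G a) x).
  apply: eq_bigr => a _; rewrite Dmulti_foldl {1}(fourier_invE fc fr gr) four_foldl_partial//.
  exact: rapidZ.
rewrite -(four_sum _ _ _ _ Gr); congr four; apply/funext => xi.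
rewrite /hrefl evaliE mulrCA mulr_suml; apply: eq_bigr => a _.
rewrite /G foldl_mulcoordE prod_multi_seq mulrA; congr (_ * _).
rewrite rmorphM mulrAC mulrC; congr (_ * _).
rewrite mdegE rmorphXn rmorphN rmorph1 -prodrXr -big_split /=; apply: eq_bigr => j _.
rewrite -exprMn mul1r; congr (_ ^+ _).
by apply: cplx_eq; rewrite !mxE !ReImE /=; ring.
Qed.

Lemma dominatedD (T1 T2 : (Rd -> R[i]) -> (Rd -> R[i])) : dominated T1 -> dominated T2 ->
  dominated (fun f x => T1 f x + T2 f x).
Proof.
move=> D1 D2 eta e0; have [e1 [K1 [e10 K10 H1]]] := D1 eta e0.
have [e2 [K2 [e20 K20 H2]]] := D2 eta e0.
exists (Num.max e1 e2), (K1 + K2); split; [by rewrite lt_max e10|exact: addr_ge0|].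
move=> f A ft fA gA x.
have le1 : e1 <= Num.max e1 e2 by rewrite le_max lexx.
have le2 : e2 <= Num.max e1 e2 by rewrite le_max lexx orbT.
have h1 := H1 f A ft (wbound_le wt le1 (lexx A) fA) (wbound_le wt le1 (lexx A) gA) x.
have h2 := H2 f A ft (wbound_le wt le2 (lexx A) fA) (wbound_le wt le2 (lexx A) gA) x.
by rewrite (le_trans (normcD _ _))// !mulrDl lerD.
Qed.

Lemma dominatedZ c (T : (Rd -> R[i]) -> (Rd -> R[i])) : dominated T ->
  dominated (fun f x => c * T f x).
Proof.
move=> D1 eta e0; have [e1 [K1 [e10 K10 H1]]] := D1 eta e0.
exists e1, (normc c * K1); split => //; first by rewrite mulr_ge0 ?normc_ge0.
by move=> f A ft fA gA; rewrite -mulrA; apply: wboundZ; exact: H1.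
Qed.

Lemma dominated_adjD p : dominated (adjD p).
Proof.
rewrite /adjD; elim: (msupp p) => [|a r IH].
  move=> eta e0; exists 1, 0; split => // f A _ fA _ x.
  by rewrite big_nil normc0 mul0r mul0r.
have -> : (fun f x => \sum_(b <- a :: r) ((-1) ^+ mdeg b * mcoeff b p)%:C%C * Dmulti b f x) =
   (fun f x => ((-1) ^+ mdeg a * mcoeff a p)%:C%C * Dmulti a f x +
      \sum_(b <- r) ((-1) ^+ mdeg b * mcoeff b p)%:C%C * Dmulti b f x).
  by apply/funext => f; apply/funext => x; rewrite big_cons.
apply: dominatedD => //; apply: dominatedZ => eta e0.
have [e1 [K1 [e10 K10 H1]]] := tempered_bounds wt a e0.
by exists e1, K1; split => // f A ft fA gA; have [] := H1 f A ft fA gA.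
Qed.

Lemma adjD_tempered p f : tempered w f ->
  tempered w (adjD p f) /\ fourier (adjD p f) = fun xi => hrefl (evali p) xi * fourier f xi.
Proof.
move=> ft; have hs := symbol_evali p; have [gc gr] := symbol_rapid hs ft.
have Tc : vcont (adjD p f) by rewrite adjD_Tmul//; apply: rapid_four_vcont; exact: rapidZ.
have Tr : rapid (adjD p f).
  apply: (dominated_rapid (dominated_adjD p) ft); exact: vcont_vmeas.
have E : fourier (adjD p f) = fun xi => hrefl (evali p) xi * fourier f xi.
  by move: Tr; rewrite adjD_Tmul//; exact: fourier_Tmul.
split => //; split => // eta e0.
have [e1 [K1 [e10 K10 H1]]] := dominated_adjD p e0.
have [e2 [K2 [e20 K20 H2]]] := dominated_symbol hs e0.
pose em := Num.max e1 e2; have em0 : 0 < em by rewrite lt_max e10.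
have [_ /(_ em em0)[A [fA gA]]] := ft.
have le1 : e1 <= em by rewrite le_max lexx.
have le2 : e2 <= em by rewrite le_max lexx orbT.
have h1 := H1 f A ft (wbound_le wt le1 (lexx A) fA) (wbound_le wt le1 (lexx A) gA).
have h2 := H2 f A ft (wbound_le wt le2 (lexx A) fA) (wbound_le wt le2 (lexx A) gA).
exists (Num.max (K1 * A) (K2 * A)); split.
  by apply: (wbound_le wt (lexx eta) _ h1); rewrite le_max lexx.
by rewrite E; apply: (wbound_le wt (lexx eta) _ h2); rewrite le_max lexx orbT.
Qed.
End Multipliers.

(** * Multipliers preserve S_omega *)

Section MultiplierBound.
Variables (R : realType) (n : nat) (w : 'rV[R]_n.+1 -> R).
Hypothesis wt : tame_weight w.
Local Notation Rd := 'rV[R]_n.+1.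
Local Notation Cd := 'rV[R[i]]_n.+1.
Local Notation T := (measurableTypeR R).
Implicit Types (f g : Rd -> R[i]) (h : Cd -> R[i]) (p : mpoly n.+1 R).
Local Opaque cintegralRd.
Local Notation ic := (inv_const R n).

(** A differential operator whose symbol is bounded below by a power of the
    bracket on a strip; dividing by it, for N large, makes a symbol
    integrable. *)
Definition elliptic N : mpoly n.+1 R :=
  \prod_(j < n.+1) (1 - (mpolyX R (mnm1 j)) ^+ 2) ^+ N.

Lemma evali_elliptic N (z : Cd) : evali (elliptic N) z = \prod_j (1 + z 0 j ^+ 2) ^+ N.
Proof.
rewrite /evali /elliptic rmorph_prod rmorph_prod; apply: eq_bigr => j _.
rewrite !rmorphXn !rmorphB !rmorphXn !rmorph1 /= map_mpolyX mevalXU.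
by rewrite exprMn expr2 iu2 mulN1r opprK.
Qed.

Lemma elliptic_bound N (x y : Rd) : `|y| <= 2^-1 ->
  (3 / 4) ^+ (n.+1 * N) * bracket x ^+ N <= normc (evali (elliptic N) (cpt x y)).
Proof.
move=> y2; rewrite evali_elliptic normc_prod exprM -exprMn.
have -> : (3 / 4) ^+ n.+1 * bracket x = \prod_j (3 / 4 * (1 + x 0 j ^+ 2)).
  by rewrite big_split /= prodr_const card_ord.
rewrite -prodrXl.
apply: ler_prod => j _; rewrite exprn_ge0 ?mulr_ge0 ?addr_ge0 ?sqr_ge0//= normcX.
rewrite lerXn2r ?nnegrE ?normc_ge0 ?mulr_ge0 ?addr_ge0 ?sqr_ge0//.
rewrite (le_trans _ (le_trans (ler_norm _) (Re_le_normc _)))// cpt_coord expr2 !ReImE /=.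
have := coord_le_norm y j => yj; have {}yj := le_trans yj y2.
have : y 0 j ^+ 2 <= (2^-1) ^+ 2 by rewrite -(real_normK (num_real _)) lerXn2r ?nnegrE.
have := sqr_ge0 (x 0 j); rewrite !expr2; move: (x 0 j * x 0 j) (y 0 j * y 0 j) => a b.
by clear; lra.
Qed.

(** Fubini: a multiplier with integrable symbol is the convolution with the
    Fourier integral of its symbol. *)
Lemma Tmul_convolution (H : Cd -> R[i]) g psi x (r C B : R) : 0 < r ->
  (forall x y : Rd, `|y| <= r -> hol H (cpt x y) /\ normc (H (cpt x y)) <= C / bracket x) ->
  decay 1 B psi -> g = (fun xi => hrefl H xi * fourier psi xi) ->
  four 1 g x = cintegralRd (fun y => psi y * four 1 (hrefl H) (x - y)).
Proof.
move=> r0 HH pd ->.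
have r0' : `|0 : Rd| <= r by rewrite normr0 ltW.
have Hd : decay 1 C (hrefl H).
  split.
    have hc : vcont (fun x => H (cpt x 0)) by apply: vcont_hol => z; have [] := HH z 0 r0'.
    apply: vcont_vmeas => z e e0; have [d d0 hd] := hc (- z) e e0; exists d => // y yz.
    by apply: hd => j; rewrite !mxE -opprD normrN.
  by move=> z; rewrite expr1 -bracketN; have [_] := HH (- z) 0 r0'.
have Fi := vint_decay (decay_ker 1 x Hd); have Gi := vint_decay pd.
have km : cmeas (fun p : n.+1.-tuple T * n.+1.-tuple T =>
    ker (-1 * dotp (rowof p.2) (rowof p.1))).
  have := @cmeas_ker_dotp2 R n (-1); congr cmeas; apply/funext => p.
  by rewrite dotpC.
have k1 (xi y : Rd) : normc (ker (-1 * dotp y xi)) <= 1 by rewrite normc_ker.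
have [_ E] := fubini_Rd Fi Gi km k1.
transitivity (cintegralRd (fun xi => ker (1 * dotp xi x) * hrefl H xi *
    cintegralRd (fun y => ker (-1 * dotp y xi) * psi y))).
  rewrite /four; congr cintegralRd; apply/funext => xi.
  by rewrite fourierE mulrA.
rewrite E; congr cintegralRd; apply/funext => y; congr (_ * _).
congr cintegralRd; apply/funext => xi; rewrite mulrA -kerD; congr (ker _ * _).
by rewrite dotpDr dotpNr (dotpC y); ring.
Qed.

(** A power of (1 - d_1^2)...(1 - d_d^2) is transferred to the test function,
    which makes the symbol integrable on a strip. The kernel then decays
    exponentially, faster than exp(- eta w), and the subadditivity of w lets
    the convolution keep the decay of the test function. *)
Lemma dominated_Tmul h : symbol h -> dominated w (Tmul h).
Proof.
move=> [r0 [N [C0 [r00 hs]]]] eta e0.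
pose r := Num.min r0 2^-1; have rp : 0 < r by rewrite lt_min r00 /= invr_gt0 ltr0n.
(* Three powers more than the growth of h: one is enough for integrability, and
   three give the continuity of the kernel through [four_partial]. *)
pose H z := h z / evali (elliptic N.+3) z.
pose c34 : R := (3 / 4) ^+ (n.+1 * N.+3).
have c34p : 0 < c34 by rewrite exprn_gt0// divr_gt0.
have ell_neq0 (x y : Rd) : `|y| <= r -> evali (elliptic N.+3) (cpt x y) != 0.
  rewrite le_min => /andP[_ y2]; rewrite -normc_gt0.
  apply: lt_le_trans (elliptic_bound N.+3 x y2).
  by rewrite mulr_gt0// exprn_gt0// bracket_gt0.
have HH3 (x y : Rd) : `|y| <= r ->
    hol H (cpt x y) /\ normc (H (cpt x y)) <= (C0 / c34) / bracket x ^+ 3.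
  move=> yr; have en0 := ell_neq0 x y yr; move: yr; rewrite le_min => /andP[y1 y2].
  have [h1 h2] := hs x y y1; split.
    by apply: holM => //; apply: holV => //; exact: hol_evali.
  have bp := bracket_gt0 x.
  have el := elliptic_bound N.+3 x y2.
  rewrite /H normcM normcV ler_pdivrMr ?normc_gt0//.
  apply: le_trans h2 _.
  have C00 : 0 <= C0.
    have [_ h3] := hs x y y1; have := le_trans (normc_ge0 _) h3.
    by rewrite pmulr_lge0// exprn_gt0.
  apply: le_trans (ler_wpM2l _ el); last by rewrite !divr_ge0 ?exprn_ge0 ?(ltW c34p) ?(ltW bp).
  rewrite le_eqVlt; apply/orP; left; apply/eqP; rewrite -/c34.
  have -> : bracket x ^+ N.+3 = bracket x ^+ N * bracket x ^+ 3 by rewrite -exprD addn3.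
  have b0 : bracket x != 0 by rewrite gt_eqF.
  have c0 : c34 != 0 by rewrite gt_eqF.
  by field; rewrite b0 c0.
have HH (x y : Rd) : `|y| <= r ->
    hol H (cpt x y) /\ normc (H (cpt x y)) <= (C0 / c34) / bracket x.
  move=> yr; have [h1 h2] := HH3 x y yr; split => //; apply: le_trans h2 _.
  have yr0 : `|y| <= r0 by move: yr; rewrite le_min => /andP[].
  have [h3 h4] := hs x y yr0.
  have C00 : 0 <= C0.
    have := le_trans (normc_ge0 _) h4.
    by rewrite pmulr_lge0// exprn_gt0// bracket_gt0.
  rewrite ler_wpM2l ?divr_ge0 ?(ltW c34p)// lef_pV2 ?posrE ?exprn_gt0 ?bracket_gt0//.
  by rewrite exprS ler_peMr ?bracket_ge0// exprn_ege1// bracket_ge1.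
have hE xi : hrefl h xi = hrefl H xi * hrefl (evali (elliptic N.+3)) xi.
  by rewrite /hrefl /H divfK//; apply: ell_neq0; rewrite normr0 ltW.
have [e1 [Cw [e10 Hw]]] := w_log wt 1.
have Cw0 : 0 <= Cw.
  have := le_trans (exprn_ge0 1 (bracket_ge0 0)) (Hw 0).
  by rewrite pmulr_lge0// expR_gt0.
have [e2 [Kp [e20 Kp0 Hp]]] := dominated_adjD wt (elliptic N.+3) (addr_gt0 e0 e10).
have [K1 HK1] := w_lin wt (divr_gt0 rp e0).
pose CK := 2 * (C0 / c34 * bracket_int R n).
have CK0 : 0 <= CK.
  have := le_trans (normc_ge0 _) (kernel_decay rp HH 0).
  by rewrite pmulr_lge0// expR_gt0.
pose K := normc ic * (2 * (Kp * CK * expR (eta * K1) * Cw * bracket_int R n)).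
exists e2, K; split => //.
  have I0 := bracket_int_ge0 R n; have E0 := expR_ge0 (eta * K1).
  by apply: mulr_ge0 (normc_ge0 _) _; do !apply: mulr_ge0 => //.
move=> f A ft fA gA x.
have [psit psiE] := adjD_tempered wt (elliptic N.+3) ft.
have psib := Hp f A ft fA gA; set psi := adjD _ f in psit psiE psib.
have [pr pgr] := tempered_rapid wt psit; have [pc _] := psit.
have [B pd] := pr 1%N.
have [gc gr] := symbol_rapid wt (ex_intro _ r0 (ex_intro _ N (ex_intro _ C0 (conj r00 hs)))) ft.
have [B' gd] := gr 1%N.
rewrite /Tmul (fourZ _ _ _ gd) normcM /K -[leRHS]mulrA -[leRHS]mulrA ler_wpM2l ?normc_ge0//.
have gE : (fun xi => hrefl h xi * fourier f xi) = (fun xi => hrefl H xi * fourier psi xi).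
  by apply/funext => xi; rewrite psiE hE mulrA.
rewrite (Tmul_convolution x rp HH pd gE).
pose M := Kp * A * CK * expR (eta * K1) * Cw * expR (- (eta * w x)).
have A0 := wbound_ge0 fA.
suff Hd : decay 1 M (fun y => psi y * four 1 (hrefl H) (x - y)).
  apply: le_trans (normc_cintegralRd_le Hd) _.
  by rewrite le_eqVlt; apply/orP; left; apply/eqP; rewrite /M; ring.
split.
  apply: vcont_vmeas; apply: vcontM => // y e ep.
  have kc : vcont (four 1 (hrefl H)).
    have kd : decay 3 (C0 / c34) (hrefl H).
      have r0' : `|0 : Rd| <= r by rewrite normr0 ltW.
      have hc : vcont (fun x => H (cpt x 0)) by apply: vcont_hol => z; have [] := HH z 0 r0'.
      split; last by move=> z; rewrite -bracketN; have [_] := HH3 (- z) 0 r0'.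
      apply: vcont_vmeas => z e' e0'; have [d d0 hd] := hc (- z) e' e0'; exists d => // y' yz.
      by apply: hd => j; rewrite !mxE -opprD normrN.
    by apply: differentiable_vcont => z; have [] := four_partial 1 kd z.
  have [d d0 hd] := kc (x - y) e ep; exists d => // y' yy'; apply: hd => j.
  rewrite !mxE; move: (yy' j); rewrite -normrN; congr (`| _ | < _); ring.
move=> y; rewrite normcM expr1.
have h1 := psib y; have h2 := kernel_decay rp HH (x - y).
apply: le_trans (ler_pM (normc_ge0 _) (normc_ge0 _) h1 h2) _.
(* The factor exp(- e1 w(y)) pays for the integrability in y. *)
have hw : expR (- (e1 * w y)) <= Cw / bracket y.
  rewrite expRN ler_pdivlMr ?bracket_gt0// ler_pdivrMl ?expR_gt0// mulrC.
  by have := Hw y; rewrite expr1.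
have wx : - (r * `|x - y|) <= eta * K1 - eta * w (x - y).
  have := ler_wpM2l (ltW e0) (HK1 (x - y)).
  rewrite mulrDr mulrA [eta * (r / eta)]mulrC divfK ?gt_eqF//.
  by move: (eta * w _) (r * `|_|) (eta * K1) => a b c; clear; lra.
have wxy : w x <= w (x - y) + w y by rewrite -{1}(subrK y x) wD.
have w2 : - (eta * w (x - y)) - eta * w y <= - (eta * w x).
  have := ler_wpM2l (ltW e0) wxy; rewrite mulrDr.
  by move: (eta * w x) (eta * w (x - y)) (eta * w y) => a b c; clear; lra.
have we : expR (- ((eta + e1) * w y)) * expR (- (r * `|x - y|)) <=
    Cw / bracket y * (expR (eta * K1) * expR (- (eta * w x))).
  rewrite (_ : - ((eta + e1) * w y) = - (e1 * w y) - eta * w y); last by ring.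
  rewrite expRD -mulrA; apply: ler_pM hw _; rewrite ?mulr_ge0 ?expR_ge0//.
  rewrite -!expRD ler_expR.
  move: wx w2; move: (r * _) (eta * K1) (eta * w (x - y)) (eta * w x) (eta * w y) => a b c d e.
  by clear; lra.
rewrite (_ : Kp * A * _ * _ = Kp * A * CK *
  (expR (- ((eta + e1) * w y)) * expR (- (r * `|x - y|)))); last by rewrite /CK; ring.
rewrite (_ : M / bracket y = Kp * A * CK *
  (Cw / bracket y * (expR (eta * K1) * expR (- (eta * w x))))); last by rewrite /M; ring.
by apply: ler_wpM2l we; apply: mulr_ge0 CK0; exact: mulr_ge0.
Qed.

Lemma Tmul_tempered h f : symbol h -> tempered w f ->
  tempered w (Tmul h f) /\ fourier (Tmul h f) = fun xi => hrefl h xi * fourier f xi.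
Proof.
move=> hs ft; have [gc gr] := symbol_rapid wt hs ft.
have Tc : vcont (Tmul h f) by apply: rapid_four_vcont; exact: rapidZ.
have Tr : rapid (Tmul h f).
  by apply: (dominated_rapid wt (dominated_Tmul hs) ft); exact: vcont_vmeas.
have E := fourier_Tmul wt hs ft Tr.
split => //; split => // eta e0.
have [e1 [K1 [e10 K10 H1]]] := dominated_Tmul hs e0.
have [e2 [K2 [e20 K20 H2]]] := dominated_symbol wt hs e0.
pose em := Num.max e1 e2; have em0 : 0 < em by rewrite lt_max e10.
have [_ /(_ em em0)[A [fA gA]]] := ft.
have le1 : e1 <= em by rewrite le_max lexx.
have le2 : e2 <= em by rewrite le_max lexx orbT.
have h1 := H1 f A ft (wbound_le wt le1 (lexx A) fA) (wbound_le wt le1 (lexx A) gA).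
have h2 := H2 f A ft (wbound_le wt le2 (lexx A) fA) (wbound_le wt le2 (lexx A) gA).
exists (Num.max (K1 * A) (K2 * A)); split.
  by apply: (wbound_le wt (lexx eta) _ h1); rewrite le_max lexx.
by rewrite E; apply: (wbound_le wt (lexx eta) _ h2); rewrite le_max lexx orbT.
Qed.

Lemma Tmul_comp h1 h2 f : symbol h2 -> tempered w f ->
  Tmul h1 (Tmul h2 f) = Tmul (fun z => h1 z * h2 z) f.
Proof.
move=> hs ft; have [_ E] := Tmul_tempered hs ft.
rewrite {1}/Tmul E; congr four; apply/funext => xi.
by rewrite /hrefl !mulrA.
Qed.

Lemma Tmul_id h f : tempered w f -> (forall xi, hrefl h xi = 1) -> Tmul h f = f.
Proof.
move=> ft h1; have [fr gr] := tempered_rapid wt ft; have [fc _] := ft.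
rewrite [RHS](fourier_invE fc fr gr) /Tmul; congr four; apply/funext => xi.
by rewrite h1 mul1r.
Qed.

Lemma fourier_linear c f g : tempered w f -> tempered w g ->
  fourier (fun x => c * f x + g x) = fun xi => c * fourier f xi + fourier g xi.
Proof.
move=> ft gt; have [fr _] := tempered_rapid wt ft; have [gr _] := tempered_rapid wt gt.
have [A fA] := fr 1%N; have [B gB] := gr 1%N; have [A' fA'] := rapidZ c fr 1%N.
apply/funext => xi.
by rewrite !fourier_four (fourD (-1) xi fA' gB) (fourZ (-1) c xi fA).
Qed.

Lemma tempered_linear c f g : tempered w f -> tempered w g ->
  tempered w (fun x => c * f x + g x).
Proof.
move=> ft gt; have E := fourier_linear c ft gt.
move: ft gt => [fc fb] [gc gb]; split; first by apply: vcontD => //; exact: vcontZ.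
move=> eta e0; have [A [fA fA']] := fb eta e0; have [B [gB gB']] := gb eta e0.
have aux f1 g1 : wbound w eta A f1 -> wbound w eta B g1 ->
    wbound w eta (normc c * A + B) (fun x => c * f1 x + g1 x).
  move=> h1 h2 x; rewrite (le_trans (normcD _ _))// mulrDl lerD//.
  exact: wboundZ h1 x.
by exists (normc c * A + B); rewrite E; split; exact: aux.
Qed.

Lemma Tmul_linear h c f g : symbol h -> tempered w f -> tempered w g ->
  Tmul h (fun x => c * f x + g x) = fun x => c * Tmul h f x + Tmul h g x.
Proof.
move=> hs ft gt; have [_ fr] := symbol_rapid wt hs ft; have [_ gr] := symbol_rapid wt hs gt.
have [A fA] := rapidZ ic fr 1%N; have [A' fA'] := rapidZ c (rapidZ ic fr) 1%N.
have [B gB] := rapidZ ic gr 1%N.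
apply/funext => x; rewrite /Tmul -(fourZ 1 c x fA) -(fourD 1 x fA' gB).
rewrite (fourier_linear c ft gt); congr four; apply/funext => xi; ring.
Qed.

Lemma fourier_translate f (t : Rd) : rapid f ->
  fourier (fun x => f (x - t)) = fun xi => ker (-1 * dotp t xi) * fourier f xi.
Proof.
move=> fr; have [A fA] := fr 1%N; apply/funext => xi; rewrite !fourier_four.
have [_ E] := cintegralRd_translate (- t) (vint_decay (decay_ker (-1) xi fA)).
have fi := vint_decay (decay_ker (-1) xi fA).
have [vi _] := cintegralRd_translate (- t) fi.
rewrite /four -E -(cintegralRdZ _ vi); congr cintegralRd; apply/funext => x.
by rewrite mulrA -kerD -mulrDr -dotpDl [t + _]addrC subrK.
Qed.

Lemma tempered_translate f (t : Rd) : tempered w f -> tempered w (fun x => f (x - t)).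
Proof.
move=> ft; have [fr _] := tempered_rapid wt ft; have E := fourier_translate t fr.
move: ft => [fc fb]; split.
  move=> x e e0; have [r r0 h] := fc (x - t) e e0; exists r => // y yx.
  by apply: h => j; rewrite !mxE opprD opprK addrACA [- _ + _]addrC subrr addr0 yx.
move=> eta e0; have [A [fA fA']] := fb eta e0; have A0 := wbound_ge0 fA.
exists (A * expR (eta * w t)); split => x.
  rewrite (le_trans (fA _))// -mulrA ler_wpM2l// -expRD ler_expR.
  have : w x <= w (x - t) + w t by rewrite -{1}(subrK t x) wD.
  move/(ler_wpM2l (ltW e0)); rewrite mulrDr.
  by move: (eta * w x) (eta * w (x - t)) (eta * w t) => a b c; clear; lra.
rewrite E normcM normc_ker mul1r (le_trans (fA' x))// mulrAC ler_peMr ?mulr_ge0 ?expR_ge0//.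
by rewrite -expR0 ler_expR mulr_ge0 ?(ltW e0)// w_ge0.
Qed.

Lemma Tmul_translate h f (t : Rd) : symbol h -> tempered w f ->
  Tmul h (fun x => f (x - t)) = fun x => Tmul h f (x - t).
Proof.
move=> hs ft; have [fr _] := tempered_rapid wt ft.
apply/funext => x; rewrite /Tmul (fourier_translate t fr).
congr cintegralRd; apply/funext => xi.
by rewrite !mul1r dotpDr dotpNr kerD (dotpC t) mulN1r; ring.
Qed.

Lemma fourier_conj f xi : rapid f -> fourier (fun x => conjc (f x)) xi = conjc (fourier f (- xi)).
Proof.
move=> fr; have [A fA] := fr 1%N; rewrite !fourier_four /four.
rewrite [RHS]conjc_cintegral; last exact: vint_decay (decay_ker (-1) (- xi) fA).
apply: eq_cintegral => x.
have conjM (u v : R[i]) : conjc (u * v) = conjc u * conjc v.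
  by apply: cplx_eq; rewrite !ReImE; ring.
by rewrite conjM conjc_ker dotpNr !mulN1r opprK.
Qed.

Lemma tempered_conj f : tempered w f -> tempered w (fun x => conjc (f x)).
Proof.
move=> ft; have [fr _] := tempered_rapid wt ft.
have E xi := fourier_conj xi fr.
move: ft => [fc fb]; split.
  move=> x e e0; have [r r0 h] := fc x e e0; exists r => // y yx.
  by rewrite -rmorphB normc_conj h.
move=> eta /fb[A [fA fA']]; exists A; split => x; first by rewrite normc_conj.
by rewrite E normc_conj -(wN wt x).
Qed.
End MultiplierBound.

(** * Leading forms of polynomials *)

Section LeadingForm.
Variables (R : realType) (n : nat).
Local Notation Rd := 'rV[R]_n.+1.
Local Notation Cd := 'rV[R[i]]_n.+1.
Implicit Types (p : mpoly n.+1 R).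

(** The number with digits a_0, a_1, ... in base B. *)
Definition base_value k (B : nat) (a : 'I_k -> nat) : nat := \sum_(j < k) a j * B ^ j.

Lemma base_value_inj k B (a b : 'I_k -> nat) :
  (forall j, a j < B)%N -> (forall j, b j < B)%N ->
  base_value B a = base_value B b -> a =1 b.
Proof.
elim: k a b => [|k IH] a b aB bB; first by move=> _ [].
have recE (c : 'I_k.+1 -> nat) :
    base_value B c = (base_value B (fun j => c (lift ord0 j)) * B + c ord0)%N.
  rewrite /base_value big_ord_recl expn0 muln1 addnC big_distrl /=; congr (_ + _)%N.
  by apply: eq_bigr => j _; rewrite /bump /= expnS mulnCA mulnC.
rewrite !recE => E.
have E0 : a ord0 = b ord0.
  by have := congr1 (modn^~ B) E; rewrite /= !modnMDl !modn_small.
have B0 : (0 < B)%N by exact: leq_ltn_trans (leq0n _) (aB ord0).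
have E1 : base_value B (fun j => a (lift ord0 j)) = base_value B (fun j => b (lift ord0 j)).
  by have := congr1 (divn^~ B) E; rewrite /= !divnMDl// !divn_small// !addn0.
move=> j; case: (unliftP ord0 j) => [i ->|-> //].
by apply: (IH (fun j => a (lift ord0 j)) (fun j => b (lift ord0 j))).
Qed.

Lemma poly_nonroot (P : {poly R}) : P != 0 -> exists t : R, P.[t] != 0.
Proof.
move=> P0; apply: contrapT => /forallNP H.
pose rs : seq R := [seq i%:R | i <- iota 0 (size P)].
have : (size rs < size P)%N.
  apply: max_poly_roots => //.
    apply/allP => x /mapP[i _ ->]; rewrite /root; apply/negPn/negP; exact: H.
  rewrite map_inj_uniq ?iota_uniq// => i j /eqP; rewrite eqr_nat => /eqP; exact.
by rewrite size_map size_iota ltnn.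
Qed.

(** Kronecker substitution: for v_j = t^(B^j) with B large, distinct monomials
    become distinct powers of t, and a nonzero polynomial in t has a nonroot. *)
Lemma form_nonroot p (r : pred (multinom n.+1)) a0 : a0 \in msupp p -> r a0 ->
  exists v : Rd, \sum_(a <- msupp p | r a) mcoeff a p * \prod_j v 0 j ^+ fun_of_multinom a j != 0.
Proof.
move=> a0p ra0; pose B := (\max_(a <- msupp p) \max_j fun_of_multinom a j).+1.
have aB a j : a \in msupp p -> (fun_of_multinom a j < B)%N.
  move=> ap; rewrite ltnS (big_rem a)//= leq_max; apply/orP; left.
  exact: (@leq_bigmax _ (fun j => fun_of_multinom a j)).
pose K (a : multinom n.+1) := base_value B (fun_of_multinom a).
have Kinj a b : a \in msupp p -> b \in msupp p -> K a = K b -> a = b.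
  by move=> ap bp /base_value_inj E; apply/mnmP => j; apply: E => i; exact: aB.
pose P : {poly R} := \sum_(a <- msupp p | r a) mcoeff a p *: 'X^(K a).
have P0 : P != 0.
  apply/eqP => /(congr1 (fun q : {poly R} => q`_(K a0))); rewrite coef0 /P coef_sum => /eqP.
  rewrite big_mkcond (bigD1_seq a0) ?msupp_uniq//= ra0 big_seq_cond big1 ?addr0.
    by rewrite coefZ coefXn eqxx mulr1 mcoeff_eq0 a0p.
  move=> a /andP[ap aa0]; case: ifP => // _; rewrite coefZ coefXn.
  case: eqP => [E|_]; last by rewrite mulr0.
  by move: aa0; rewrite (Kinj _ _ a0p ap E) eqxx.
have [t Pt] := poly_nonroot P0; exists (\row_j t ^+ (B ^ j)).
move: Pt; rewrite /P horner_sum; congr (_ != 0); apply: eq_bigr => a _.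
rewrite hornerZ hornerXn /K /base_value -prodrXr; congr (_ * _).
by apply: eq_bigr => j _; rewrite mxE -exprM mulnC.
Qed.

(** The polynomial zeta |-> p(i (z + zeta v)). *)
Definition line_poly p (z : Cd) (v : Rd) : {poly R[i]} :=
  \sum_(a <- msupp p) ((mcoeff a p)%:C)%C *:
    \prod_j ((iu * z 0 j)%:P + (iu * ((v 0 j)%:C)%C) *: 'X) ^+ fun_of_multinom a j.

Lemma line_polyE p z v (zeta : R[i]) :
  (line_poly p z v).[zeta] = evali p (z + zeta *: cpt v 0).
Proof.
rewrite /line_poly horner_sum evaliE; apply: eq_bigr => a _.
rewrite hornerZ horner_prod; congr (_ * _); apply: eq_bigr => j _.
rewrite horner_exp !hornerE !mxE; congr (_ ^+ _).
by rewrite (_ : Complex (v 0 j) 0 = ((v 0 j)%:C)%C)//; ring.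
Qed.

(** Unlike the leading coefficient, the coefficient in a prescribed degree k
    that bounds the degree is additive, and multiplicative even when it
    vanishes. *)
Definition top_coef (k : nat) (A : {poly R[i]}) (c : R[i]) := (size A <= k.+1)%N /\ A`_k = c.

Lemma top_coefM k l A B c d : top_coef k A c -> top_coef l B d -> top_coef (k + l) (A * B) (c * d).
Proof.
move=> [sA cA] [sB cB]; split.
  apply: leq_trans (size_polyMleq _ _) _.
  have : (size A + size B <= (k + l).+2)%N by rewrite -addnS -addSn leq_add.
  by case: (size A + size B)%N.
have kl : (k < (k + l).+1)%N by rewrite ltnS leq_addr.
rewrite coefM (bigD1 (Ordinal kl))//= addKn cA cB big1 ?addr0// => j jk.
have {}jk : (j : nat) != k by apply: contraNneq jk => E; apply/eqP/val_inj.
case: (ltngtP j k) => [jk'|jk'|E]; last by rewrite E eqxx in jk.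
  rewrite [B`_ _]nth_default ?mulr0//; apply: leq_trans sB _.
  by rewrite -addnBAC ?(ltnW jk')// -[X in (X <= _)%N]add1n leq_add2r subn_gt0.
by rewrite [A`_ _]nth_default ?mul0r//; exact: leq_trans sA _.
Qed.

Lemma top_coefX k A c m : top_coef k A c -> top_coef (k * m) (A ^+ m) (c ^+ m).
Proof.
move=> H; elim: m => [|m IH]; last by rewrite !exprS mulnS; exact: top_coefM.
by rewrite muln0 !expr0; split; rewrite ?size_poly1 ?coef1.
Qed.

Lemma top_coef_prod (I : Type) (r : seq I) (k : I -> nat) (A : I -> {poly R[i]}) (c : I -> R[i]) :
  (forall i, top_coef (k i) (A i) (c i)) ->
  top_coef (\sum_(i <- r) k i) (\prod_(i <- r) A i) (\prod_(i <- r) c i).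
Proof.
move=> H; elim: r => [|i r IH]; last by rewrite !big_cons; exact: top_coefM.
by rewrite !big_nil; split; rewrite ?size_poly1 ?coef1.
Qed.

Lemma top_coef_linear (u v : R[i]) : top_coef 1 (u%:P + v *: 'X) v.
Proof.
split; last by rewrite coefD coefC coefZ coefX mulr1 add0r.
apply: leq_trans (size_polyD _ _) _; rewrite geq_max; apply/andP; split.
  exact: leq_trans (size_polyC_leq1 _) _.
by apply: leq_trans (size_scale_leq _ _) _; rewrite size_polyX.
Qed.

Definition tdeg p := \max_(a <- msupp p) mdeg a.
Definition lead_form p (v : Rd) : R :=
  \sum_(a <- msupp p | mdeg a == tdeg p) mcoeff a p * \prod_j v 0 j ^+ fun_of_multinom a j.

Lemma lead_form_nonroot p : p != 0 -> exists v, lead_form p v != 0.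
Proof.
rewrite -msupp_eq0 => p0.
have [a ap Ea] : exists2 a, a \in msupp p & mdeg a = tdeg p.
  rewrite /tdeg; case: (msupp p) p0 => // b s _.
  elim: s b => [|c s IH] b.
    by exists b; rewrite ?inE ?eqxx// big_cons big_nil maxn0.
  have [a ain aE] := IH c; rewrite big_cons -aE.
  case: (leqP (mdeg b) (mdeg a)) => ba.
    by exists a => //; rewrite inE ain orbT.
  by exists b => //; rewrite inE eqxx.
by apply: (form_nonroot ap); rewrite Ea.
Qed.

Lemma top_coef_sum (I : Type) (r : seq I) m (A : I -> {poly R[i]}) (c : I -> R[i]) :
  (forall i, top_coef m (A i) (c i)) ->
  top_coef m (\sum_(i <- r) A i) (\sum_(i <- r) c i).
Proof.
move=> H; elim: r => [|i r [IH1 IH2]]; first by rewrite !big_nil; split; rewrite ?size_poly0 ?coef0.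
have [h1 h2] := H i; rewrite !big_cons; split; last by rewrite coefD h2 IH2.
by apply: leq_trans (size_polyD _ _) _; rewrite geq_max h1.
Qed.

(** Only the monomials of maximal degree contribute to the top power of zeta,
    and each of their factors contributes its coefficient of zeta, in which z
    does not occur. *)
Lemma line_poly_top p z v :
  top_coef (tdeg p) (line_poly p z v) (iu ^+ tdeg p * ((lead_form p v)%:C)%C).
Proof.
pose A a := if a \in msupp p then ((mcoeff a p)%:C)%C *:
    \prod_j ((iu * z 0 j)%:P + (iu * ((v 0 j)%:C)%C) *: 'X) ^+ fun_of_multinom a j else 0.
pose c a := if (a \in msupp p) && (mdeg a == tdeg p) then
    iu ^+ tdeg p * ((mcoeff a p * \prod_j v 0 j ^+ fun_of_multinom a j)%:C)%C else 0.
have -> : line_poly p z v = \sum_(a <- msupp p) A a.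
  by rewrite /line_poly big_seq [RHS]big_seq; apply: eq_bigr => a; rewrite /A => ->.
have -> : iu ^+ tdeg p * ((lead_form p v)%:C)%C = \sum_(a <- msupp p) c a.
  rewrite /lead_form rmorph_sum mulr_sumr big_mkcond big_seq [RHS]big_seq.
  by apply: eq_bigr => a; rewrite /c => ->.
apply: top_coef_sum => a; rewrite /A /c; case: ifP => [ap|_] /=; last first.
  by split; rewrite ?size_poly0 ?coef0.
have [sQ cQ] : top_coef (mdeg a) (\prod_j ((iu * z 0 j)%:P + (iu * ((v 0 j)%:C)%C) *: 'X) ^+ fun_of_multinom a j)
    (iu ^+ mdeg a * ((\prod_j v 0 j ^+ fun_of_multinom a j)%:C)%C).
  rewrite mdegE -prodrXr rmorph_prod -big_split /=.
  apply: top_coef_prod => j; rewrite rmorphXn -exprMn -[X in top_coef X]mul1n.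
  apply: top_coefX; exact: top_coef_linear.
have aD : (mdeg a <= tdeg p)%N by rewrite /tdeg (big_rem a)//= leq_max leqnn.
split; first by apply: leq_trans (size_scale_leq _ _) _; exact: leq_trans sQ _.
rewrite coefZ; case: eqP => [E|/eqP E].
  by rewrite -E cQ rmorphM; ring.
rewrite nth_default ?mulr0//; apply: leq_trans sQ _.
by rewrite ltn_neqAle E.
Qed.
End LeadingForm.

(** * Division by a polynomial on a strip *)

Section Division.
Variables (R : realType) (n : nat).
Local Notation Rd := 'rV[R]_n.+1.
Local Notation Cd := 'rV[R[i]]_n.+1.
Implicit Types (p q : mpoly n.+1 R) (h : Cd -> R[i]).

Lemma stripE (eps : R) (x y : Rd) : strip eps (cpt x y) <-> enorm y < eps.
Proof.
rewrite /strip /=; have -> : map_mx (@complex.Im R) (cpt x y) = y; last by [].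
by apply/rowP => j; rewrite !mxE.
Qed.

Lemma cpt_real (x : Rd) : cpt x 0 = map_mx (real_complex R) x.
Proof. by apply/rowP => j; rewrite !mxE. Qed.

Lemma cptE (z : Cd) : exists x y, z = cpt x y.
Proof.
exists (map_mx (@complex.Re R) z), (map_mx (@complex.Im R) z).
by apply/rowP => j; rewrite !mxE; case: (z 0 j).
Qed.

Lemma cpt_scale (x y v : Rd) (s t : R) :
  cpt x y + Complex s t *: cpt v 0 = cpt (x + s *: v) (y + t *: v).
Proof.
by apply/rowP => j; rewrite !mxE; apply: cplx_eq; rewrite !ReImE /=; ring.
Qed.

Lemma cpt_scale_im (x y : Rd) (s t : R) :
  cpt x 0 + Complex s t *: cpt y 0 = cpt (x + s *: y) (t *: y).
Proof. by rewrite cpt_scale add0r. Qed.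

Lemma enormZ (c : R) (x : Rd) : enorm (c *: x) = `|c| * enorm x.
Proof.
by rewrite /enorm dotpZl dotpZr mulrA -expr2 sqrtrM ?sqr_ge0// sqrtr_sqr.
Qed.


Lemma bracket_add_le (x h : Rd) (Y : R) : (forall j, `|h 0 j| <= Y) ->
  bracket (x + h) <= (2 * (1 + Y ^+ 2)) ^+ n.+1 * bracket x.
Proof.
move=> hY; have Y0 : 0 <= Y := le_trans (normr_ge0 _) (hY 0).
have := bracket_translate (x + h) (- h); rewrite addrK bracketN => /le_trans; apply.
rewrite ler_wpM2r ?bracket_ge0// exprMn ler_wpM2l ?exprn_ge0//.
rewrite /bracket -[X in _ ^+ X](card_ord n.+1) -prodr_const; apply: ler_prod => j _.
rewrite addr_ge0 ?sqr_ge0//= lerD2l -(real_normK (num_real _)) lerXn2r ?nnegrE//.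
Qed.

(** Malgrange's division estimate. The values of the quotient near a zero of p
    are recovered from squares in a complex line with a direction v in which
    the leading form of p does not vanish; the leading coefficient on that
    line, hence the bound, is uniform in the base point. *)
Lemma division_symbol p q h (eps : R) : p != 0 -> 0 < eps ->
  (forall z, strip eps z -> hol h z) ->
  (forall z, strip eps z -> h z * evali p z = evali q z) -> symbol h.
Proof.
move=> p0 eps0 hh hpq; have [v v0] := lead_form_nonroot p0.
have [rq [N [C [rq0 Hq]]]] := symbol_evali q.
pose e0 := Num.min eps rq; have e00 : 0 < e0 by rewrite lt_min eps0.
pose rho := e0 / (2 * (enorm v + 1)).
have v1 : 0 < enorm v + 1 by rewrite ltr_wpDl// enorm_ge0.
have rho0 : 0 < rho by rewrite divr_gt0// mulr_gt0.
pose r := e0 / (2 * n.+1%:R) / 2.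
have n1 : 0 < n.+1%:R :> R by [].
have r0 : 0 < r by rewrite !divr_gt0// mulr_gt0.
pose m := tdeg p; pose delta := rho / (2 * m.+1%:R).
have delta0 : 0 < delta by rewrite divr_gt0// mulr_gt0.
have lf0 : 0 < `|lead_form p v| by rewrite normr_gt0.
pose D := (2 * (1 + (rho * enorm v) ^+ 2)) ^+ n.+1.
have C0 : 0 <= C.
  have := Hq 0 0; rewrite normr0 => /(_ (ltW rq0))[_ h1].
  have := le_trans (normc_ge0 _) h1.
  by rewrite pmulr_lge0// exprn_gt0// bracket_gt0.
exists r, N, (64 * (C * D ^+ N / delta ^+ m) / `|lead_form p v|); split => // x y yr.
have inside (s t : R) : - rho <= s <= rho -> - rho <= t <= rho ->
    strip eps (cpt (x + s *: v) (y + t *: v)) /\ `|y + t *: v| <= rq.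
  move=> _ ht; have nt : `|t| <= rho by rewrite ler_norml.
  have H : enorm (y + t *: v) < e0.
    rewrite (le_lt_trans (enormD _ _))// [ltRHS]splitr enormZ ltr_leD//.
      rewrite (le_lt_trans (enorm_le_norm y))//.
      apply: (@le_lt_trans _ _ (n.+1%:R * r)); first by rewrite ler_wpM2l.
      rewrite [X in X < _](_ : _ = e0 / 2 / 2); last by rewrite /r; field.
      by rewrite ltr_pdivrMr// ltr_pMr ?divr_gt0// ltr1n.
    apply: (@le_trans _ _ (rho * (enorm v + 1))).
      by rewrite ler_pM ?enorm_ge0// lerDl.
    by rewrite le_eqVlt; apply/orP; left; apply/eqP; rewrite /rho; field; rewrite gt_eqF.
  split; first by apply/stripE; apply: lt_le_trans H _; rewrite ge_min lexx.
  apply: (@le_trans _ _ e0); last by rewrite ge_min lexx orbT.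
  apply: norm_le_coord => [|j]; first exact: ltW.
  exact: le_trans (coord_le_enorm _ j) (ltW H).
have zz : - rho <= 0 <= rho by rewrite oppr_le0 ltW.
have [s0 _] := inside 0 0 zz zz; rewrite !scale0r !addr0 in s0.
split; first exact: hh.
pose P := line_poly p (cpt x y) v.
have [sP cP] := line_poly_top p (cpt x y) v; rewrite -/P -/m in sP cP.
have cP0 : P`_m != 0.
  rewrite cP -normc_gt0 normcM normcX normc_iu expr1n mul1r normc_real//.
have szP : size P = m.+1.
  apply/eqP; rewrite eqn_leq sP /= ltnNge; apply/negP => /leq_sizeP /(_ m (leqnn _)) E.
  by rewrite E eqxx in cP0.
have P0 : P != 0 by rewrite -size_poly_eq0 szP.
have := @Malgrange_bound R P (fun zeta => h (cpt x y + zeta *: cpt v 0)) rho (C * (D * bracket x) ^+ N).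
rewrite /= szP /= scale0r addr0 => MB.
rewrite mulrAC ler_pdivlMr// mulrC.
have -> : `|lead_form p v| = normc (lead_coef P).
  by rewrite lead_coefE szP /= cP normcM normcX normc_iu expr1n mul1r normc_real.
apply: le_trans (MB P0 rho0 _ _) _.
- move=> s t hs ht; apply: hol_line; rewrite cpt_scale; apply: hh.
  by have [] := inside s t hs ht.
- move=> s t hs ht; rewrite line_polyE cpt_scale; have [i1 i2] := inside s t hs ht.
  rewrite hpq//; have [_ h2] := Hq (x + s *: v) _ i2.
  apply: le_trans h2 _; rewrite ler_wpM2l// lerXn2r ?nnegrE ?bracket_ge0//.
    by rewrite mulr_ge0 ?bracket_ge0// exprn_ge0// mulr_ge0// addr_ge0// sqr_ge0.
  apply: bracket_add_le => j; rewrite mxE normrM ler_pM//; first by rewrite ler_norml.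
  exact: coord_le_enorm.
- by rewrite -/delta exprMn le_eqVlt; apply/orP; left; apply/eqP; ring.
Qed.

Lemma hol_differentiable (h : Cd -> R[i]^o) z : differentiable h z -> hol h z.
Proof.
move=> hd; split.
  move=> e e0; have eC : 0 < (e%:C)%C :> R[i] by rewrite ltcE /= eqxx e0.
  have /cvgrPdist_lt /(_ _ eC) /nbhs_ballP[r /= r0 H] := differentiable_continuous hd.
  have rE : r = ((cRe r)%:C)%C by move: r0; rewrite ltcE => /andP[/eqP /= E _]; apply: cplx_eq.
  have rR : 0 < cRe r by move: r0; rewrite ltcE => /andP[].
  exists (cRe r) => // z' zz'.
  have : ball z r z'.
    rewrite -ball_normE /= rE; have [->|nz] := eqVneq (`|z - z'|) 0.
      by rewrite ltcE /= eqxx rR.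
    have [[i j] /= E] := mx_norm_neq0 nz.
    rewrite (_ : `|z - z'| = `|(z - z') i j|)// cnormE ltcE /= eqxx /= ord1 !mxE.
    by rewrite normcBC.
  by move=> /H /=; rewrite cnormE ltcE /= normcBC => /andP[].
move=> u; exists ('d h z u) => e e0.
have [_ /eqaddoP E] := proj1 (diff_locallyP _ _) hd.
pose nu := cRe (`|u| : R[i]); have nuE : (`|u| : R[i]) = (nu%:C)%C.
  have : 0 <= `|u| :> R[i] by [].
  by rewrite lecE => /andP[/eqP /= E0 _]; apply: cplx_eq.
have nu0 : 0 <= nu by have : 0 <= `|u| :> R[i] by []; rewrite nuE lecE => /andP[].
have e'0 : 0 < ((e / (nu + 1))%:C)%C :> R[i].
  by rewrite ltcE /= eqxx divr_gt0// ltr_wpDl.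
have /nbhs_ballP[r /= r0 H] := E _ e'0.
have rE : r = ((cRe r)%:C)%C by move: r0; rewrite ltcE => /andP[/eqP /= E0 _]; apply: cplx_eq.
have rR : 0 < cRe r by move: r0; rewrite ltcE => /andP[].
exists (cRe r / (nu + 1)); first by rewrite divr_gt0// ltr_wpDl.
move=> w; rewrite subr0 => wr.
have : ball 0 r (w *: u).
  rewrite -ball_normE /= sub0r normrN normrZ rE nuE cnormE -rmorphM ltcE /= eqxx /=.
  have : normc w * (nu + 1) < cRe r by rewrite -ltr_pdivlMr// ltr_wpDl.
  by have := normc_ge0 w; rewrite mulrDr mulr1; lra.
move=> /H /=; rewrite !fctE /= linearZ /= normrZ nuE !cnormE -!rmorphM lecE /= => /andP[_].
rewrite scale0r addr0 [w *: u + z]addrC opprD addrA => h1.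
rewrite [X in normc X](_ : _ = h (z + w *: u) - h z - w *: 'd h z u); last first.
  by rewrite mulrC.
apply: le_trans h1 _; rewrite mulrCA mulrC -[leRHS]mulr1 -!mulrA ler_wpM2l ?(ltW e0)//.
by rewrite mulrA mulr1 ler_piMl ?normc_ge0// ler_pdivrMl ?ltr_wpDl// mulr1 lerDl.
Qed.

Lemma poly_nonroot_near (P : {poly R[i]}) (d : R) : P != 0 -> 0 < d ->
  exists2 t : R, 0 < t < d & P.[(t%:C)%C] != 0.
Proof.
move=> P0 d0; apply: contrapT => H.
pose pt (i : nat) : R := d / i.+2%:R.
pose rs : seq R[i] := [seq ((pt i)%:C)%C | i <- iota 0 (size P)].
have : (size rs < size P)%N.
  apply: max_poly_roots => //.
    apply/allP => x /mapP[i _ ->]; rewrite /root; apply/negPn/negP => Pt; apply: H.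
    exists (pt i) => //; rewrite divr_gt0//= ltr_pdivrMr// ltr_pMr// ltr1n//.
  rewrite map_inj_uniq ?iota_uniq// => i j [] /(mulfI (lt0r_neq0 d0)) /invr_inj /eqP.
  by rewrite eqr_nat => /eqP [].
by rewrite size_map size_iota ltnn.
Qed.

(** The identity propagates from the real points with p <> 0 to all real
    points by density. A point x + i y of the strip lies on the complex line
    through x with direction y, whose real points are already covered, and the
    identity theorem applies there. *)
Lemma extension_identity p q h (eps : R) : p != 0 -> 0 < eps ->
  (forall z, strip eps z -> hol h z) ->
  (forall xi : Rd, evali p (cpt xi 0) != 0 -> h (cpt xi 0) = evali q (cpt xi 0) / evali p (cpt xi 0)) ->
  forall z, strip eps z -> h z * evali p z = evali q z.
Proof.
move=> p0 eps0 hh hreal.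
pose g z := h z * evali p z - evali q z.
have gh z : strip eps z -> hol g z.
  move=> zs; apply: holB; last exact: hol_evali.
  by apply: holM; [exact: hh|exact: hol_evali].
have enorm0 : enorm (0 : Rd) = 0 by rewrite -(scale0r 0) enormZ normr0 mul0r.
have real_strip (x : Rd) : strip eps (cpt x 0) by apply/stripE; rewrite enorm0.
have greal (x : Rd) : g (cpt x 0) = 0.
  apply/eqP/negPn/negP => gx; have gx0 : 0 < normc (g (cpt x 0)) by rewrite normc_gt0.
  have [gc _] := gh _ (real_strip x); have [r r0 H] := gc _ gx0.
  have [v v0] := lead_form_nonroot p0.
  have [_ cP] := line_poly_top p (cpt x 0) v.
  have P0 : line_poly p (cpt x 0) v != 0.
    apply/eqP => E; move: cP; rewrite E coef0 => /esym/eqP; apply/negP.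
    by rewrite -normc_gt0 normcM normcX normc_iu expr1n mul1r normc_real normr_gt0.
  have [t /andP[t0 tr]] := poly_nonroot_near P0 (divr_gt0 r0 (ltr_wpDl (normr_ge0 v) ltr01)).
  rewrite line_polyE cpt_scale scale0r addr0 => Pt.
  have := H (cpt (x + t *: v) 0); rewrite /g hreal// divfK// subrr sub0r normcN ltxx.
  move=> E; suff: false by []; apply: E => j; rewrite !cpt_coord complexBh normc_real !mxE [x 0 j + _]addrC addrK normrM gtr0_norm//.
  apply: (@le_lt_trans _ _ (t * (`|v| + 1))); last by rewrite -ltr_pdivlMr// ltr_wpDl.
  by rewrite ler_wpM2l ?(ltW t0)// (le_trans (coord_le_norm v j))// lerDl.
move=> z zs; have [x [y zE]] := cptE z; rewrite {z}zE in zs *.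
have y_lt : enorm y < eps by apply: (proj1 (stripE eps x y)).
suff : g (cpt x y) = 0 by move=> /eqP; rewrite subr_eq0 => /eqP.
have [y0|y0] := eqVneq (enorm y) 0.
  rewrite (_ : y = 0) ?greal//; apply/rowP => j; rewrite mxE.
  by have := coord_le_enorm y j; rewrite y0 normr_le0 => /eqP.
have yp : 0 < enorm y by rewrite lt_neqAle eq_sym y0 enorm_ge0.
pose s := (1 + eps / enorm y) / 2.
have sy : 1 < s /\ s * enorm y < eps.
  have : 1 < eps / enorm y by rewrite ltr_pdivlMr// mul1r.
  have : eps / enorm y * enorm y = eps by rewrite divfK.
  rewrite /s; move: (eps / enorm y) => k kE k1; split; first by clear -k1; lra.
  by rewrite -kE ltr_pM2r//; clear -k1; lra.
have [s1 s2] := sy; have s0 : 0 < s by exact: lt_trans s1.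
have := @identity_square R s (fun zeta => g (cpt x 0 + zeta *: cpt y 0)) s0.
move=> /(_ _ _ iu); rewrite normc_iu /iu cpt_scale_im scale0r addr0 scale1r => E.
apply: E; last exact: s1.
- move=> a b _ hb; apply: hol_line; rewrite cpt_scale_im; apply: gh.
  apply/stripE; rewrite enormZ; apply: le_lt_trans s2.
  by rewrite ler_wpM2r ?enorm_ge0// ler_norml.
- by move=> a _; rewrite (_ : (a%:C)%C = Complex a 0)// cpt_scale_im scale0r greal.
Qed.
End Division.

(** * Random vectors and characteristic functions *)

Section RandomVectors.
Variables (R : realType) (n : nat) (d : measure_display) (Om : measurableType d).
Variable P : probability Om R.
Local Notation Rd := 'rV[R]_n.+1.
Local Notation T := (measurableTypeR R).
Implicit Types (f : Rd -> R[i]) (Y : Om -> Rd) (B delta : R).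
Local Opaque cintegralRd ker four gaussC gauss dotp.

Lemma rintegrable_prob_cst (K : R) : rintegrable P (fun _ => K).
Proof.
have : rintegrable P (fun _ => 1 : R).
  apply/rintegrable_ge0 => //; split; first exact: measurable_cst.
  have := @integral_cst _ _ _ P setT measurableT 1%:E; rewrite /= => ->.
  by rewrite probability_setT mul1e ltry.
by move/(rintegrableZ K); under eq_fun do rewrite mulr1.
Qed.

Definition rvector Y := forall j, measurable_fun setT (fun o => Y o 0 j).

Lemma measurable_dotp_rvector Y : rvector Y ->
  measurable_fun setT (fun p : Om * n.+1.-tuple T => dotp (rowof p.2) (Y p.1)).
Proof.
Local Transparent dotp.
move=> Ym; apply: measurable_sum => j.
rewrite (_ : (fun _ => _) = fun p : Om * n.+1.-tuple T => tnth p.2 j * Y p.1 0 j).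
  apply: measurable_funM.
    exact: (measurableT_comp (@measurable_tnth _ T n.+1 j) measurable_snd).
  exact: (measurableT_comp (Ym j) measurable_fst).
by apply/funext => p; rewrite mxE.
Qed.
Local Opaque dotp.

Lemma regularized_vint s f delta B : delta != 0 -> decay 1 B f ->
  vint (fun xi => gaussC (delta *: xi) * four s f xi).
Proof.
move=> dn fd.
have [Gi _] := cintegralRd_affine 0 dn (vint_decay (decay_gaussC R n)).
have Gi' : vint (fun xi : Rd => gaussC (delta *: xi)).
  by move: Gi; under eq_fun do rewrite addr0.
have km : cmeas (fun p : n.+1.-tuple T * n.+1.-tuple T =>
    ker (s * dotp (rowof p.2) (rowof p.1))).
  have := @cmeas_ker_dotp2 R n s; congr cmeas; apply/funext => p.
  by rewrite dotpC.
have k1 (xi y : Rd) : normc (ker (s * dotp y xi)) <= 1 by rewrite normc_ker.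
by have [] := fubini_Rd Gi' (vint_decay fd) km k1.
Qed.

(** By Fubini, averaging the regularized inversion integral over the law of Y
    leaves the characteristic function of Y under the integral sign. *)
Lemma expectation_regularized Y f delta B : rvector Y -> delta != 0 -> decay 1 B f ->
  cintegrable P (fun o => regularized 1 f (Y o) delta) /\
  cintegral P (fun o => regularized 1 f (Y o) delta) =
  cintegralRd (fun xi => gaussC (delta *: xi) * four (- 1) f xi *
    cintegral P (fun o => ker (dotp xi (Y o)))).
Proof.
move=> Ym dn fd; have Gi := regularized_vint (- 1) dn fd.
pose G xi := gaussC (delta *: xi) * four (- 1) f xi.
pose F (p : Om * n.+1.-tuple T) := ker (dotp (rowof p.2) (Y p.1)) * G (rowof p.2).
have Fm : cmeas F.
  apply: cmeasM; first by apply: cmeas_ker; exact: measurable_dotp_rvector.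
  exact: (cmeas_comp (@measurable_snd _ _ _ _) (cintegrable_meas Gi)).
have g1i : rintegrable P (fun _ => 1 : R) by exact: rintegrable_prob_cst.
have g2i := cintegrable_normc Gi.
have Fb o t : normc (F (o, t)) <= 1 * normc (G (rowof t)).
  by rewrite /F normcM normc_ker.
have g20 t : 0 <= normc (G (rowof t)) by exact: normc_ge0.
have E : (fun o => regularized 1 f (Y o) delta) =
    (fun o => cintegral (lebesgue_tuple R n.+1) (fun t => F (o, t))).
  apply/funext => o; rewrite /regularized cintegralRdE; apply: eq_cintegral => t.
  by rewrite /F /G mul1r mulrA.
rewrite E; split; first exact: (cintegrable_fubini g1i g2i (fun=> ler01) g20 Fm Fb).
rewrite (dominated_fubini g1i g2i (fun=> ler01) g20 Fm Fb) cintegralRdE.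
apply: eq_cintegral => t; rewrite -cintegralZ.
  by apply: eq_cintegral => o; rewrite /F mulrC.
apply: (@cintegrable_le _ _ _ _ _ (fun=> 1)) => //.
  apply: (cmeas_comp (measurable_pair2 t) (cmeas_ker (measurable_dotp_rvector Ym))).
by move=> o; rewrite normc_ker.
Qed.

Lemma regularized_bound f x delta B : 0 < delta -> decay 1 B f ->
  normc (regularized 1 f x delta) <= gauss_int R n * (2 * (B * gauss_int R n)).
Proof.
move=> d0 fd; have dn : delta != 0 by rewrite gt_eqF.
have B0 := decay_ge0 fd.
rewrite (regularizedE x (expr1n _ 2) d0 fd) normcM normc_real gtr0_norm ?gauss_int_gt0//.
rewrite ler_wpM2l ?(ltW (gauss_int_gt0 R n))//.
have [f1 _] := cintegralRd_affine x dn (vint_decay fd).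
have [gm _] := decay_gaussC R n.
have -> : B * gauss_int R n = Rintegral (lebesgue_tuple R n.+1) setT (fun t => B * gauss (rowof t)).
  by rewrite RintegralZl//; exact: rvint_gauss.
apply: normc_cintegral_le.
- by apply: cmeasM; [exact: cintegrable_meas f1|exact: gm].
- move=> t; rewrite normcM [normc (gaussC _)]normc_real gtr0_norm ?gauss_gt0//.
  rewrite ler_wpM2r ?(ltW (gauss_gt0 _))//; have [_ H] := fd.
  apply: le_trans (H _) _; rewrite expr1 ler_pdivrMr ?bracket_gt0//.
  by rewrite ler_peMr// bracket_ge1.
- by apply: rintegrableZ; exact: rvint_gauss.
Qed.

(** The scale delta tends to 0 under the expectation, by dominated
    convergence; the factor is the constant of Fourier inversion. *)
Lemma law_of_charfun Y1 Y2 f B : rvector Y1 -> rvector Y2 ->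
  (forall xi, cintegral P (fun o => ker (dotp xi (Y1 o))) =
              cintegral P (fun o => ker (dotp xi (Y2 o)))) ->
  vcont f -> decay 1 B f ->
  cintegral P (fun o => ((gauss_int R n ^+ 2)%:C)%C * f (Y1 o)) =
  cintegral P (fun o => ((gauss_int R n ^+ 2)%:C)%C * f (Y2 o)).
Proof.
move=> Y1m Y2m E fc fd.
pose K := gauss_int R n * (2 * (B * gauss_int R n)).
have Ki : rintegrable P (fun _ => K) by exact: rintegrable_prob_cst.
have dn m : (m.+1%:R : R)^-1 != 0 by rewrite invr_eq0 pnatr_eq0.
have d0 m : 0 < (m.+1%:R : R)^-1 by rewrite invr_gt0.
have lim Y : rvector Y -> forall e : R, 0 < e -> exists N, forall m, (N <= m)%N ->
    normc (cintegral P (fun o => regularized 1 f (Y o) (m.+1%:R)^-1) -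
      cintegral P (fun o => ((gauss_int R n ^+ 2)%:C)%C * f (Y o))) < e.
  move=> Ym; apply: (cintegral_cvg Ki).
  - by move=> m; have [/cintegrable_meas] := expectation_regularized Ym (dn m) fd.
  - by move=> o; exact: (regularized_cvg_point _ (expr1n _ 2) fc fd).
  - by move=> m o; exact: (regularized_bound _ (d0 m) fd).
apply: (climit_unique (lim Y1 Y1m)) => e /(lim Y2 Y2m)[N H]; exists N => m /H.
have [_ E1] := expectation_regularized Y1m (dn m) fd.
have [_ E2] := expectation_regularized Y2m (dn m) fd.
have -> : cintegral P (fun o => regularized 1 f (Y1 o) (m.+1%:R)^-1) =
    cintegral P (fun o => regularized 1 f (Y2 o) (m.+1%:R)^-1); last exact.
by rewrite E1 E2; congr cintegralRd; apply/funext => xi; rewrite E.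
Qed.
End RandomVectors.

(** * Probabilities of boxes *)

Section BoxProbabilities.
Variables (R : realType) (n : nat) (d : measure_display) (Om : measurableType d).
Variable P : probability Om R.
Local Notation Rd := 'rV[R]_n.+1.
Local Notation T := (measurableTypeR R).
Implicit Types (f : Rd -> R[i]) (Y : Om -> Rd).
Local Opaque cintegralRd.

Definition clamp01 (u : R) : R := Num.max 0 (Num.min 1 u).

Lemma clamp01_ge0 u : 0 <= clamp01 u. Proof. by rewrite /clamp01 le_max lexx. Qed.
Lemma clamp01_le1 u : clamp01 u <= 1.
Proof. by rewrite /clamp01 ge_max ler01 ge_min lexx. Qed.
Lemma clamp01_0 u : u <= 0 -> clamp01 u = 0.
Proof.
by move=> u0; rewrite /clamp01; apply/max_idPl; rewrite ge_min u0 orbT.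
Qed.
Lemma clamp01_1 u : 1 <= u -> clamp01 u = 1.
Proof. by move=> u1; rewrite /clamp01 (min_idPl u1); apply/max_idPr. Qed.

Lemma measurable_clamp01 : measurable_fun setT clamp01.
Proof.
apply: measurable_maxr; first exact: measurable_cst.
by apply: measurable_minr; [exact: measurable_cst|exact: measurable_id].
Qed.

(** A continuous approximation from below of the indicator of an open box. *)
Definition tent (a b : Rd) (m : nat) (x : Rd) : R :=
  \prod_j (clamp01 (m%:R * (x 0 j - a 0 j)) * clamp01 (m%:R * (b 0 j - x 0 j))).
Definition in_box (a b : Rd) : set Rd := [set x | forall j, a 0 j < x 0 j < b 0 j].

Lemma vcont_prod (I : Type) (r : seq I) (F : I -> Rd -> R[i]) :
  (forall i, vcont (F i)) -> vcont (fun x => \prod_(i <- r) F i x).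
Proof.
move=> Fc; elim: r => [|i r IH].
  move=> x e e0; exists 1 => // y _.
  by rewrite !big_nil subrr normc0.
rewrite (_ : (fun x => _) = fun x => F i x * \prod_(j <- r) F j x); first exact: vcontM.
by apply/funext => y; rewrite big_cons.
Qed.

Lemma vcont_clamp (k c : R) j : vcont (fun x : Rd => ((clamp01 (k * (x 0 j - c)))%:C)%C).
Proof.
move=> x e e0; have k0 : 0 < `|k| + 1 by rewrite ltr_wpDl.
exists (e / (`|k| + 1)); first by rewrite divr_gt0.
move=> y /(_ j) yx; rewrite -rmorphB normc_real.
apply: le_lt_trans (clamp_lipschitz _ _ ler01) _.
rewrite -mulrBr opprB addrA subrK normrM.
move: yx; rewrite ltr_pdivlMr//; have := normr_ge0 (y 0 j - x 0 j).
by rewrite mulrDr mulr1 mulrC; lra.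
Qed.

Lemma tent_vcont a b m : vcont (fun x => ((tent a b m x)%:C)%C).
Proof.
rewrite (_ : (fun x : Rd => _) = fun x : Rd => \prod_j (((clamp01 (m%:R * (x 0 j - a 0 j)))%:C)%C *
    ((clamp01 (- m%:R * (x 0 j - b 0 j)))%:C)%C)).
  by apply: vcont_prod => j; apply: vcontM; exact: vcont_clamp.
apply/funext => x; rewrite /tent rmorph_prod; apply: eq_bigr => j _.
by rewrite rmorphM mulNr -mulrN opprB.
Qed.

Lemma tent_ge0 a b m x : 0 <= tent a b m x.
Proof. by apply: prodr_ge0 => j _; rewrite mulr_ge0 ?clamp01_ge0. Qed.

Lemma tent_le1 a b m x : tent a b m x <= 1.
Proof.
by apply: prodr_ile1 => j _; rewrite mulr_ge0 ?clamp01_ge0//= mulr_ile1 ?clamp01_ge0 ?clamp01_le1.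
Qed.

Lemma tent_out a b m x : ~ in_box a b x -> tent a b m x = 0.
Proof.
move=> /existsNP[j /negP]; rewrite negb_and -!leNgt => H.
rewrite /tent (bigD1 j)//=; apply/eqP; rewrite mulf_eq0; apply/orP; left.
case/orP: H => h; rewrite mulf_eq0; apply/orP; [left|right]; apply/eqP/clamp01_0;
  by rewrite mulr_ge0_le0// subr_le0.
Qed.

Lemma tent_in a b x : in_box a b x -> exists N, forall m, (N <= m)%N -> tent a b m x = 1.
Proof.
move=> H; have h1 j : 0 < x 0 j - a 0 j by rewrite subr_gt0; have /andP[] := H j.
have h2 j : 0 < b 0 j - x 0 j by rewrite subr_gt0; have /andP[] := H j.
pose bd j := maxn (Num.bound (x 0 j - a 0 j)^-1) (Num.bound (b 0 j - x 0 j)^-1).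
exists (\max_j bd j)%N => m Nm; rewrite /tent big1// => j _.
have Nj : (bd j <= m)%N by apply: leq_trans Nm; exact: leq_bigmax.
move: Nj; rewrite /bd geq_max => /andP[m1 m2].
have big (u : R) : 0 < u -> (Num.bound u^-1 <= m)%N -> 1 <= m%:R * u.
  move=> u0 um; rewrite -ler_pdivrMr// mul1r.
  have ui : 0 <= u^-1 by rewrite invr_ge0 ltW.
  by apply: le_trans (ltW (archi_boundP ui)) _; rewrite ler_nat.
by rewrite !clamp01_1 ?mulr1//; exact: big.
Qed.

Lemma tent_decay a b m : exists B, decay 1 B (fun x => ((tent a b m x)%:C)%C).
Proof.
exists (\prod_j (1 + (`|a 0 j| + `|b 0 j|) ^+ 2)); split.
  exact: vcont_vmeas (tent_vcont a b m).
move=> x; rewrite normc_real ger0_norm ?tent_ge0// expr1.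
have B0 : 0 <= \prod_j (1 + (`|a 0 j| + `|b 0 j|) ^+ 2).
  by apply: prodr_ge0 => j _; rewrite addr_ge0// sqr_ge0.
have [xb|xb] := pselect (in_box a b x); last first.
  by rewrite tent_out// divr_ge0// bracket_ge0.
apply: le_trans (tent_le1 a b m x) _.
rewrite ler_pdivlMr ?bracket_gt0// mul1r; apply: ler_prod => j _.
rewrite addr_ge0 ?sqr_ge0//= lerD2l -(real_normK (num_real (x 0 j))) lerXn2r ?nnegrE ?addr_ge0//.
have /andP[h1 h2] := xb j.
have := ler_norm (b 0 j); have := ler_norm (- a 0 j); rewrite normrN.
have := normr_ge0 (a 0 j); have := normr_ge0 (b 0 j).
by move: (`|a 0 j|) (`|b 0 j|) => u v v0 u0 hu hv; rewrite ler_norml; apply/andP; split; clear -h1 h2 hu hv u0 v0; lra.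
Qed.

(** Tents converge pointwise to the indicator of the open box. *)
Lemma box_prob_of_charfun Y1 Y2 a b : rvector Y1 -> rvector Y2 ->
  (forall xi, cintegral P (fun o => ker (dotp xi (Y1 o))) =
              cintegral P (fun o => ker (dotp xi (Y2 o)))) ->
  P (Y1 @^-1` in_box a b) = P (Y2 @^-1` in_box a b).
Proof.
move=> Y1m Y2m E; have c0 := gauss_int_gt0 R n.
set c := gauss_int R n in c0; have c20 : 0 < c ^+ 2 by rewrite exprn_gt0.
have boxm Y : rvector Y -> measurable (Y @^-1` in_box a b).
  move=> Ym; rewrite (_ : _ @^-1` _ = \bigcap_(j in [set: 'I_n.+1])
     ((fun o => Y o 0 j) @^-1` [set` `]a 0 j, b 0 j[])).
    apply: fin_bigcap_measurable => // j _.
    by have := Ym j measurableT [set` `]a 0 j, b 0 j[] (measurable_itv _); rewrite setTI.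
  apply/seteqP; split => o /=.
    by move=> H j _; have := H j; rewrite /= in_itv.
  by move=> H j; have := H j I; rewrite /= in_itv.
have one_i (K : R) : rintegrable P (fun _ => K) by exact: rintegrable_prob_cst.
pose J Y := cintegral P (fun o => ((c ^+ 2)%:C)%C * ((\1_(Y @^-1` in_box a b) o)%:C)%C).
have lim Y : rvector Y -> forall e : R, 0 < e -> exists N, forall m, (N <= m)%N ->
   normc (cintegral P (fun o => ((c ^+ 2)%:C)%C * ((tent a b m (Y o))%:C)%C) - J Y) < e.
  move=> Ym; apply: (cintegral_cvg (one_i (c ^+ 2))).
  - move=> m; apply: cmeasM; first exact: cmeas_cst.
    apply: cmeas_real; apply: measurable_prod => j _; apply: measurable_funM.
      apply: (measurableT_comp measurable_clamp01); apply: measurable_funM; first exact: measurable_cst.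
      by apply: measurable_funB; [exact: Ym|exact: measurable_cst].
    apply: (measurableT_comp measurable_clamp01); apply: measurable_funM; first exact: measurable_cst.
    by apply: measurable_funB; [exact: measurable_cst|exact: Ym].
  - move=> o e e0; rewrite indicE.
    have [yb|yb] := pselect (in_box a b (Y o)).
      have [N HN] := tent_in yb; exists N => m /HN ->.
      by rewrite mem_set// subrr normc0.
    exists 0%N => m _; rewrite (tent_out m yb) memNset// subrr normc0//.
  - move=> m o; rewrite normcM !normc_real ger0_norm ?(ltW c20)// ger0_norm ?tent_ge0//.
    by rewrite ler_piMr ?(ltW c20)// tent_le1.
have JE : J Y1 = J Y2.
  apply: (climit_unique (lim Y1 Y1m)) => e /(lim Y2 Y2m)[N H]; exists N => m /H.
  have [B td] := tent_decay a b m.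
  by rewrite (law_of_charfun Y1m Y2m E (tent_vcont a b m) td).
have JP Y : rvector Y -> J Y = ((c ^+ 2 * fine (P (Y @^-1` in_box a b)))%:C)%C.
  move=> Ym; rewrite /J.
  have -> : (fun o => ((c ^+ 2)%:C)%C * ((\1_(Y @^-1` in_box a b) o)%:C)%C) =
     (fun o => ((c ^+ 2 * \1_(Y @^-1` in_box a b) o)%:C)%C).
    by apply/funext => o; rewrite -rmorphM.
  rewrite cintegral_real; congr ((_)%:C)%C.
  have ii : rintegrable P (\1_(Y @^-1` in_box a b)).
    apply: rintegrable_le (one_i 1); first exact: measurable_indic (boxm _ Ym).
    by move=> o; rewrite indicE; case: (_ \in _); rewrite /= ?normr1 ?normr0.
  rewrite RintegralZl//; congr (_ * _); rewrite /Rintegral; congr fine.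
  by rewrite integral_indic ?setIT//; exact: boxm.
have := JE; rewrite !JP// => -[] /(mulfI (lt0r_neq0 c20)) H.
have fin A : measurable A -> P A \is a fin_num by move=> ?; exact: fin_num_measure.
by rewrite -(fineK (fin _ (boxm _ Y1m))) H (fineK (fin _ (boxm _ Y2m))).
Qed.
End BoxProbabilities.

(** * The law of a random ultradistribution *)

Section BorelComplex.
Context d (T : measurableType d) (R : realType).

(** An open subset of the plane is a countable union of rational squares. *)
Lemma cmeas_borelC (f : T -> R[i]) (B : set R[i]) : cmeas f -> borelC B ->
  measurable (f @^-1` B).
Proof.
move=> [f1 f2].
apply: (@smallest_sub _ (sigma_algebra setT) _ [set B | measurable (f @^-1` B)]).
  split => /=.
  - by rewrite preimage_set0.
  - by move=> A mA; rewrite setTD preimage_setC; exact: measurableC.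
  - by move=> F mF; rewrite preimage_bigcup; exact: bigcupT_measurable.
move=> U Uo /=.
pose box (q : rat * rat * rat) : set R[i] :=
  [set z | `|cRe z - ratr q.1.1| < ratr q.2 /\ `|cIm z - ratr q.1.2| < ratr q.2].
have boxm q : measurable (f @^-1` box q).
  have m1 := f1 measurableT _ (measurable_ball (ratr q.1.1 : R) (ratr q.2)).
  have m2 := f2 measurableT _ (measurable_ball (ratr q.1.2 : R) (ratr q.2)).
  rewrite setTI in m1; rewrite setTI in m2; have := measurableI _ _ m1 m2.
  congr measurable; apply/seteqP; split => x; rewrite /ball /= => -[h1 h2]; split;
    by rewrite distrC.
rewrite (_ : f @^-1` U = \bigcup_q (if `[< box q `<=` U >] then f @^-1` box q else set0)).
  apply: countable_bigcupT_measurable; first exact: countableP.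
  by move=> q; case: asboolP => _ //; exact: boxm.
apply/seteqP; split => x; last by case=> q _; case: asboolP => // qU; exact: qU.
move=> /= Ux; move: Uo; rewrite /= openE => /(_ _ Ux) /nbhs_ballP[r /= r0 H].
have rE : r = ((cRe r)%:C)%C by move: r0; rewrite ltcE => /andP[/eqP /= E _]; apply: cplx_eq.
have rR : 0 < cRe r by move: r0; rewrite ltcE => /andP[].
have [s] := rat_in_itvoo (divr_gt0 rR (ltr0n R 4)).
rewrite in_itv/= => /andP[s0 sr].
have rat_near (u : R) : exists q : rat, `|u - ratr q| < ratr s.
  have [|q] := @rat_in_itvoo R (u - ratr s) (u + ratr s); first by clear -s0; lra.
  rewrite in_itv/= => /andP[q1 q2]; exists q; rewrite distrC ltr_norml.
  by apply/andP; clear -q1 q2; lra.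
have [q1 h1] := rat_near (cRe (f x)); have [q2 h2] := rat_near (cIm (f x)).
exists (q1, q2, s) => //; case: asboolP => [_|]; first by split.
case => z [z1 z2]; apply: H; rewrite -ball_normE /= cnormE rE ltcE /= eqxx /=.
have half (a b c : R) : `|a - c| < ratr s -> `|b - c| < ratr s -> `|a - b| < cRe r / 2.
  move=> ha hb; rewrite -(subrK c a) -addrA (le_lt_trans (ler_normD _ _))//.
  by rewrite [`|c - b|]distrC; clear -ha hb sr; lra.
rewrite (le_lt_trans (normc_le_ReIm _))// !ReImE [ltRHS]splitr ltrD//.
  exact: half h1 z1.
exact: half h2 z2.
Qed.

Lemma borelC_Re (c : R) : borelC [set z : R[i] | c < cRe z].
Proof.
apply: sub_gen_smallest => /=; rewrite openE => z /= cz; apply/nbhs_ballP.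
exists (((cRe z - c)%:C)%C); first by rewrite /= ltcE /= eqxx subr_gt0.
move=> y; rewrite -ball_normE /= cnormE ltcE /= eqxx /= => h.
have := le_lt_trans (Re_le_normc _) h; rewrite !ReImE ltr_norml => /andP[_ h1].
by clear -h1; lra.
Qed.

Lemma borelC_Im (c : R) : borelC [set z : R[i] | c < cIm z].
Proof.
apply: sub_gen_smallest => /=; rewrite openE => z /= cz; apply/nbhs_ballP.
exists (((cIm z - c)%:C)%C); first by rewrite /= ltcE /= eqxx subr_gt0.
move=> y; rewrite -ball_normE /= cnormE ltcE /= eqxx /= => h.
have := le_lt_trans (Im_le_normc _) h; rewrite !ReImE ltr_norml => /andP[_ h1].
by clear -h1; lra.
Qed.
End BorelComplex.

Section UltradistributionLaws.
Variables (R : realType) (n : nat) (w : 'rV[R]_n.+1 -> R).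
Hypothesis wt : tame_weight w.
Local Notation Rd := 'rV[R]_n.+1.
Local Notation S := (test_function w).
Local Notation S' := (ultradistributionC w).
Implicit Types (f g h : S).

Lemma test_temp f : tempered w f. Proof. exact: (test_tempered wt (testP f)). Qed.

Definition mktest (g : Rd -> R[i]) (gt : tempered w g) : S := TestFunction (tempered_test wt gt).

Lemma pairing_ext (u : ultradistribution w) f g : (forall x, f x = g x) -> u f = u g.
Proof.
move=> fg; have := @pairing_linear _ _ _ u 0 f g f.
by rewrite mul0r add0r; apply => x; rewrite mul0r add0r.
Qed.

Lemma pairing0 (u : ultradistribution w) (h : S) : (forall x, h x = 0) -> u h = 0.
Proof.
move=> h0; have := @pairing_linear _ _ _ u (-1) h h h.
by rewrite mulN1r addNr; apply => x; rewrite h0 mulr0 addr0.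
Qed.

Lemma tempered0 f : tempered w (fun _ => 0).
Proof.
rewrite (_ : (fun _ => 0) = (fun x => (-1) * f x + f x)).
  exact: (tempered_linear wt (-1) (test_temp f) (test_temp f)).
by apply/funext => x; rewrite mulN1r addNr.
Qed.

Lemma cylinder_measurable f (B : set R[i]) : borelC B ->
  measurable [set u : S' | B ((u : ultradistribution w) f)].
Proof.
move=> Bb; apply: sub_gen_smallest; exists 1%N, (fun _ => f), B; split => //.
by apply/seteqP; split => [u /= Bu _ //|u /= H]; exact: (H ord0).
Qed.

Lemma cmeas_pairing f : cmeas (fun u : S' => (u : ultradistribution w) f).
Proof.
split; apply: (measurability _ (RGenOInfty.measurableE R)) => _ [_ [a ->] <-]; rewrite setTI.
- have := cylinder_measurable f (borelC_Re a); congr measurable.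
  by apply/seteqP; split => u /=; rewrite in_itv /= andbT.
- have := cylinder_measurable f (borelC_Im a); congr measurable.
  by apply/seteqP; split => u /=; rewrite in_itv /= andbT.
Qed.

(** Real parts suffice because Im <u,f> = Re <u,- i f>. In this form the boxes
    are a pi-system that generates the cylindrical sigma-algebra. *)
Definition cyl_box : set (set S') :=
  [set A | exists (k : nat) (f : 'I_k -> S) (a b : 'I_k -> R),
     A = [set u : S' | forall j, a j < cRe ((u : ultradistribution w) (f j)) < b j]].

Lemma cyl_boxI : setI_closed cyl_box.
Proof.
move=> A B [k [f [a [b ->]]]] [l [g [c [e ->]]]].
pose glue X (u : 'I_k -> X) (v : 'I_l -> X) (j : 'I_(k + l)) : X :=
  match fintype.split j with inl i => u i | inr i => v i end.
exists (k + l)%N, (glue S f g), (glue R a c), (glue R b e).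
apply/seteqP; split => u /=.
  by move=> [h1 h2] j; rewrite /glue; case: (fintype.split j).
move=> H; split => j.
  by have := H (lshift l j); rewrite /glue (unsplitK (inl j)).
by have := H (rshift k j); rewrite /glue (unsplitK (inr j)).
Qed.

Lemma cyl_boxE : @measurable _ S' = <<s cyl_box >>.
Proof.
apply/seteqP; split; last first.
  apply: smallest_sub; first exact: sigma_algebra_measurable.
  move=> _ [k [f [a [b ->]]]].
  rewrite (_ : [set u | _] = \bigcap_(j in [set: 'I_k])
     ((fun u : S' => cRe ((u : ultradistribution w) (f j))) @^-1` [set` `]a j, b j[])).
    apply: fin_bigcap_measurable => // j _; have [m1 _] := cmeas_pairing (f j).
    by have := m1 measurableT [set` `]a j, b j[] (measurable_itv _); rewrite setTI.
  apply/seteqP; split => u /=.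
    by move=> H j _; have := H j; rewrite /= in_itv.
  by move=> H j; have := H j I; rewrite /= in_itv.
apply: smallest_sub; first exact: smallest_sigma_algebra.
move=> _ [k [f [B [Bb ->]]]].
pose X := g_sigma_algebraType cyl_box.
have re_meas g : measurable_fun setT (fun u : X => cRe ((u : ultradistribution w) g)).
  apply: (measurability _ (RGenOpens.measurableE R)) => _ [_ [a [b ->]] <-]; rewrite setTI.
  apply: sub_gen_smallest; exists 1%N, (fun=> g), (fun=> a), (fun=> b).
  apply/seteqP; split => u /=; first by rewrite in_itv.
  by move=> /(_ ord0); rewrite in_itv.
have im_meas g : measurable_fun setT (fun u : X => cIm ((u : ultradistribution w) g)).
  have ft' := tempered_linear wt (- iu) (test_temp g) (tempered0 g).
  have E (u : ultradistribution w) : cIm (u g) = cRe (u (mktest ft')).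
    have -> : u (mktest ft') = - iu * u g + u (mktest (tempered0 g)).
      exact: (@pairing_linear _ _ _ u (- iu) g (mktest (tempered0 g)) (mktest ft')).
    rewrite (@pairing0 u (mktest (tempered0 g)) (fun=> erefl)) addr0.
    by case: (u g) => a1 b1; rewrite !ReImE /=; ring.
  have := re_meas (mktest ft'); congr (measurable_fun _); apply/funext => u.
  by rewrite E.
have pair_meas g : cmeas (fun u : X => (u : ultradistribution w) g) by split.
rewrite (_ : [set u | _] = \bigcap_(j in [set: 'I_k])
     ((fun u : X => (u : ultradistribution w) (f j)) @^-1` B)); last first.
  apply/seteqP; split => u /= H; first by move=> j _; exact: H.
  by move=> j; exact: (H j I).
have : @measurable _ X (\bigcap_(j in [set: 'I_k])
     ((fun u : X => (u : ultradistribution w) (f j)) @^-1` B)).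
  apply: fin_bigcap_measurable => // j _; exact: cmeas_borelC (pair_meas _) Bb.
exact.
Qed.

Lemma tempered_Re f : tempered w (fun x => ((cRe (f x))%:C)%C).
Proof.
rewrite (_ : (fun x => _) = (fun x => 2^-1 * f x + (2^-1 * conjc (f x) + 0))).
  have cf := tempered_conj wt (test_temp f).
  exact: (tempered_linear wt _ (test_temp f) (tempered_linear wt _ cf (tempered0 f))).
apply/funext => x; have n2 : (2^-1 : R[i]) = ((2^-1)%:C)%C by rewrite fmorphV rmorph_nat.
by rewrite n2; apply: cplx_eq; rewrite !ReImE /=; field.
Qed.

Lemma tempered_Im f : tempered w (fun x => ((cIm (f x))%:C)%C).
Proof.
rewrite (_ : (fun x => _) = (fun x => - (iu / 2) * f x + ((iu / 2) * conjc (f x) + 0))).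
  have cf := tempered_conj wt (test_temp f).
  exact: (tempered_linear wt _ (test_temp f) (tempered_linear wt _ cf (tempered0 f))).
apply/funext => x; have n2 : (2^-1 : R[i]) = ((2^-1)%:C)%C by rewrite fmorphV rmorph_nat.
by rewrite n2; apply: cplx_eq; rewrite !ReImE /=; field.
Qed.

Definition Re_test f : S := mktest (tempered_Re f).
Definition Im_test f : S := mktest (tempered_Im f).

Definition real_ultra (u : ultradistribution w) :=
  forall f, (forall x, cIm (f x) = 0) -> cIm (u f) = 0.

(** Linearity splits u f into u (Re f) + i u (Im f), and both pairings are
    real. *)
Lemma real_ultra_Re (u : ultradistribution w) f : real_ultra u ->
  (cRe (u f))%:C%C = u (Re_test f).
Proof.
move=> ur; have E : u f = iu * u (Im_test f) + u (Re_test f).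
  apply: pairing_linear => x /=.
  by apply: cplx_eq; rewrite !ReImE /=; ring.
have r1 : cIm (u (Re_test f)) = 0 by apply: ur.
have r2 : cIm (u (Im_test f)) = 0 by apply: ur.
by rewrite E; apply: cplx_eq; rewrite !ReImE /= ?r1 ?r2; ring.
Qed.

Lemma tempered_comb k (xi : 'I_k -> R) (f : 'I_k -> S) (f0 : S) :
  tempered w (fun x => \sum_j ((xi j)%:C)%C * f j x).
Proof.
elim: (index_enum _) => [|j r IH].
  rewrite (_ : (fun x => _) = fun=> 0); first exact: tempered0 f0.
  by apply/funext => x; rewrite big_nil.
rewrite (_ : (fun x => _) = (fun x => ((xi j)%:C)%C * f j x +
    \sum_(j <- r) ((xi j)%:C)%C * f j x)).
  exact: (tempered_linear wt _ (test_temp (f j)) IH).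
by apply/funext => x; rewrite big_cons.
Qed.

Lemma pairing_sum k (xi : 'I_k -> R) (f : 'I_k -> S) (u : ultradistribution w) (h : S) :
  (forall x, h x = \sum_j ((xi j)%:C)%C * f j x) ->
  u h = \sum_j ((xi j)%:C)%C * u (f j).
Proof.
elim: (index_enum _) h => [|j r IH] h hE.
  by rewrite big_nil; apply: pairing0 => x; rewrite hE big_nil.
pose g x := h x - ((xi j)%:C)%C * f j x.
have gt : tempered w g.
  rewrite (_ : g = fun x => - ((xi j)%:C)%C * f j x + h x).
    exact: (tempered_linear wt _ (test_temp (f j)) (test_temp h)).
  by apply/funext => x; rewrite /g mulNr addrC.
rewrite big_cons -(IH (mktest gt)); last first.
  by move=> x /=; rewrite /g hE big_cons addrC addKr.
by apply: pairing_linear => x /=; rewrite /g addrC subrK.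
Qed.

Section TwoProcesses.
Context d (Om : measurableType d) (P : probability Om R).
Variables L1 L2 : {mfun Om >-> S'}.
Hypothesis L1r : forall o, real_ultra (L1 o).
Hypothesis L2r : forall o, real_ultra (L2 o).
Hypothesis char_eq : forall f, (forall x, cIm (f x) = 0) ->
  cintegral P (fun o => cexp (iu * (L1 o : ultradistribution w) f)) =
  cintegral P (fun o => cexp (iu * (L2 o : ultradistribution w) f)).

(** The characteristic function of the vector of the Re <L,f_j> at xi is the
    characteristic functional at the real part of the combination of the f_j
    with coefficients xi_j. *)
Lemma box_prob_eq (A : set S') : cyl_box A -> distribution P L1 A = distribution P L2 A.
Proof.
move=> [[|k] [f [a [b ->]]]].
  by congr (P _); apply/seteqP; split => o _ [].
pose Y (L : {mfun Om >-> S'}) o : 'rV[R]_k.+1 :=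
  \row_j cRe ((L o : ultradistribution w) (f j)).
pose av : 'rV[R]_k.+1 := \row_j a j; pose bv : 'rV[R]_k.+1 := \row_j b j.
have Ym (L : {mfun Om >-> S'}) : rvector (Y L).
  move=> j; have [m1 _] := cmeas_pairing (f j).
  have := measurableT_comp m1 (measurable_funPT L).
  by congr (measurable_fun _); apply/funext => o; rewrite /= mxE.
have boxE (L : {mfun Om >-> S'}) : L @^-1` [set u : S' | forall j, a j < cRe ((u : ultradistribution w) (f j)) < b j] =
   Y L @^-1` in_box av bv.
  by apply/seteqP; split => o /= H j; have := H j; rewrite /Y !mxE.
rewrite /distribution /pushforward !boxE; apply: box_prob_of_charfun => // xi.
pose F := mktest (tempered_comb (fun j => xi 0 j) f (f ord0)).
have kerE (L : {mfun Om >-> S'}) o : (forall o, real_ultra (L o)) ->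
    ker (dotp xi (Y L o)) = cexp (iu * (L o : ultradistribution w) (Re_test F)).
  move=> Lr; rewrite /ker -real_ultra_Re// (pairing_sum (h := F) _ (fun x => erefl)).
  congr (cexp (iu * ((_)%:C)%C)); rewrite Re_sum /dotp; apply: eq_bigr => j _.
  by rewrite mxE; case: ((L o : ultradistribution w) (f j)) => a1 b1 /=; rewrite mul0r subr0.
transitivity (cintegral P (fun o => cexp (iu * (L1 o : ultradistribution w) (Re_test F)))).
  by apply: eq_cintegral => o; exact: kerE.
rewrite char_eq//; apply: eq_cintegral => o; exact/esym/kerE.
Qed.

(** Probability measures that agree on a generating pi-system are equal. *)
Lemma same_law_of_char : same_law P L1 L2.
Proof.
move=> A mA; pose g (k : nat) : set S' := setT.
have gG k : cyl_box (g k).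
  have e0 : 'I_0 -> S by case.
  exists 0%N, e0, (fun=> 0), (fun=> 0).
  by apply/seteqP; split => u // _ [].
apply: (@measure_unique _ R S' cyl_box g cyl_boxE cyl_boxI gG _ _ _ _ _ A mA).
- by apply/seteqP; split => // u _; exists 0%N.
- exact: box_prob_eq.
- move=> k; apply: (@le_lt_trans _ _ (P setT)); first exact: lexx.
  by rewrite probability_setT ltry.
Qed.
End TwoProcesses.
End UltradistributionLaws.

(** * Pullback of ultradistributions *)

Section Pullback.
Variables (R : realType) (n : nat) (w : 'rV[R]_n.+1 -> R).
Hypothesis wt : tame_weight w.
Local Notation Rd := 'rV[R]_n.+1.
Local Notation S := (test_function w).
Local Notation S' := (ultradistributionC w).
Local Opaque cintegralRd fourier.

(** Continuous linear operators of S_omega. The bounds concern A f and its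
    Fourier transform only; [tempered_bounds] supplies the derivatives. *)
Record toperator (A : (Rd -> R[i]) -> (Rd -> R[i])) : Prop := TOperator {
  top_temp : forall f, tempered w f -> tempered w (A f);
  top_lin : forall c f g, tempered w f -> tempered w g ->
    A (fun x => c * f x + g x) = fun x => c * A f x + A g x;
  top_dom : dominated w A;
  top_domF : dominated w (fun f => fourier (A f))
}.

Lemma toperator_Tmul h : symbol h -> toperator (Tmul h).
Proof.
move=> hs; split.
- by move=> f ft; have [] := Tmul_tempered wt hs ft.
- by move=> c f g; exact: Tmul_linear.
- exact: dominated_Tmul.
- move=> eta e0; have [e1 [K1 [e10 K10 H1]]] := dominated_symbol wt hs e0.
  exists e1, K1; split => // f A ft fA gA; have [_ ->] := Tmul_tempered wt hs ft.
  exact: H1.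
Qed.

Lemma toperator_translate (t : Rd) : toperator (fun f x => f (x - t)).
Proof.
split.
- by move=> f; exact: tempered_translate.
- by move=> c f g _ _.
- move=> eta e0; exists eta, (expR (eta * w t)); split; [exact: e0|exact: expR_ge0|].
  move=> f A ft fA gA x; have A0 := wbound_ge0 fA.
  rewrite (le_trans (fA _))// [leRHS]mulrAC mulrC ler_wpM2r// -expRD ler_expR.
  have : w x <= w (x - t) + w t by rewrite -{1}(subrK t x) wD.
  move/(ler_wpM2l (ltW e0)); rewrite mulrDr.
  by move: (eta * w x) (eta * w (x - t)) (eta * w t) => a b c; clear; lra.
- move=> eta e0; exists eta, 1; split => // f A ft fA gA x.
  have [fr _] := tempered_rapid wt ft.
  by rewrite (fourier_translate t fr) normcM normc_ker !mul1r gA.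
Qed.

(** By linearity it is enough to bound A (g - f); finitely many seminorms are
    treated one after another. *)
Lemma seminorm_dominated A (f : S) (sq : seq (multinom n.+1 * R)) (dl : R) :
  toperator A -> 0 < dl ->
  exists (s : seq (multinom n.+1 * R)) (dl' : R), 0 < dl' /\ forall g : S,
    seminorm_ball f s dl' g -> forall i, i \in sq -> 0 < i.2 ->
      (p_norm w i.1 i.2 (fun x => (A g x - A f x)%R) < dl%:E)%E /\
      (pi_norm w i.1 i.2 (fun x => (A g x - A f x)%R) < dl%:E)%E.
Proof.
move=> [At Al Ad AdF] dl0; elim: sq => [|i sq [s1 [d1 [d10 H1]]]].
  by exists [::], 1; split.
have [i0|i0] := leP i.2 0.
  exists s1, d1; split => // g gb j; rewrite inE => /orP[/eqP ->|]; last exact: H1.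
  by rewrite ltNge i0.
have [e1 [K1 [e10 K10 B1]]] := tempered_bounds wt i.1 i0.
have [e2 [K2 [e20 K20 B2]]] := Ad e1 e10; have [e3 [K3 [e30 K30 B3]]] := AdF e1 e10.
pose eta := Num.max e2 e3; have eta0 : 0 < eta by rewrite lt_max e20.
pose KK := Num.max K2 K3; have KK0 : 0 <= KK by rewrite le_max K20.
pose K := K1 * KK; have K0 : 0 <= K by exact: mulr_ge0.
have Kp : 0 < K + 1 by rewrite ltr_wpDl.
pose d2 := Num.min d1 (dl / (K + 1)).
have d20 : 0 < d2 by rewrite lt_min d10 divr_gt0.
exists ((@mnm0 n.+1, eta) :: s1), d2; split => // g gb j.
have gb1 : seminorm_ball f s1 d1 g.
  move=> k ks k0; have [|h1 h2] := gb k _ k0; first by rewrite inE ks orbT.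
  have dd : (d2%:E <= d1%:E)%E by rewrite lee_fin ge_min lexx.
  by split; [exact: lt_le_trans h1 dd|exact: lt_le_trans h2 dd].
rewrite inE => /orP[/eqP ->|js] j0; last exact: H1 gb1 j js j0.
have ft := test_temp wt f; have gt := test_temp wt g.
pose u : Rd -> R[i] := fun x => (-1) * f x + g x.
have ut : tempered w u by exact: tempered_linear.
have uE : (fun x => g x - f x) = u by apply/funext => x; rewrite /u mulN1r addrC.
have AuE : (fun x => A g x - A f x) = A u.
  by rewrite /u Al//; apply/funext => x; rewrite mulN1r addrC.
have [|/= n1 n2] := gb (@mnm0 n.+1, eta) _ eta0; first by rewrite inE eqxx.
rewrite uE in n1 n2; rewrite AuE.
have ub : wbound w eta d2 u by have := wbound_p_norm (ltW n1); rewrite Dmulti0.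
have Fb : wbound w eta d2 (fourier u) by have := wbound_p_norm (ltW n2); rewrite Dmulti0.
have d2p := ltW d20.
have le2 : e2 <= eta by rewrite le_max lexx.
have le3 : e3 <= eta by rewrite le_max lexx orbT.
have c1 := B2 u d2 ut (wbound_le wt le2 (lexx _) ub) (wbound_le wt le2 (lexx _) Fb).
have c2 := B3 u d2 ut (wbound_le wt le3 (lexx _) ub) (wbound_le wt le3 (lexx _) Fb).
have k1 : wbound w e1 (KK * d2) (A u).
  by apply: (wbound_le wt (lexx e1) _ c1); rewrite ler_wpM2r// le_max lexx.
have k2 : wbound w e1 (KK * d2) (fourier (A u)).
  by apply: (wbound_le wt (lexx e1) _ c2); rewrite ler_wpM2r// le_max lexx orbT.
have [b1 b2] := B1 (A u) (KK * d2) (At u ut) k1 k2.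
have small : K1 * (KK * d2) < dl.
  rewrite mulrA -/K; apply: (@le_lt_trans _ _ (K * (dl / (K + 1)))).
    by rewrite ler_wpM2l// ge_min lexx orbT.
  by rewrite mulrA ltr_pdivrMr// mulrC ltr_pM2l// ltrDl.
have smallE : ((K1 * (KK * d2))%:E < dl%:E)%E by rewrite lte_fin.
by split; [exact: le_lt_trans (p_norm_le b1) smallE|exact: le_lt_trans (p_norm_le b2) smallE].
Qed.

Section operator.
Variables (A : (Rd -> R[i]) -> (Rd -> R[i])) (At : toperator A).

Definition apply_op (f : S) : S := mktest wt (top_temp At (test_temp wt f)).

Lemma pull_linear (u : ultradistribution w) : clinear (fun f => u (apply_op f)).
Proof.
move=> c f g h hE; apply: pairing_linear => x /=.
have -> : test_val h = (fun x => c * f x + g x) by apply/funext.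
by rewrite (top_lin At)//; exact: test_temp.
Qed.

Lemma pull_continuous (u : ultradistribution w) : seminorm_continuous (fun f => u (apply_op f)).
Proof.
move=> f e e0; have [sq [dl [dl0 H]]] := pairing_continuous u (apply_op f) e0.
have [s [dl' [d0 H']]] := seminorm_dominated f sq At dl0.
exists s, dl'; split => // g gb; apply: H => i isq i0; exact: H' gb i isq i0.
Qed.

(** The transpose of A. *)
Definition pull (u : ultradistribution w) : ultradistribution w :=
  Ultradistribution (pull_linear u) (pull_continuous u).

Lemma measurable_pull : measurable_fun setT (pull : S' -> S').
Proof.
apply: (@measurability _ _ S' S' setT pull (@cylindrical _ _ w)) => // _ [_ [k [f [B [Bb ->]]]] <-].
rewrite setTI; apply: sub_gen_smallest.
by exists k, (fun j => apply_op (f j)), B; split.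
Qed.
End operator.

Lemma ultra_ext (u v : ultradistribution w) : (forall f, u f = v f) -> u = v.
Proof.
case: u => u ul uc; case: v => v vl vc /= uv.
have uvE : u = v by apply/funext.
by rewrite uvE in ul uc *; congr Ultradistribution; exact: Prop_irrelevance.
Qed.

Section processes.
Context d (Om : measurableType d) (P : probability Om R).

Lemma mfunE (F : Om -> S') : measurable_fun setT F ->
  exists s : {mfun Om >-> S'}, forall o, s o = F o.
Proof.
move=> mF; have Pf : F \in mfun by rewrite inE.
by exists (mfun_Sub Pf) => o; rewrite mfun_valP.
Qed.

(** The change of variables from the law to the sample space needs an
    integrable integrand; it is bounded because the pairing is real. *)
Lemma char_functionalE (L : {mfun Om >-> S'}) (f : S) :
  (forall o, cIm ((L o : ultradistribution w) f) = 0) ->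
  char_functional P L f = cintegral P (fun o => cexp (iu * (L o : ultradistribution w) f)).
Proof.
move=> Lr.
have mv : cmeas (fun u : S' => cexp (iu * (u : ultradistribution w) f)).
  apply: cmeas_cexp; apply: cmeasM; [exact: cmeas_cst|exact: cmeas_pairing].
have mo : cmeas (fun o => cexp (iu * (L o : ultradistribution w) f)).
  exact: (cmeas_comp (measurable_funPT L) mv).
have io : cintegrable P (fun o => cexp (iu * (L o : ultradistribution w) f)).
  apply: (cintegrable_le mo _ (rintegrable_prob_cst P 1)) => o.
  rewrite normc_cexp_im//; case: ((L o : ultradistribution w) f) (Lr o) => a1 b1 /= ->.
  by rewrite mulr0 mul0r subr0.
case: mv => m1 m2; case: io => i1 i2.
rewrite /char_functional; apply: cplx_eq => /=; rewrite /Rintegral; congr fine.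
  by apply: (@integral_distribution _ _ _ _ _ P L) i1; exact/measurable_EFinP.
by apply: (@integral_distribution _ _ _ _ _ P L) i2; exact/measurable_EFinP.
Qed.
End processes.
End Pullback.

(** * Stationarity and the solution *)

Section Stationarity.
Variables (R : realType) (n : nat) (w : 'rV[R]_n.+1 -> R).
Hypothesis wt : tame_weight w.
Local Notation Rd := 'rV[R]_n.+1.
Local Notation S := (test_function w).
Local Notation S' := (ultradistributionC w).
Context d (Om : measurableType d) (P : probability Om R).
Variables (L : {mfun Om >-> S'}) (a gamma : R).
Variable nu : {measure set (measurableTypeR R) -> \bar R}.
Hypothesis L_noise : levy_white_noise P L a gamma nu.
Local Opaque cintegralRd.

Lemma noise_real o : real_ultra (L o : ultradistribution w).
Proof. by move=> f fr; have [H _ _] := L_noise fr. Qed.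

(** The Levy exponent is integrated against Lebesgue measure, which is
    translation invariant, and the characteristic functional determines the
    law. *)
Lemma noise_stationary (t : Rd) (Lt : {mfun Om >-> S'}) :
  (forall o (f : S), (Lt o : ultradistribution w) f =
     (L o : ultradistribution w) (apply_op wt (toperator_translate wt t) f)) ->
  same_law P Lt L.
Proof.
move=> LtE; pose tr f := apply_op wt (toperator_translate wt t) f.
have trr (f : S) : (forall x, cIm (f x) = 0) -> forall x, cIm (tr f x) = 0 by move=> H x /=.
apply: (same_law_of_char wt (P := P)).
- by move=> o f fr; rewrite LtE; apply: noise_real => x; exact: trr.
- exact: noise_real.
move=> f fr; have [r1 i1 c1] := L_noise fr; have [r2 i2 c2] := L_noise (trr f fr).
transitivity (cintegral P (fun o => cexp (iu * (L o : ultradistribution w) (tr f)))).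
  by apply: eq_cintegral => o; rewrite LtE.
have E : cintegralRd (fun x => levy_exponent a gamma nu (cRe (tr f x))) =
    cintegralRd (fun x => levy_exponent a gamma nu (cRe (f x))).
  by have [_ <-] := @cintegralRd_translate R n (- t) (fun x => levy_exponent a gamma nu (cRe (f x))) i1.
have c3 := etrans c2 (etrans (congr1 (@cexp R) E) (esym c1)).
exact: etrans (esym (char_functionalE P r2)) (etrans c3 (char_functionalE P r1)).
Qed.
End Stationarity.

Section Solution.
Variables (R : realType) (n : nat) (w : 'rV[R]_n.+1 -> R).
Hypothesis wt : tame_weight w.
Local Notation Rd := 'rV[R]_n.+1.
Local Notation Cd := 'rV[R[i]]_n.+1.
Local Notation S := (test_function w).
Local Notation S' := (ultradistributionC w).
Implicit Types (p q : mpoly n.+1 R) (h : Cd -> R[i]).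
Local Opaque cintegralRd.

Lemma Tmul_ext h1 h2 f : (forall xi : Rd, h1 (cpt xi 0) = h2 (cpt xi 0)) -> Tmul h1 f = Tmul h2 f.
Proof. by move=> H; congr four; apply/funext => xi; rewrite /hrefl H. Qed.

Lemma pairing_val (u : ultradistribution w) (f g : S) : test_val f = test_val g -> u f = u g.
Proof. by move=> fg; apply: pairing_ext => x; rewrite fg. Qed.

Lemma pairs_toE (u : ultradistribution w) (f : Rd -> R[i]) (c : R[i]) (g : S) :
  test_val g = f -> pairs_to u f c <-> u g = c.
Proof.
move=> gf; split; last by exists g.
by move=> [g' [g'f <-]]; apply: pairing_val; rewrite gf g'f.
Qed.

(** Symbols multiply, so T_h p(D)^* = q(D)^* on test functions. *)
Lemma pull_pde p q h (hs : symbol h) (u : ultradistribution w) :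
  (forall xi : Rd, h (cpt xi 0) * evali p (cpt xi 0) = evali q (cpt xi 0)) ->
  pde p q (pull wt (toperator_Tmul wt hs) u) u.
Proof.
move=> hpq f; have ft := test_temp wt f.
have [pt _] := adjD_tempered wt p ft; have [qt _] := adjD_tempered wt q ft.
exists (u (mktest wt qt)); split; last by apply/(@pairs_toE _ _ _ (mktest wt qt)).
apply/(@pairs_toE _ _ _ (mktest wt pt)) => //.
rewrite /=; apply: pairing_val => /=.
rewrite (adjD_Tmul wt p ft) (Tmul_comp wt _ (symbol_evali p) ft) (adjD_Tmul wt q ft).
exact: Tmul_ext.
Qed.

(** Every test function f is p(D)^* phi with phi = T_k f, and <u, p(D)^* phi>
    is determined by v. *)
Lemma pde_unique p q k (ks : symbol k) (u u' v : ultradistribution w) :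
  (forall xi : Rd, k (cpt xi 0) * evali p (cpt xi 0) = 1) ->
  pde p q u v -> pde p q u' v -> u' = u.
Proof.
move=> kp Hu Hu'; apply: ultra_ext => f; have ft := test_temp wt f.
have [kt _] := Tmul_tempered wt ks ft; pose phi := mktest wt kt.
have [pt _] := adjD_tempered wt p kt; have [qt _] := adjD_tempered wt q kt.
have fE : test_val f = adjD p phi.
  rewrite (adjD_Tmul wt p kt) (Tmul_comp wt _ ks ft) (Tmul_id wt)// => xi.
  by rewrite /hrefl mulrC kp.
have [c [c1 c2]] := Hu phi; have [c' [c1' c2']] := Hu' phi.
move/(pairs_toE _ _ fE) : c1 => ->; move/(pairs_toE _ _ fE) : c1' => ->.
move/(pairs_toE (g := mktest wt qt) _ _ erefl) : c2 => <-.
by move/(pairs_toE (g := mktest wt qt) _ _ erefl) : c2' => <-.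
Qed.

Lemma pull_translate h (hs : symbol h) (t : Rd) (u : ultradistribution w) :
  pull wt (toperator_translate wt t) (pull wt (toperator_Tmul wt hs) u) =
  pull wt (toperator_Tmul wt hs) (pull wt (toperator_translate wt t) u).
Proof.
apply: ultra_ext => f /=; apply: pairing_val => /=.
by rewrite (Tmul_translate wt)//; exact: test_temp.
Qed.
End Solution.

Theorem theorem3p9 (R : realType) (n : nat)
    (p q : mpoly n.+1 R) (eps : R)
    (p_neq0 : p != 0) (eps_gt0 : 0 < eps)
    (ext : has_holomorphic_extension p q eps)
    (w : 'rV[R]_n.+1 -> R) (w_adm : admissible_weight w)
    (d : measure_display) (Omega : measurableType d) (P : probability Omega R)
    (L : {mfun Omega >-> ultradistributionC w})
    (a gamma : R) (nu : {measure set (measurableTypeR R) -> \bar R})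
    (a_ge0 : 0 <= a) (nu_levy : levy_measure nu)
    (L_noise : levy_white_noise P L a gamma nu)
    (c : R) (c_gt0 : 0 < c)
    (moment : (\int[nu]_(r in [set r : R | (1 < `|r|)%R])
        (`|r|%:E * \int[lebesgue_measure]_(x in `]0%R, (`|r|^-1)%R[)
           ((weight_inv w (c * ln (`|x|^-1))) ^+ n.+1)%:E) < +oo)%E) :
  exists s : {mfun Omega >-> ultradistributionC w},
    [/\ stationary P s,
        forall o : Omega, pde p q (s o) (L o) &
        (forall z, strip eps z -> evali p z != 0) ->
        forall (s' : {mfun Omega >-> ultradistributionC w}) (o : Omega),
          pde p q (s' o) (L o) -> s' o = s o].
Proof.
have wt := admissible_tame w_adm.
have [h [hh hreal]] := ext.
have hhol z : strip eps z -> hol h z by move=> /hh; exact: hol_differentiable.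
have hval (xi : 'rV[R]_n.+1) : evali p (cpt xi 0) != 0 ->
    h (cpt xi 0) = evali q (cpt xi 0) / evali p (cpt xi 0).
  by rewrite cpt_real; exact: hreal.
have hpq := extension_identity p_neq0 eps_gt0 hhol hval.
have hs := division_symbol p_neq0 eps_gt0 hhol hpq.
have real_strip (xi : 'rV[R]_n.+1) : strip eps (cpt xi 0).
  by apply/stripE; rewrite -(scale0r 0) enormZ normr0 mul0r.
pose T := toperator_Tmul wt hs.
have mT := measurable_pull wt T.
have [s sE] : exists s : {mfun Omega >-> ultradistributionC w}, forall o, s o = pull wt T (L o).
  by apply: mfunE; exact: (measurableT_comp mT (measurable_funPT L)).
exists s; split.
- move=> t; pose tau := toperator_translate wt t.
  have mtau := measurable_pull wt tau.
  have [Lt LtE] : exists Lt : {mfun Omega >-> ultradistributionC w}, forall o, Lt o = pull wt tau (L o).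
    by apply: mfunE; exact: (measurableT_comp mtau (measurable_funPT L)).
  have [s' s'E] : exists s' : {mfun Omega >-> ultradistributionC w}, forall o, s' o = pull wt T (Lt o).
    by apply: mfunE; exact: (measurableT_comp mT (measurable_funPT Lt)).
  exists s'; split.
    move=> o f; exists (apply_op wt tau f); split => //.
    by rewrite s'E LtE -(pull_translate wt hs) sE.
  move=> A mA; have law : same_law P Lt L.
    by apply: (noise_stationary (wt := wt) L_noise (t := t)) => o f; rewrite LtE.
  have mTA : measurable ((pull wt T : ultradistributionC w -> ultradistributionC w) @^-1` A).
    by have := mT measurableT A mA; rewrite setTI.
  have := law _ mTA; rewrite /distribution /pushforward => E.
  rewrite (_ : s' @^-1` A = Lt @^-1` ((pull wt T : ultradistributionC w -> ultradistributionC w) @^-1` A)).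
    rewrite E; congr (P _); apply/seteqP; split => o /=; rewrite sE//.
  by apply/seteqP; split => o /=; rewrite s'E.
- move=> o; rewrite sE; apply: pull_pde => xi; exact: hpq.
(* 1/p is a quotient of polynomials that is holomorphic on the strip, so the
   division estimate applies to it as it does to h. *)
- move=> nz s' o Hs'; rewrite sE.
  have khol z : strip eps z -> hol (fun z => (evali p z)^-1) z.
    by move=> zs; apply: holV; [exact: nz|exact: hol_evali].
  have e1 z : evali (1 : mpoly n.+1 R) z = 1 by rewrite /evali !rmorph1.
  have kp z : strip eps z -> (evali p z)^-1 * evali p z = evali (1 : mpoly n.+1 R) z.
    by move=> zs; rewrite e1 mulVf// nz.
  have ks := division_symbol p_neq0 eps_gt0 khol kp.
  apply: (pde_unique wt ks (p := p) (q := q) (v := L o)) => //.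
    by move=> xi; rewrite -(e1 (cpt xi 0)); exact: kp.
  by apply: pull_pde => xi; exact: hpq.
Qed.
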